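(* Let $p\in\mathbb N_+$ and let $(X^{(n)}_i)_{i\in T_n}$ be a sequence of mean-zero random fields as in the context, with $\alpha$-mixing coefficients $(\alpha_{\ell,n})_{\ell\ge1}$ (of order $p+1$). Suppose there exists $r\in[p+2,\infty]$ such that $$\liminf_{n\to\infty}\frac{\sigma_n^2}{|T_n|}>0,\qquad \sup_{n,\,i\in T_n}\|X_i^{(n)}\|_r<\infty,$$ and that $$\sup_n\sum_{\ell=1}^\infty\ell^{d-1}\alpha_{\ell,n}^{(r-p-1)/r}<\infty,\qquad M^{(i)}_{n,m,\delta}\to0,\qquad M^{(ii)}_{n,m}\to0\quad\text{as }n\to\infty$$ for some sequence of positive integers $m=m_n=o(|T_n|^{1/(4d)})$ and some fixed $\delta\in[0,1]\cap[0,r-p-1)$, where $$M^{(i)}_{n,m,\delta}:=|T_n|^{-(p-1+\delta)/2}\,m^{dp}\sum_{\ell=m+1}^{m+1+\lfloor |T_n|^{1/d}/2\rfloor}\ell^{d\delta-\delta}\,\alpha_{\ell,n}^{(r-p-1-\delta)/r},$$ $$M^{(ii)}_{n,m}:=|T_n|^{-(p-1)/2}\sum_{\ell=m+1}^{m+1+\lfloor |T_n|^{1/d}/2\rfloor}\ell^{dp-1}\,\alpha_{\ell,n}^{(r-p-1)/r}.$$ For $1\le j\le p-1$ set $$\mathcal R_{j,n}:=\min_{1\le b\le m}|T_n|^{-j/2}\Bigl(b^{d(j+1)}+\sum_{\ell=b+1}^{b+1+\lfloor |T_n|^{1/d}/2\rfloor}\ell^{d(j+1)-1}\alpha_{\ell,n}^{(r-j-2)/r}\Bigr),$$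 the minimum being over integers $b$. Then $W_n$ converges to $N(0,1)$ in the Wasserstein-$p$ distance, and $$\mathcal W_p(\mathcal L(W_n),N(0,1))=\mathcal O\Bigl(\Bigl\{\sum_{j=1}^{p-1}\mathcal R_{j,n}^{p/j}+|T_n|^{-p/2}m^{d(p+1)}+M^{(i)}_{n,m,\delta}+M^{(ii)}_{n,m}\Bigr\}^{1/p}\Bigr),$$ where the sum over $j$ is empty when $p=1$. In particular, $$\mathcal W_p(\mathcal L(W_n),N(0,1))=\mathcal O(|T_n|^{-1/2}m^{2d})+\mathcal O\bigl((M^{(i)}_{n,m,\delta})^{1/p}\bigr)+\mathcal O\bigl((M^{(ii)}_{n,m})^{1/p}\bigr).$$
   Context: Setting. Fix $d\in\mathbb N_+$. $T_1\subseteq T_2\subseteq\cdots$ are finite nonempty subsets of $\mathbb Z^d$ with $|T_n|\to\infty$. For each $n$, $(X^{(n)}_i)_{i\in T_n}$ is a family of real random variables with mean zero and finite second moments (no stationarity is assumed). Put $\sigma_n^2:=\operatorname{Var}(\sum_{i\in T_n}X^{(n)}_i)$ and $W_n:=\sigma_n^{-1}\sum_{i\in T_n}X^{(n)}_i$ (defined when $\sigma_n>0$). $\|X\|_r:=(\mathbb E|X|^r)^{1/r}$ for $r<\infty$, and $\|X\|_\infty$ is the essential supremum norm. When $r=\infty$, ratios $(r-a)/r$ with finite $a$ are read as $1$. Mixing coefficients. For sub-$\sigma$-algebras $\mathcal A,\mathcal B$, $\alpha(\mathcal A,\mathcal B):=\sup_{A\in\mathcal A,B\in\mathcal B}|\mathbb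 P(A\cap B)-\mathbb P(A)\mathbb P(B)|$. For positive integers $\ell,q$, $\alpha^{[q]}_{\ell,n}:=0\vee\sup\{\alpha(\sigma(X^{(n)}_i:i\in U_1),\sigma(X^{(n)}_i:i\in U_2)):U_1,U_2\subseteq T_n,\ |U_1|\le q,\ d(U_1,U_2)\ge\ell\}$, where $d(U_1,U_2)=\min\{\|i_1-i_2\|:i_1\in U_1,i_2\in U_2\}$ and $\|\cdot\|$ is the maximum norm. Throughout, $\alpha_{\ell,n}:=\alpha_{\ell,n}^{[p+1]}$. Wasserstein distance. $\mathcal W_p(\nu,\mu):=\inf_\gamma(\mathbb E_{(X,Y)\sim\gamma}|X-Y|^p)^{1/p}$, the infimum being over all couplings $\gamma$ of $\nu$ and $\mu$. $\mathcal L(W)$ is the law of $W$. $\mathcal O$-notation is as $n\to\infty$, with implied constants not depending on $n$. *)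

(* Defs.v *)
From HB Require Import structures.
From mathcomp Require Import all_boot all_order all_algebra finmap.
From mathcomp Require Import all_classical all_reals all_analysis.
From mathcomp Require Import measurable_realfun.

Set Implicit Arguments.
Unset Strict Implicit.
Unset Printing Implicit Defensive.

Import Order.TTheory GRing.Theory Num.Theory.
Import numFieldNormedType.Exports.

Local Open Scope classical_set_scope.
Local Open Scope ring_scope.

Section Mixing.
Context {disp : measure_display} {Omega : measurableType disp} {R : realType}.
Variable P : probability Omega R.

Definition alpha_mixing (A B : set_system Omega) : R :=
  sup [set `|fine (P (a `&` b)) - fine (P a) * fine (P b)| | a in A & b in B].

Context {d : nat} {T : {fset 'rV[int]_d}}.
Variable X : T -> {RV P >-> R}.

(* The sigma-algebra generated by the X i, i in U. *)
Definition sigma_field (U : {set T}) : set_system Omega :=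
  <<s \bigcup_(i in [set` U]) preimage_set_system setT (X i) measurable >>.

(* d(U1, U2) >= l; the norm on 'rV[int]_d is the maximum norm.
   The distance to the empty set is infinite. *)
Definition far_apart (l : nat) (U1 U2 : {set T}) : Prop :=
  forall i1 i2 : T, i1 \in U1 -> i2 \in U2 ->
    l%:Z <= `|fsval i1 - fsval i2|.

Definition alpha_coef (q l : nat) : R :=
  Num.max 0 (sup [set alpha_mixing (sigma_field U.1) (sigma_field U.2) |
    U in [set U : {set T} * {set T} |
            (#|U.1| <= q)%N /\ far_apart l U.1 U.2]]).

Definition field_sum : {mfun Omega >-> R} := \sum_(i : T) X i.

Definition sigma2 : R := fine 'V_P[field_sum].

(* Equal to 0 in the degenerate case sigma2 = 0. *)
Definition normalized_sum : {mfun Omega >-> R} :=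
  (Num.sqrt sigma2)^-1 *: field_sum.

End Mixing.

Section Wasserstein.
Context {R : realType}.
Local Open Scope ereal_scope.

Definition coupling (nu mu : probability R R)
    (g : probability (R * R)%type R) : Prop :=
  forall A : set R, measurable A ->
    g (A `*` setT) = nu A /\ g (setT `*` A) = mu A.

Definition wasserstein (p : nat) (nu mu : probability R R) : \bar R :=
  ereal_inf [set 'N[g]_(p%:R%:E)[EFin \o (fun z => (z.1 - z.2)%R)] |
             g in coupling nu mu].

End Wasserstein.

(* The library's normal_prob lives on measurableTypeR R, whose display differs
   from that of the canonical Borel structure of R carried by laws of real
   random variables; std_normal is N(0,1) on the latter. *)
Section StdNormal.
Context {R : realType}.

Definition std_normal : set R -> \bar R := normal_prob 0 1.

HB.instance Definition _ := isMeasure.Build _ R R std_normal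
  (@measure0 _ _ R (normal_prob 0 1)) (@measure_ge0 _ _ R (normal_prob 0 1))
  (@measure_semi_sigma_additive _ _ R (normal_prob 0 1)).

HB.instance Definition _ := Measure_isProbability.Build _ R R std_normal
  (@probability_setT _ _ R (normal_prob 0 1)).

End StdNormal.

Section Rates.
Context {R : realType}.

(* (r - a) / r, read as 1 when r = +oo *)
Definition mixing_exp (r : \bar R) (a : R) : R :=
  if r is s%:E then (s - a) / s else 1.

(* In the following, N stands for |T_n| and a l for alpha_{l,n}. *)
Variables (d p : nat) (r : \bar R) (N : nat) (a : nat -> R).

Definition window : nat := Num.truncn (N%:R `^ d%:R^-1 / 2 : R).

Definition M1 (m : nat) (delta : R) : R :=
  N%:R `^ (- ((p%:R - 1 + delta) / 2)) * m%:R ^+ (d * p) *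
  \sum_(m.+1 <= l < (m.+1 + window).+1)
     l%:R `^ (d%:R * delta - delta) * a l `^ mixing_exp r (p%:R + 1 + delta).

Definition M2 (m : nat) : R :=
  N%:R `^ (- ((p%:R - 1) / 2)) *
  \sum_(m.+1 <= l < (m.+1 + window).+1)
     l%:R ^+ (d * p).-1 * a l `^ mixing_exp r (p%:R + 1).

Definition remainder_at (j b : nat) : R :=
  N%:R `^ (- (j%:R / 2)) *
  (b%:R ^+ (d * j.+1) +
   \sum_(b.+1 <= l < (b.+1 + window).+1)
      l%:R ^+ (d * j.+1).-1 * a l `^ mixing_exp r (j%:R + 2)).

(* The default value of the minimum is attained at b = 1, hence harmless
   for m >= 1. *)
Definition remainder (m j : nat) : R :=
  \big[Num.min/remainder_at j 1%N]_(1 <= b < m.+1) remainder_at j b.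

Definition rate (m : nat) (delta : R) : R :=
  \sum_(1 <= j < p) remainder m j `^ (p%:R / j%:R) +
  N%:R `^ (- (p%:R / 2)) * m%:R ^+ (d * p.+1) + M1 m delta + M2 m.

End Rates.

(* u = O(e) as n -> oo for an extended-real u. In particular u is
   eventually finite. *)
Definition ebigO {R : realType} (u : nat -> \bar R) (e : nat -> R) : Prop :=
  exists2 f : nat -> R^o, f =O_\oo (e : nat -> R^o) &
    \forall n \near \oo, u n = (f n)%:E.

(* Main.v *)
Require Import Defs.
From HB Require Import structures.
From mathcomp Require Import all_boot all_order all_algebra finmap.
From mathcomp Require Import all_classical all_reals all_analysis.
From mathcomp Require Import measurable_realfun zify ring lra.

Set Implicit Arguments.
Unset Strict Implicit.
Unset Printing Implicit Defensive.

Import Order.TTheory GRing.Theory Num.Theory.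
Import numFieldNormedType.Exports.

Local Open Scope classical_set_scope.
Local Open Scope ring_scope.

(** Writing S for the sum, the telescoping of the sites by their distance to those
    already met, Taylor expansion and Davydov's covariance inequality give
    E W f(W) = sum_k c_k E f^(k)(W) up to an error of order the claimed rate, for every
    smooth f with bounded top derivatives. Testing monomials shows that c_0 = 0, c_1 = 1 and
    that the c_k, k >= 2, are O(eps^(k-1)), where eps^p is the rate.

    Inserting the solution f of Stein's equation f' - x f = h - E h(Z) and iterating gives
    E h(W) - E h(Z) = E h'(Z) P(Z) + O(eps^p |h^(p)|) for a polynomial P = O(eps). Gaussian
    integration by parts converts the right-hand side into E h(Z + D(Z)) - E h(Z) for a
    polynomial D = O(eps), and W_p(Z + D(Z), Z) = O(eps).

    It remains to bound W_p between two laws whose expectations of h differ by at most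
    O(eps^p |h^(p)|). By duality, after discretisation at scale eps, the cost of the quantile
    coupling is an expectation of potentials f, g with f_i - g_j <= |i - j|^p, and some smooth
    h with bounded p-th derivative is squeezed between f and g up to a constant. *)

(** * Jets and Taylor remainders *)

Section Calculus.
Context {R : realType}.
Implicit Types (f g h : R -> R) (x y a b c : R).

(** All constants depend on p, d, r, [delta] and the moment and variance bounds only, and an error
    may involve only the top derivatives of the test function, never its other sup norms. Indeed the
    final test function is a fixed one rescaled to cells of width eps: its p-th derivative is of
    size eps^-p and just offsets eps^p, while nothing is known of its other bounds. Hence Stein's
    equation is solved with f^(q) and f^(q+1) bounded by |h^(q)| alone.

    The moments may end at r = p + 2, which dictates two regimes. An expansion against a bounded
    F^(q+1) uses covariances of total degree q + 2, which is below r only for q < p; these errors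
    are the R_q. At the top order, increments of F^(p), bounded and Lipschitz and therefore
    [delta]-Hoelder, are paired with products of degree p + 1: the total degree p + 1 + [delta]
    stays below r, and this produces M^(i). The covariances of degree p + 1 met earlier in the
    recursion produce M^(ii). *)

Definition der f g := forall x, is_derive x 1 f (g x).

Lemma der_cst c : der (fun=> c) (fun=> 0).
Proof. by move=> x; exact: is_derive_cst. Qed.

Lemma der_id : der id (fun=> 1).
Proof. by move=> x; exact: is_derive_id. Qed.

Lemma eq_der f g h : der f g -> g =1 h -> der f h.
Proof. by move=> fg /funext <-. Qed.

Lemma derD f g f' g' : der f f' -> der g g' ->
  der (fun x => f x + g x) (fun x => f' x + g' x).
Proof. by move=> hf hg x; have := is_deriveD (hf x) (hg x). Qed.

Lemma derB f g f' g' : der f f' -> der g g' ->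
  der (fun x => f x - g x) (fun x => f' x - g' x).
Proof. by move=> hf hg x; have := is_deriveB (hf x) (hg x). Qed.

Lemma derM f g f' g' : der f f' -> der g g' ->
  der (fun x => f x * g x) (fun x => f' x * g x + f x * g' x).
Proof.
move=> hf hg x; have := is_deriveM (hf x) (hg x); rewrite /GRing.scale /=.
by rewrite addrC [g x * _]mulrC.
Qed.

Lemma derZ c f f' : der f f' -> der (fun x => c * f x) (fun x => c * f' x).
Proof. by move=> hf x; have := is_deriveZ c (hf x). Qed.

Lemma derX f f' n : der f f' -> der (fun x => f x ^+ n) (fun x => n%:R * f x ^+ n.-1 * f' x).
Proof.
move=> hf x; have := is_deriveX n (hf x).
by rewrite (_ : f ^+ n = fun x => f x ^+ n)//; apply/funext => y; rewrite fctE.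
Qed.

Lemma der_comp f g f' g' : der f f' -> der g g' ->
  der (fun x => f (g x)) (fun x => g' x * f' (g x)).
Proof.
move=> hf hg x; have := @is_derive1_comp R f g x (f' (g x)) (g' x) (hf _) (hg _).
by rewrite mulrC.
Qed.

Lemma der_expR f f' : der f f' -> der (fun x => expR (f x)) (fun x => f' x * expR (f x)).
Proof. by move=> hf; apply: (der_comp (f := expR)) => // x; exact: is_derive_expR. Qed.

Lemma der_shift f f' c : der f f' -> der (fun x => f (c + x)) (fun x => f' (c + x)).
Proof.
move=> hf; apply: eq_der (der_comp hf (derD (der_cst c) der_id)) _ => x.
by rewrite add0r mul1r.
Qed.

Lemma der_scale f f' c : der f f' -> der (fun x => f (c * x)) (fun x => c * f' (c * x)).
Proof.
by move=> hf; apply: eq_der (der_comp hf (derZ c der_id)) _ => x; rewrite mulr1.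
Qed.

Lemma der_sum (I : Type) (s : seq I) (F G : I -> R -> R) :
  (forall i, der (F i) (G i)) ->
  der (fun x => \sum_(i <- s) F i x) (fun x => \sum_(i <- s) G i x).
Proof.
move=> h; elim: s => [|i s IH].
  rewrite (_ : (fun x => _) = fun=> 0); last by apply/funext => x; rewrite big_nil.
  by apply: eq_der (der_cst 0) _ => x; rewrite big_nil.
rewrite (_ : (fun x => _) = fun x => F i x + \sum_(j <- s) F j x); last first.
  by apply/funext => x; rewrite big_cons.
by apply: eq_der (derD (h i) IH) _ => x; rewrite big_cons.
Qed.

Lemma der_cont f f' : der f f' -> continuous f.
Proof. by move=> h x; apply/differentiable_continuous/derivable1_diffP; case: (h x). Qed.

Lemma der_meas f f' : der f f' -> measurable_fun setT f.
Proof. by move=> h; apply: continuous_measurable_fun; exact: der_cont h. Qed.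

Lemma der_MVT f f' a b : der f f' -> a <= b ->
  exists2 c, a <= c <= b & f b - f a = f' c * (b - a).
Proof.
move=> h ab; have [|c] := @MVT_segment R f f' a b ab (fun x _ => h x).
  by apply: continuous_subspaceT; exact: der_cont h.
by rewrite in_itv /=; exists c.
Qed.

Lemma der_norm_le f f' M : der f f' -> (forall x, `|f' x| <= M) ->
  forall x y, `|f x - f y| <= M * `|x - y|.
Proof.
move=> h hM x y; wlog xy : x y / y <= x.
  move=> H; have [|/ltW] := leP y x; first exact: H.
  by rewrite distrC (distrC x); exact: H.
have [c _ ->] := der_MVT h xy; rewrite normrM ler_wpM2r//.
Qed.

Lemma der_le f f' a b : der f f' -> a <= b -> (forall x, a <= x <= b -> 0 <= f' x) ->
  f a <= f b.
Proof.
move=> h ab h0; rewrite -subr_ge0; have [c cab ->] := der_MVT h ab.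
by rewrite mulr_ge0 ?subr_ge0 ?h0.
Qed.

Lemma der_ge f f' a b : der f f' -> a <= b -> (forall x, a <= x <= b -> f' x <= 0) ->
  f b <= f a.
Proof.
move=> h ab h0; rewrite -subr_le0; have [c cab ->] := der_MVT h ab.
by rewrite mulr_le0_ge0 ?subr_ge0 ?h0.
Qed.

Lemma der0_cst f : der f (fun=> 0) -> forall x y, f x = f y.
Proof.
move=> h x y; apply/eqP; rewrite -subr_eq0 -normr_le0.
by apply: le_trans (der_norm_le h (M := 0) _ x y) _ => [z|]; rewrite ?normr0 ?mul0r.
Qed.

(** A function bundled with its first q derivatives: differentiation is a shift of the index, and
    nothing is asked beyond index q. *)
Definition jet (q : nat) (F : nat -> R -> R) := forall k, (k < q)%N -> der (F k) (F k.+1).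

Lemma jet_shift q F k : (k <= q)%N -> jet q F -> jet (q - k) (fun i => F (k + i)%N).
Proof. by move=> kq jF i iq; rewrite addnS; apply: jF; rewrite -ltn_subRL. Qed.

Lemma jet_le q q' F : (q <= q')%N -> jet q' F -> jet q F.
Proof. by move=> qq jF i iq; apply: jF; exact: leq_trans qq. Qed.

Definition tayrem (F : nat -> R -> R) n v x :=
  F 0 (v + x) - \sum_(a < n) x ^+ a / a`!%:R * F a v.

Lemma tayrem_der F n v : jet n.+1 F ->
  der (tayrem F n.+1 v) (tayrem (fun i => F i.+1) n v).
Proof.
move=> jF; rewrite /tayrem; apply: eq_der.
  apply: derB; first exact: der_shift (jF 0%N isT).
  apply: (@der_sum _ _ (fun (a : 'I_n.+1) x => x ^+ a / a`!%:R * F a v)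
    (fun (a : 'I_n.+1) x => (a%:R * x ^+ a.-1) / a`!%:R * F a v)) => a.
  apply: eq_der.
    apply: derM; last exact: der_cst.
    by apply: derM; [exact: derX der_id|exact: der_cst].
  by move=> x /=; rewrite !mulr0 !addr0 mulr1.
move=> x; congr (_ - _); rewrite big_ord_recl /= mul0r !mul0r add0r.
apply: eq_bigr => a _; rewrite /bump leq0n add1n; congr (_ * _).
have h1 : a.+1%:R != 0 :> R by rewrite pnatr_eq0.
have h2 : a`!%:R != 0 :> R by rewrite pnatr_eq0 -lt0n fact_gt0.
rewrite add0n factS natrM; move: h1 h2; set u := a.+1%:R; set w := a`!%:R => h1 h2.
by rewrite invfM mulrACA mulfV// mul1r.
Qed.

Lemma tayrem0 F n v : (0 < n)%N -> tayrem F n v 0 = 0.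
Proof.
case: n => // n _; rewrite /tayrem addr0 big_ord_recl /= expr0 fact0 divr1 mul1r.
by rewrite big1 ?addr0 ?subrr// => i _; rewrite /= expr0n /= mul0r mul0r.
Qed.

(* The constant 1 in place of 1/n! suffices and makes the induction immediate. *)
Lemma tayrem_le F n v x M : jet n F -> (forall y, `|F n y| <= M) ->
  `|tayrem F n v x| <= M * `|x| ^+ n.
Proof.
elim: n F x => [|n IH] F x jF hM.
  by rewrite /tayrem big_ord0 subr0 expr0 mulr1.
have IH' y : `|tayrem (fun i => F i.+1) n v y| <= M * `|y| ^+ n.
  by apply: IH => // k kn; apply: jF.
have M0 : 0 <= M by exact: le_trans (hM 0).
have tD := tayrem_der v jF.
have T0 := @tayrem0 F n.+1 v isT.
have key a b y0 : a <= b -> `|a| <= `|x| -> `|b| <= `|x| -> (a = 0 /\ b = x) \/ (a = x /\ b = 0) ->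
    `|tayrem F n.+1 v b - tayrem F n.+1 v a| <= M * `|x| ^+ n * (b - a).
  move=> ab ax bx _; have [c /andP[ac cb] ->] := der_MVT tD ab.
  rewrite normrM (ger0_norm (x := b - a)) ?subr_ge0// ler_wpM2r ?subr_ge0//.
  apply: le_trans (IH' c) _; rewrite ler_wpM2l// lerXn2r ?nnegrE//.
  move: ax bx; rewrite !ler_norml => /andP[h1 _] /andP[_ h2].
  by apply/andP; split; [exact: le_trans ac|exact: le_trans h2].
have [x0|x0] := leP 0 x.
  have := key 0 x 0 x0; rewrite normr0 normr_ge0 lexx T0 !subr0 => /(_ isT isT (or_introl _)).
  by rewrite exprSr mulrA {3}(ger0_norm x0); apply.
have := key x 0 0 (ltW x0); rewrite normr0 normr_ge0 lexx T0 !sub0r normrN => /(_ isT isT (or_intror _)).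
by rewrite exprSr mulrA {3}(ltr0_norm x0); apply.
Qed.

(** Taylor expansion at 0. All lower derivatives grow polynomially once the top one is bounded, and
    this is where their integrability comes from. *)
Lemma jet_growth F n M : jet n F -> (forall y, `|F n y| <= M) ->
  exists c, 0 <= c /\ forall x, `|F 0%N x| <= c * (1 + `|x|) ^+ n.
Proof.
move=> jF hM; have M0 : 0 <= M by exact: le_trans (hM 0).
exists (M + \sum_(a < n) `|F a 0|); split; first by rewrite addr_ge0// sumr_ge0.
move=> x; have := tayrem_le 0 x jF hM; rewrite /tayrem add0r => h.
have -> : F 0%N x = (F 0%N x - \sum_(a < n) x ^+ a / a`!%:R * F a 0) +
  \sum_(a < n) x ^+ a / a`!%:R * F a 0 by rewrite subrK.
have x1 : 1 <= 1 + `|x| by rewrite lerDl.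
rewrite (le_trans (ler_normD _ _))// mulrDl lerD//.
  apply: le_trans h _; rewrite ler_wpM2l// lerXn2r ?nnegrE ?addr_ge0//.
  by rewrite lerDr.
rewrite mulr_suml (le_trans (ler_norm_sum _ _ _))//; apply: ler_sum => a _.
rewrite normrM mulrC ler_wpM2l// normrM normrX (ger0_norm (x := _^-1)) ?invr_ge0//.
apply: (@le_trans _ _ (`|x| ^+ a)).
  by rewrite ler_piMr ?exprn_ge0// invf_le1 ?ler1n ?fact_gt0// ltr0n fact_gt0.
apply: (@le_trans _ _ ((1 + `|x|) ^+ a)); first by rewrite lerXn2r ?nnegrE ?addr_ge0 ?lerDr.
by rewrite ler_weXn2l// ltnW.
Qed.

End Calculus.

(** * Expectations and covariances under mixing *)

Section Expectation.
Context {d : measure_display} {Omega : measurableType d} {R : realType}.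
Variable P : probability Omega R.
Implicit Types f g : Omega -> R.

Definition Ex f : R := \int[P]_x f x.
Definition integ f := P.-integrable setT (EFin \o f).

Lemma integ_meas f : integ f -> measurable_fun setT f.
Proof. by move=> /integrableP[/measurable_EFinP]. Qed.

Lemma integD f g : integ f -> integ g -> integ (fun w => f w + g w).
Proof. by move=> hf hg; have := integrableD measurableT hf hg. Qed.

Lemma integB f g : integ f -> integ g -> integ (fun w => f w - g w).
Proof. by move=> hf hg; have := integrableB measurableT hf hg. Qed.

Lemma integZ c f : integ f -> integ (fun w => c * f w).
Proof. by move=> hf; have := integrableZl measurableT c hf. Qed.

Lemma integ_norm f : integ f -> integ (fun w => `|f w|).
Proof. exact: integrable_norm. Qed.

Lemma integ_cst c : integ (fun=> c).
Proof. exact: finite_measure_integrable_cst. Qed.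

Lemma integ_le f g : measurable_fun setT f -> (forall w, `|f w| <= g w) ->
  integ g -> integ f.
Proof.
move=> mf fg ig; apply: le_integrable ig => //; first exact/measurable_EFinP.
by move=> w _ /=; rewrite lee_fin (le_trans (fg w))// ler_norm.
Qed.

Lemma integ_bnd f c : measurable_fun setT f -> (forall w, `|f w| <= c) -> integ f.
Proof. by move=> mf fc; apply: (integ_le mf fc); exact: integ_cst. Qed.

Lemma integ_sum (I : Type) (s : seq I) (F : I -> Omega -> R) :
  (forall i, integ (F i)) -> integ (fun w => \sum_(i <- s) F i w).
Proof.
move=> h; elim: s => [|i s IH].
  by under eq_fun do rewrite big_nil; exact: integ_cst.
by under eq_fun do rewrite big_cons; exact: integD.
Qed.

Lemma eq_Ex f g : f =1 g -> Ex f = Ex g.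
Proof. by move=> /funext ->. Qed.

Lemma ExD f g : integ f -> integ g -> Ex (fun w => f w + g w) = Ex f + Ex g.
Proof. exact: RintegralD. Qed.

Lemma ExB f g : integ f -> integ g -> Ex (fun w => f w - g w) = Ex f - Ex g.
Proof. exact: RintegralB. Qed.

Lemma ExZ c f : integ f -> Ex (fun w => c * f w) = c * Ex f.
Proof. by move=> hf; exact: RintegralZl. Qed.

Lemma Ex_cst c : Ex (fun=> c) = c.
Proof.
rewrite /Ex Rintegral_cst//.
rewrite -[RHS]mulr1; congr (_ * _).
exact: (congr1 fine (@probability_setT _ _ _ P)).
Qed.

Lemma le_Ex f g : integ f -> integ g -> (forall w, f w <= g w) -> Ex f <= Ex g.
Proof. by move=> hf hg fg; exact: le_Rintegral. Qed.

(** The maximum of [f] and [g] equals [g] almost everywhere and turns the inequality into a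
    pointwise one. *)
Lemma le_Ex_ae f g : integ f -> integ g -> {ae P, forall w, f w <= g w} ->
  Ex f <= Ex g.
Proof.
move=> hf hg fg; pose g' w := Num.max (f w) (g w).
have mg' : measurable_fun setT g' by apply: measurable_maxr; exact: integ_meas.
have E : (\int[P]_x (g x)%:E = \int[P]_x (g' x)%:E)%E.
  apply: ae_eq_integral => //; try exact/measurable_EFinP/integ_meas.
    exact/measurable_EFinP.
  by apply: filterS fg => w h _ /=; rewrite /g' max_r.
have ig' : integ g'.
  apply: (@integ_le _ (fun w => `|f w| + `|g w|)) => //; last first.
    by apply: integD; exact: integ_norm.
  by move=> w; rewrite /g' maxEle; case: ifP => _; rewrite ?lerDl ?lerDr normr_ge0.
have -> : Ex g = Ex g' by rewrite /Ex /Rintegral E.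
by apply: le_Ex => // w; rewrite /g' le_max lexx.
Qed.

Lemma Ex_ge0 f : (forall w, 0 <= f w) -> 0 <= Ex f.
Proof. by move=> h; apply: Rintegral_ge0. Qed.

Lemma normr_Ex f : integ f -> `|Ex f| <= Ex (fun w => `|f w|).
Proof. by move=> hf; exact: le_normr_Rintegral. Qed.

Lemma Ex_le_cst f c : integ f -> (forall w, f w <= c) -> Ex f <= c.
Proof.
by move=> hf fc; rewrite -[leRHS](Ex_cst c); apply: le_Ex => //; exact: integ_cst.
Qed.

Lemma normr_Ex_le f g : integ f -> integ g -> (forall w, `|f w| <= g w) ->
  `|Ex f| <= Ex g.
Proof.
move=> hf hg fg; apply: le_trans (normr_Ex hf) _.
by apply: le_Ex => //; exact: integ_norm.
Qed.

Lemma Ex_sum (I : Type) (s : seq I) (F : I -> Omega -> R) :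
  (forall i, integ (F i)) ->
  Ex (fun w => \sum_(i <- s) F i w) = \sum_(i <- s) Ex (F i).
Proof.
move=> h; elim: s => [|i s IH].
  by rewrite big_nil -[RHS](Ex_cst 0); apply: eq_Ex => w; rewrite big_nil.
rewrite big_cons -IH -ExD//; last exact: integ_sum.
by apply: eq_Ex => w; rewrite big_cons.
Qed.

Lemma Ex_indic (A : set Omega) : measurable A -> Ex (\1_A) = fine (P A).
Proof. by move=> mA; rewrite /Ex /Rintegral integral_indic// setIT. Qed.

Lemma integ_indic (A : set Omega) : measurable A -> integ (\1_A).
Proof.
move=> mA; apply: (@integ_bnd _ 1); first exact: measurable_indic.
by move=> w; rewrite indicE; case: (_ \in _); rewrite (normr0, normr1).
Qed.

Definition cov f g : R := Ex (fun w => f w * g w) - Ex f * Ex g.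

End Expectation.

Section BoundedCov.
Context {d : measure_display} {Omega : measurableType d} {R : realType}.
Variable P : probability Omega R.
Implicit Types (f g : Omega -> R) (SA SB : set_system Omega).

Local Notation Ex := (Ex P).
Local Notation integ := (integ P).
Local Notation cov := (cov P).

Lemma integM_bnd f g a b : measurable_fun setT f -> measurable_fun setT g ->
  (forall w, `|f w| <= a) -> (forall w, `|g w| <= b) ->
  integ (fun w => f w * g w).
Proof.
move=> mf mg fa gb; apply: (@integ_bnd _ _ _ _ _ (a * b)).
  exact: measurable_funM.
by move=> w; rewrite normrM ler_pM.
Qed.

Lemma cov_perturb f g f' g' e : measurable_fun setT f -> measurable_fun setT g ->
  measurable_fun setT f' -> measurable_fun setT g' ->
  (forall w, `|f w| <= 1) -> (forall w, `|g w| <= 1) ->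
  (forall w, `|f' w| <= 1) -> (forall w, `|g' w| <= 1) ->
  (forall w, `|f w - f' w| <= e) -> (forall w, `|g w - g' w| <= e) ->
  `|cov f g| <= `|cov f' g'| + 4 * e.
Proof.
move=> mf mg mf' mg' f1 g1 f'1 g'1 fe ge.
have If := integ_bnd P mf f1. have Ig := integ_bnd P mg g1.
have If' := integ_bnd P mf' f'1. have Ig' := integ_bnd P mg' g'1.
(* [Omega] is inhabited, and any of its points witnesses 0 <= e. *)
have e0 : 0 <= e by case: (pselect (exists w : Omega, True)) => [[w _]|n];
  [exact: le_trans (fe w)|exfalso; apply: n; exists point].
have bd h : integ h -> (forall w, `|h w| <= 1) -> `|Ex h| <= 1.
  by move=> Ih h1; rewrite -[leRHS](Ex_cst P 1); apply: normr_Ex_le => //; exact: integ_cst.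
have dE h h' : integ h -> integ h' -> (forall w, `|h w - h' w| <= e) ->
    `|Ex h - Ex h'| <= e.
  move=> Ih Ih' he; rewrite -ExB// -[leRHS](Ex_cst P e).
  by apply: normr_Ex_le => //; [exact: integB|exact: integ_cst].
have H1 : `|Ex (fun w => f w * g w) - Ex (fun w => f' w * g' w)| <= 2 * e.
  rewrite -ExB; [|exact: integM_bnd f1 g1|exact: integM_bnd f'1 g'1].
  rewrite -[leRHS](Ex_cst P); apply: normr_Ex_le; last 2 first.
  - exact: integ_cst.
  - move=> w; rewrite (_ : _ - _ = (f w - f' w) * g w + f' w * (g w - g' w)); last by ring.
    rewrite (le_trans (ler_normD _ _))// !normrM mulr2n mulrDl mul1r lerD//.
      by rewrite -[leRHS]mulr1 ler_pM.
    by rewrite -[leRHS]mul1r ler_pM.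
  apply: integB; [exact: integM_bnd f1 g1|exact: integM_bnd f'1 g'1].
have H2 : `|Ex f * Ex g - Ex f' * Ex g'| <= 2 * e.
  rewrite (_ : _ - _ = (Ex f - Ex f') * Ex g + Ex f' * (Ex g - Ex g')); last by ring.
  rewrite (le_trans (ler_normD _ _))// !normrM mulr2n mulrDl mul1r lerD//.
    by rewrite -[leRHS]mulr1 ler_pM// ?dE ?bd.
  by rewrite -[leRHS]mul1r ler_pM// ?dE ?bd.
rewrite -lerBlDl (le_trans (lerB_dist _ _))// /cov.
rewrite (_ : _ - _ - _ = Ex (fun w => f w * g w) - Ex (fun w => f' w * g' w)
  - (Ex f * Ex g - Ex f' * Ex g')); last by ring.
by rewrite (le_trans (ler_normB _ _))// (le_trans (lerD H1 H2))// -mulrDl; lra.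
Qed.

(** The sum counts the thresholds i/n that do not exceed u, so it is the integer part of n u. *)
Lemma levels_approx (u : R) (n : nat) : 0 <= u <= 1 -> (0 < n)%N ->
  `|u - n%:R^-1 * \sum_(i < n) (((i.+1)%:R / n%:R <= u)%R)%:R| <= n%:R^-1.
Proof.
move=> /andP[u0 u1] n0.
have n0' : (0 : R) < n%:R by rewrite ltr0n.
have nu0 : 0 <= n%:R * u by rewrite mulr_ge0.
have tn : (Num.truncn (n%:R * u) <= n)%N.
  rewrite -(ler_nat R); apply: (@le_trans _ _ (n%:R * u)); first by rewrite truncn_le.
  by rewrite -[leRHS]mulr1 ler_pM2l.
have -> : \sum_(i < n) (((i.+1)%:R / n%:R <= u)%R)%:R = (Num.truncn (n%:R * u))%:R :> R.
  rewrite -natr_sum; congr (_%:R).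
  under eq_bigr do rewrite ler_pdivrMr// mulrC -truncn_ge_nat//.
  rewrite -(big_mkord xpredT (fun i => (i.+1 <= Num.truncn (n%:R * u))%N : nat)).
  rewrite (big_cat_nat _ tn) //= [X in (_ + X)%N](_ : _ = 0)%N ?addn0; last first.
    by rewrite big_nat big1// => i /andP[ti _]; rewrite ltnNge ti.
  rewrite big_nat (eq_bigr (fun=> 1%N)) -?big_nat ?sum_nat_const_nat ?subn0 ?muln1//.
  by move=> i /= ->.
have /andP[t1 t2] := truncn_itv nu0.
rewrite (_ : u - _ = n%:R^-1 * (n%:R * u - (Num.truncn (n%:R * u))%:R)); last first.
  by field; rewrite gt_eqF.
rewrite ger0_norm; last by rewrite mulr_ge0 ?invr_ge0 ?subr_ge0// ltW.
rewrite -[leRHS]mulr1 ler_pM2l ?invr_gt0// lerBlDl.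
by rewrite -natr1 in t2; exact: ltW.
Qed.

Variables (SA SB : set_system Omega) (a : R).
Hypothesis mixAB : forall A B, SA A -> SB B ->
  `|fine (P (A `&` B)) - fine (P A) * fine (P B)| <= a.

(** All that a mixing bound on events needs to know of a function: its upper level sets belong to
    S. *)
Definition lev_meas (S : set_system Omega) f :=
  forall t : R, measurable [set w | t <= f w] /\ S [set w | t <= f w].

Let lev f (n : nat) w : R := n%:R^-1 * \sum_(i < n) \1_[set w | (i.+1)%:R / n%:R <= f w] w.

Let lev_m S f n : lev_meas S f -> measurable_fun setT (lev f n).
Proof.
move=> h; apply: measurable_funM => //.
by apply: measurable_sum => i; apply: measurable_indic; case: (h ((i.+1)%:R / n%:R)).
Qed.

Let lev_eq f n w : lev f n w = n%:R^-1 * \sum_(i < n) (((i.+1)%:R / n%:R <= f w)%R)%:R.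
Proof.
congr (_ * _); apply: eq_bigr => i _; rewrite indicE; congr ((nat_of_bool _)%:R).
by apply/idP/idP => [/set_mem|H]; last exact/mem_set.
Qed.

Let lev1 f n w : `|lev f n w| <= 1.
Proof.
rewrite lev_eq ger0_norm ?mulr_ge0 ?invr_ge0 ?sumr_ge0//.
case: n => [|n]; first by rewrite invr0 mul0r.
rewrite ler_pdivrMl// mulr1; apply: le_trans (_ : \sum_(i < n.+1) 1 <= _).
  by apply: ler_sum => i _; case: (_ <= f w).
by rewrite sumr_const card_ord.
Qed.

(* A [0,1]-valued f is within 1/n of the average of the indicators of {f >= i/n}, which reduces
   the claim to events. *)
Lemma cov_unit f g : measurable_fun setT f -> measurable_fun setT g ->
  lev_meas SA f -> lev_meas SB g ->
  (forall w, 0 <= f w <= 1) -> (forall w, 0 <= g w <= 1) -> `|cov f g| <= a.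
Proof.
move=> mf mg lf lg f01 g01.
have nrm h w : 0 <= h w <= 1 -> `|h w| <= 1 by move=> /andP[? ?]; rewrite ger0_norm.
suff H n : `|cov f g| <= a + 4 * (n.+1)%:R^-1.
  apply/ler_addgt0Pl => e e0.
  have e4 : 0 < e / 4 by lra.
  have [n] := ltr_add_invr e4.
  rewrite add0r => hn.
  by apply: le_trans (H n) _; rewrite addrC lerD2r mulrC -ler_pdivlMr//; exact: ltW.
have n0 : (0 < n.+1)%N by [].
apply: le_trans (@cov_perturb f g (lev f n.+1) (lev g n.+1) (n.+1)%:R^-1 _ _ _ _ _ _ _ _ _ _) _ => //.
- exact: lev_m lf.
- exact: lev_m lg.
- by move=> w; exact: nrm.
- by move=> w; exact: nrm.
- by move=> w; rewrite lev_eq; exact: levels_approx.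
- by move=> w; rewrite lev_eq; exact: levels_approx.
rewrite lerD2r.
set N : R := (n.+1)%:R.
pose A i := [set w | (i.+1)%:R / N <= f w]. pose B i := [set w | (i.+1)%:R / N <= g w].
have mA i : measurable (A i) by case: (lf ((i.+1)%:R / N)).
have mB i : measurable (B i) by case: (lg ((i.+1)%:R / N)).
have ifA (i : 'I_n.+1) : integ (\1_(A i)) by exact: integ_indic.
have ifB (i : 'I_n.+1) : integ (\1_(B i)) by exact: integ_indic.
have EA : Ex (lev f n.+1) = N^-1 * \sum_(i < n.+1) fine (P (A i)).
  rewrite [LHS]ExZ; last exact: integ_sum.
  rewrite Ex_sum//; congr (_ * _); apply: eq_bigr => i _; rewrite -Ex_indic //; exact: eq_Ex.
have EB : Ex (lev g n.+1) = N^-1 * \sum_(i < n.+1) fine (P (B i)).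
  rewrite [LHS]ExZ; last exact: integ_sum.
  rewrite Ex_sum//; congr (_ * _); apply: eq_bigr => i _; rewrite -Ex_indic //; exact: eq_Ex.
have EAB : Ex (fun w => lev f n.+1 w * lev g n.+1 w) =
   N^-1 * N^-1 * \sum_(i < n.+1) \sum_(j < n.+1) fine (P (A i `&` B j)).
  under eq_Ex => w.
    rewrite mulrACA big_distrlr /=.
    under eq_bigr => i _. under eq_bigr => j _.
      rewrite (_ : _ * _ = \1_(A i `&` B j) w); last by rewrite indicI.
      over.
    over.
    over.
  rewrite ExZ; last by apply: integ_sum => i; apply: integ_sum => j; apply: integ_indic; exact: measurableI.
  rewrite Ex_sum; last by move=> i; apply: integ_sum => j; apply: integ_indic; exact: measurableI.
  congr (_ * _); apply: eq_bigr => i _.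
  rewrite Ex_sum; last by move=> j; apply: integ_indic; exact: measurableI.
  by apply: eq_bigr => j _; rewrite Ex_indic//; exact: measurableI.
rewrite /cov EA EB EAB mulrACA -mulrBr big_distrlr /= -sumrB.
have N0 : 0 < N by rewrite ltr0n.
rewrite normrM ger0_norm ?mulr_ge0 ?invr_ge0//; [|exact: ltW..].
rewrite -invfM ler_pdivrMl ?mulr_gt0//.
apply: le_trans (ler_norm_sum _ _ _) _.
apply: le_trans (_ : \sum_(i < n.+1) (N * a) <= _); last first.
  by rewrite sumr_const card_ord -[leLHS]mulr_natl mulrA.
apply: ler_sum => i _; rewrite -sumrB.
apply: le_trans (ler_norm_sum _ _ _) _.
apply: le_trans (_ : \sum_(i < n.+1) a <= _); last by rewrite sumr_const card_ord mulr_natl.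
by apply: ler_sum => j _; apply: mixAB; [case: (lf ((i.+1)%:R / N))|case: (lg ((j.+1)%:R / N))].
Qed.

Lemma cov_affine f g x y u v : measurable_fun setT f -> measurable_fun setT g ->
  integ f -> integ g -> integ (fun w => f w * g w) ->
  cov (fun w => x * f w + y) (fun w => u * g w + v) = x * u * cov f g.
Proof.
move=> mf mg If Ig Ifg; rewrite /cov.
rewrite !ExD ?ExZ ?Ex_cst //; try (exact: integ_cst || exact: integZ).
rewrite (_ : Ex _ = Ex (fun w => (x * u) * (f w * g w) + (x * v) * f w + (y * u) * g w + y * v)); last first.
  by apply: eq_Ex => w; ring.
rewrite !ExD ?ExZ ?Ex_cst //; first ring.
all: by repeat (exact: integ_cst || apply: integZ || apply: integD).
Qed.

(** Mapping [-b, b] and [-c, c] affinely onto [0, 1] divides the covariance by 4 b c. *)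
Lemma cov_bounded f g b c : measurable_fun setT f -> measurable_fun setT g ->
  lev_meas SA f -> lev_meas SB g -> 0 < b -> 0 < c ->
  (forall w, `|f w| <= b) -> (forall w, `|g w| <= c) -> `|cov f g| <= 4 * a * b * c.
Proof.
move=> mf mg lf lg b0 c0 fb gc.
have If := integ_bnd P mf fb. have Ig := integ_bnd P mg gc.
have Ifg := integM_bnd mf mg fb gc.
have aff S h e : 0 < e -> measurable_fun setT h -> lev_meas S h -> (forall w, `|h w| <= e) ->
  [/\ measurable_fun setT (fun w => (e *+ 2)^-1 * h w + 2^-1),
      lev_meas S (fun w => (e *+ 2)^-1 * h w + 2^-1) &
      forall w, 0 <= (e *+ 2)^-1 * h w + 2^-1 <= 1].
  move=> e0 mh lh he; split.
  - by apply: measurable_funD => //; apply: measurable_funM.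
  - move=> t; have := lh (e *+ 2 * (t - 2^-1)).
    rewrite (_ : [set w | e *+ 2 * (t - 2^-1) <= h w] =
     [set w | t <= (e *+ 2)^-1 * h w + 2^-1])//.
    apply/seteqP; split=> w /=; rewrite -lerBlDr; last by rewrite ler_pdivlMl// pmulrn_lgt0.
    by rewrite ler_pdivlMl// pmulrn_lgt0.
  - move=> w; have := he w; rewrite ler_norml => /andP[h1 h2].
    have e20 : 0 < e *+ 2 by rewrite pmulrn_lgt0.
    rewrite mulrC.
    have E : e / (e *+ 2) = 2^-1 by field; rewrite gt_eqF.
    have : - (2^-1) <= h w / (e *+ 2) <= 2^-1.
      by rewrite -E -mulNr !ler_pM2r ?invr_gt0 ?h1 ?h2.
    by move=> /andP[? ?]; lra.
have [mf' lf' f01] := aff _ _ _ b0 mf lf fb.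
have [mg' lg' g01] := aff _ _ _ c0 mg lg gc.
have := cov_unit mf' mg' lf' lg' f01 g01.
have b2 : 0 < b *+ 2 by rewrite pmulrn_lgt0.
have c2 : 0 < c *+ 2 by rewrite pmulrn_lgt0.
rewrite cov_affine// normrM -invfM (@ger0_norm _ (_^-1)); last first.
  by rewrite invr_ge0 mulr_ge0 // ltW.
rewrite ler_pdivrMl ?mulr_gt0//.
by rewrite [X in _ <= X -> _](_ : _ = 4 * a * b * c)//; ring.
Qed.

End BoundedCov.

Lemma powR_le1 {R : realType} (x y : R) : 0 <= x -> x <= 1 -> 0 <= y -> x `^ y <= 1.
Proof.
move=> x0 x1 y0; have := @ge0_ler_powR R y y0 x 1; rewrite !nnegrE powR1.
by move=> /(_ x0 ler01 x1).
Qed.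

Lemma powR_ge1 {R : realType} (x y : R) : 1 <= x -> 0 <= y -> 1 <= x `^ y.
Proof.
move=> x1 y0; have := @ge0_ler_powR R y y0 1 x; rewrite !nnegrE powR1.
by move=> /(_ ler01 (le_trans ler01 x1) x1).
Qed.

(** * Truncation, envelopes and Davydov's inequality *)

Section Clip.
Context {R : realType}.
Implicit Types c x : R.

Definition clip (c x : R) := Num.max (- c) (Num.min x c).

Lemma clip_cases c x : 0 <= c -> [\/ x <= - c /\ clip c x = - c,
  c <= x /\ clip c x = c | - c <= x <= c /\ clip c x = x].
Proof.
move=> c0; rewrite /clip; have [h1|h1] := leP x c.
  by have [h2|h2] := leP (- c) x; [apply: Or33|apply: Or31; rewrite ltW].
have [h2|h2] := leP (- c) c; first by apply: Or32; rewrite ltW.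
by exfalso; lra.
Qed.

Lemma clip_norm c x : 0 <= c -> `|clip c x| <= c.
Proof.
move=> c0; rewrite /clip ler_norml le_max lexx /= ge_max ge_min lexx orbT andbT.
by rewrite (le_trans _ c0)// oppr_le0.
Qed.

Lemma clip_le_norm c x : 0 <= c -> `|clip c x| <= `|x|.
Proof.
move=> c0; have h1 := ler_norm x; have h2 := ler_norm (- x); rewrite normrN in h2.
by case: (clip_cases x c0) => -[h ->] //; rewrite ?normrN ger0_norm//; lra.
Qed.

Lemma clip_id c x : `|x| <= c -> clip c x = x.
Proof. by rewrite ler_norml => /andP[h1 h2]; rewrite /clip min_l// max_r. Qed.

Lemma clip_diff c x : 0 <= c -> `|x - clip c x| <= `|x|.
Proof.
move=> c0; case: (clip_cases x c0) => -[h ->]; last by rewrite subrr normr0.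
- by rewrite !ler0_norm; lra.
- by rewrite !ger0_norm; lra.
Qed.

End Clip.

Section Domination.
Context {d : measure_display} {Omega : measurableType d} {R : realType}.
Variables (P : probability Omega R) (r : \bar R).
Implicit Types (A B f g : Omega -> R) (K : R).

Local Notation Ex := (Ex P).
Local Notation integ := (integ P).
Local Notation cov := (cov P).

(* Envelopes A >= 1 with a bounded r-th moment (bounded almost surely when r = +oo): a product
   of n variables below A is below A^n, so degrees add up along the recursion. *)
Definition dom K A : Prop :=
  [/\ measurable_fun setT A, forall w, 1 <= A w, 0 <= K &
   match r with
   | s%:E => integ (fun w => A w `^ s) /\ Ex (fun w => A w `^ s) <= K
   | +oo%E => {ae P, forall w, A w <= K}
   | -oo%E => False
   end].

Lemma measurable_powRr (s : R) A : measurable_fun setT A ->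
  measurable_fun setT (fun w => A w `^ s).
Proof. by move=> mA; apply: (measurableT_comp (measurable_powR s)). Qed.

(** Gives two factors of a product a common envelope, at the cost of adding the constants. *)
Lemma dom_max K K' A B : dom K A -> dom K' B ->
  dom (K + K') (fun w => Num.max (A w) (B w)).
Proof.
case=> mA A1 K0 hA [mB B1 K'0 hB]; split.
- exact: measurable_maxr.
- by move=> w; rewrite le_max A1.
- by rewrite addr_ge0.
case: r hA hB => [s||] //; last first.
  by move=> hA hB; apply: filterS2 hA hB => w a b; rewrite ge_max ler_wpDr ?ler_wpDl.
move=> [iA eA] [iB eB].
have bd w : Num.max (A w) (B w) `^ s <= A w `^ s + B w `^ s.
  by rewrite maxEle; case: ifP => _; rewrite ?lerDl ?lerDr powR_ge0.
have im : integ (fun w => Num.max (A w) (B w) `^ s).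
  apply: integ_le (integD iA iB); first by apply: measurable_powRr; exact: measurable_maxr.
  by move=> w; rewrite ger0_norm ?powR_ge0.
split=> //; apply: (@le_trans _ _ (Ex (fun w => A w `^ s + B w `^ s))).
  by apply: le_Ex => //; exact: integD.
by rewrite ExD// lerD.
Qed.

(** The domination constant of l A when K is that of A. *)
Definition scl (l K : R) := match r with s%:E => l `^ s * K | _ => l * K end.

Lemma dom_scale l K A : 1 <= l -> dom K A -> dom (scl l K) (fun w => l * A w).
Proof.
move=> l1 [mA A1 K0 hA]; have l0 : 0 <= l by exact: le_trans l1.
rewrite /scl; split.
- by apply: measurable_funM.
- by move=> w; rewrite -[leLHS]mulr1 ler_pM.
- by case: r hA => [s _||] //; rewrite mulr_ge0 ?powR_ge0.
case: r hA => [s [iA eA]||] //; last first.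
  by move=> hA; apply: filterS hA => w ?; rewrite ler_wpM2l.
have E : (fun w => (l * A w) `^ s) = (fun w => l `^ s * A w `^ s).
  by apply/funext => w; rewrite powRM// (le_trans ler01).
by rewrite E; split; [exact: integZ|rewrite ExZ// ler_wpM2l ?powR_ge0].
Qed.

Lemma dom_ge0 K A w : dom K A -> 0 <= A w.
Proof. by case=> _ A1 _ _; exact: le_trans (A1 w). Qed.

Lemma le_dom K K' A : K <= K' -> dom K A -> dom K' A.
Proof.
move=> KK' [mA A1 K0 hA]; split=> //; first exact: le_trans KK'.
case: r hA => [s [iA eA]||] //; first by split=> //; exact: le_trans KK'.
by move=> hA; apply: filterS hA => w ?; exact: le_trans KK'.
Qed.

(** One bound on the s-th moment of an envelope for both cases: K when r is finite, since then A^s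
    <= A^r, and K^s when r = +oo. *)
Definition mom K (s : R) := 1 + K + K `^ s.

Lemma mom_ge0 K s : 0 <= K -> 0 <= mom K s.
Proof. by move=> K0; rewrite !addr_ge0// powR_ge0. Qed.

Lemma integ_ae f c : measurable_fun setT f -> {ae P, forall w, `|f w| <= c} -> integ f.
Proof.
move=> mf h; pose f' := clip `|c| \o f.
have mf' : measurable_fun setT f' by apply: measurable_maxr => //; exact: measurable_minr.
have If' : integ f' by apply: (@integ_bnd _ _ _ _ _ `|c|) => // w; exact: clip_norm.
apply/integrableP; split; first exact/measurable_EFinP.
move/integrableP: If' => [_]; apply: le_lt_trans; apply: ae_ge0_le_integral => //.
- by apply: measurableT_comp => //; exact/measurable_EFinP.
- by apply: measurableT_comp => //; exact/measurable_EFinP.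
apply: filterS h => w hw _; rewrite /= lee_fin /f'.
by rewrite /= clip_id// (le_trans hw)// ler_norm.
Qed.

Lemma dom_moment K A s : dom K A -> 0 <= s -> (s%:E <= r)%E ->
  integ (fun w => A w `^ s) /\ Ex (fun w => A w `^ s) <= mom K s.
Proof.
move=> [mA A1 K0 hA] s0 sr; rewrite /mom.
case: r hA sr => [t [iA eA]||] //; last first.
  move=> hA _; have h : {ae P, forall w, A w `^ s <= K `^ s}.
    apply: filterS hA => w hw; apply: ge0_ler_powR => //; rewrite nnegrE //.
    exact: le_trans (A1 w).
  have I : integ (fun w => A w `^ s).
    apply: (@integ_ae _ (K `^ s)); first exact: measurable_powRr.
    by apply: filterS h => w; rewrite ger0_norm ?powR_ge0.
  split=> //; apply: (@le_trans _ _ (K `^ s)); last by rewrite lerDr addr_ge0.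
  by rewrite -[leRHS](Ex_cst P); apply: le_Ex_ae => //; exact: integ_cst.
rewrite lee_fin => st.
have h w : A w `^ s <= A w `^ t by apply: ler_powR.
have I : integ (fun w => A w `^ s).
  apply: integ_le iA; first exact: measurable_powRr.
  by move=> w; rewrite ger0_norm ?powR_ge0.
split=> //; apply: (@le_trans _ _ K); first by apply: le_trans eA; exact: le_Ex.
by rewrite -addrA addrCA lerDl addr_ge0 ?powR_ge0.
Qed.

Lemma mixing_exp_gt0 s : 0 <= s -> (s%:E < r)%E -> 0 < mixing_exp r s.
Proof.
move=> s0; rewrite /mixing_exp; case: r => [t||] //; rewrite lte_fin => st.
by rewrite divr_gt0 ?subr_gt0// (le_lt_trans s0).
Qed.

Definition tailf A s (T : R) : Omega -> R := fun w => A w `^ s * (T < A w)%R%:R.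

Lemma tailf_meas A s T : measurable_fun setT A -> measurable_fun setT (tailf A s T).
Proof.
move=> mA; apply: measurable_funM; first exact: measurable_powRr.
have -> : (fun w => (T < A w)%R%:R) = \1_(A @^-1` `]T, +oo[) :> (Omega -> R).
  apply/funext => w; rewrite indicE; congr ((nat_of_bool _)%:R).
  by apply/idP/idP => [h|/set_mem]; rewrite ?inE /= in_itv /= andbT.
by apply: measurable_indic; rewrite -[X in measurable X]setTI; exact: mA.
Qed.

(** For r = t finite the level is T = a^(-1/t): then a T^s = a^((t-s)/t), and A^s <= T^(s-t) A^t
    where A > T. For r = +oo the level 1 + K is almost surely not exceeded. *)
Lemma dom_tail K s a : 0 <= K -> 0 <= s -> (s%:E < r)%E -> 0 < a <= 1 ->
  exists T, [/\ 1 <= T, a * T `^ s <= (1 + K) `^ s * a `^ mixing_exp r s &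
   forall A, dom K A ->
     integ (tailf A s T) /\ Ex (tailf A s T) <= K * a `^ mixing_exp r s].
Proof.
move=> K0 s0 sr /andP[a0 a1]; rewrite /dom.
case: r sr => [t||] //= sr; last first.
  exists (1 + K); split.
  - by rewrite lerDl.
  - by rewrite (powRr1 (ltW a0)) mulrC.
  - move=> A [mA A1 _ hA].
    have h : {ae P, forall w, tailf A s (1 + K) w <= 0}.
      apply: filterS hA => w hw; rewrite /tailf ltNge (le_trans hw) ?mulr0//.
      by rewrite lerDr.
    have m0 w : 0 <= tailf A s (1 + K) w by rewrite mulr_ge0 ?powR_ge0.
    have I : integ (tailf A s (1 + K)).
      apply: (@integ_ae _ 0); first exact: tailf_meas.
      by apply: filterS h => w ?; rewrite ger0_norm.
    split=> //; apply: (@le_trans _ _ 0); last by rewrite mulr_ge0 ?powR_ge0.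
    by rewrite -[leRHS](Ex_cst P); apply: le_Ex_ae => //; exact: integ_cst.
rewrite lte_fin in sr; have t0 : 0 < t by exact: le_lt_trans sr.
exists (a `^ (- t^-1)).
have T1 : 1 <= a `^ (- t^-1).
  rewrite powRN -[leLHS]invr1 lef_pV2 ?posrE ?powR_gt0//.
  by apply: powR_le1 => //; rewrite ?invr_ge0; exact: ltW.
have E : a * a `^ (- t^-1) `^ s = a `^ ((t - s) / t).
  rewrite -powRrM -{1}(powRr1 (ltW a0)) -powRD; last by apply/implyP => _; rewrite gt_eqF.
  by congr (_ `^ _); field; rewrite gt_eqF.
split=> //.
  by rewrite E ler_peMl ?powR_ge0//; apply: powR_ge1; rewrite ?lerDl.
move=> A [mA A1 _ [iA eA]].
have bd w : tailf A s (a `^ (- t^-1)) w <= a `^ ((t - s) / t) * A w `^ t.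
  have A0 : 0 < A w by exact: lt_le_trans (A1 w).
  rewrite /tailf; case: ltP => hT; last by rewrite mulr0 mulr_ge0 ?powR_ge0.
  rewrite mulr1.
  have -> : A w `^ s = A w `^ t * A w `^ (s - t).
    by rewrite -powRD ?[t + _]addrC ?subrK//; apply/implyP => _; rewrite gt_eqF.
  rewrite mulrC ler_wpM2r ?powR_ge0//.
  have -> : a `^ ((t - s) / t) = (a `^ (- t^-1)) `^ (s - t).
    by rewrite -powRrM; congr (_ `^ _); ring.
  rewrite -opprB !powRN lef_pV2 ?posrE ?powR_gt0// ?(lt_le_trans _ T1)//.
  2: by rewrite invr_gt0 powR_gt0.
  apply: ge0_ler_powR; rewrite ?nnegrE ?subr_ge0 ?invr_ge0 ?powR_ge0 ?(ltW sr) ?(ltW A0)//.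
  by rewrite -powRN ltW.
have I : integ (tailf A s (a `^ (- t^-1))).
  apply: integ_le (integZ _ iA); first exact: tailf_meas.
  by move=> w; rewrite ger0_norm; [exact: bd|rewrite mulr_ge0 ?powR_ge0].
split=> //; apply: le_trans (le_Ex I (integZ _ iA) bd) _.
by rewrite ExZ// mulrC ler_wpM2r ?powR_ge0.
Qed.

Lemma clip_meas c f : measurable_fun setT f -> measurable_fun setT (clip c \o f).
Proof. by move=> mf; apply: measurable_maxr => //; exact: measurable_minr. Qed.

Lemma clip_lev (S : set_system Omega) c f : S setT -> S set0 -> lev_meas S f ->
  lev_meas S (clip c \o f).
Proof.
move=> ST S0 lf t.
have [tc|ct] := leP t (- c).
  rewrite (_ : [set w | _] = setT) //.
  by apply/seteqP; split=> w // _ /=; rewrite /clip le_max tc.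
have [tc|ct'] := leP t c.
  rewrite (_ : [set w | _] = [set w | t <= f w])//.
  apply/seteqP; split=> w /=; rewrite /clip le_max le_min tc andbT.
    by case/orP => //; rewrite leNgt ct.
  by move=> ->; rewrite orbT.
rewrite (_ : [set w | _] = set0)//.
apply/seteqP; split=> w //=; rewrite /clip le_max le_min (leNgt t c) ct' andbF orbF.
by rewrite leNgt ct.
Qed.

(** The summands account, in order, for the covariance of the truncated variables, the truncation
    error of the expected product and that of the product of the expectations. *)
Definition covC K (s : R) := 4 * (1 + K) `^ s + 2 * K + 2 * K * mom K s.

Lemma covC_ge0 K s : 0 <= K -> 0 <= covC K s.
Proof. by move=> K0; rewrite !addr_ge0// ?mulr_ge0 ?powR_ge0 ?mom_ge0// mulr_ge0. Qed.

(* Davydov's inequality: truncate at the level T for which a T^(e+s) is comparable to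
   a^((r-e-s)/r). *)
Lemma cov_dom (SA SB : set_system Omega) (a K e s : R) A f g :
  (forall X Y, SA X -> SB Y ->
    `|fine (P (X `&` Y)) - fine (P X) * fine (P Y)| <= a) ->
  SA setT -> SA set0 -> SB setT -> SB set0 ->
  0 <= a <= 1 -> 0 <= e -> 0 <= s -> ((e + s)%:E < r)%E -> dom K A ->
  measurable_fun setT f -> measurable_fun setT g -> lev_meas SA f -> lev_meas SB g ->
  (forall w, `|f w| <= A w `^ e) -> (forall w, `|g w| <= A w `^ s) ->
  `|cov f g| <= covC K (e + s) * a `^ mixing_exp r (e + s).
Proof.
move=> hmix AT A0 BT B0 /andP[a0 a1] e0 s0 esr dA mf mg lf lg fA gA.
have es0 : 0 <= e + s by rewrite addr_ge0.
have th0 := mixing_exp_gt0 es0 esr.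
case: (dA) => mA A1 K0 _.
have C0 := covC_ge0 (e + s) K0.
(* A zero coefficient admits no truncation level, so [a] is replaced by a positive b >= a; for a = 0
   the bound is then used with b small. *)
suff main b : a <= b -> 0 < b <= 1 -> `|cov f g| <= covC K (e + s) * b `^ mixing_exp r (e + s).
  move: a0; rewrite le_eqVlt => /orP[/eqP a0|a0]; last by apply: main; rewrite ?a0 ?a1.
  rewrite -a0 powR0 ?gt_eqF// mulr0 leNgt; apply/negP => v0.
  set v := `|cov f g| in v0 main *; set C := covC K (e + s) in C0 main *.
  have D0 : 0 < C + v by rewrite ltr_wpDl.
  (* With b chosen so that its power in the bound is x, the bound would read v <= C x, and C x < v
     for this x. *)
  pose x := v / (C + v).
  have x0 : 0 < x by rewrite divr_gt0.
  have x1 : x <= 1 by rewrite ler_pdivrMr// mul1r lerDr.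
  have := main (x `^ (mixing_exp r (e + s))^-1); rewrite -a0 powR_ge0 powR_gt0// => /(_ isT).
  have -> : x `^ (mixing_exp r (e + s))^-1 <= 1.
    by apply: powR_le1 => //; rewrite ?invr_ge0; exact: ltW.
  move=> /(_ isT); rewrite -powRrM mulVf ?gt_eqF// (powRr1 (ltW x0)) leNgt => /negP; apply.
  by rewrite /x mulrCA gtr_pMr// ltr_pdivrMr// mul1r ltrDl.
move=> ab b01; have hmix' X Y : SA X -> SB Y ->
    `|fine (P (X `&` Y)) - fine (P X) * fine (P Y)| <= b.
  by move=> ? ?; apply: le_trans ab; exact: hmix.
have [T [T1 aT hT]] := dom_tail K0 es0 esr b01.
have T0 : 0 < T by exact: lt_le_trans T1.
have [Ih Eh] := hT _ dA.
set tau := K * _ in Eh; set h := tailf A (e + s) T in Ih Eh.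
have [Im Em] := dom_moment dA es0 (ltW esr).
have Ap w x y : 0 <= y -> A w `^ x <= A w `^ (x + y).
  by move=> y0; apply: ler_powR; rewrite ?lerDl.
have Aps w : A w `^ s <= A w `^ (e + s) by rewrite addrC Ap.
pose f1 := clip (T `^ e) \o f; pose g1 := clip (T `^ s) \o g.
have mf1 : measurable_fun setT f1 by exact: clip_meas.
have mg1 : measurable_fun setT g1 by exact: clip_meas.
have hw w : h w = A w `^ (e + s) * (T < A w)%R%:R by [].
have df (u : R) F w : 0 <= u -> `|F w| <= A w `^ u ->
    `|F w - clip (T `^ u) (F w)| <= A w `^ u * (T < A w)%R%:R.
  move=> u0 FA; have [FT|FT] := leP `|F w| (T `^ u).
    by rewrite clip_id// subrr normr0 mulr_ge0 ?powR_ge0.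
  have -> : T < A w.
    rewrite ltNge; apply/negP => AT'; move: FT; rewrite ltNge => /negP; apply.
    apply: le_trans FA _; apply: ge0_ler_powR; rewrite ?nnegrE ?(dom_ge0 _ dA)//.
    exact: ltW.
  by rewrite mulr1 (le_trans (clip_diff _ _)) ?powR_ge0.
have Ae w : A w `^ (e + s) = A w `^ e * A w `^ s.
  by rewrite powRD//; apply/implyP => _; rewrite gt_eqF// (lt_le_trans _ (A1 w)).
have If : integ f.
  by apply: (integ_le mf _ Im) => w; apply: le_trans (Ap _ _ _ s0).
have Ig : integ g.
  by apply: (integ_le mg _ Im) => w; apply: le_trans (Aps w).
have Ifg : integ (fun w => f w * g w).
  apply: (integ_le _ _ Im); first exact: measurable_funM.
  by move=> w; rewrite normrM Ae ler_pM.
have f1A w : `|f1 w| <= A w `^ e by apply: le_trans (fA w); apply: clip_le_norm; exact: powR_ge0.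
have g1A w : `|g1 w| <= A w `^ s by apply: le_trans (gA w); apply: clip_le_norm; exact: powR_ge0.
have If1 : integ f1.
  by apply: (integ_le mf1 _ Im) => w; apply: le_trans (Ap _ _ _ s0).
have Ig1 : integ g1.
  by apply: (integ_le mg1 _ Im) => w; apply: le_trans (Aps w).
have Ifg1 : integ (fun w => f1 w * g1 w).
  apply: (integ_le _ _ Im); first exact: measurable_funM.
  by move=> w; rewrite normrM Ae ler_pM.
have D1 : `|Ex (fun w => f w * g w) - Ex (fun w => f1 w * g1 w)| <= 2 * tau.
  rewrite -ExB//; apply: (@le_trans _ _ (Ex (fun w => 2 * h w))); last first.
    by rewrite ExZ// ler_wpM2l.
  apply: normr_Ex_le; [exact: integB|exact: integZ|move=> w].
  rewrite (_ : _ - _ = (f w - f1 w) * g w + f1 w * (g w - g1 w)); last by ring.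
  rewrite (le_trans (ler_normD _ _))// !normrM mulr_natl mulr2n hw Ae lerD//.
    by rewrite mulrAC ler_pM// df.
  by rewrite -mulrA ler_pM// df.
have D2 F (u : R) : 0 <= u -> (forall w, A w `^ u <= A w `^ (e + s)) -> integ F ->
    measurable_fun setT F -> (forall w, `|F w| <= A w `^ u) ->
    `|Ex F - Ex (clip (T `^ u) \o F)| <= tau.
  move=> u0 Au IF mF FA.
  have IF1 : integ (clip (T `^ u) \o F).
    apply: (integ_le _ _ Im); first exact: clip_meas.
    move=> w; apply: le_trans (Au w); apply: le_trans (FA w); apply: clip_le_norm.
    exact: powR_ge0.
  rewrite -ExB//; apply: le_trans Eh; apply: normr_Ex_le => //; first exact: integB.
  by move=> w; rewrite hw; apply: le_trans (df _ _ _ u0 (FA w)) _; rewrite ler_wpM2r.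
have M F (u : R) : (forall w, A w `^ u <= A w `^ (e + s)) -> integ F ->
    (forall w, `|F w| <= A w `^ u) -> `|Ex F| <= mom K (e + s).
  move=> Au IF FA; apply: le_trans Em; apply: normr_Ex_le => // w.
  exact: le_trans (Au w).
have mu0 := mom_ge0 (e + s) K0.
have tau0 : 0 <= tau by rewrite mulr_ge0 ?powR_ge0.
have D3 : `|Ex f * Ex g - Ex f1 * Ex g1| <= 2 * tau * mom K (e + s).
  rewrite (_ : _ - _ = (Ex f - Ex f1) * Ex g + Ex f1 * (Ex g - Ex g1)); last by ring.
  rewrite (le_trans (ler_normD _ _))// !normrM -mulrA mulr_natl mulr2n lerD//.
    apply: ler_pM => //; last exact: (M _ s).
    by apply: (D2 f e) => // w; exact: Ap.
  rewrite mulrC; apply: ler_pM => //; first by apply: (D2 g s).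
  by apply: (M _ e) => // w; exact: Ap.
have D4 : `|cov f1 g1| <= 4 * b * T `^ e * T `^ s.
  apply: (@cov_bounded _ _ _ _ SA SB) => //; rewrite ?powR_gt0//.
  - exact: clip_lev.
  - exact: clip_lev.
  - by move=> w; apply: clip_norm; exact: powR_ge0.
  - by move=> w; apply: clip_norm; exact: powR_ge0.
have -> : cov f g = cov f1 g1 + (Ex (fun w => f w * g w) - Ex (fun w => f1 w * g1 w))
   - (Ex f * Ex g - Ex f1 * Ex g1) by rewrite /cov; ring.
rewrite (le_trans (ler_normB _ _))// (_ : covC K (e + s) * b `^ mixing_exp r (e + s) =
   4 * ((1 + K) `^ (e + s) * b `^ mixing_exp r (e + s)) + 2 * tau + 2 * tau * mom K (e + s));
  last by rewrite /covC /tau; ring.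
apply: lerD => //; apply: le_trans (ler_normD _ _) _; apply: lerD => //.
apply: le_trans D4 _; rewrite -!mulrA ler_wpM2l// -powRD//.
by apply/implyP => _; rewrite gt_eqF.
Qed.

End Domination.

(** * Degrees and sigma-fields *)

Section SigmaFields.
Context {d : measure_display} {Omega : measurableType d} {R : realType}.
Context {T : finType}.
Variable X : T -> Omega -> R.
Hypothesis mX : forall i, measurable_fun setT (X i).
Implicit Types (U V : {set T}) (f g : Omega -> R).

Definition gens U : set_system Omega :=
  \bigcup_(i in [set` U]) preimage_set_system setT (X i) measurable.

(** Phrased on the copy of [Omega] that carries the generated sigma-field, so that the closure
    properties of measurable functions apply verbatim. *)
Definition smeas U f := measurable_fun (setT : set (g_sigma_algebraType (gens U))) f.

Lemma gens_measurable U : <<s gens U >> `<=` d.-measurable.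
Proof.
apply: smallest_sub; first exact: sigma_algebra_measurable.
by move=> A [i _ [B mB <-]]; rewrite setTI -[X in measurable X]setTI; exact: mX.
Qed.

Lemma smeas_meas U f : smeas U f -> measurable_fun setT f.
Proof. by move=> h _ B mB; apply: (@gens_measurable U); exact: h. Qed.

Lemma smeas_sub U V f : U \subset V -> smeas U f -> smeas V f.
Proof.
move=> /fintype.subsetP UV h _ B mB; have := h measurableT B mB.
apply: sub_sigma_algebra2 => A [i iU Ai]; exists i => //; exact: UV.
Qed.

Lemma smeas_X U i : i \in U -> smeas U (X i).
Proof.
move=> iU _ B mB; apply: sub_sigma_algebra; exists i => //; exists B => //.
Qed.

Lemma smeas_cst U c : smeas U (fun=> c).
Proof. exact: measurable_cst. Qed.

Lemma smeasM U f g : smeas U f -> smeas U g -> smeas U (fun w => f w * g w).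
Proof. exact: measurable_funM. Qed.

Lemma smeasD U f g : smeas U f -> smeas U g -> smeas U (fun w => f w + g w).
Proof. exact: measurable_funD. Qed.

Lemma smeasB U f g : smeas U f -> smeas U g -> smeas U (fun w => f w - g w).
Proof. exact: measurable_funB. Qed.

Lemma smeas_comp U (F : R -> R) f : measurable_fun setT F -> smeas U f ->
  smeas U (fun w => F (f w)).
Proof. exact: measurableT_comp. Qed.

Lemma smeas_exp U f n : smeas U f -> smeas U (fun w => f w ^+ n).
Proof. exact: measurable_funX. Qed.

Lemma smeas_sum U (I : Type) (s : seq I) (F : I -> Omega -> R) :
  (forall i, smeas U (F i)) -> smeas U (fun w => \sum_(i <- s) F i w).
Proof. by move=> h; apply: measurable_sum. Qed.

Lemma smeas_Wsum U (s : seq T) : {subset s <= U} -> smeas U (fun w => \sum_(i <- s) X i w).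
Proof.
elim: s => [_|i s IH sU].
  by under eq_fun do rewrite big_nil; exact: smeas_cst.
under eq_fun do rewrite big_cons.
apply: smeasD; first by apply: smeas_X; apply: sU; rewrite mem_head.
by apply: IH => j js; apply: sU; rewrite inE js orbT.
Qed.

Lemma smeas_lev U f : smeas U f -> lev_meas <<s gens U >> f.
Proof.
move=> h t.
have H : <<s gens U >> [set w | t <= f w].
  have := h measurableT `[t, +oo[%classic (measurable_itv _).
  rewrite setTI (_ : _ @^-1` _ = [set w | t <= f w])//.
  by apply/seteqP; split=> w /=; rewrite in_itv /= andbT.
by split=> //; exact: gens_measurable H.
Qed.

Lemma gens_setT U : <<s gens U >> setT.
Proof. exact: (@measurableT _ (g_sigma_algebraType (gens U))). Qed.

Lemma gens_set0 U : <<s gens U >> set0.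
Proof. exact: sigma_algebra0. Qed.

End SigmaFields.

Section Degree.
Context {d : measure_display} {Omega : measurableType d} {R : realType}.
Variables (P : probability Omega R) (r : \bar R).
Implicit Types (f g : Omega -> R) (K : R) (n m : nat).

Local Notation Ex := (Ex P).
Local Notation integ := (integ P).
Local Notation cov := (cov P).
Local Notation dom := (dom P r).

(** Degree n with a controlled constant. The variant [pd] forgets the constant and includes
    measurability; it serves for integrability. *)
Definition dm K n f := exists2 A, dom K A & forall w, `|f w| <= A w ^+ n.

Definition pd n f := measurable_fun setT f /\
  exists K A c, [/\ dom K A, 0 <= c & forall w, `|f w| <= c * A w ^+ n].

Lemma dm_le K K' n f : K <= K' -> dm K n f -> dm K' n f.
Proof. by move=> KK [A dA fA]; exists A => //; exact: le_dom dA. Qed.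

Lemma dm_pd K n f : measurable_fun setT f -> dm K n f -> pd n f.
Proof. by move=> mf [A dA fA]; split=> //; exists K, A, 1; split=> // w; rewrite mul1r. Qed.

Lemma dom_expS K A m n w : dom K A -> (m <= n)%N -> A w ^+ m <= A w ^+ n.
Proof. by case=> _ A1 _ _ mn; exact: ler_weXn2l. Qed.

Lemma dmM K K' n m f g : dm K n f -> dm K' m g ->
  dm (K + K') (n + m) (fun w => f w * g w).
Proof.
move=> [A dA fA] [B dB gB]; exists (fun w => Num.max (A w) (B w)); first exact: dom_max.
move=> w; rewrite normrM exprD; apply: ler_pM => //.
  apply: le_trans (fA w) _; rewrite lerXn2r ?nnegrE ?le_max ?lexx ?(dom_ge0 w dA)//.
apply: le_trans (gB w) _; rewrite lerXn2r ?nnegrE ?le_max ?lexx ?(dom_ge0 w dB) ?orbT//.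
Qed.

Lemma pd_cst n c : (0 <= 1 :> R) -> (exists K A, dom K A) -> pd n (fun=> c).
Proof.
move=> _ [K [A dA]]; split => //; exists K, A, `|c|; split=> // w.
by rewrite ler_peMr// exprn_ege1//; case: dA.
Qed.

Lemma pdM n m f g : pd n f -> pd m g -> pd (n + m) (fun w => f w * g w).
Proof.
move=> [mf [K [A [c [dA c0 fA]]]]] [mg [K' [B [c' [dB c'0 gB]]]]].
split; first exact: measurable_funM.
exists (K + K'), (fun w => Num.max (A w) (B w)), (c * c'); split.
- exact: dom_max.
- exact: mulr_ge0.
move=> w; rewrite normrM exprD mulrACA; apply: ler_pM => //.
  apply: le_trans (fA w) _; rewrite ler_wpM2l// lerXn2r ?nnegrE ?le_max ?lexx ?(dom_ge0 w dA)//.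
apply: le_trans (gB w) _; rewrite ler_wpM2l// lerXn2r ?nnegrE ?le_max ?lexx ?(dom_ge0 w dB) ?orbT//.
Qed.

Lemma pdD n f g : pd n f -> pd n g -> pd n (fun w => f w + g w).
Proof.
move=> [mf [K [A [c [dA c0 fA]]]]] [mg [K' [B [c' [dB c'0 gB]]]]].
split; first exact: measurable_funD.
exists (K + K'), (fun w => Num.max (A w) (B w)), (c + c'); split.
- exact: dom_max.
- exact: addr_ge0.
move=> w; rewrite (le_trans (ler_normD _ _))// mulrDl; apply: lerD.
  apply: le_trans (fA w) _; rewrite ler_wpM2l// lerXn2r ?nnegrE ?le_max ?lexx ?(dom_ge0 w dA)//.
apply: le_trans (gB w) _; rewrite ler_wpM2l// lerXn2r ?nnegrE ?le_max ?lexx ?(dom_ge0 w dB) ?orbT//.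
Qed.

Lemma pdZ n c f : pd n f -> pd n (fun w => c * f w).
Proof.
move=> [mf [K [A [c' [dA c0 fA]]]]]; split; first by apply: measurable_funM.
exists K, A, (`|c| * c'); split=> //; first exact: mulr_ge0.
by move=> w; rewrite normrM -mulrA ler_wpM2l.
Qed.

Lemma pdB n f g : pd n f -> pd n g -> pd n (fun w => f w - g w).
Proof.
move=> hf /(pdZ (-1)) hg; have := pdD hf hg.
by under eq_fun do rewrite mulN1r.
Qed.

Lemma pd_sum n (I : Type) (s : seq I) (F : I -> Omega -> R) : (exists K A, dom K A) ->
  (forall i, pd n (F i)) -> pd n (fun w => \sum_(i <- s) F i w).
Proof.
move=> hd h; elim: s => [|i s IH].
  by under eq_fun do rewrite big_nil; exact: pd_cst.
by under eq_fun do rewrite big_cons; exact: pdD.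
Qed.

Lemma pd_exp n m f : (exists K A, dom K A) -> pd n f -> pd (n * m) (fun w => f w ^+ m).
Proof.
move=> hd hf; elim: m => [|m IH].
  by under eq_fun do rewrite expr0; exact: pd_cst.
by under eq_fun do rewrite exprS; rewrite mulnS; exact: pdM.
Qed.

Lemma pd_integ n f : (n%:R%:E <= r)%E -> pd n f -> integ f.
Proof.
move=> nr [mf [K [A [c [dA c0 fA]]]]].
have [I _] := dom_moment dA (ler0n _ n) nr.
apply: (integ_le mf _ (integZ c I)) => w.
by rewrite powR_mulrn ?(dom_ge0 w dA).
Qed.

Lemma dm_Ex K n f : 0 <= K -> (n%:R%:E <= r)%E -> measurable_fun setT f -> dm K n f ->
  `|Ex f| <= mom K n%:R.
Proof.
move=> K0 nr mf [A dA fA]; have [I E] := dom_moment dA (ler0n _ n) nr.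
have fA' w : `|f w| <= A w `^ n%:R by rewrite powR_mulrn ?(dom_ge0 w dA).
apply: le_trans E; apply: normr_Ex_le => //; exact: integ_le fA' I.
Qed.

Lemma cov_dm (SA SB : set_system Omega) (a K K' : R) e s f g :
  (forall X Y, SA X -> SB Y ->
    `|fine (P (X `&` Y)) - fine (P X) * fine (P Y)| <= a) ->
  SA setT -> SA set0 -> SB setT -> SB set0 ->
  0 <= a <= 1 -> ((e + s)%:R%:E < r)%E ->
  measurable_fun setT f -> measurable_fun setT g -> lev_meas SA f -> lev_meas SB g ->
  dm K e f -> dm K' s g ->
  `|cov f g| <= covC (K + K') (e + s)%:R * a `^ mixing_exp r (e + s)%:R.
Proof.
move=> hm AT A0 BT B0 a01 esr mf mg lf lg [A dA fA] [B dB gB].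
rewrite natrD in esr *.
apply: (cov_dom (A := fun w => Num.max (A w) (B w)) hm) => //.
- exact: dom_max.
- move=> w; rewrite powR_mulrn; last by rewrite le_max (dom_ge0 w dA).
  by apply: le_trans (fA w) _; rewrite lerXn2r ?nnegrE ?le_max ?lexx ?(dom_ge0 w dA).
- move=> w; rewrite powR_mulrn; last by rewrite le_max (dom_ge0 w dA).
  by apply: le_trans (gB w) _; rewrite lerXn2r ?nnegrE ?le_max ?lexx ?(dom_ge0 w dB) ?orbT.
Qed.

End Degree.

(** * The expansion of E W f(W) for a weakly dependent sum *)

Tactic Notation "nlia" constr(a) := move: (a); clear; lia.
Tactic Notation "nlia" constr(a) constr(b) := move: (a) (b); clear; lia.
Tactic Notation "nlia" constr(a) constr(b) constr(c) := move: (a) (b) (c); clear; lia.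
Tactic Notation "nlia" constr(a) constr(b) constr(c) constr(d) :=
  move: (a) (b) (c) (d); clear; lia.

Section Constants.
Context {R : realType}.
Variables (r : \bar R) (q : nat) (K0 : R).
Hypothesis K00 : 0 <= K0.
Implicit Types (K s : R).

Lemma mom_le K K' s : 0 <= s -> 0 <= K -> K <= K' -> mom K s <= mom K' s.
Proof.
move=> s0 k0 kk; rewrite /mom !lerD//; apply: ge0_ler_powR; rewrite ?nnegrE//.
exact: le_trans kk.
Qed.

Lemma covC_le K K' s : 0 <= s -> 0 <= K -> K <= K' -> covC K s <= covC K' s.
Proof.
move=> s0 k0 kk; have k'0 : 0 <= K' by exact: le_trans kk.
rewrite /covC; apply: lerD; first apply: lerD.
- rewrite ler_wpM2l//; apply: ge0_ler_powR; rewrite ?nnegrE ?addr_ge0// lerD2l//.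
- by rewrite ler_wpM2l.
- apply: ler_pM => //; first by rewrite mulr_ge0.
  + exact: mom_ge0.
  + by rewrite ler_wpM2l.
  + exact: mom_le.
Qed.

(** Sums over the degrees, so that a single constant serves all degrees up to q + 1. *)
Definition momq K : R := \sum_(s < q.+2) mom K s%:R.
Definition covq K : R := \sum_(s < q.+2) covC K s%:R.

Lemma momq_ge0 K : 0 <= K -> 0 <= momq K.
Proof. by move=> k0; apply: sumr_ge0 => i _; exact: mom_ge0. Qed.

Lemma covq_ge0 K : 0 <= K -> 0 <= covq K.
Proof. by move=> k0; apply: sumr_ge0 => i _; exact: covC_ge0. Qed.

Lemma mom_momq K (s : nat) : 0 <= K -> (s <= q.+1)%N -> mom K s%:R <= momq K.
Proof.
move=> k0 sq; rewrite /momq (bigD1 (inord s))//= inordK// lerDl.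
by apply: sumr_ge0 => i _; exact: mom_ge0.
Qed.

Lemma covC_covq K (s : nat) : 0 <= K -> (s <= q.+1)%N -> covC K s%:R <= covq K.
Proof.
move=> k0 sq; rewrite /covq (bigD1 (inord s))//= inordK// lerDl.
by apply: sumr_ge0 => i _; exact: covC_ge0.
Qed.

Lemma momq_le K K' : 0 <= K -> K <= K' -> momq K <= momq K'.
Proof. by move=> k0 kk; apply: ler_sum => i _; exact: mom_le. Qed.

Lemma covq_le K K' : 0 <= K -> K <= K' -> covq K <= covq K'.
Proof. by move=> k0 kk; apply: ler_sum => i _; exact: covC_le. Qed.

Lemma scl_ge0 l K : 0 <= l -> 0 <= K -> 0 <= scl r l K.
Proof. by move=> l0 k0; rewrite /scl; case: r => [s||]; rewrite mulr_ge0 ?powR_ge0. Qed.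

(** In [M'], the second term bounds the mean of a product with a scalar factor, the third the
    covariance with a centred factor. In the new K, the terms pay for a product of two factors, for
    one more variable, for a scalar of size [M'] seen as a variable, and for centring a product. *)
Fixpoint KM (t : nat) : R * R :=
  if t is t'.+1 then
    let: (K, M) := KM t' in
    let M' := M + M * momq K + covq (K + K) in
    (K + K + K0 + scl r (1 + M') 1 + scl r (1 + momq (K + K)) (K + K), M')
  else (K0 + scl r 2 1, 1).

(* Domination constant and size of the scalar factors after t expansion steps. *)
Definition Kn t := (KM t).1.
Definition Mn t := (KM t).2.

Lemma Mn_S t : Mn t.+1 = Mn t + Mn t * momq (Kn t) + covq (Kn t + Kn t).
Proof. by rewrite /Mn /Kn /=; case: (KM t). Qed.

Lemma Kn_S t : Kn t.+1 = Kn t + Kn t + K0 + scl r (1 + Mn t.+1) 1 +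
  scl r (1 + momq (Kn t + Kn t)) (Kn t + Kn t).
Proof. by rewrite Mn_S /Mn /Kn /=; case: (KM t). Qed.

Lemma KMn_ge0 t : 0 <= Kn t /\ 1 <= Mn t.
Proof.
elim: t => [|t [IH1 IH2]].
  by split; rewrite /Kn /Mn //= addr_ge0// scl_ge0.
have kk : 0 <= Kn t + Kn t by rewrite addr_ge0.
have M0 : 0 <= Mn t by exact: le_trans IH2.
have M1 : 1 <= Mn t.+1.
  by rewrite Mn_S -addrA ler_wpDr// addr_ge0 ?covq_ge0// mulr_ge0 ?momq_ge0.
have M1' : 0 <= Mn t.+1 by exact: le_trans M1.
by split=> //; rewrite Kn_S !addr_ge0// scl_ge0// addr_ge0// momq_ge0.
Qed.

Lemma Kn_ge0 t : 0 <= Kn t. Proof. by case: (KMn_ge0 t). Qed.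
Lemma Mn_ge1 t : 1 <= Mn t. Proof. by case: (KMn_ge0 t). Qed.
Lemma Mn_ge0 t : 0 <= Mn t. Proof. exact: le_trans (Mn_ge1 t). Qed.

Lemma Mn_mono t t' : (t <= t')%N -> Mn t <= Mn t'.
Proof.
move=> /subnK <-; elim: (t' - t)%N => // n IH; apply: le_trans IH _.
rewrite addSn Mn_S -addrA lerDl addr_ge0 ?covq_ge0 ?addr_ge0 ?Kn_ge0//.
by rewrite mulr_ge0 ?momq_ge0 ?Kn_ge0 ?Mn_ge0.
Qed.

Lemma Kn_parts t : let K := Kn t in let K' := Kn t.+1 in
  [/\ K + K <= K', K + K0 <= K', scl r (1 + Mn t.+1) 1 <= K' &
  scl r (1 + momq (K + K)) (K + K) <= K'].
Proof.
have k := Kn_ge0 t; have kk : 0 <= Kn t + Kn t by rewrite addr_ge0.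
have s1 : 0 <= scl r (1 + Mn t.+1) 1 by rewrite scl_ge0// addr_ge0 ?Mn_ge0.
have s2 : 0 <= scl r (1 + momq (Kn t + Kn t)) (Kn t + Kn t).
  by rewrite scl_ge0// addr_ge0 ?momq_ge0.
rewrite /= Kn_S; move: (scl r _ 1) (scl r _ (_ + _)) s1 s2 => a b s1 s2.
move: (Kn t) k => K k; move: (K00) => h0.
by split; lra.
Qed.

Lemma Kn_mono t t' : (t <= t')%N -> Kn t <= Kn t'.
Proof.
move=> /subnK <-; elim: (t' - t)%N => // n IH; apply: le_trans IH _.
by rewrite addSn; have [h _ _ _] := Kn_parts (n + t); apply: le_trans h; rewrite lerDl Kn_ge0.
Qed.

Lemma K0_Kn t : K0 <= Kn t.
Proof.
apply: (@le_trans _ _ (Kn 0)); last exact: Kn_mono.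
by rewrite /Kn /= lerDl scl_ge0.
Qed.

(** Bounds, up to the mixing factor, the expectation of an admissible factor times a Taylor
    remainder: a covariance if the factor is centred, a scalar times a moment if it is constant. *)
Definition Ct (tm : nat) := covq (Kn tm + (Kn tm + K0)) + Mn tm * momq (Kn tm + K0).

Lemma Ct_ge0 tm : 0 <= Ct tm.
Proof. by rewrite addr_ge0 ?covq_ge0 ?mulr_ge0 ?momq_ge0 ?Mn_ge0 ?addr_ge0 ?Kn_ge0. Qed.

End Constants.

(** * Error sums over balls and shells *)

Section ErrorSums.
Context {R : realType}.
Variables (bl sh a : nat -> R) (L : nat) (cc C : R).
Hypothesis bl1 : forall l, 1 <= bl l.
Hypothesis bl_mono : forall l l', (l <= l')%N -> bl l <= bl l'.
Hypothesis sh0 : forall l, 0 <= sh l.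
Hypothesis sh_bl : forall l l', \sum_(l.+1 <= i < l') sh i <= bl l'.
Hypothesis a0 : forall l, 0 <= a l.
Hypothesis cc0 : 0 <= cc.
Hypothesis C0 : 0 <= C.

(** The error of an expansion of order n at scale l, where [bl] is the volume of balls and [sh] that
    of shells: n sites within distance l, weighted by [tau], or one site in a shell i > l and n - 1
    sites within distance i, weighted by the mixing coefficient at i. *)
Definition Err n (tau : R) l :=
  tau * bl l ^+ n + \sum_(l.+1 <= i < L.+1) sh i * bl i ^+ n.-1 * a i.

(** Solves the recursion CE n = cc (1 + CE 1 + ... + CE (n - 1)), in which each step multiplies the
    sum of all lower-order errors by cc. *)
Definition CE n : R := cc * (1 + cc) ^+ n.-1.

Let bl0 l : 0 <= bl l. Proof. exact: le_trans (bl1 l). Qed.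
Let blp l : 0 < bl l. Proof. exact: lt_le_trans (bl1 l). Qed.

Lemma Err_ge0 n tau l : 0 <= tau -> 0 <= Err n tau l.
Proof.
move=> t0; apply: addr_ge0; first by rewrite mulr_ge0 ?exprn_ge0.
by apply: sumr_ge0 => i _; rewrite !mulr_ge0 ?exprn_ge0.
Qed.

Lemma CE_ge0 n : 0 <= CE n.
Proof. by rewrite mulr_ge0 ?exprn_ge0 ?addr_ge0. Qed.

Lemma CE_sum n : \sum_(i < n) CE (n - i) + 1 = (1 + cc) ^+ n.
Proof.
elim: n => [|n IH]; first by rewrite big_ord0 add0r expr0.
rewrite big_ord_recl subn0 -addrA.
under eq_bigr do rewrite lift0 subSS.
by rewrite IH /CE /= exprS -[X in _ + X]mul1r -mulrDl addrC.
Qed.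

(** As [bl] is monotone and at least 1, a further ball is absorbed by raising the order. *)
Lemma ErrS n i tau l : (0 < i < n)%N -> 0 <= tau -> bl l * Err i tau l <= Err n tau l.
Proof.
move=> /andP[i0 ni] t0; rewrite mulrDr; apply: lerD.
  by rewrite mulrCA -exprS ler_wpM2l// ler_weXn2l.
rewrite mulr_sumr [leLHS]big_nat_cond [leRHS]big_nat_cond; apply: ler_sum => k /andP[/andP[lk _] _].
rewrite mulrA; apply: ler_wpM2r => //; rewrite mulrCA; apply: ler_wpM2l => //; rewrite mulrC.
apply: (@le_trans _ _ (bl k ^+ i.-1 * bl k)); first by rewrite ler_wpM2l ?exprn_ge0// bl_mono// ltnW.
by rewrite -exprSr ler_weXn2l//; move: i0 ni; case: i => //= i _; case: n.
Qed.

Lemma tau_Err n tau l : (0 < n)%N -> 0 <= tau -> bl l * tau <= Err n tau l.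
Proof.
move=> n0 t0; rewrite /Err mulrC ler_wpDr//.
  by apply: sumr_ge0 => i _; rewrite !mulr_ge0 ?exprn_ge0.
by rewrite ler_wpM2l// -[leLHS]expr1 ler_weXn2l.
Qed.

(** The cost of removing the sites of one ball, each of which triggers expansions of all lower
    orders and one Taylor remainder. *)
Lemma inc_le n tau l : (0 < n)%N -> 0 <= tau ->
  bl l * (\sum_(i < n.-1) CE (n.-1 - i)%N * Err (n.-1 - i)%N tau l + tau) <=
  (1 + cc) ^+ n.-1 * Err n tau l.
Proof.
move=> n0 t0; rewrite -CE_sum mulrDr mulrDl mul1r; apply: lerD; last exact: tau_Err.
rewrite mulr_sumr mulr_suml; apply: ler_sum => i _.
rewrite mulrCA; apply: ler_wpM2l; first exact: CE_ge0.
by apply: ErrS => //; have := ltn_ord i; lia.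
Qed.

(** The shell part of [Err] with one factor [bl i] divided out. Summing over a further shell k < i
    restores that factor. *)
Definition Zs n l := \sum_(l.+1 <= i < L.+1) sh i * (bl i ^+ n.-1 / bl i) * a i.

Lemma Zs_ge0 n l : 0 <= Zs n l.
Proof. by apply: sumr_ge0 => i _; rewrite !mulr_ge0 ?exprn_ge0 ?invr_ge0. Qed.

Lemma Err_Zs n i tau l : (0 < i < n)%N -> 0 <= tau ->
  Err i tau l <= tau * bl l ^+ n.-1 + Zs n l.
Proof.
move=> /andP[i0 ni] t0; apply: lerD.
  by rewrite ler_wpM2l// ler_weXn2l//; case: n ni.
apply: ler_sum => k _; rewrite ler_wpM2r// ler_wpM2l// ler_pdivlMr// -exprSr.
by rewrite ler_weXn2l//; move: i0 ni; case: i => //= i _; case: n.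
Qed.

Lemma inc_Zs n tau l : (0 < n)%N -> 0 <= tau ->
  \sum_(i < n.-1) CE (n.-1 - i)%N * Err (n.-1 - i)%N tau l + tau <=
  (1 + cc) ^+ n.-1 * (tau * bl l ^+ n.-1 + Zs n l).
Proof.
move=> n0 t0; rewrite -CE_sum mulrDl mul1r; apply: lerD.
  rewrite mulr_suml; apply: ler_sum => i _; apply: ler_wpM2l; first exact: CE_ge0.
  by apply: Err_Zs => //; have := ltn_ord i; lia.
by rewrite ler_wpDr ?Zs_ge0// ler_peMr// exprn_ege1.
Qed.

(** After exchanging the sums, the inner one runs over the shells between l and i, whose total
    volume is at most [bl i]. *)
Lemma exch_le (c : nat -> R) l M : (forall i, 0 <= c i) ->
  \sum_(l.+1 <= k < M) sh k * (\sum_(k.+1 <= i < M) c i) <= \sum_(l.+1 <= i < M) c i * bl i.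
Proof.
move=> c0; elim: M => [|M IH]; first by rewrite !big_geq.
have [lM|Ml] := leqP M l; first by rewrite !big_geq.
rewrite big_nat_recr//= [\sum_(M.+1 <= i < M.+1) _]big_geq// mulr0 addr0 [leRHS]big_nat_recr//=.
rewrite big_nat_cond.
under eq_bigr => k /andP[/andP[_ kM] _] do rewrite big_nat_recr//= mulrDr.
rewrite -big_nat_cond big_split /= lerD// -mulr_suml mulrC ler_wpM2l//.
Qed.

(** The cost of telescoping over the far sites: a site in shell k starts expansions at its own scale
    k, with remainders already of size C a k. *)
Lemma jump_le n l : (0 < n)%N ->
  \sum_(l.+1 <= k < L.+1) sh k * (C * a k * bl k ^+ n.-1 + Zs n k) <=
  (C + 1) * \sum_(l.+1 <= i < L.+1) sh i * bl i ^+ n.-1 * a i.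
Proof.
move=> n0; under eq_bigr do rewrite mulrDr; rewrite big_split /= mulrDl mul1r.
apply: lerD.
  by rewrite mulr_sumr; apply: ler_sum => k _; rewrite le_eqVlt; apply/orP; left; apply/eqP; ring.
apply: le_trans (exch_le _ _ _) _.
  by move=> i; rewrite !mulr_ge0 ?exprn_ge0 ?invr_ge0.
apply: ler_sum => i _; rewrite le_eqVlt; apply/orP; left; apply/eqP.
by field; rewrite gt_eqF.
Qed.

End ErrorSums.

(** * The recursive expansion over an abstract distance *)

Section Recursion.
Context {d : measure_display} {Omega : measurableType d} {R : realType}.
Variables (P : probability Omega R) (r : \bar R).
Context {T : finType}.
Variable X : T -> Omega -> R.
Variables (q Q : nat) (K0 nb : R) (D : {set T} -> T -> nat) (bl sh al : nat -> R).
Variables (b0 L tm : nat) (cls : (nat -> R -> R) -> Prop).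

Local Notation Ex := (Ex P).
Local Notation integ := (integ P).
Local Notation cov := (cov P).
Local Notation dom := (dom P r).
Local Notation dm := (dm P r).
Local Notation pd := (pd P r).
Local Notation Kn := (Kn r q K0).
Local Notation Mn := (Mn r q K0).
Local Notation momqS := (momq q.+1).
Local Notation momq := (momq q).
Local Notation covq := (covq q).
Local Notation smeas := (smeas X).
Local Notation sg U := <<s gens X U >>.

Hypothesis mX : forall i, measurable_fun setT (X i).
Hypothesis K00 : 0 <= K0.
Hypothesis domX : forall i, dm K0 1 (X i).
Hypothesis K01 : 1 <= K0.
Hypothesis hqr : (q.+1%:R%:E < r)%E.
Hypothesis qQ : (q <= Q)%N.
Hypothesis nb1 : 1 <= nb.
Hypothesis D_set0 : forall u, D finset.set0 u = L.
Hypothesis D_le : forall I u, (D I u <= L)%N.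
Hypothesis ball_le : forall (I : {set T}) l, (#|I| <= q.+1)%N -> (b0 <= l <= L)%N ->
  (#|[set u | (D I u <= l)%N]|)%:R <= nb * bl l.
Hypothesis shell_le : forall (I : {set T}) l, (#|I| <= q.+1)%N -> (b0 < l <= L)%N ->
  (#|[set u | D I u == l]|)%:R <= nb * sh l.
Hypothesis bl1 : forall l, 1 <= bl l.
Hypothesis bl_mono : forall l l', (l <= l')%N -> bl l <= bl l'.
Hypothesis sh0 : forall l, 0 <= sh l.
Hypothesis sh_bl : forall l l', \sum_(l.+1 <= i < l') sh i <= bl l'.
Hypothesis al01 : forall l, 0 <= al l <= 1.
Hypothesis mix : forall (I U : {set T}) l, (#|I| <= q.+1)%N -> (b0 < l <= L)%N ->
  (forall u, u \in U -> (l <= D I u)%N) -> forall A B, sg I A -> sg U B ->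
  `|fine (P (A `&` B)) - fine (P A) * fine (P B)| <= al l.
Hypothesis cls_jet : forall F, cls F -> jet q F.
Hypothesis cls_bd : forall F, cls F -> forall x, `|F q x| <= 1.
Hypothesis cls_meas : forall F, cls F -> measurable_fun setT (F q).

Definition Wsum (s : seq T) (w : Omega) : R := \sum_(i <- s) X i w.
Definition EW (F : nat -> R -> R) b := Ex (fun w => F b (Wsum (enum T) w)).

(* The coefficients c do not depend on F: testing against monomials identifies them later
   with the normalised cumulants of W. *)
Definition Exp (f : (nat -> R -> R) -> R) (err : R) :=
  exists c : nat -> R, forall F, cls F -> `|f F - \sum_(b < Q) c b * EW F b| <= err.

Lemma Exp_le f e e' : e <= e' -> Exp f e -> Exp f e'.
Proof. by move=> ee [c h]; exists c => F /h ?; exact: le_trans ee. Qed.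

Lemma Exp_ext f g e : (forall F, cls F -> f F = g F) -> Exp f e -> Exp g e.
Proof. by move=> fg [c h]; exists c => F cF; rewrite -fg//; exact: h. Qed.

Lemma Exp0 f e : (forall F, cls F -> `|f F| <= e) -> Exp f e.
Proof. by move=> h; exists (fun=> 0) => F /h; rewrite big1 ?subr0// => i _; rewrite mul0r. Qed.

Lemma ExpD f g e e' : Exp f e -> Exp g e' -> Exp (fun F => f F + g F) (e + e').
Proof.
move=> [c h] [c' h']; exists (fun b => c b + c' b) => F cF.
have -> : \sum_(b < Q) (c b + c' b) * EW F b =
  \sum_(b < Q) c b * EW F b + \sum_(b < Q) c' b * EW F b.
  by rewrite -big_split; apply: eq_bigr => i _; rewrite mulrDl.
rewrite opprD addrACA (le_trans (ler_normD _ _))// lerD ?h ?h'//.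
Qed.

Lemma ExpZ a f e : Exp f e -> Exp (fun F => a * f F) (`|a| * e).
Proof.
move=> [c h]; exists (fun b => a * c b) => F cF.
under eq_bigr do rewrite -mulrA.
by rewrite -mulr_sumr -mulrBr normrM ler_wpM2l ?h.
Qed.

Lemma Exp_sum (I : Type) (s : seq I) (f : I -> (nat -> R -> R) -> R) (e : I -> R) :
  (forall i, Exp (f i) (e i)) -> Exp (fun F => \sum_(i <- s) f i F) (\sum_(i <- s) e i).
Proof.
move=> h; elim: s => [|i s IH].
  by rewrite big_nil; apply: Exp0 => F _; rewrite big_nil normr0.
rewrite big_cons; apply: Exp_ext (ExpD (h i) IH) => F _; rewrite big_cons//.
Qed.

Lemma ExpEW c k : (k < Q)%N -> Exp (fun F => c * EW F k) 0.
Proof.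
move=> kQ; exists (fun b => c * (b == k)%:R) => F _.
rewrite (bigD1 (Ordinal kQ))//= eqxx mulr1 big1 ?addr0 ?subrr ?normr0// => i ik.
by rewrite (negbTE (_ : (i : nat) != k)) ?mulr0 ?mul0r//.
Qed.

Let q1r : (q.+1%:R%:E <= r)%E. Proof. exact: ltW. Qed.

Lemma le_deg n : (n <= q.+1)%N -> (n%:R%:E <= r)%E.
Proof. by move=> nq; apply: le_trans q1r; rewrite lee_fin ler_nat. Qed.

Lemma cls_meask F k : cls F -> (k <= q)%N -> measurable_fun setT (F k).
Proof.
move=> cF; rewrite leq_eqVlt => /orP[/eqP->|kq]; first exact: cls_meas.
exact: der_meas (cls_jet cF kq).
Qed.

Lemma dom_one : dom 1 (fun=> 1).
Proof.
split=> //; case: r hqr => [s||] // _; last exact: aeW.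
by under eq_fun do rewrite powR1; split; [exact: integ_cst|rewrite Ex_cst].
Qed.

Let domK : dom K0 (fun=> 1). Proof. exact: le_dom dom_one. Qed.

Let hdom : exists K A, dom K A. Proof. by exists K0, (fun=> 1). Qed.

Lemma pdX i : pd 1 (X i).
Proof. by apply: dm_pd (domX i). Qed.

Lemma meas_Wsum s : measurable_fun setT (Wsum s).
Proof. by apply: measurable_sum. Qed.

Lemma pd_Wsum s : pd 1 (Wsum s).
Proof. by apply: pd_sum => //; exact: pdX. Qed.

Lemma pd_norm_le n (f g : Omega -> R) : measurable_fun setT f -> pd n g ->
  (forall w, `|f w| <= `|g w|) -> pd n f.
Proof.
move=> mf [_ [K [A [c [dA c0 gA]]]]] fg; split=> //; exists K, A, c; split=> // w.
exact: le_trans (gA w).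
Qed.

Lemma pd_F F k s : cls F -> (k <= q)%N -> pd (q - k) (fun w => F k (Wsum s w)).
Proof.
move=> cF kq.
have jF : jet (q - k) (fun i => F (k + i)%N) by apply: jet_shift => //; exact: cls_jet.
have bF y : `|F (k + (q - k))%N y| <= 1 by rewrite subnKC//; exact: cls_bd.
have [c [c0 hc]] := jet_growth jF bF.
apply: (@pd_norm_le _ _ (fun w => c * (1 + `|Wsum s w|) ^+ (q - k))).
- by apply: measurableT_comp (meas_Wsum s); exact: cls_meask.
- rewrite -[X in pd X]mul1n; apply: pdZ; apply: pd_exp => //; apply: pdD; first exact: pd_cst.
  apply: (@pd_norm_le _ _ (Wsum s)); [|exact: pd_Wsum|by move=> w; rewrite normr_id].
  by apply: measurableT_comp => //; exact: meas_Wsum.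
- move=> w; have := hc (Wsum s w); rewrite addn0 => h.
  by rewrite [leRHS]ger0_norm// mulr_ge0// exprn_ge0// addr_ge0.
Qed.

(** The sites of [s1] are removed one at a time from the left. The hypothesis on an increment
    records what precedes and what follows its site, since its bound depends on the position. *)
Lemma tel z mz k s1 s2 (B : T -> R) : pd mz z -> (k <= q)%N -> (mz + (q - k) <= q.+1)%N ->
  (forall u s', (exists s0 s'', s1 = s0 ++ u :: s'' /\ s' = s'' ++ s2) ->
    Exp (fun F => Ex (fun w => z w * (F k (Wsum (u :: s') w) - F k (Wsum s' w)))) (B u)) ->
  Exp (fun F => Ex (fun w => z w * F k (Wsum (s1 ++ s2) w)) -
                Ex (fun w => z w * F k (Wsum s2 w))) (\sum_(u <- s1) B u).
Proof.
move=> pz kq mq; have I s F : cls F -> integ (fun w => z w * F k (Wsum s w)).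
  by move=> cF; apply: pd_integ (pdM pz (pd_F s cF kq)); exact: le_deg.
elim: s1 => [|u s1 IH] H.
  by rewrite big_nil; apply: Exp0 => F _; rewrite subrr normr0.
rewrite big_cons; apply: Exp_ext; last first.
  apply: ExpD; first by apply: (H u (s1 ++ s2)); exists [::], s1.
  by apply: IH => v s' [s0 [s'' [E1 E2]]]; apply: H; exists (u :: s0), s''; rewrite E1.
move=> F cF /=; rewrite -ExB; try exact: I.
rewrite -ExD -?ExB; try by [apply: I|apply: integB; apply: I].
  by apply: eq_Ex => w; ring.
apply: integ_le (integD (integ_norm (I (u :: s1 ++ s2) F cF)) (integ_norm (I (s1 ++ s2) F cF))).
  apply: measurable_funM; first by case: pz.
  by apply: measurable_funB; apply: measurableT_comp (meas_Wsum _); exact: cls_meask.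
by move=> w; rewrite mulrBr; exact: ler_normB.
Qed.

Definition kap (t : nat) : R := t%:R * nb.
(** The exponent of the largest degree q + 1, the weakest among those that occur because the
    coefficients are at most 1. *)
Definition alt (l : nat) : R := al l `^ mixing_exp r q.+1%:R.

Lemma alt01 l : 0 <= alt l <= 1.
Proof.
case/andP: (al01 l) => a0 a1; rewrite powR_ge0 /=; apply: powR_le1 => //.
by apply: ltW; apply: mixing_exp_gt0.
Qed.

Lemma al_exp l n : (n <= q.+1)%N -> al l `^ mixing_exp r n%:R <= alt l.
Proof.
move=> nq; case/andP: (al01 l) => a0 a1; rewrite /alt.
have e1 := @mixing_exp_gt0 _ r _ (ler0n R q.+1) hqr.
have hl : mixing_exp r q.+1%:R <= mixing_exp r n%:R :> R.
  rewrite /mixing_exp; case: r hqr => [s||] //; rewrite lte_fin => hs.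
  by rewrite ler_pM2r ?invr_gt0 ?(le_lt_trans _ hs)// lerB// ler_nat.
move: a0; rewrite le_eqVlt => /orP[/eqP <-|a0].
  by rewrite powR0 ?gt_eqF ?(lt_le_trans e1)// powR_ge0.
rewrite -[X in _ `^ X](subrK (mixing_exp r q.+1%:R)) powRD; last first.
  by apply/implyP => _; rewrite gt_eqF.
by rewrite ler_piMl ?powR_ge0// powR_le1 ?subr_ge0// ltW.
Qed.

Definition etaok t l (I : {set T}) eta j (J : {set T}) :=
  [/\ dm (Kn t) j eta, smeas J eta, (#|J| <= j)%N & forall u, u \in J -> (l <= D I u)%N].

Definition seqok t l (I : {set T}) (s : seq T) :=
  [/\ uniq s, forall u, u \in s -> (l <= D I u)%N & #|T|%:R <= (size s)%:R + kap t * bl l].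

Definition Gty := nat -> (Omega -> R) -> nat -> {set T} -> Prop.

(* G t xi e I says that xi may occur as the sigma(I)-measurable factor, of degree e, after t
   steps of the recursion, and tau bounds the Taylor remainders in which it occurs. *)
Record Gok (l : nat) (tau : R) (G : Gty) : Prop := {
  G_dm : forall t xi e I, (t <= tm)%N -> G t xi e I ->
    [/\ dm (Kn t) e xi, smeas I xi & (#|I| <= e)%N];
  G_mono : forall t xi e I, G t xi e I -> G t.+1 xi e I;
  G_cst : forall t xi e I eta j J, (t < tm)%N -> G t xi e I -> etaok t l I eta j J ->
    (0 < e + j <= q)%N -> G t.+1 (fun=> Ex (fun w => xi w * eta w)) (e + j)%N finset.set0;
  G_term : forall t xi e I eta j J u s n, (t < tm)%N -> G t xi e I -> etaok t l I eta j J ->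
    u \notin s -> (l <= D I u)%N -> seqok t.+1 l I s -> (0 < n <= q)%N -> (e + j + n)%N = q.+1 ->
    Exp (fun F => Ex (fun w => xi w * eta w *
      tayrem (fun i => F (q - n + i)%N) n (Wsum s w) (X u w))) tau }.

Lemma pd_of_G l tau G t xi e I : Gok l tau G -> (t <= tm)%N -> G t xi e I -> pd e xi.
Proof.
by move=> ok tt /(G_dm ok tt) [h1 h2 _]; apply: dm_pd h1; exact: (smeas_meas mX h2).
Qed.

Lemma pd_of_eta t l I eta j J : etaok t l I eta j J -> pd j eta.
Proof. by case=> h1 h2 _ _; apply: dm_pd h1; exact: (smeas_meas mX h2). Qed.

Lemma eta_one t l I : (l <= L)%N -> etaok t l I (fun=> 1) 0 finset.set0.
Proof.
move=> lL; split; [|exact: smeas_cst|by rewrite cards0|by move=> u; rewrite inE].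
by exists (fun=> 1); [apply: le_dom domK; exact: K0_Kn|move=> w; rewrite normr1 expr0].
Qed.

Lemma dm_Xn u n : dm K0 n (fun w => X u w ^+ n).
Proof.
have [A dA hA] := domX u; exists A => // w; rewrite normrX lerXn2r ?nnegrE ?(dom_ge0 w dA)//.
Qed.

Lemma etaok_X t l I eta j J u a : (l <= D I u)%N -> (0 < a)%N -> etaok t l I eta j J ->
  etaok t.+1 l I (fun w => eta w * X u w ^+ a) (j + a) (u |: J).
Proof.
move=> lu a0 [h1 h2 h3 h4]; split.
- apply: dm_le (dmM h1 (dm_Xn u a)).
  by have [_ h _ _] := Kn_parts r q K00 t.
- apply: smeasM; first by apply: smeas_sub h2; apply: finset.subsetUr.
  by apply: smeas_exp; apply: smeas_X; rewrite !inE eqxx.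
- rewrite cardsU1; apply: (@leq_trans (1 + j)); first by rewrite leq_add// leq_b1.
  by rewrite addnC leq_add2l.
- by move=> v; rewrite !inE => /orP[/eqP ->|/h4].
Qed.

(** Taylor expansion of one increment: the a-th term moves X u^a into [eta] and leaves an expansion
    of order n - a, whose error is [Eb (n - a)]; the remainder is covered by [tau]. *)
Lemma inc n G l tau t xi e I eta j J u s (Eb : nat -> R) : Gok l tau G -> (t < tm)%N ->
  G t xi e I -> etaok t l I eta j J -> u \notin s -> (l <= D I u)%N -> seqok t.+1 l I s ->
  (0 < n <= q)%N -> (e + j + n)%N = q.+1 -> (forall i, 0 <= Eb i) ->
  (forall i eta' j' J', (0 < i < n)%N -> etaok t.+1 l I eta' j' J' -> (e + j' + i)%N = q.+1 ->
    Exp (fun F => Ex (fun w => xi w * eta' w * F (q - i)%N (Wsum s w))) (Eb i)) ->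
  Exp (fun F => Ex (fun w => xi w * eta w *
    (F (q - n)%N (Wsum (u :: s) w) - F (q - n)%N (Wsum s w))))
    (\sum_(a < n.-1) Eb (n.-1 - a)%N + tau).
Proof.
move=> ok tt Gx ee us lu ss /andP[n0 nq] ejn Eb0 IH.
have term := G_term ok tt Gx ee us lu ss (introT andP (conj n0 nq)) ejn.
case: n n0 nq ejn IH term => // n _ nq ejn IH term.
have px := pd_of_G ok (ltnW tt) Gx. have pe := pd_of_eta ee.
pose f (a : 'I_n) F := (a.+1)`!%:R^-1 *
  Ex (fun w => xi w * (eta w * X u w ^+ a.+1) * F (q - (n - a))%N (Wsum s w)).
have Ef : Exp (fun F => \sum_(a < n) f a F) (\sum_(a < n) Eb (n - a)%N).
  apply: Exp_sum => a; apply: Exp_le (ExpZ _ (IH (n - a)%N _ (j + a.+1)%N (u |: J) _ _ _)).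
  - rewrite ger0_norm ?invr_ge0// ler_piMl// invf_le1 ?ler1n ?fact_gt0// ltr0n fact_gt0//.
  - by rewrite subn_gt0 ltn_ord ltnS leq_subr.
  - exact: etaok_X.
  - by rewrite -ejn; have := ltn_ord a; lia.
apply: Exp_ext (ExpD Ef term) => F cF; rewrite /f.
have I0 k m z : pd m z -> (k <= q)%N -> (m + (q - k) <= q.+1)%N ->
    forall s', integ (fun w => z w * F k (Wsum s' w)).
  by move=> pz kq mk s'; apply: pd_integ (pdM pz (pd_F s' cF kq)); exact: le_deg.
have Ia0 (a : 'I_n) : integ (fun w =>
    xi w * (eta w * X u w ^+ a.+1) * F (q - (n - a))%N (Wsum s w)).
  apply: (I0 _ (e + (j + a.+1))%N); try by have := ltn_ord a; lia.
  by apply: pdM => //; apply: pdM => //; rewrite -[X in pd X]mul1n; apply: pd_exp => //; exact: pdX.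
have Ia (a : 'I_n) := integZ (a.+1)`!%:R^-1 (Ia0 a).
have Id s' : integ (fun w => xi w * eta w * F (q - n.+1)%N (Wsum s' w)).
  by apply: (I0 _ (e + j)%N); [exact: pdM|lia|lia].
have E (w : Omega) : xi w * eta w * (F (q - n.+1)%N (Wsum (u :: s) w) - F (q - n.+1)%N (Wsum s w))
  - \sum_(a < n) (a.+1)`!%:R^-1 * (xi w * (eta w * X u w ^+ a.+1) * F (q - (n - a))%N (Wsum s w))
  = xi w * eta w * tayrem (fun i => F (q - n.+1 + i)%N) n.+1 (Wsum s w) (X u w).
  rewrite /tayrem big_ord_recl /= expr0 fact0 divr1 mul1r !addn0.
  have -> : Wsum (u :: s) w = Wsum s w + X u w by rewrite /Wsum big_cons addrC.
  rewrite opprD addrA [RHS]mulrBr mulr_sumr; congr (_ - _); apply: eq_bigr => a _.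
  rewrite /bump leq0n add1n.
  have -> : (q - n.+1 + a.+1 = q - (n - a))%N by have := ltn_ord a; lia.
  by ring.
have It : integ (fun w => xi w * eta w * tayrem (fun i => F (q - n.+1 + i)%N) n.+1 (Wsum s w) (X u w)).
  have := integB (integB (Id (u :: s)) (Id s)) (@integ_sum _ _ _ _ _ (index_enum _) _ Ia).
  by congr (integ _); apply/funext => w; rewrite -E mulrBr.
have -> : \sum_(a < n) (a.+1)`!%:R^-1 *
    Ex (fun w => xi w * (eta w * X u w ^+ a.+1) * F (q - (n - a))%N (Wsum s w)) =
  Ex (fun w => \sum_(a < n) (a.+1)`!%:R^-1 *
    (xi w * (eta w * X u w ^+ a.+1) * F (q - (n - a))%N (Wsum s w))).
  by rewrite Ex_sum//; apply: eq_bigr => a _; rewrite ExZ.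
rewrite -ExD//; last exact: integ_sum.
by apply: eq_Ex => w; rewrite -E addrC subrK.
Qed.

Lemma dm_cst K c n : (0 < n)%N -> `|c| <= K -> dm (scl r (1 + K) 1) n (fun=> c).
Proof.
move=> n0 cK; have K0' : 0 <= K by exact: le_trans cK.
exists (fun=> (1 + K) * 1); first by apply: dom_scale; [rewrite lerDl|exact: dom_one].
move=> w; rewrite mulr1; apply: (@le_trans _ _ ((1 + K) ^+ 1)).
  by rewrite expr1 (le_trans cK)// lerDr.
by rewrite ler_weXn2l// lerDl.
Qed.

Lemma dm_center K n f : 0 <= K -> (0 < n <= q.+1)%N -> measurable_fun setT f -> dm K n f ->
  dm (scl r (1 + momq K) K) n (fun w => f w - Ex f).
Proof.
move=> k0 /andP[n0 nq] mf df; have E := dm_Ex k0 (le_deg nq) mf df.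
case: df => A dA hA; have m0 := momq_ge0 q k0.
exists (fun w => (1 + momq K) * A w); first by apply: dom_scale => //; rewrite lerDl.
move=> w; have A1 : 1 <= A w by case: dA.
have An : 1 <= A w ^+ n by exact: exprn_ege1.
rewrite exprMn; apply: (@le_trans _ _ ((1 + momq K) * A w ^+ n)); last first.
  by rewrite ler_wpM2r ?(le_trans ler01)// -[leLHS]expr1 ler_weXn2l// lerDl.
rewrite (le_trans (ler_normB _ _))// mulrDl mul1r lerD//.
apply: le_trans E _; apply: le_trans (mom_momq k0 nq) _.
by rewrite ler_peMr.
Qed.

(** Scalar factors, which arise when a product is replaced by its mean. [om] is 1 initially and the
    mixing coefficient once a covariance has been split off. In degree 0 the envelope A^0 = 1 leaves
    no room for a constant, whence the last clause. *)
Definition Gc (om : R) : Gty := fun t xi e I => exists c,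
  [/\ xi = (fun=> c), `|c| <= Mn t * om, I = finset.set0 & (e = 0%N -> `|c| <= 1)].

(** Centred factors: the expectation of such a factor times f is the covariance of z and f. *)
Definition Gz : Gty := fun t xi e I => exists z,
  [/\ xi = (fun w => z w - Ex z), smeas I z, dm (Kn t) e z, dm (Kn t) e xi & (#|I| <= e)%N].

Lemma Gc_dm om t xi e I : 0 <= om <= 1 -> (t <= tm)%N -> Gc om t xi e I ->
  [/\ dm (Kn t) e xi, smeas I xi & (#|I| <= e)%N].
Proof.
move=> /andP[om0 om1] tt [c [-> cM -> c1]]; split; [|exact: smeas_cst|by rewrite cards0].
have cM' : `|c| <= Mn t by apply: le_trans cM _; rewrite ler_piMr// Mn_ge0.
case: e c1 => [/(_ erefl) c1|e _].
  by exists (fun=> 1); [apply: le_dom domK; exact: K0_Kn|move=> w; rewrite expr0].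
apply: dm_le (dm_cst _ cM') => //; case: t {tt cM} cM' => [|t] cM.
  by rewrite /Kn /Mn /= lerDr.
by have [_ _ h _] := Kn_parts r q K00 t.
Qed.

Lemma Gc_mono om t xi e I : 0 <= om -> Gc om t xi e I -> Gc om t.+1 xi e I.
Proof.
move=> om0 [c [-> cM -> c1]]; exists c; split=> //; apply: le_trans cM _.
by rewrite ler_wpM2r// Mn_mono.
Qed.

Lemma Gc_cst om l t xi e I eta j J : 0 <= om -> Gc om t xi e I -> etaok t l I eta j J ->
  (0 < e + j <= q)%N -> Gc om t.+1 (fun=> Ex (fun w => xi w * eta w)) (e + j)%N finset.set0.
Proof.
move=> om0 [c [-> cM -> c1]] ee /andP[ej0 ejq]; have pe := pd_of_eta ee.
have jq : (j <= q.+1)%N by lia.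
eexists; split; [by []| |by []|by move=> E; rewrite E in ej0].
rewrite ExZ; last by apply: pd_integ pe; exact: le_deg.
case: ee => h1 h2 _ _; have E := dm_Ex (Kn_ge0 r q K00 t) (le_deg jq) (smeas_meas mX h2) h1.
have k0 := Kn_ge0 r q K00 t.
rewrite normrM; apply: (@le_trans _ _ (Mn t * om * momq (Kn t))).
  by apply: ler_pM => //; apply: le_trans E _; exact: mom_momq.
rewrite mulrAC ler_wpM2r// Mn_S -addrA [Mn t + _]addrC -addrA lerDl addr_ge0 ?Mn_ge0//.
by rewrite covq_ge0// addr_ge0.
Qed.

Lemma Gok_Gc om l tau : 0 <= om <= 1 ->
  (forall t xi e I eta j J u s n, (t < tm)%N -> Gc om t xi e I -> etaok t l I eta j J ->
    u \notin s -> (l <= D I u)%N -> seqok t.+1 l I s -> (0 < n <= q)%N -> (e + j + n)%N = q.+1 ->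
    Exp (fun F => Ex (fun w => xi w * eta w *
      tayrem (fun i => F (q - n + i)%N) n (Wsum s w) (X u w))) tau) -> Gok l tau (Gc om).
Proof.
move=> om01 h; have /andP[om0 _] := om01; split => //.
- by move=> t xi e I tt; exact: Gc_dm.
- by move=> t xi e I; exact: Gc_mono.
- by move=> t xi e I eta j J tt; exact: Gc_cst.
Qed.

Lemma tayrem_eta t l I eta j J u s n F : cls F -> etaok t l I eta j J -> (l <= D I u)%N ->
  (forall v, v \in s -> (l <= D I v)%N) -> (0 < n <= q)%N ->
  let eta' w := eta w * tayrem (fun i => F (q - n + i)%N) n (Wsum s w) (X u w) in
  dm (Kn t + K0) (j + n) eta' /\ smeas [set v | (l <= D I v)%N] eta'.
Proof.
move=> cF [h1 h2 h3 h4] lu ls /andP[n0 nq] /=; split.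
  apply: dmM => //; have [A dA hA] := domX u; exists A => // w.
  have jF : jet n (fun i => F (q - n + i)%N).
    by rewrite -{1}(subKn nq); apply: jet_shift; [exact: leq_subr|exact: cls_jet].
  have bF y : `|F (q - n + n)%N y| <= 1 by rewrite subnK//; exact: cls_bd.
  apply: le_trans (tayrem_le _ _ jF bF) _; rewrite mul1r lerXn2r ?nnegrE ?(dom_ge0 w dA)//.
have mW : smeas [set v | (l <= D I v)%N] (Wsum s).
  by apply: smeas_Wsum => v /ls; rewrite inE.
have mXu : smeas [set v | (l <= D I v)%N] (X u) by apply: smeas_X; rewrite inE.
apply: smeasM; first by apply: smeas_sub h2; apply/fintype.subsetP => v /h4; rewrite inE.
apply: smeasB.
  apply: (@smeas_comp _ _ _ _ _ _ (F (q - n + 0)%N) (fun w => Wsum s w + X u w)).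
    by rewrite addn0; apply: cls_meask => //; exact: leq_subr.
  exact: smeasD.
apply: smeas_sum => a; apply: smeasM.
  by apply: smeasM; [exact: smeas_exp|exact: smeas_cst].
apply: smeas_comp => //; apply: cls_meask => //; have := ltn_ord a; lia.
Qed.

(** The factors met after a jump to distance l: still centred, or already a scalar that carries the
    gain [alt l]. *)
Definition Gst l : Gty := fun t xi e I => Gc (alt l) t xi e I \/ Gz t xi e I.

Lemma Gz_Ex t xi e I f : (t <= tm)%N -> Gz t xi e I -> forall m, (e + m <= q.+1)%N -> pd m f ->
  exists2 z, smeas I z /\ dm (Kn t) e z & Ex (fun w => xi w * f w) = cov z f.
Proof.
move=> tt [z [-> mz dz dxi Ie]] m em pf; exists z => //.
have pz : pd e z by apply: dm_pd dz; exact: (smeas_meas mX mz).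
under eq_Ex do rewrite mulrBl.
rewrite ExB ?ExZ//; try apply: integZ.
- by apply: pd_integ pf; apply: le_deg; nlia em.
- by apply: pd_integ (pdM pz pf); exact: le_deg.
- by apply: pd_integ pf; apply: le_deg; nlia em.
Qed.

Lemma cov_le t K' l (I U : {set T}) e m z f : (b0 < l <= L)%N -> (#|I| <= e)%N -> (e + m <= q.+1)%N ->
  0 <= K' -> smeas I z -> dm (Kn t) e z -> smeas U f -> (forall u, u \in U -> (l <= D I u)%N) ->
  dm K' m f -> `|cov z f| <= covq (Kn t + K') * alt l.
Proof.
move=> lL Ie em k' mz dz mf fU df.
have Iq : (#|I| <= q.+1)%N by apply: leq_trans Ie _; apply: leq_trans em; exact: leq_addr.
have h := mix Iq lL fU.
have emr : ((e + m)%:R%:E < r)%E by apply: le_lt_trans hqr; rewrite lee_fin ler_nat.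
apply: le_trans (cov_dm h _ _ _ _ (al01 l) emr _ _ _ _ dz df) _.
- exact: gens_setT.
- exact: gens_set0.
- exact: gens_setT.
- exact: gens_set0.
- exact: (smeas_meas mX mz).
- exact: (smeas_meas mX mf).
- exact: smeas_lev.
- exact: smeas_lev.
have kk : 0 <= Kn t + K' by rewrite addr_ge0// Kn_ge0.
by apply: ler_pM; rewrite ?covC_ge0 ?powR_ge0 ?covC_covq ?al_exp.
Qed.

Lemma Gc_bound om t xi e I m f : 0 <= om -> (t <= tm)%N -> Gc om t xi e I -> 0 <= Kn t + K0 ->
  (e + m <= q.+1)%N -> pd m f -> measurable_fun setT f -> dm (Kn t + K0) m f ->
  `|Ex (fun w => xi w * f w)| <= Ct r q K0 tm * om.
Proof.
move=> om0 tt [c [-> cM _ _]] kK em pf mf df; have k0 := Kn_ge0 r q K00 t.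
have mq : (m <= q.+1)%N by nlia em.
have kk : Kn t <= Kn tm by exact: Kn_mono.
have kt : 0 <= Kn tm + (Kn tm + K0) by rewrite !addr_ge0 ?Kn_ge0.
rewrite ExZ; last by apply: pd_integ pf; exact: le_deg.
have E := dm_Ex kK (le_deg mq) mf df.
rewrite normrM /Ct mulrDl; apply: ler_wpDl; first by rewrite mulr_ge0 ?covq_ge0.
rewrite mulrAC; apply: ler_pM => //.
  by apply: le_trans cM _; rewrite ler_wpM2r// Mn_mono.
apply: le_trans E _; apply: (@le_trans _ _ (momq (Kn t + K0))).
  exact: mom_momq.
by apply: momq_le => //; rewrite lerD2r.
Qed.

(** The mean of a centred factor times [eta] is a covariance across distance l, so passing to the
    mean keeps the gain [alt l] in the scalar; a Taylor remainder against a centred factor is a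
    covariance of the same kind. *)
Lemma Gok_Gst l : (b0 < l <= L)%N -> Gok l (Ct r q K0 tm * alt l) (Gst l).
Proof.
move=> lL; have k0 t := Kn_ge0 r q K00 t; have /andP[a0 a1] := alt01 l.
split.
- move=> t xi e I tt [h|[z [E mz dz dxi Ie]]]; first exact: Gc_dm (alt01 l) tt h.
  by split=> //; rewrite E; apply: smeasB mz _; exact: smeas_cst.
- move=> t xi e I [h|[z [E mz dz dxi Ie]]]; [by left; exact: Gc_mono|right].
  have kk : Kn t <= Kn t.+1 by exact: Kn_mono.
  by exists z; split=> //; [exact: dm_le dz|exact: dm_le dxi].
- move=> t xi e I eta j J tt [h|h] ee ejq; left; first exact: Gc_cst ee _.
  have pe := pd_of_eta ee; have ejq' : (e + j <= q.+1)%N by nlia ejq.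
  have [z [mz dz] E] := Gz_Ex (ltnW tt) h ejq' pe.
  case: h => z0 [_ _ _ _ Ie]; case: ee => h1 h2 h3 h4.
  eexists; split; [by []| |by []|by move=> E'; rewrite E' in ejq].
  rewrite E; apply: le_trans (cov_le lL Ie ejq' (k0 t) mz dz h2 h4 h1) _.
  by rewrite ler_wpM2r// Mn_S lerDr addr_ge0 ?mulr_ge0 ?momq_ge0 ?Mn_ge0.
- move=> t xi e I eta j J u s n tt h ee us lu [us' ls _] n0 ejn; apply: Exp0 => F cF.
  have [de me] := tayrem_eta cF ee lu ls n0.
  set eta' := fun w => _ in de me.
  have pe : pd (j + n) eta' by apply: dm_pd de; exact: (smeas_meas mX me).
  have kK : 0 <= Kn t + K0 by rewrite addr_ge0.
  have kk : Kn t <= Kn tm by apply: Kn_mono => //; exact: ltnW.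
  have ejn' : (e + (j + n) <= q.+1)%N by nlia ejn.
  have -> : Ex (fun w => xi w * eta w *
     tayrem (fun i => F (q - n + i)%N) n (Wsum s w) (X u w)) = Ex (fun w => xi w * eta' w).
    by apply: eq_Ex => w; rewrite /eta' mulrA.
  case: h => [h|h]; first exact: (Gc_bound a0 (ltnW tt) h kK ejn' pe (smeas_meas mX me) de).
  have [z [mz dz] ->] := Gz_Ex (ltnW tt) h ejn' pe.
  case: h => z0 [_ _ _ _ Ie].
  apply: le_trans (cov_le lL Ie ejn' kK mz dz me _ de) _; first by move=> v; rewrite inE.
  rewrite ler_wpM2r// /Ct ler_wpDr ?mulr_ge0 ?momq_ge0 ?Mn_ge0 ?addr_ge0//.
  by apply: covq_le; rewrite ?addr_ge0// !lerD.
Qed.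

Lemma size_le_card (s : seq T) (p : pred T) : uniq s -> (forall u, u \in s -> p u) ->
  (size s <= #|[set u | p u]|)%N.
Proof.
move=> us ps; rewrite -(card_uniqP us); apply: subset_leq_card.
by apply/fintype.subsetP => u /ps; rewrite inE.
Qed.

Lemma far_sum (I : {set T}) l (s : seq T) (g : nat -> R) : (#|I| <= q.+1)%N -> (b0 <= l)%N ->
  (forall i, 0 <= g i) -> uniq s -> (forall u, u \in s -> (l < D I u)%N) ->
  \sum_(u <- s) g (D I u) <= nb * \sum_(l.+1 <= i < L.+1) sh i * g i.
Proof.
move=> Iq bl0 g0 us ls.
have -> : \sum_(u <- s) g (D I u) =
   \sum_(u <- s) \sum_(l.+1 <= i < L.+1) (D I u == i)%:R * g i.
  apply: eq_big_seq => u /ls lu.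
  rewrite (bigD1_seq (D I u)) ?iota_uniq//=; last by rewrite mem_index_iota lu ltnS D_le.
  rewrite eqxx mul1r big1 ?addr0// => i; rewrite eq_sym => /negbTE ->.
  by rewrite mul0r.
rewrite exchange_big /= mulr_sumr [leLHS]big_nat_cond [leRHS]big_nat_cond.
apply: ler_sum => i /andP[/andP[li iL] _].
rewrite -mulr_suml mulrA ler_wpM2r//.
apply: le_trans (shell_le Iq (l := i) _); last by rewrite (leq_ltn_trans bl0 li).
rewrite -natr_sum ler_nat.
rewrite (eq_bigr (fun u => if D I u == i then 1 else 0)%N); last by move=> u _; case: eqP.
rewrite -big_mkcond sum1_count -size_filter; apply: size_le_card; first exact: filter_uniq.
by move=> u; rewrite mem_filter => /andP[].
Qed.

Local Notation Ctm := (Ct r q K0 tm).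
(** One summand for each group of sites handled in a step: the far ones shell by shell, the near
    ones, and those put back. *)
Definition ccst : R := nb * (Ctm + 1) + nb + kap tm.+1.
Local Notation CE := (CE ccst).
Local Notation Err := (Err bl sh alt L).

Let nb0 : 0 <= nb. Proof. exact: le_trans nb1. Qed.
Let kap0 t : 0 <= kap t. Proof. by rewrite mulr_ge0. Qed.
Let cc0 : 0 <= ccst.
Proof. by rewrite !addr_ge0// mulr_ge0// addr_ge0// Ct_ge0. Qed.
Let alt0 l : 0 <= alt l. Proof. by case/andP: (alt01 l). Qed.
Let bl0 l : 0 <= bl l. Proof. exact: le_trans (bl1 l). Qed.

Definition incb n tau l := \sum_(i < n.-1) CE (n.-1 - i)%N * Err (n.-1 - i)%N tau l + tau.

(* n counts the derivatives still available: F^(q-n) is expanded around the sum over the sites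
   far from the ones already met, and the product of the variables met so far is replaced by
   its centred version (Gz) or by its mean (Gc). *)
Theorem expansion n : (0 < n <= q)%N -> forall G l tau t xi e I eta j J s, Gok l tau G ->
  (b0 <= l <= L)%N -> 0 <= tau -> (t + 2 * n <= tm)%N -> G t xi e I ->
  etaok t l I eta j J -> seqok t l I s -> (e + j + n)%N = q.+1 ->
  Exp (fun F => Ex (fun w => xi w * eta w * F (q - n)%N (Wsum s w))) (CE n * Err n tau l).
Proof.
elim/ltn_ind: n => n IH /andP[n0 nq] G l tau t xi e I eta j J s ok lL tau0 ttm Gx ee ss ejn.
have tm' : (t.+1 < tm)%N by nlia ttm n0.
have n0q : (0 < n <= q)%N by rewrite n0.
have [us ls Ns] := ss; have [e1 e2 e3 e4] := ee; have /andP[b0l lL'] := lL.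
have px := pd_of_G ok (ltnW (ltnW tm')) Gx; have pe := pd_of_eta ee.
have [dx mx Ie] := G_dm ok (ltnW (ltnW tm')) Gx.
(* The sites that carry the whole product; from here on distances are measured from them. *)
pose W0 := I :|: J.
have W0e : (#|W0| <= e + j)%N.
  by apply: leq_trans (leq_addr #|I :&: J| _) _; rewrite cardsUI leq_add.
have W0q : (#|W0| <= q.+1)%N by nlia W0e ejn.
pose near := [seq u <- s | (D W0 u <= l)%N]; pose far := [seq u <- s | (l < D W0 u)%N].
have pnf : perm_eq (near ++ far) s.
  rewrite /far (eq_filter (a2 := predC (fun u => D W0 u <= l)%N)); last first.
    by move=> u /=; rewrite ltnNge.
  exact: (permEl (perm_filterC _ _)).
have unf : uniq (near ++ far) by rewrite (perm_uniq pnf).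
have ufar : uniq far by rewrite filter_uniq.
have WE w : Wsum s w = Wsum (near ++ far) w by rewrite /Wsum (perm_big _ pnf).
have lfar u : u \in far -> (l < D W0 u)%N by rewrite mem_filter => /andP[].
have snear : (size near)%:R <= nb * bl l.
  apply: le_trans (ball_le W0q lL); rewrite ler_nat; apply: size_le_card.
    by rewrite filter_uniq.
  by move=> u; rewrite mem_filter => /andP[].
have sfar : #|T|%:R <= (size far)%:R + kap t.+1 * bl l.
  apply: le_trans Ns _; rewrite -(perm_size pnf) size_cat natrD.
  by rewrite /kap -natr1 mulrDl mul1r mulrDl; lra.
have kk : (q - n <= q)%N by exact: leq_subr.
have pxe : pd (e + j) (fun w => xi w * eta w) by exact: pdM.
have IWs F z m s' : cls F -> (m + n <= q.+1)%N -> pd m z ->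
    integ (fun w => z w * F (q - n)%N (Wsum s' w)).
  move=> cF mn pz; apply: pd_integ (pdM pz (pd_F s' cF kk)); apply: le_deg; nlia mn nq.
(* The sites near I and J are removed one by one; each costs an expansion of lower order. *)
have S1 : Exp (fun F => Ex (fun w => xi w * eta w * F (q - n)%N (Wsum (near ++ far) w)) -
    Ex (fun w => xi w * eta w * F (q - n)%N (Wsum far w))) (\sum_(u <- near) incb n tau l).
  apply: (tel pxe kk); first by nlia ejn nq.
  move=> u s' [s0 [s'' [En ->]]].
  have un' : uniq (u :: s'' ++ far).
    by move: unf; rewrite En -catA cat_uniq => /and3P[_ _].
  have sub v : v \in u :: s'' ++ far -> v \in s.
    by move=> vs; rewrite -(perm_mem pnf) En -catA mem_cat vs orbT.
  have ss' : seqok t.+1 l I (s'' ++ far).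
    split; first by case/andP: un'.
      by move=> v vs; apply: ls; apply: sub; rewrite inE vs orbT.
    by apply: le_trans sfar _; rewrite lerD2r ler_nat size_cat leq_addl.
  apply: (inc (Eb := fun i => CE i * Err i tau l) ok (ltnW tm') Gx ee _ _ ss') => //.
  - by case/andP: un'.
  - by apply: ls; apply: sub; rewrite mem_head.
  - by move=> i; rewrite mulr_ge0 ?CE_ge0 ?Err_ge0.
  - move=> i eta' j' J' /andP[i0 i_n] ee' eji.
    apply: (IH i i_n _ G l tau t.+1 xi e I eta' j' J') => //.
    + by nlia i0 i_n nq.
    + by nlia ttm i_n.
    + exact: (G_mono ok).
(* xi eta is centred; its covariance with f(far sites) telescopes in the order of decreasing
   distance, each increment carrying the mixing coefficient of its own distance. *)
pose z' w := xi w * eta w - Ex (fun w => xi w * eta w).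
have mxe : measurable_fun setT (fun w => xi w * eta w) by case: pxe.
have sm : smeas W0 (fun w => xi w * eta w).
  by apply: smeasM; [apply: smeas_sub mx; exact: finset.subsetUl|apply: smeas_sub e2; exact: finset.subsetUr].
have [kp1 kp2 kp3 kp4] := Kn_parts r q K00 t.
have ej0 : (0 < e + j <= q.+1)%N by nlia ejn nq.
have Gz' : Gz t.+1 z' (e + j) W0.
  exists (fun w => xi w * eta w); split=> //; first exact: dm_le (dmM dx e1).
  apply: dm_le kp4 _; apply: dm_center => //; first by rewrite addr_ge0 ?Kn_ge0.
  exact: dmM.
have pz' : pd (e + j) z'.
  by apply: pdB => //; apply: pd_cst.
(* Nearest first, so that each increment involves only sites at least as far from [W0] as its own
   site. *)
pose sfr := sort (fun u v => D W0 u <= D W0 v)%N far.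
have psf : perm_eq sfr far by rewrite perm_sort.
have S2 : Exp (fun F => Ex (fun w => z' w * F (q - n)%N (Wsum far w)))
    (\sum_(u <- sfr) incb n (Ctm * alt (D W0 u)) (D W0 u)).
  have srt : pairwise (fun u v => D W0 u <= D W0 v)%N sfr.
    rewrite -sorted_pairwise; first by apply: sort_sorted => u v; exact: leq_total.
    by move=> u v w; exact: leq_trans.
  apply: Exp_ext (tel (s1 := sfr) (s2 := [::]) pz' kk _ _) => [F cF| |].
  (* The telescope ends at the empty sum, where F is a constant and the centred [z'] integrates to
     0. *)
  - rewrite cats0 [X in _ - X](_ : _ = 0) ?subr0; last first.
      under eq_Ex do rewrite /Wsum big_nil mulrC.
      rewrite ExZ; last by apply: pd_integ pz'; apply: le_deg; nlia ej0.
      rewrite /z' ExB ?Ex_cst ?subrr ?mulr0//; last exact: integ_cst.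
      by apply: pd_integ pxe; apply: le_deg; nlia ej0.
    by apply: eq_Ex => w; rewrite /Wsum (perm_big _ psf).
  - by nlia ejn nq.
  move=> u s' [s0 [s'' [En ->]]]; rewrite cats0.
  set l' := D W0 u.
  have uin v : v \in u :: s'' -> v \in far.
    by move=> vs; rewrite -(perm_mem psf) En mem_cat vs orbT.
  have ll' : (l < l')%N by apply: lfar; apply: uin; rewrite mem_head.
  have l'L : (b0 < l' <= L)%N by rewrite D_le (leq_ltn_trans b0l ll').
  have ok' := Gok_Gst l'L.
  have un' : uniq (u :: s'').
    have : uniq sfr by rewrite (perm_uniq psf).
    by rewrite En cat_uniq => /and3P[].
  have srt2 : all (fun v => D W0 u <= D W0 v)%N s''.
    by move: srt; rewrite En pairwise_cat /= => /and3P[_ _ /andP[]].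
  have srt1 v : v \in s0 -> (D W0 v <= l')%N.
    move: srt; rewrite En pairwise_cat allrel_consr => /and3P[/andP[/allP h _] _ _] /h//.
  have ss' : seqok t.+2 l' W0 s''.
    split; [by case/andP: un'|by move=> v vs; exact: (allP srt2)|].
    apply: le_trans Ns _.
    (* The sites of [s] missing from [s''] all lie within [l'] of [W0], so a single further ball
       accounts for them. *)
    have c1 : (size s <= size s'' + #|[set v | (D W0 v <= l')%N]|)%N.
      have -> : size s = (size s'' + size ((u :: s0) ++ near))%N.
        move: (perm_size pnf) (perm_size psf); rewrite En !size_cat /=.
        move: (size near) (size far) (size s) (size s0) (size s''); clear; lia.
      rewrite leq_add2l; apply: size_le_card.
        have : uniq (near ++ (s0 ++ u :: s'')).
          by rewrite -En (perm_uniq (_ : perm_eq _ (near ++ far))) ?perm_cat2l.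
        rewrite (_ : uniq _ = uniq (((u :: s0) ++ near) ++ s'')).
          by rewrite cat_uniq => /andP[].
        apply: perm_uniq; apply/permP => a; rewrite !count_cat /=; clear; lia.
      move=> v; rewrite mem_cat inE => /orP[/orP[/eqP->|/srt1]//|].
      by rewrite mem_filter => /andP[h _]; apply: leq_trans h (ltnW ll').
    have c2 := ball_le W0q (l := l') ltac:(by rewrite (leq_trans b0l (ltnW ll')) D_le).
    apply: (@le_trans _ _ ((size s'')%:R + nb * bl l' + kap t * bl l')).
      apply: lerD; last by rewrite ler_wpM2l// bl_mono// ltnW.
      by apply: le_trans (_ : (size s'' + #|[set v | (D W0 v <= l')%N]|)%:R <= _);
        rewrite ?ler_nat// natrD lerD2l.
    rewrite -addrA lerD2l -mulrDl ler_wpM2r// /kap -[X in X + _]mul1r -mulrDl addrC natr1.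
    by rewrite ler_wpM2r// ler_nat.
  have tl' : 0 <= Ctm * alt l' by rewrite mulr_ge0// Ct_ge0.
  rewrite (_ : (fun F => Ex (fun w => z' w * (F (q - n)%N (Wsum (u :: s'') w) - _))) =
    (fun F => Ex (fun w => z' w * 1 * (F (q - n)%N (Wsum (u :: s'') w) -
      F (q - n)%N (Wsum s'' w))))); last first.
    by apply/funext => F; apply: eq_Ex => w; rewrite mulr1.
  have GG : Gst l' t.+1 z' (e + j) W0 by right.
  apply: (inc (Eb := fun i => CE i * Err i (Ctm * alt l') l') ok' tm' GG
    (eta_one t.+1 W0 (D_le W0 u)) _ _ ss') => //.
  - by case/andP: un'.
  - by rewrite addn0.
  - by move=> i; rewrite mulr_ge0 ?CE_ge0 ?Err_ge0.
  - move=> i eta' j' J' /andP[i0 i_n] ee' eji.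
    apply: (IH i i_n _ (Gst l') l' _ t.+2 z' (e + j)%N W0 eta' j' J') => //.
    + by nlia i0 i_n nq.
    + by rewrite D_le (leq_trans b0l (ltnW ll')).
    + by nlia ttm i_n.
    + exact: (G_mono ok').
(* In the product of the expectations the removed sites are put back. *)
pose c := Ex (fun w => xi w * eta w).
pose rest := [seq u <- enum T | u \notin far].
have prf : perm_eq (rest ++ far) (enum T).
  have h := permEl (perm_filterC (fun u => u \notin far) (enum T)).
  apply: perm_trans h; rewrite perm_cat2l; apply: uniq_perm => //.
    by rewrite filter_uniq ?enum_uniq.
  by move=> u; rewrite mem_filter mem_enum andbT /= negbK.
have urf : uniq (rest ++ far) by rewrite (perm_uniq prf) enum_uniq.
have srest : (size rest)%:R <= kap t.+1 * bl l.
  have E := perm_size prf; rewrite size_cat -cardE in E.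
  by move: sfar; rewrite -E natrD addrC lerD2l.
have pc : pd (e + j) (fun=> c) by exact: pd_cst.
have ejq : (0 < e + j <= q)%N by nlia ejn n0 nq.
have Gc' : G t.+1 (fun=> c) (e + j)%N finset.set0 by apply: (G_cst ok _ Gx ee ejq); exact: ltnW.
have S3' : Exp (fun F => Ex (fun w => c * F (q - n)%N (Wsum (rest ++ far) w)) -
    Ex (fun w => c * F (q - n)%N (Wsum far w))) (\sum_(u <- rest) incb n tau l).
  apply: (tel pc kk); first by nlia ejn nq.
  move=> u s' [s0 [s'' [En ->]]].
  have un' : uniq (u :: s'' ++ far).
    by move: urf; rewrite En -catA cat_uniq => /and3P[_ _].
  have ss' : seqok t.+2 l finset.set0 (s'' ++ far).
    split; [by case/andP: un'|by move=> v _; rewrite D_set0|].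
    apply: le_trans sfar _; apply: lerD; first by rewrite ler_nat size_cat leq_addl.
    by rewrite ler_wpM2r// /kap ler_wpM2r// ler_nat.
  rewrite (_ : (fun F => Ex (fun w => c * (F (q - n)%N (Wsum (u :: s'' ++ far) w) - _))) =
    (fun F => Ex (fun w => c * 1 * (F (q - n)%N (Wsum (u :: s'' ++ far) w) -
      F (q - n)%N (Wsum (s'' ++ far) w))))); last first.
    by apply/funext => F; apply: eq_Ex => w; rewrite mulr1.
  apply: (inc (Eb := fun i => CE i * Err i tau l) ok tm' Gc' (eta_one t.+1 finset.set0 lL') _ _ ss') => //.
  - by case/andP: un'.
  - by rewrite D_set0.
  - by rewrite addn0.
  - by move=> i; rewrite mulr_ge0 ?CE_ge0 ?Err_ge0.
  - move=> i eta' j' J' /andP[i0 i_n] ee' eji.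
    apply: (IH i i_n _ G l tau t.+2 (fun=> c) (e + j)%N finset.set0 eta' j' J') => //.
    + by nlia i0 i_n nq.
    + by nlia ttm i_n.
    + exact: (G_mono ok).
have kQ : (q - n < Q)%N by apply: leq_trans qQ; nlia n0 nq.
have S3 : Exp (fun F => c * Ex (fun w => F (q - n)%N (Wsum far w)))
    (0 + `|-1| * \sum_(u <- rest) incb n tau l).
  apply: Exp_ext (ExpD (ExpEW c kQ) (ExpZ (-1) S3')) => F cF.
  have I1 s' : integ (fun w => F (q - n)%N (Wsum s' w)).
    by apply: pd_integ (pd_F s' cF kk); apply: le_deg; exact: leq_trans (leq_subr _ _) (leqnSn q).
  rewrite !ExZ// mulN1r /EW opprB addrCA [X in c * X - _](_ : _ = Ex (fun w => F (q - n)%N (Wsum (rest ++ far) w))).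
    by rewrite subrr addr0.
  by apply: eq_Ex => w; rewrite /Wsum (perm_big _ prf).
apply: Exp_le; last first.
  apply: Exp_ext (ExpD S1 (ExpD S2 S3)) => F cF.
  have I1 s' : integ (fun w => F (q - n)%N (Wsum s' w)).
    by apply: pd_integ (pd_F s' cF kk); apply: le_deg; exact: leq_trans (leq_subr _ _) (leqnSn q).
  rewrite -ExZ// -ExD; last 2 first.
  - by apply: (IWs F z' (e + j)%N) => //; nlia ejn.
  - exact: integZ.
  rewrite (_ : Ex (fun w => xi w * eta w * F (q - n)%N (Wsum s w)) =
    Ex (fun w => xi w * eta w * F (q - n)%N (Wsum (near ++ far) w))); last first.
    by apply: eq_Ex => w; rewrite WE.
  rewrite -addrA -[RHS]addr0; congr (_ + _); rewrite addrC; apply/eqP; rewrite subr_eq0; apply/eqP.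
  by apply: eq_Ex => w; rewrite /z' /c mulrBl subrK.
rewrite add0r normrN normr1 mul1r !big_const_seq !count_predT !iter_addr_0.
have Ib : bl l * incb n tau l <= (1 + ccst) ^+ n.-1 * Err n tau l by apply: inc_le.
have Er0 : 0 <= Err n tau l by apply: Err_ge0.
have ib0 tau' l' : 0 <= tau' -> 0 <= incb n tau' l'.
  by move=> h; rewrite addr_ge0// sumr_ge0// => i _; rewrite mulr_ge0 ?CE_ge0 ?Err_ge0.
have P0 : 0 <= (1 + ccst) ^+ n.-1 by rewrite exprn_ge0// addr_ge0.
have B1 : incb n tau l *+ size near <= nb * ((1 + ccst) ^+ n.-1 * Err n tau l).
  rewrite -mulr_natl; apply: (@le_trans _ _ (nb * bl l * incb n tau l)).
    by rewrite ler_wpM2r// ib0.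
  by rewrite -mulrA ler_wpM2l.
have B3 : incb n tau l *+ size rest <= kap tm.+1 * ((1 + ccst) ^+ n.-1 * Err n tau l).
  rewrite -mulr_natl; apply: (@le_trans _ _ (kap tm.+1 * bl l * incb n tau l)).
    rewrite ler_wpM2r ?ib0//; apply: le_trans srest _; rewrite ler_wpM2r// /kap ler_wpM2r// ler_nat.
    exact: leqW (ltnW tm').
  by rewrite -mulrA ler_wpM2l.
have B2 : \sum_(u <- sfr) incb n (Ctm * alt (D W0 u)) (D W0 u) <=
    nb * (Ctm + 1) * ((1 + ccst) ^+ n.-1 * Err n tau l).
  apply: (@le_trans _ _ (nb * \sum_(l.+1 <= i < L.+1) sh i * incb n (Ctm * alt i) i)).
    apply: far_sum => //.
    - by move=> i; apply: ib0; rewrite mulr_ge0 ?Ct_ge0.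
    - by rewrite (perm_uniq psf).
    - by move=> u; rewrite (perm_mem psf); exact: lfar.
  rewrite -mulrA ler_wpM2l//.
  apply: (@le_trans _ _ (\sum_(l.+1 <= i < L.+1) (1 + ccst) ^+ n.-1 *
     (sh i * (Ctm * alt i * bl i ^+ n.-1 + Zs bl sh alt L n i)))).
    apply: ler_sum => i _; rewrite [leRHS]mulrCA; apply: ler_wpM2l => //.
    by apply: inc_Zs => //; rewrite mulr_ge0 ?Ct_ge0.
  rewrite -mulr_sumr mulrCA ler_wpM2l//; have Ct0 : 0 <= Ctm by exact: Ct_ge0.
  have Hj := @jump_le R bl sh alt L Ctm bl1 sh0 sh_bl alt0 n l n0.
  apply: le_trans Hj _.
  apply: ler_wpM2l; first by rewrite addr_ge0.
  by rewrite lerDr; apply: mulr_ge0 => //; exact: exprn_ge0.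
apply: le_trans (lerD B1 (lerD B2 B3)) _.
have -> : CE n * Err n tau l = ccst * ((1 + ccst) ^+ n.-1 * Err n tau l) by rewrite -mulrA.
by rewrite -!mulrDl ler_wpM2r ?mulr_ge0// /ccst addrCA addrA.
Unshelve. all: exact: 0%N.
Qed.

Lemma powR_conv (t x y s : R) : 0 <= t <= 1 -> 0 <= x -> 0 <= y -> 1 <= s ->
  (t * x + (1 - t) * y) `^ s <= t * x `^ s + (1 - t) * y `^ s.
Proof.
move=> /andP[t0 t1] x0 y0 s1.
by apply: (convex_powR s1 (Itv01 t0 t1)) => //=; rewrite inE/= in_itv/= ?x0 ?y0.
Qed.

(** Convexity of the power s >= 1. Unlike for the maximum of two envelopes, the constant does not
    grow. *)
Lemma dom_conv K A B t : 0 <= t <= 1 -> dom K A -> dom K B ->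
  dom K (fun w => t * A w + (1 - t) * B w).
Proof.
move=> t01 [mA A1 k0 hA] [mB B1 _ hB]; have /andP[t0 t1] := t01.
have t1' : 0 <= 1 - t by rewrite subr_ge0.
have cv (a b c : R) : a <= b -> a <= c -> a <= t * b + (1 - t) * c.
  move=> ab ac; rewrite -[leLHS]mul1r -[X in X * a](subrKC t) mulrDl.
  by apply: lerD; rewrite ler_wpM2l.
have cv' (a b c : R) : b <= a -> c <= a -> t * b + (1 - t) * c <= a.
  move=> ab ac; rewrite -[leRHS]mul1r -[X in _ <= X * a](subrKC t) [leRHS]mulrDl.
  by apply: lerD; rewrite ler_wpM2l.
have mm : measurable_fun setT (fun w => t * A w + (1 - t) * B w).
  by apply: measurable_funD; apply: measurable_funM.
split=> //; first by move=> w; exact: cv.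
case: r hqr hA hB => [s||] hs; last first.
- by [].
- by move=> hA hB; apply: filterS2 hA hB => w a b; exact: cv'.
move=> [iA eA] [iB eB].
have s1 : 1 <= s by move: hs; rewrite lte_fin => /ltW; apply: le_trans; rewrite ler1n.
have bd w : (t * A w + (1 - t) * B w) `^ s <= t * A w `^ s + (1 - t) * B w `^ s.
  by apply: powR_conv => //; [exact: le_trans (A1 w)|exact: le_trans (B1 w)].
have I2 := integD (integZ t iA) (integZ (1 - t) iB).
have I1 : integ (fun w => (t * A w + (1 - t) * B w) `^ s).
  apply: (integ_le _ _ I2); first exact: measurableT_comp (measurable_powR s) mm.
  by move=> w; rewrite ger0_norm ?powR_ge0.
split; first exact: I1.
apply: le_trans (le_Ex I1 I2 bd) _; rewrite ExD; [|exact: integZ|exact: integZ].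
by rewrite (ExZ _ iA) (ExZ _ iB); exact: cv'.
Qed.

(** The mean of any number of envelopes of constant [K0] is again one, so a sum of n variables is of
    degree 1 at the price of the factor n only. *)
Lemma Wsum_mean (s : seq T) : exists2 A, dom K0 A &
  forall w, `|Wsum s w| <= (size s)%:R * A w.
Proof.
elim: s => [|i s [A dA hA]].
  by exists (fun=> 1) => // w; rewrite /Wsum big_nil normr0 mul0r.
have [B dB hB] := domX i; set n : R := (size s)%:R in hA.
have n0 : 0 <= n by rewrite /n.
exists (fun w => (n / (n + 1)) * A w + (1 - n / (n + 1)) * B w).
  by apply: dom_conv => //; rewrite divr_ge0 ?addr_ge0//= ler_pdivrMr ?mul1r ?ltr_wpDl// lerDl.
move=> w; rewrite /Wsum big_cons /= -natr1 (le_trans (ler_normD _ _))//.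
have n1 : n + 1 != 0 by rewrite gt_eqF// ltr_wpDl.
have -> : (n + 1) * (n / (n + 1) * A w + (1 - n / (n + 1)) * B w) = B w + n * A w.
  by field.
by rewrite lerD ?hA//; have := hB w; rewrite expr1.
Qed.

Hypothesis b0L : (b0 < L)%N.
Hypothesis htm : (2 * q <= tm)%N.
Hypothesis q0 : (0 < q)%N.

(** Each X i starts the recursion as the factor [eta], next to the factor 1 on the empty set, from
    which every site has distance L. *)
Lemma W_expansion tau : Gok b0 tau (Gc 1) -> 0 <= tau ->
  Exp (fun F => Ex (fun w => Wsum (enum T) w * F 0%N (Wsum (enum T) w)))
    (#|T|%:R * (CE q * Err q tau b0)).
Proof.
move=> ok tau0.
have H i : Exp (fun F => Ex (fun w => X i w * F 0%N (Wsum (enum T) w))) (CE q * Err q tau b0).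
  have ee : etaok 0 b0 finset.set0 (X i) 1 [set i].
    split; [apply: dm_le (domX i); exact: K0_Kn|by apply: smeas_X; rewrite inE|by rewrite cards1|].
    by move=> u _; rewrite D_set0 ltnW.
  have ss : seqok 0 b0 finset.set0 (enum T).
    split; [exact: enum_uniq|by move=> u _; rewrite D_set0 ltnW|].
    by rewrite /kap !mul0r addr0 -cardE.
  have G1 : Gc 1 0 (fun=> 1) 0 finset.set0.
    by exists 1; split=> //; rewrite normr1 // /Mn /= mulr1.
  have qq : (0 < q <= q)%N by rewrite q0 leqnn.
  have bL : (b0 <= b0 <= L)%N by rewrite leqnn ltnW.
  have t2 : (0 + 2 * q <= tm)%N by [].
  apply: Exp_ext (expansion qq ok bL tau0 t2 G1 ee ss _) => // F cF.
  by apply: eq_Ex => w; rewrite mul1r subnn.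
apply: Exp_le; last apply: Exp_ext (Exp_sum (enum T) H) => F cF.
  by rewrite big_const_seq count_predT iter_addr_0 -cardE mulr_natl.
rewrite -Ex_sum; last first.
  move=> i; apply: pd_integ (pdM (pdX i) (pd_F (enum T) cF (leq0n q))).
  by apply: le_deg; rewrite subn0 add1n.
by apply: eq_Ex => w; rewrite /Wsum mulr_suml.
Qed.

(** At the initial scale the Taylor remainders are bounded by moments of degree q + 1 alone, without
    any gain from mixing. *)
Theorem expansion_low : Exp (fun F => Ex (fun w => Wsum (enum T) w * F 0%N (Wsum (enum T) w)))
    (#|T|%:R * (CE q * Err q Ctm b0)).
Proof.
apply: W_expansion; last exact: Ct_ge0.
have om : 0 <= (1 : R) <= 1 by rewrite ler01 lexx.
apply: Gok_Gc => // t xi e I eta j J u s n tt h ee us lu [us' ls _] n0 ejn; apply: Exp0 => F cF.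
have [de me] := tayrem_eta cF ee lu ls n0.
have -> : Ex (fun w => xi w * eta w *
   tayrem (fun i => F (q - n + i)%N) n (Wsum s w) (X u w)) =
   Ex (fun w => xi w * (eta w * tayrem (fun i => F (q - n + i)%N) n (Wsum s w) (X u w))).
  by apply: eq_Ex => w; rewrite mulrA.
rewrite -[Ctm]mulr1; apply: (Gc_bound (m := (j + n)%N) ler01 (ltnW tt) h) => //.
- by rewrite addr_ge0 ?Kn_ge0.
- by nlia ejn.
- by apply: dm_pd de; exact: (smeas_meas mX me).
- exact: (smeas_meas mX me).
Qed.

(** * The top order: Lipschitz and Hoelder bounds on F^(q) *)

Variables (lam1 hh delta : R).
Hypothesis qQ1 : (q < Q)%N.
Hypothesis hqr2 : (q.+2%:R%:E <= r)%E.
Hypothesis delta01 : 0 <= delta <= 1.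
Hypothesis hqd : ((q.+1%:R + delta)%:E < r)%E.
Hypothesis hh0 : 0 <= hh.
Hypothesis cls_jet1 : forall F, cls F -> jet q.+1 F.
Hypothesis cls_bd1 : forall F, cls F -> forall x, `|F q.+1 x| <= lam1.
Hypothesis cls_hoelder : forall F, cls F -> forall x y,
  `|F q x - F q y| <= hh * `|x - y| `^ delta.

Definition ald (l : nat) : R := al l `^ mixing_exp r (q.+1%:R + delta).

Let Km := Kn tm + K0 + K0.
Let mq2 := momqS Km.

(** In order: the next Taylor remainder, the near sites, the sites put back, the far shells below L,
    and everything at distance L. *)
Definition tau_ref : R := Mn tm * (lam1 * mq2 * bl b0 + lam1 * nb * mq2 * bl b0 +
  mq2 * (lam1 * kap tm.+1 * mq2 * bl b0) +
  hh * covC Km (q.+1%:R + delta) * (\sum_(b0.+1 <= l < L) (nb * sh l) `^ delta * ald l) +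
  covq (Kn tm.+1 + 1) * alt L).

Lemma le_deg2 n : (n <= q.+2)%N -> (n%:R%:E <= r)%E.
Proof. by move=> nq; apply: le_trans hqr2; rewrite lee_fin ler_nat. Qed.

Lemma cls_lam1 F : cls F -> 0 <= lam1.
Proof. by move=> cF; exact: le_trans (cls_bd1 cF 0). Qed.

Lemma Fq_lip F x y : cls F -> `|F q x - F q y| <= lam1 * `|x - y|.
Proof. by move=> cF; apply: der_norm_le (cls_jet1 cF (ltnSn q)) (cls_bd1 cF) x y. Qed.

Lemma meas_Fq F s : cls F -> measurable_fun setT (fun w => F q (Wsum s w)).
Proof. by move=> cF; apply: measurableT_comp (meas_Wsum s); exact: cls_meas. Qed.

(** F^(q) is Lipschitz with constant [lam1], and the sum over [s1] is its number of sites times an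
    envelope; this spends one more degree, up to q + 2. *)
Lemma lip_sum K m z s1 s2 F : cls F -> 0 <= K -> K <= Kn tm + K0 -> (m <= q.+1)%N ->
  measurable_fun setT z -> dm K m z ->
  `|Ex (fun w => z w * (F q (Wsum (s1 ++ s2) w) - F q (Wsum s2 w)))| <= lam1 * (size s1)%:R * mq2.
Proof.
move=> cF k0 kK mq mz dz; have l0 := cls_lam1 cF.
have [A dA hA] := Wsum_mean s1.
have dmA : dm K0 1 A.
  by exists A => // w; rewrite expr1 ger0_norm// (dom_ge0 w dA).
have mA : measurable_fun setT A by case: dA.
have dz' : dm (K + K0) (m + 1) (fun w => `|z w| * A w).
  by apply: dmM dmA; case: dz => B dB hB; exists B => // w; rewrite normr_id.
have mz' : measurable_fun setT (fun w => `|z w| * A w).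
  by apply: measurable_funM => //; apply: measurableT_comp.
have m2 : (m + 1 <= q.+2)%N by rewrite addn1 ltnS.
have kk : 0 <= K + K0 by rewrite addr_ge0.
have I' : integ (fun w => `|z w| * A w).
  by apply: pd_integ (dm_pd mz' dz'); exact: le_deg2.
have E := dm_Ex kk (le_deg2 m2) mz' dz'.
have bd w : `|z w * (F q (Wsum (s1 ++ s2) w) - F q (Wsum s2 w))| <=
    lam1 * (size s1)%:R * (`|z w| * A w).
  rewrite normrM mulrCA; apply: ler_wpM2l => //.
  apply: le_trans (Fq_lip _ _ cF) _; rewrite -mulrA ler_wpM2l//.
  by rewrite /Wsum big_cat addrK; exact: hA.
have mm : measurable_fun setT (fun w => z w * (F q (Wsum (s1 ++ s2) w) - F q (Wsum s2 w))).
  by apply: measurable_funM => //; apply: measurable_funB; exact: meas_Fq.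
apply: (@le_trans _ _ (Ex (fun w => lam1 * (size s1)%:R * (`|z w| * A w)))).
  by apply: normr_Ex_le; [exact: integ_le bd (integZ _ I')|exact: integZ|exact: bd].
rewrite ExZ//; apply: ler_wpM2l; first by rewrite mulr_ge0.
apply: (@le_trans _ _ (mom (K + K0) (m + 1)%:R)); first by apply: le_trans E; exact: ler_norm.
apply: (@le_trans _ _ (momqS (K + K0))); first exact: mom_momq.
by apply: momq_le => //; rewrite /Km lerD2r.
Qed.

Lemma dm_up K n m f : (n <= m)%N -> dm K n f -> dm K m f.
Proof. by move=> nm [A dA hA]; exists A => // w; apply: le_trans (hA w) _; exact: dom_expS dA nm. Qed.

(** A whole shell is removed at once. By the Hoelder condition the increment of F^(q) has degree
    [delta] instead of 1, so the covariance has total degree q + 1 + [delta] only. *)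
Lemma shell_cov (I : {set T}) K y l s1 s2 F : cls F -> (b0 < l <= L)%N -> (#|I| <= q.+1)%N ->
  0 <= K -> K <= Kn tm + K0 -> smeas I y -> dm K q.+1 y ->
  (forall u, u \in s1 ++ s2 -> (l <= D I u)%N) -> (size s1)%:R <= nb * sh l ->
  `|cov y (fun w => F q (Wsum (s1 ++ s2) w) - F q (Wsum s2 w))| <=
    hh * covC Km (q.+1%:R + delta) * ((nb * sh l) `^ delta * ald l).
Proof.
move=> cF lL Iq k0 kK my dy sU ss.
have [/andP[d0 d1] my'] := (delta01, smeas_meas mX my).
have qd0 : 0 <= q.+1%:R + delta by rewrite addr_ge0.
have km0 : 0 <= Km by rewrite !addr_ge0 ?Kn_ge0.
have [A dA hA] := Wsum_mean s1; case: (dy) => B dB hB.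
have dAB := dom_max dA dB; have kkm : K0 + K <= Km by rewrite addrC lerD2r.
set g := fun w => _.
have smg : smeas [set v | (l <= D I v)%N] g.
  apply: smeasB; apply: smeas_comp; try exact: cls_meas.
    by apply: smeas_Wsum => v /sU; rewrite inE.
  by apply: smeas_Wsum => v vs; rewrite inE; apply: sU; rewrite mem_cat vs orbT.
have mg := smeas_meas mX smg.
pose k := hh * (size s1)%:R `^ delta.
have kk0 : 0 <= k by rewrite mulr_ge0 ?powR_ge0.
have gA w : `|g w| <= k * A w `^ delta.
  apply: le_trans (cls_hoelder cF _ _) _; rewrite /k -mulrA ler_wpM2l//.
  rewrite -powRM ?(dom_ge0 w dA)//; apply: ge0_ler_powR; rewrite ?nnegrE ?mulr_ge0 ?(dom_ge0 w dA)//.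
  by rewrite /Wsum big_cat addrK; exact: hA.
have Ey : integ y by apply: pd_integ (dm_pd my' dy); exact: le_deg.
have pg : pd 0 g.
  split=> //; exists K0, (fun=> 1), 2; split=> // w; rewrite expr0 mulr1.
  by rewrite (le_trans (ler_normB _ _))// mulr2n lerD// cls_bd.
have Eg : integ g by apply: pd_integ pg; exact: le_deg.
have Eyg : integ (fun w => y w * g w).
  by apply: pd_integ (pdM (dm_pd my' dy) pg); rewrite addn0; exact: le_deg.
have cg0 : 0 <= covC (K0 + K) (q.+1%:R + delta) by rewrite covC_ge0// addr_ge0.
have C1 : `|cov y g| <= k * (covC (K0 + K) (q.+1%:R + delta) * ald l).
  have [k00|k1] := eqVneq k 0.
    have g0 w : g w = 0.
      by apply/eqP; rewrite -normr_le0; have := gA w; rewrite k00 mul0r.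
    rewrite (_ : g = fun=> 0); last by apply/funext.
    by rewrite /cov; under eq_Ex do rewrite mulr0; rewrite !Ex_cst mulr0 subrr normr0 k00 mul0r.
  have {}k1 : 0 < k by rewrite lt_neqAle eq_sym k1.
  have E : `|cov y (fun w => k^-1 * g w)| <= covC (K0 + K) (q.+1%:R + delta) * ald l.
    apply: (cov_dom (SA := sg I) (SB := sg [set v | (l <= D I v)%N]) (a := al l) _ _ _ _ _ _ _ _ _ dAB) => //.
    - by move=> X0 Y0 hX hY; apply: (mix Iq lL) hX hY => v; rewrite inE.
    - exact: gens_setT.
    - exact: gens_set0.
    - exact: gens_setT.
    - exact: gens_set0.
    - by apply: measurable_funM.
    - exact: smeas_lev.
    - by apply: smeas_lev => //; apply: smeasM => //; exact: smeas_cst.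
    - move=> w; rewrite powR_mulrn; last by rewrite le_max (dom_ge0 w dA).
      by apply: le_trans (hB w) _; rewrite lerXn2r ?nnegrE ?le_max ?lexx ?(dom_ge0 w dB) ?orbT.
    - move=> w; rewrite normrM ger0_norm ?invr_ge0 ?(ltW k1)// ler_pdivrMl//.
      apply: le_trans (gA w) _; apply: ler_pM; rewrite ?powR_ge0 ?lerDl//.
      by apply: ge0_ler_powR; rewrite ?nnegrE ?le_max ?lexx ?(dom_ge0 w dA).
  have -> : cov y g = k * cov y (fun w => k^-1 * g w).
    rewrite /cov ExZ// mulrBr; under [X in k * X - _]eq_Ex do rewrite mulrCA.
    by rewrite ExZ// !mulrA divff ?gt_eqF// mul1r [k * _ / k]mulrAC divff ?gt_eqF// mul1r.
  by rewrite normrM ger0_norm// ler_wpM2l.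
apply: le_trans C1 _; rewrite /k -!mulrA ler_wpM2l// mulrCA; apply: ler_pM.
- exact: cg0.
- by rewrite mulr_ge0 ?powR_ge0.
- by apply: covC_le => //; rewrite addr_ge0.
- rewrite ler_wpM2r ?powR_ge0//; apply: ge0_ler_powR; rewrite ?nnegrE// mulr_ge0//.
Unshelve. all: exact: 0%N.
Qed.

(** Telescoping over whole shells up to L. The sites at distance L remain together, and there the
    bound on F^(q), of degree 0, suffices. *)
Lemma cov_shells (I : {set T}) K y s F : cls F -> (#|I| <= q.+1)%N ->
  0 <= K -> K <= Kn tm + K0 -> smeas I y -> dm K q.+1 y -> uniq s ->
  (forall u, u \in s -> (b0 < D I u)%N) ->
  `|cov y (fun w => F q (Wsum s w))| <=
    hh * covC Km (q.+1%:R + delta) * (\sum_(b0.+1 <= l < L) (nb * sh l) `^ delta * ald l) +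
    covq (Kn tm.+1 + 1) * alt L.
Proof.
move=> cF Iq k0 kK my dy us sD; have my' := smeas_meas mX my.
have Ey : integ y by apply: pd_integ (dm_pd my' dy); exact: le_deg.
have pg s' : pd 0 (fun w => F q (Wsum s' w)).
  split; first exact: meas_Fq.
  by exists K0, (fun=> 1), 1; split=> // w; rewrite expr0 mulr1 cls_bd.
have Eg s' : integ (fun w => F q (Wsum s' w)) by apply: pd_integ (pg s'); exact: le_deg.
have Eyg s' : integ (fun w => y w * F q (Wsum s' w)).
  by apply: pd_integ (pdM (dm_pd my' dy) (pg s')); rewrite addn0; exact: le_deg.
pose sl l := [seq u <- s | (l < D I u)%N].
have s0 : sl b0 = s by apply/all_filterP/allP.
have step l : (b0 < l <= L)%N -> `|cov y (fun w => F q (Wsum (sl l.-1) w))| <=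
    hh * covC Km (q.+1%:R + delta) * ((nb * sh l) `^ delta * ald l) +
    `|cov y (fun w => F q (Wsum (sl l) w))|.
  move=> lL; have l0 : (0 < l)%N by case/andP: lL; case: (l).
  pose s1 := [seq u <- s | D I u == l].
  have pm : perm_eq (s1 ++ sl l) (sl l.-1).
    apply/permP => a; rewrite count_cat !count_filter -count_predUI.
    rewrite [X in (_ + X)%N](_ : _ = 0%N) ?addn0; last first.
      rewrite -(count_pred0 s); apply: eq_count => u /=; apply/negbTE/negP.
      by move=> /andP[/andP[_ /eqP ->] /andP[_]]; rewrite ltnn.
    apply: eq_count => u /=; rewrite -andb_orr; congr (_ && _).
    rewrite (_ : (l.-1 < D I u)%N = (l <= D I u)%N); first by rewrite [in RHS]leq_eqVlt eq_sym.
    by rewrite -{2}(prednK l0).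
  have WE w : Wsum (sl l.-1) w = Wsum (s1 ++ sl l) w by rewrite /Wsum (perm_big _ pm).
  have h := @shell_cov I K y l s1 (sl l) F cF lL Iq k0 kK my dy.
  have sz : (size s1)%:R <= nb * sh l.
    apply: le_trans (shell_le Iq lL); rewrite ler_nat; apply: size_le_card; first exact: filter_uniq.
    by move=> u; rewrite mem_filter => /andP[].
  have {}h := h _ sz.
  have -> : cov y (fun w => F q (Wsum (sl l.-1) w)) =
     cov y (fun w => F q (Wsum (s1 ++ sl l) w) - F q (Wsum (sl l) w)) +
     cov y (fun w => F q (Wsum (sl l) w)).
    rewrite /cov; under [Ex (fun w => y w * (_ - _))]eq_Ex do rewrite mulrBr.
    rewrite !ExB//; under eq_Ex do rewrite WE.
    under [X in _ - _ * X = _]eq_Ex do rewrite WE.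
    ring.
  rewrite (le_trans (ler_normD _ _))// lerD2r; apply: h.
  move=> u; rewrite mem_cat !mem_filter => /orP[/andP[/eqP -> //]|/andP[/ltnW]//].
have main k : (b0 + k < L)%N -> `|cov y (fun w => F q (Wsum s w))| <=
    hh * covC Km (q.+1%:R + delta) * (\sum_(b0.+1 <= l < (b0 + k).+1) (nb * sh l) `^ delta * ald l) +
    `|cov y (fun w => F q (Wsum (sl (b0 + k)%N) w))|.
  elim: k => [|k IH] kL.
    by rewrite addn0 big_geq// mulr0 add0r s0.
  rewrite addnS in kL *; apply: le_trans (IH (ltnW kL)) _.
  rewrite [X in _ <= _ * X + _]big_nat_recr/=; last by rewrite ltnS leq_addr.
  rewrite [X in _ <= X + _]mulrDr -[leRHS]addrA lerD2l; have := step (b0 + k).+1; rewrite /=; apply.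
  by rewrite ltnS leq_addr ltnW.
have Lb : (b0 + (L.-1 - b0) = L.-1)%N by nlia b0L.
have Lp : (L.-1.+1 = L)%N by nlia b0L.
have := main (L.-1 - b0)%N; rewrite Lb Lp => H.
apply: le_trans (H _) _; first by nlia b0L.
rewrite lerD2l.
apply: (@cov_le tm.+1 1 L I [set v | (L <= D I v)%N] q.+1 0) => //.
- by rewrite b0L leqnn.
- by rewrite addn0.
- apply: dm_le dy; apply: le_trans kK _.
  by have [_ h _ _] := Kn_parts r q K00 tm.
- apply: smeas_comp; first exact: cls_meas.
  apply: smeas_Wsum => v; rewrite mem_filter inE => /andP[h _]; nlia h b0L.
- by move=> u; rewrite inE.
- by exists (fun=> 1); [exact: dom_one|move=> w; rewrite expr0 cls_bd].
Qed.

(** The term X^n / n! of the Taylor expansion is split off the remainder. With y the product of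
    [eta] and X^n, E y F^(q) is compared with E y times E F^(q)(W), an admissible term of the
    expansion; the covariance, the removed sites and the next remainder are the error. The new term
    is why q < Q is required. *)
Lemma refined_term om t xi e I eta j J u s n : (t < tm)%N -> om = 1 -> Gc om t xi e I ->
  etaok t b0 I eta j J -> u \notin s -> (b0 <= D I u)%N -> seqok t.+1 b0 I s ->
  (0 < n <= q)%N -> (e + j + n)%N = q.+1 ->
  Exp (fun F => Ex (fun w => xi w * eta w *
      tayrem (fun i => F (q - n + i)%N) n (Wsum s w) (X u w))) tau_ref.
Proof.
move=> tt -> [c [-> cM -> _]] ee us lu [uqs ls Ns] /andP[n0 nq] ejn.
rewrite mulr1 in cM.
have /andP[d0 d1] := delta01.
have [e1 e2 e3 e4] := ee.
have jn : (j + n <= q.+1)%N by nlia ejn.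
pose y w := eta w * X u w ^+ n; pose J' := u |: J.
have kt : Kn t <= Kn tm by apply: Kn_mono => //; exact: ltnW.
have k0 : 0 <= Kn t + K0 by rewrite addr_ge0 ?Kn_ge0.
have kK : Kn t + K0 <= Kn tm + K0 by rewrite lerD2r.
have [dy my J'j _] : etaok t.+1 b0 finset.set0 y (j + n) J' by exact: etaok_X lu n0 ee.
have {}dy : dm (Kn t + K0) (j + n) y by apply: dmM e1 (dm_Xn u n).
have my' := smeas_meas mX my.
have J'q : (#|J'| <= q.+1)%N by exact: leq_trans J'j jn.
have dyq := dm_up jn dy.
have Eyb : `|Ex y| <= mq2.
  apply: le_trans (dm_Ex k0 (le_deg jn) my' dy) _.
  apply: (@le_trans _ _ (momqS (Kn t + K0))); first by apply: mom_momq => //; exact: leqW.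
  by apply: momq_le => //; rewrite /Km (le_trans kK)// lerDl.
have mq0 : 0 <= mq2 by exact: le_trans Eyb.
pose near := [seq v <- s | (D J' v <= b0)%N]; pose far := [seq v <- s | (b0 < D J' v)%N].
have pnf : perm_eq (near ++ far) s.
  rewrite /far (eq_filter (a2 := predC (fun v => D J' v <= b0)%N)); last first.
    by move=> v /=; rewrite ltnNge.
  exact: (permEl (perm_filterC _ _)).
have ufar : uniq far by rewrite filter_uniq.
have WE w : Wsum s w = Wsum (near ++ far) w by rewrite /Wsum (perm_big _ pnf).
have bL : (b0 <= b0 <= L)%N by rewrite leqnn ltnW.
have snear : (size near)%:R <= nb * bl b0.
  apply: le_trans (ball_le J'q bL); rewrite ler_nat; apply: size_le_card.
    by rewrite filter_uniq.
  by move=> v; rewrite mem_filter => /andP[].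
pose rest := [seq v <- enum T | v \notin far].
have prf : perm_eq (rest ++ far) (enum T).
  have h := permEl (perm_filterC (fun v => v \notin far) (enum T)).
  apply: perm_trans h; rewrite perm_cat2l; apply: uniq_perm => //.
    by rewrite filter_uniq ?enum_uniq.
  by move=> v; rewrite mem_filter mem_enum andbT /= negbK.
have WT w : Wsum (enum T) w = Wsum (rest ++ far) w by rewrite /Wsum (perm_big _ prf).
have srest : (size rest)%:R <= kap tm.+1 * bl b0.
  have E := perm_size prf; rewrite size_cat -cardE in E.
  have E2 := perm_size pnf; rewrite size_cat in E2.
  move: Ns; rewrite -E -E2 !natrD => h.
  have : (size rest)%:R <= nb * bl b0 + kap t.+1 * bl b0 by lra.
  move/le_trans; apply; rewrite -mulrDl ler_wpM2r//.
  rewrite /kap -[X in X + _]mul1r -mulrDl ler_wpM2r// addrC natr1 ler_nat ltnS//.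
exists (fun b => (b == q)%:R * (c / n`!%:R * Ex y)) => F cF.
have l0 := cls_lam1 cF.
rewrite (bigD1 (Ordinal qQ1))//= eqxx mul1r big1 ?addr0; last first.
  by move=> i iq; rewrite (negbTE (_ : (i : nat) != q)) ?mul0r//.
have Ey : integ y by apply: pd_integ (dm_pd my' dy); exact: le_deg.
have Eyg s' : integ (fun w => y w * F q (Wsum s' w)).
  apply: pd_integ (pdM (dm_pd my' dy) (pd_F s' cF (leqnn q))); rewrite subnn addn0.
  exact: le_deg.
pose R2 w := tayrem (fun i => F (q - n + i)%N) n.+1 (Wsum s w) (X u w).
have R2E w : tayrem (fun i => F (q - n + i)%N) n (Wsum s w) (X u w) =
    X u w ^+ n / n`!%:R * F q (Wsum s w) + R2 w.
  by rewrite /R2 /tayrem big_ord_recr /= subnK//; ring.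
have mR2 : measurable_fun setT R2.
  apply: measurable_funB.
    apply: measurableT_comp; first by apply: cls_meask => //; nlia nq.
    by apply: measurable_funD => //; exact: meas_Wsum.
  apply: measurable_sum => a; apply: measurable_funM.
    by apply: measurable_funM => //; exact: measurable_funX.
  apply: measurableT_comp (meas_Wsum s); apply: cls_meask => //; have := ltn_ord a; nlia nq.
have jF : jet n.+1 (fun i => F (q - n + i)%N).
  have -> : n.+1 = (q.+1 - (q - n))%N by nlia nq.
  by apply: jet_shift; [nlia nq|exact: cls_jet1].
have bF z : `|F (q - n + n.+1)%N z| <= lam1 by rewrite addnS subnK//; exact: cls_bd1.
have [A dA hA] := domX u.
have bR2 w : `|R2 w| <= lam1 * A w ^+ n.+1.
  by apply: le_trans (tayrem_le _ _ jF bF) _; rewrite ler_wpM2l// lerXn2r ?nnegrE ?(dom_ge0 w dA).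
have dmA : dm K0 n.+1 (fun w => A w ^+ n.+1).
  by exists A => // w; rewrite ger0_norm// exprn_ge0// (dom_ge0 w dA).
have deA : dm (Kn t + K0) (j + n.+1) (fun w => `|eta w| * A w ^+ n.+1).
  by apply: dmM dmA; case: e1 => B dB hB; exists B => // w; rewrite normr_id.
have mA : measurable_fun setT A by case: dA.
have meA : measurable_fun setT (fun w => `|eta w| * A w ^+ n.+1).
  apply: measurable_funM; last exact: measurable_funX.
  by apply: measurableT_comp => //; exact: (smeas_meas mX e2).
have jn2 : (j + n.+1 <= q.+2)%N by nlia jn.
have IeA : integ (fun w => `|eta w| * A w ^+ n.+1).
  by apply: pd_integ (dm_pd meA deA); exact: le_deg2.
have beR w : `|eta w * R2 w| <= lam1 * (`|eta w| * A w ^+ n.+1).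
  by rewrite normrM mulrCA ler_wpM2l.
have IeR : integ (fun w => eta w * R2 w).
  apply: (integ_le _ beR (integZ _ IeA)); apply: measurable_funM => //.
  exact: (smeas_meas mX e2).
have T2 : `|Ex (fun w => eta w * R2 w)| <= lam1 * mq2.
  apply: le_trans (normr_Ex_le IeR (integZ _ IeA) beR) _.
  rewrite ExZ// ler_wpM2l//; apply: le_trans (ler_norm _) _.
  apply: le_trans (dm_Ex k0 (le_deg2 jn2) meA deA) _.
  apply: (@le_trans _ _ (momqS (Kn t + K0))); first exact: mom_momq.
  by apply: momq_le => //; rewrite /Km (le_trans kK)// lerDl.
have E1 : Ex (fun w => c * eta w * tayrem (fun i => F (q - n + i)%N) n (Wsum s w) (X u w)) =
    c / n`!%:R * Ex (fun w => y w * F q (Wsum s w)) + c * Ex (fun w => eta w * R2 w).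
  rewrite -!ExZ// -ExD; [|exact: integZ|exact: integZ].
  by apply: eq_Ex => w; rewrite R2E /y; ring.
have T1 : `|Ex (fun w => y w * F q (Wsum s w)) - Ex y * EW F q| <=
    lam1 * nb * mq2 * bl b0 + mq2 * (lam1 * kap tm.+1 * mq2 * bl b0) +
    (hh * covC Km (q.+1%:R + delta) * (\sum_(b0.+1 <= l < L) (nb * sh l) `^ delta * ald l) +
    covq (Kn tm.+1 + 1) * alt L).
  have Eg s' : integ (fun w => F q (Wsum s' w)).
    by apply: pd_integ (pd_F s' cF (leqnn q)); rewrite subnn; exact: le_deg.
  have -> : Ex (fun w => y w * F q (Wsum s w)) - Ex y * EW F q =
    Ex (fun w => y w * (F q (Wsum (near ++ far) w) - F q (Wsum far w))) -
    Ex y * Ex (fun w => 1 * (F q (Wsum (rest ++ far) w) - F q (Wsum far w))) +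
    cov y (fun w => F q (Wsum far w)).
    rewrite /cov /EW; under [Ex (fun w => y w * F q (Wsum s w))]eq_Ex do rewrite WE.
    under [Ex (fun w => F q (Wsum (enum T) w))]eq_Ex do rewrite WT.
    under [Ex (fun w => y w * (_ - _))]eq_Ex do rewrite mulrBr.
    under [Ex (fun w => 1 * (_ - _))]eq_Ex do rewrite mul1r.
    by rewrite !ExB//; ring.
  have dm1 : dm K0 0 (fun=> 1) by exists (fun=> 1) => // w; rewrite normr1 expr0.
  have h1 := lip_sum near far cF k0 kK jn my' dy.
  have h2 := lip_sum rest far cF K00 (ler_wpDl (Kn_ge0 r q K00 tm) (lexx K0)) (leq0n _)
    (measurable_cst _) dm1.
  have h3 := cov_shells cF J'q k0 kK my dyq ufar.
  apply: le_trans (ler_normD _ _) _; apply: lerD; last first.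
    by apply: h3 => v; rewrite mem_filter => /andP[].
  apply: le_trans (ler_normB _ _) _; apply: lerD.
    apply: le_trans h1 _; rewrite [leRHS](_ : _ = lam1 * (nb * bl b0) * mq2); last by ring.
    by rewrite ler_wpM2r// ler_wpM2l.
  rewrite normrM; apply: ler_pM => //; apply: le_trans h2 _.
  rewrite [leRHS](_ : _ = lam1 * (kap tm.+1 * bl b0) * mq2); last by ring.
  by rewrite ler_wpM2r// ler_wpM2l.
have fn : `|c / n`!%:R| <= Mn tm.
  rewrite normrM (@ger0_norm _ (_^-1)) ?invr_ge0//; apply: (@le_trans _ _ `|c|).
    by rewrite ler_piMr// invf_le1 ?ler1n ?fact_gt0// ltr0n fact_gt0.
  by apply: le_trans cM _; apply: Mn_mono => //; exact: ltnW.
have cM' : `|c| <= Mn tm by apply: le_trans cM _; apply: Mn_mono => //; exact: ltnW.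
rewrite E1 [X in `|X|](_ : _ = c / n`!%:R * (Ex (fun w => y w * F q (Wsum s w)) - Ex y * EW F q) +
  c * Ex (fun w => eta w * R2 w)); last by ring.
apply: le_trans (ler_normD _ _) _; rewrite !normrM in fn cM' *.
apply: (@le_trans _ _ (Mn tm * (lam1 * nb * mq2 * bl b0 + mq2 * (lam1 * kap tm.+1 * mq2 * bl b0) +
    (hh * covC Km (q.+1%:R + delta) * (\sum_(b0.+1 <= l < L) (nb * sh l) `^ delta * ald l) +
    covq (Kn tm.+1 + 1) * alt L)) + Mn tm * (lam1 * mq2 * bl b0))).
  apply: lerD.
    by apply: ler_pM => //; rewrite mulr_ge0.
  apply: ler_pM => //; apply: le_trans T2 _.
  by rewrite ler_peMr// mulr_ge0.
rewrite /tau_ref -mulrDr ler_wpM2l ?Mn_ge0// le_eqVlt; apply/orP; left; apply/eqP.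
by ring.
Qed.

Theorem expansion_refined :
  Exp (fun F => Ex (fun w => Wsum (enum T) w * F 0%N (Wsum (enum T) w)))
    (#|T|%:R * (CE q * Err q tau_ref b0)).
Proof.
have om : 0 <= (1 : R) <= 1 by rewrite ler01 lexx.
(* For an empty class the claim is vacuous; otherwise a member yields 0 <= [lam1]. *)
have [[F cF]|nF] := pselect (exists F, cls F); last first.
  by exists (fun=> 0) => F cF; exfalso; apply: nF; exists F.
have l0 := cls_lam1 cF; have /andP[d0 d1] := delta01.
have km0 : 0 <= Km by rewrite !addr_ge0 ?Kn_ge0.
have mq0 : 0 <= mq2 by exact: momq_ge0.
apply: W_expansion.
  by apply: Gok_Gc => // t xi e I eta j J u s n tt; exact: refined_term.
rewrite /tau_ref mulr_ge0 ?Mn_ge0// !addr_ge0// ?mulr_ge0 ?covC_ge0 ?covq_ge0 ?addr_ge0 ?Kn_ge0//.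
by apply: sumr_ge0 => i _; rewrite mulr_ge0 ?powR_ge0.
Qed.

End Recursion.

(** * Stein's equation *)

Section Gauss.
Context {R : realType}.
Implicit Types (f g h u : R -> R) (x c : R) (k : nat).
Local Notation mu := (@lebesgue_measure R).
Local Notation gam := (@std_normal R).

Definition gauss x := expR (- (x ^+ 2 / 2)).
Definition npk : R := normal_peak 1.

Lemma npk_gt0 : 0 < npk.
Proof. by apply: normal_peak_gt0; rewrite oner_eq0. Qed.

Lemma pdfE x : normal_pdf 0 1 x = npk * gauss x.
Proof.
rewrite normal_pdfE ?oner_eq0// /npk /gauss /normal_fun subr0 expr1n mulNr.
by rewrite mulr2n.
Qed.

Lemma gauss_gt0 x : 0 < gauss x. Proof. exact: expR_gt0. Qed.

Lemma gauss_der : der gauss (fun x => - x * gauss x).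
Proof.
apply: eq_der.
  apply: der_expR.
  rewrite (_ : (fun x => _) = (fun x => (- 2^-1) * (id x) ^+ 2)); last first.
    by apply/funext => x /=; rewrite mulNr mulrC.
  exact: derZ (derX 2 der_id).
by move=> x /=; rewrite /gauss; congr (_ * expR _); field.
Qed.

Lemma gauss_meas : measurable_fun setT gauss. Proof. exact: der_meas gauss_der. Qed.

(** The rate 3/8 = 1/2 - 1/8 leaves exp(-x^2/8) of the Gaussian factor, the kernel of a normal
    density of standard deviation 2; this density serves as integrable majorant. *)
Lemma pow_expR_le k : exists C, 0 <= C /\ forall x, (1 + `|x|) ^+ k <= C * expR (3 / 8 * x ^+ 2).
Proof.
exists (k.+1%:R ^+ k * expR 2); split; first by rewrite mulr_ge0// ?expR_ge0 ?exprn_ge0.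
move=> x; set y := 1 + `|x|; have y0 : 0 <= y by rewrite addr_ge0.
have k0 : 0 < k.+1%:R :> R by rewrite ltr0n.
have h1 : y ^+ k <= k.+1%:R ^+ k * expR y.
  rewrite -[X in X ^+ _](divfK (lt0r_neq0 k0)) exprMn mulrC ler_wpM2l ?exprn_ge0//.
  apply: (@le_trans _ _ (expR (y / k.+1%:R) ^+ k)).
    rewrite lerXn2r ?nnegrE ?divr_ge0 ?expR_ge0//.
    by rewrite (le_trans _ (expR_ge1Dx _))// lerDr.
  rewrite -expRM_natl ler_expR mulrCA ler_piMr// ler_pdivrMr// mul1r ler_nat //.
apply: le_trans h1 _; rewrite -(mulrA _ (expR 2)) -expRD ler_wpM2l ?exprn_ge0//.
rewrite ler_expR /y -(real_normK (num_real x)).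
have := sqr_ge0 (`|x| - 2); set z := `|x|; rewrite sqrrB => h.
have z0 : 0 <= z by rewrite /z.
nra.
Qed.

Lemma pow_gauss_le k : exists C, 0 <= C /\
  forall x, (1 + `|x|) ^+ k * gauss x <= C * expR (- (x ^+ 2 / 8)).
Proof.
have [C [C0 h]] := pow_expR_le k; exists C; split=> // x.
apply: le_trans (ler_wpM2r (ltW (gauss_gt0 x)) (h x)) _.
by rewrite -(mulrA C) /gauss -expRD ler_wpM2l// ler_expR; lra.
Qed.

Definition vanish (G : R -> R) :=
  forall e, 0 < e -> exists M, forall x, M <= `|x| -> `|G x| <= e.

Lemma gauss_vanish u c k : (forall x, `|u x| <= c * (1 + `|x|) ^+ k) ->
  vanish (fun x => u x * gauss x).
Proof.
move=> hu e e0; have [C [C0 hC]] := pow_gauss_le k.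
have c0 : 0 <= c by have := le_trans (normr_ge0 _) (hu 0); rewrite normr0 addr0 expr1n mulr1.
exists (1 + 8 * (c * C) / e) => x hx.
have cC0 : 0 <= c * C by rewrite mulr_ge0.
have d0 : 0 <= 8 * (c * C) / e by rewrite divr_ge0 ?(ltW e0)// mulr_ge0.
have x1 : 1 <= `|x| by apply: le_trans hx; rewrite lerDl.
rewrite normrM (ger0_norm (ltW (gauss_gt0 x))).
apply: le_trans (ler_wpM2r (ltW (gauss_gt0 x)) (hu x)) _.
rewrite -mulrA; apply: le_trans (ler_wpM2l c0 (hC x)) _; rewrite mulrA.
have x2 : 0 < x ^+ 2 by rewrite -(real_normK (num_real x)) exprn_gt0// (lt_le_trans _ x1).
rewrite expRN ler_pdivrMr ?expR_gt0//.
apply: (@le_trans _ _ (e * (x ^+ 2 / 8))); last first.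
  by rewrite ler_pM2l// (le_trans _ (expR_ge1Dx _))// lerDr.
rewrite mulrA ler_pdivlMr// -ler_pdivrMl// mulrC [c * C * 8]mulrC.
apply: (@le_trans _ _ `|x|); first by apply: le_trans hx; rewrite lerDr.
by rewrite -(real_normK (num_real x)) expr2 ler_peMr.
Qed.

(** [std_normal] and [normal_prob] live on lines with different displays, which a pushforward by the
    identity bridges. The Radon-Nikodym derivative is then identified almost everywhere with the
    density. *)
Lemma gint_ge0 (f : R -> \bar R) : measurable_fun setT f -> (forall x, (0 <= f x)%E) ->
  (\int[gam]_x f x = \int[mu]_x (f x * (npk * gauss x)%:E))%E.
Proof.
move=> mf f0.
have dom : normal_prob 0 1 `<< mu := normal_prob_dominates 0 1.
have mid : measurable_fun setT (id : measurableTypeR R -> R) by [].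
transitivity (\int[normal_prob 0 1]_x f x)%E.
  rewrite (eq_measure_integral (pushforward (normal_prob 0 1) (id : measurableTypeR R -> R))).
    by rewrite (ge0_integral_pushforward mid).
  by move=> A mA _; rewrite /pushforward.
rewrite -(Radon_Nikodym_SigmaFinite.change_of_variables dom f0 measurableT mf).
have If := Radon_Nikodym_SigmaFinite.f_integrable dom.
have mp : measurable_fun setT (fun x => (npk * gauss x)%:E).
  by apply/measurable_EFinP; apply: measurable_funM => //; exact: gauss_meas.
apply: ae_eq_integral => //.
- by apply: emeasurable_funM => //; exact: measurable_int If.
- exact: emeasurable_funM.
apply: ae_eqe_mul2l; apply: integral_ae_eq => // E _ mE.
rewrite -(Radon_Nikodym_SigmaFinite.f_integral dom mE) /normal_prob.
by apply: eq_integral => x _; rewrite pdfE.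
Qed.

Lemma gintE f : measurable_fun setT f ->
  (\int[gam]_x (f x)%:E = \int[mu]_x (f x * (npk * gauss x))%:E)%E.
Proof.
move=> mf; rewrite integralE [RHS]integralE.
have mf' : measurable_fun setT (EFin \o f) by exact/measurable_EFinP.
have p0 x : 0 <= npk * gauss x by rewrite mulr_ge0 ?ltW ?npk_gt0 ?gauss_gt0.
congr (_ - _)%E; rewrite gint_ge0//.
- apply: eq_integral => x _; rewrite !funeposE /= -!EFin_max -EFinM.
  by rewrite maxr_pMl// mul0r.
- exact: measurable_funepos.
- apply: eq_integral => x _; rewrite !funenegE /= -!EFin_max -EFinM.
  by rewrite -mulNr maxr_pMl// mul0r.
- exact: measurable_funeneg.
Qed.

Lemma integ_gauss f c k : measurable_fun setT f ->
  (forall x, `|f x| <= c * (1 + `|x|) ^+ k) -> integ gam f.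
Proof.
move=> mf hf; have [C [C0 hC]] := pow_gauss_le k.
have c0 : 0 <= c by have := le_trans (normr_ge0 _) (hf 0); rewrite normr0 addr0 expr1n mulr1.
apply/integrableP; split; first exact/measurable_EFinP.
rewrite gint_ge0//=; last first.
  by apply/measurable_EFinP; exact: (measurableT_comp _ mf).
have s2 : 2 != 0 :> R by rewrite pnatr_eq0.
have np2 : 0 < normal_peak 2 :> R := normal_peak_gt0 s2.
apply: (@le_lt_trans _ _ (\int[mu]_x ((c * C * npk / normal_peak 2)%:E * (normal_pdf 0 2 x)%:E))%E).
  apply: ge0_le_integral => //.
  - by move=> x _; rewrite -EFinM lee_fin !mulr_ge0// ?(ltW npk_gt0)// ltW ?gauss_gt0.
  - apply: emeasurable_funM; first by apply/measurable_EFinP; exact: (measurableT_comp _ mf).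
    by apply/measurable_EFinP; apply: measurable_funM => //; exact: gauss_meas.
  - by apply: emeasurable_funM => //; apply/measurable_EFinP; exact: measurable_normal_pdf.
  move=> x _; rewrite -!EFinM lee_fin normal_pdfE// /normal_fun subr0.
  rewrite [leRHS]mulrA divfK ?gt_eqF//.
  rewrite (_ : - x ^+ 2 / _ = - (x ^+ 2 / 8)); last by rewrite -mulr_natr; field.
  rewrite mulrCA [c * C * npk]mulrC -[leRHS]mulrA ler_wpM2l ?(ltW npk_gt0)//.
  apply: le_trans (ler_wpM2r (ltW (gauss_gt0 x)) (hf x)) _.
  by rewrite -(mulrA c) -(mulrA c) ler_wpM2l.
rewrite integralZl//; last exact: integrable_normal_pdf.
by rewrite integral_normal_pdf mule1 ltry.
Qed.

Lemma integ_mu f c k : measurable_fun setT f ->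
  (forall x, `|f x| <= c * (1 + `|x|) ^+ k * gauss x) -> mu.-integrable setT (EFin \o f).
Proof.
move=> mf hf; apply/integrableP; split; first exact/measurable_EFinP.
have c0 : 0 <= c.
  have := le_trans (normr_ge0 _) (hf 0); rewrite normr0 addr0 expr1n mulr1.
  by rewrite pmulr_lge0 ?gauss_gt0.
pose g x := npk^-1 * (c * (1 + `|x|) ^+ k).
have mg : measurable_fun setT g.
  apply: measurable_funM => //; apply: measurable_funM => //; apply: measurable_funX.
  by apply: measurable_funD => //; exact: measurableT_comp.
have /integrableP[_] : integ gam g.
  apply: (@integ_gauss _ (npk^-1 * c) k) => // x.
  by rewrite /g mulrA ger0_norm// !mulr_ge0 ?invr_ge0 ?(ltW npk_gt0)// exprn_ge0// addr_ge0.
rewrite gint_ge0//=; last by apply/measurable_EFinP; exact: (measurableT_comp _ mg).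
apply: le_lt_trans; apply: ge0_le_integral => //.
- by apply/measurable_EFinP; exact: (measurableT_comp _ mf).
- apply: emeasurable_funM; first by apply/measurable_EFinP; exact: (measurableT_comp _ mg).
  by apply/measurable_EFinP; apply: measurable_funM => //; exact: gauss_meas.
move=> x _; rewrite -EFinM lee_fin (ger0_norm (x := g x)); last first.
  by rewrite /g !mulr_ge0 ?invr_ge0 ?(ltW npk_gt0)// exprn_ge0// addr_ge0.
apply: le_trans (hf x) _; by rewrite /g mulrCA !mulrA mulfV ?gt_eqF ?npk_gt0// mul1r.
Qed.

Lemma Ex_gaussE f c k : measurable_fun setT f -> (forall x, `|f x| <= c * (1 + `|x|) ^+ k) ->
  Ex gam f = npk * \int[mu]_x (f x * gauss x).
Proof.
move=> mf hf; rewrite /Ex /Rintegral gintE//.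
have If : mu.-integrable setT (EFin \o (fun x => f x * gauss x)).
  apply: (@integ_mu _ c k); first by apply: measurable_funM => //; exact: gauss_meas.
  by move=> x; rewrite normrM (ger0_norm (ltW (gauss_gt0 x))) ler_wpM2r ?(ltW (gauss_gt0 x)).
rewrite -/(Rintegral mu setT (fun x => f x * gauss x)) -(RintegralZl npk measurableT If) /Rintegral.
by congr fine; apply: eq_integral => x _ /=; rewrite mulrCA.
Qed.

(** Markov's inequality, since 1 <= |x| / M on A. *)
Lemma tail_int g c k (A : set (measurableTypeR R)) (M : R) : measurable_fun setT g ->
  (forall x, `|g x| <= c * (1 + `|x|) ^+ k * gauss x) ->
  measurable A -> 0 < M -> (forall x, A x -> M <= `|x|) ->
  `|\int[mu]_(x in A) g x| <= (\int[mu]_x (`|x| * `|g x|)) / M.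
Proof.
move=> mg hg mA M0 hA.
have Ig := integ_mu mg hg.
have c0 : 0 <= c.
  have := le_trans (normr_ge0 _) (hg 0); rewrite normr0 addr0 expr1n mulr1.
  by rewrite pmulr_lge0 ?gauss_gt0.
have mh : measurable_fun setT (fun x => `|x| * `|g x|).
  by apply: measurable_funM; [exact: normr_measurable|exact: (measurableT_comp (@normr_measurable R setT) mg)].
have Ih : mu.-integrable setT (EFin \o (fun x => `|x| * `|g x|)).
  apply: (@integ_mu _ c k.+1) => // x; rewrite ger0_norm ?mulr_ge0// exprS.
  rewrite mulrCA -mulrA ler_pM// lerDr//.
have IgA := integrableS measurableT mA (@subsetT _ A) Ig.
apply: (le_trans (le_normr_Rintegral mA IgA)).
rewrite ler_pdivlMr// mulrC -RintegralZl//; last exact: integrable_norm.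
rewrite Rintegral_mkcond; apply: le_Rintegral => //.
  apply: (@le_integrable _ _ _ mu setT measurableT _ (EFin \o (fun x => `|x| * `|g x|))) => //.
    apply/measurable_EFinP; apply: (measurable_restrictT _ _).1 => //.
    apply: measurable_funS (subsetT _) _ => //; apply: measurable_funM => //.
    exact: (measurableT_comp (@normr_measurable R setT) mg).
  move=> x _ /=; rewrite lee_fin patchE; case: ifPn => [|_]; last by rewrite normr0.
  rewrite inE => Ax; rewrite !normrM !normr_id ler_wpM2r// (gtr0_norm M0).
  exact: hA.
move=> x _; rewrite patchE; case: ifPn => [|_]; last by rewrite mulr_ge0.
by rewrite inE => Ax; rewrite ler_wpM2r// hA.
Qed.

(** F is the integral of g up to x. Both tails beyond M are at most I / M, with I the first absolute
    moment of g. *)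
Lemma primitive g c k : continuous g ->
  (forall x, `|g x| <= c * (1 + `|x|) ^+ k * gauss x) ->
  exists F, [/\ der F g,
    (forall e : R, 0 < e -> exists M, forall x, x <= - M -> `|F x| <= e) &
    (forall e : R, 0 < e -> exists M, forall x, M <= x -> `|F x - \int[mu]_t g t| <= e)].
Proof.
move=> cg hg; have mg : measurable_fun setT g := continuous_measurable_fun cg.
have Ig := integ_mu mg hg.
have IS (i : interval R) : mu.-integrable [set` i] (EFin \o g).
  by apply: integrableS (subsetT _) Ig => //; exact: measurable_itv.
pose F (w : R) := \int[mu]_(t in [set` `]-oo, w]]) g t.
pose I := \int[mu]_x (`|x| * `|g x|).
have I0 : 0 <= I by apply: Rintegral_ge0 => x _; rewrite mulr_ge0.
have Mh (e : R) : 0 < e -> let M := 1 + I / e in 0 < M /\ I / M <= e.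
  move=> e0 M; have M0 : 0 < M by rewrite ltr_pwDl// divr_ge0// ltW.
  split=> //; rewrite ler_pdivrMr// /M mulrDr mulr1 mulrCA mulfV ?gt_eqF// mulr1.
  by rewrite lerDr ltW.
exists F; split.
- move=> x; have xx : x < x + 1 by rewrite ltrDl.
  have [||dF <-] := @continuous_FTC1 R g -oo%O x (x + 1) xx (IS _).
  + by rewrite ltNyr.
  + exact: cg.
  by rewrite derive1E; exact/derivableP.
- move=> e e0; have [M0 hM] := Mh e e0; exists (1 + I / e) => x xM.
  apply: le_trans hM; apply: tail_int hg _ M0 _ => //.
  move=> y /=; rewrite in_itv/= => yx; rewrite ler_normr; apply/orP; right.
  by rewrite lerNr (le_trans yx).
- move=> e e0; have [M0 hM] := Mh e e0; exists (1 + I / e) => x xM.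
  apply: le_trans hM.
  have -> : F x - \int[mu]_t g t = - \int[mu]_(t in [set` `]x, +oo[]) g t.
    rewrite -(@Rintegral_itvB R g -oo%O +oo%O x (IS _)) ?leNye ?leey//.
    by rewrite opprB /F set_itvNyy.
  rewrite normrN; apply: tail_int hg _ M0 _ => //.
  move=> y /=; rewrite in_itv/= andbT => yx; rewrite ler_normr; apply/orP; left.
  by rewrite (le_trans xM)// ltW.
Qed.

(** The derivative of u e^(-x^2/2) is (u' - x u) e^(-x^2/2). Its primitive F differs from u
    e^(-x^2/2) by a constant, and the latter vanishes at both ends. *)
Lemma gauss_ibp u u' c k : der u u' -> continuous u' ->
  (forall x, `|u x| <= c * (1 + `|x|) ^+ k) -> (forall x, `|u' x| <= c * (1 + `|x|) ^+ k) ->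
  Ex gam u' = Ex gam (fun x => x * u x).
Proof.
move=> du cu' hu hu'; have cu := der_cont du.
have mu1 := der_meas du; have mu2 : measurable_fun setT u' := continuous_measurable_fun cu'.
have c0 : 0 <= c by have := le_trans (normr_ge0 _) (hu 0); rewrite normr0 addr0 expr1n mulr1.
pose v x := u' x - x * u x.
have hv x : `|v x| <= (c + c) * (1 + `|x|) ^+ k.+1.
  rewrite /v (le_trans (ler_normB _ _))// mulrDl exprS mulrCA lerD//.
    apply: le_trans (hu' x) _; rewrite mulrCA ler_wpM2l// ler_peMl ?exprn_ge0 ?addr_ge0//.
    by rewrite lerDl.
  by rewrite normrM ler_pM// lerDr.
have cv : continuous v.
  move=> x; apply: cvgB; first exact: cu'.
  by apply: cvgM; [exact: cvg_id|exact: cu].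
have mv : measurable_fun setT v := continuous_measurable_fun cv.
have hxu x : `|x * u x| <= c * (1 + `|x|) ^+ k.+1.
  by rewrite exprS mulrCA normrM ler_pM// lerDr.
have mxu : measurable_fun setT (fun x => x * u x) by exact: measurable_funM.
apply/eqP; rewrite -subr_eq0 -ExB; first last.
- exact: integ_gauss hxu.
- exact: integ_gauss hu'.
rewrite -/(v _) (Ex_gaussE mv hv).
have [F [dF F1 F2]] : exists F, [/\ der F (fun x => v x * gauss x),
    (forall e : R, 0 < e -> exists M, forall x, x <= - M -> `|F x| <= e) &
    (forall e : R, 0 < e -> exists M, forall x, M <= x -> `|F x - \int[mu]_t (v t * gauss t)| <= e)].
  apply: (@primitive _ (c + c) k.+1).
    by move=> x; apply: cvgM; [exact: cv|exact: der_cont gauss_der x].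
  by move=> x; rewrite normrM (ger0_norm (ltW (gauss_gt0 x))) ler_wpM2r ?(ltW (gauss_gt0 x)).
have dG : der (fun x => u x * gauss x) (fun x => v x * gauss x).
  by apply: eq_der (derM du gauss_der) _ => x; rewrite /v; ring.
have V := gauss_vanish hu.
have D x y : F x - u x * gauss x = F y - u y * gauss y.
  apply: (@der0_cst _ (fun x => F x - u x * gauss x)).
  by apply: eq_der (derB dF dG) _ => z; rewrite subrr.
rewrite mulf_eq0; apply/orP; right; rewrite -normr_le0; apply/ler_addgt0Pl => e e0; rewrite addr0.
have e4 : 0 < e / 4 by rewrite divr_gt0.
have [M1 h1] := F1 _ e4. have [M2 h2] := F2 _ e4. have [M3 h3] := V _ e4.
pose M := `|M1| + `|M2| + `|M3|.
have n1 := normr_ge0 M1. have n2 := normr_ge0 M2. have n3 := normr_ge0 M3.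
have l1 := ler_norm M1. have l2 := ler_norm M2. have l3 := ler_norm M3.
have M0 : 0 <= M by rewrite /M !addr_ge0.
have := h1 (- M); rewrite lerN2 => /(_ _) a1; have {a1} a1 := a1 ltac:(rewrite /M; lra).
have := h2 M => /(_ _) a2; have {a2} a2 := a2 ltac:(rewrite /M; lra).
have := h3 M; rewrite (ger0_norm M0) => /(_ _) a3; have {a3} a3 := a3 ltac:(rewrite /M; lra).
have := h3 (- M); rewrite normrN (ger0_norm M0) => /(_ _) a4; have {a4} a4 := a4 ltac:(rewrite /M; lra).
have := D M (- M); move: a1 a2 a3 a4; rewrite !ler_norml.
set I := Rintegral _ _ _.
move: (F M) (F (-M)) (_ * gauss M) (_ * gauss (- M)) => A B C E; lra.
Qed.

Lemma derN u u' : der u u' -> der (fun x => - u x) (fun x => - u' x).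
Proof. by move=> du x; exact: is_deriveN. Qed.

(* u e^(-x^2/2) - (V/w) e^(-x^2/2) is monotone on [w, +oo[ and vanishes at infinity. *)
Lemma barrier_half u v V w : der u (fun x => x * u x + v x) -> (forall x, `|v x| <= V) ->
  vanish (fun x => u x * gauss x) -> 0 < w -> w * u w <= V.
Proof.
move=> du hv hu w0; have V0 : 0 <= V := le_trans (normr_ge0 _) (hv 0).
pose H x := u x * gauss x - V / w * gauss x.
have dH : der H (fun x => (v x + V / w * x) * gauss x).
  apply: eq_der (derB (derM du gauss_der) (derZ (V / w) gauss_der)) _ => x; ring.
suff : H w <= 0.
  rewrite /H -mulrBl pmulr_lle0 ?gauss_gt0// subr_le0 ler_pdivlMr//.
  by rewrite mulrC.
have V1 : vanish (fun x => V / w * gauss x).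
  by apply: (@gauss_vanish (fun=> V / w) `|V / w| 0) => x; rewrite expr0 mulr1.
apply/ler_addgt0Pl => e e0; rewrite addr0.
have e2 : 0 < e / 2 by rewrite divr_gt0.
have [M1 h1] := hu _ e2. have [M2 h2] := V1 _ e2.
pose X := w + `|M1| + `|M2|.
have n1 := normr_ge0 M1. have n2 := normr_ge0 M2.
have l1 := ler_norm M1. have l2 := ler_norm M2.
have X0 : 0 <= X by rewrite /X; lra.
have := h1 X; rewrite (ger0_norm X0) => /(_ _) a1; have {a1} a1 := a1 ltac:(rewrite /X; lra).
have := h2 X; rewrite (ger0_norm X0) => /(_ _) a2; have {a2} a2 := a2 ltac:(rewrite /X; lra).
apply: (@le_trans _ _ (H X)); last first.
  move: a1 a2; rewrite /H !ler_norml; move: (u X * _) (V / w * _) => A B; lra.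
apply: der_le dH _ _; first by rewrite /X; lra.
move=> x /andP[wx _]; rewrite mulr_ge0 ?(ltW (gauss_gt0 _))//.
have := hv x; rewrite ler_norml => /andP[h _].
have : V <= V / w * x by rewrite mulrAC ler_pdivlMr// ler_wpM2l.
lra.
Qed.

Lemma barrier u v V x : der u (fun x => x * u x + v x) -> (forall x, `|v x| <= V) ->
  vanish (fun x => u x * gauss x) -> `|x * u x| <= V /\ `|u x| <= 5 * V.
Proof.
move=> du hv hu; have V0 : 0 <= V := le_trans (normr_ge0 _) (hv 0).
have key u' v' : der u' (fun x => x * u' x + v' x) -> (forall x, `|v' x| <= V) ->
    vanish (fun x => u' x * gauss x) -> forall w, 0 < w -> `|w * u' w| <= V.
  move=> du' hv' hu' w w0; rewrite ler_norml (barrier_half du' hv' hu' w0) andbT.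
  rewrite lerNl -mulrN; apply: (@barrier_half (fun x => - u' x) (fun x => - v' x)) => //.
  - by apply: eq_der (derN du') _ => y; ring.
  - by move=> y; rewrite normrN.
  - by move=> e e0; have [M h] := hu' e e0; exists M => y yM; rewrite mulNr normrN h.
have xu y : `|y * u y| <= V.
  have [y0|y0|<-] := ltgtP (0 : R) y; [exact: key du hv hu _ y0| |by rewrite mul0r normr0].
  have := @key (fun x => u (- x)) (fun x => - v (- x)) _ _ _ (- y).
  rewrite opprK mulNr normrN; apply; rewrite ?oppr_gt0//.
  - by apply: eq_der (der_comp du (derN der_id)) _ => z /=; ring.
  - by move=> z; rewrite normrN.
  - move=> e e0; have [M h] := hu e e0; exists M => z zM.
    by have := h (- z); rewrite normrN /gauss sqrrN; apply.
split=> //; have [x1|x1] := leP 1 `|x|.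
  apply: (@le_trans _ _ (`|x| * `|u x|)); first by rewrite ler_peMl.
  by rewrite -normrM (le_trans (xu x))// ler_peMl// ler1n.
(* For |x| < 1 the value at x is compared with that at 1: the slope is at most 2 V and the distance
   at most 2, whence 5 = 1 + 2 * 2. *)
have [|c cc] := @der_MVT _ _ _ x 1 du; first by rewrite ltW// (le_lt_trans (ler_norm _)).
move=> E; have -> : u x = u 1 - (c * u c + v c) * (1 - x) by rewrite -E; ring.
have u1 : `|u 1| <= V by have := xu 1; rewrite mul1r.
have b1 : `|c * u c + v c| <= 2 * V.
  by rewrite (le_trans (ler_normD _ _))// mulrDl !mul1r lerD.
have b2 : `|1 - x| <= 2 by move: x1; rewrite ltr_norml ler_norml; lra.
apply: (le_trans (ler_normB _ _)); rewrite normrM.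
have := ler_pM (normr_ge0 _) (normr_ge0 _) b1 b2.
lra.
Qed.

(* u - n x^2 attains its maximum since u is bounded; n then tends to 0. *)
Lemma maxprinciple u u1 u2 h (q B H : R) : der u u1 -> der u1 u2 -> (forall x, `|u x| <= B) ->
  (forall x, u2 x = x * u1 x + q * u x + h x) -> (forall x, `|h x| <= H) -> 0 < q ->
  forall x, u x <= H / q.
Proof.
move=> d1 d2 hB eq2 hH q0.
have H0 : 0 <= H := le_trans (normr_ge0 _) (hH 0).
suff key n x : 0 < n -> u x - n * x ^+ 2 <= (2 * n + H) / q.
  move=> x; apply/ler_addgt0Pl => e e0.
  (* This n makes n x^2 + 2 n / q equal to e. *)
  pose n := e / (x ^+ 2 + 2 / q).
  have D0 : 0 < x ^+ 2 + 2 / q by rewrite ltr_wpDl ?sqr_ge0// divr_gt0.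
  have n0 : 0 < n by rewrite divr_gt0.
  have := key n x n0; rewrite mulrDl lerBlDr => /le_trans; apply.
  have : n * (x ^+ 2 + 2 / q) = e by rewrite /n divfK ?gt_eqF.
  move: (H / q) (x ^+ 2) => A X; rewrite mulrDr mulrA (mulrC 2 n) => <-; lra.
move=> n0; pose psi y := u y - n * y ^+ 2; pose psi1 y := u1 y - n * (2 * y).
have dp : der psi psi1.
  by apply: eq_der (derB d1 (derZ n (derX 2 der_id))) _ => y; rewrite /psi1 mulr1 expr1.
rewrite leNgt; apply/negP => bad.
set m := (2 * n + H) / q in bad.
have B0 : 0 <= B := le_trans (normr_ge0 _) (hB 0).
(* Outside [-A, A] the quadratic term brings psi below its value at x, so the maximum over the
   interval is global. *)
pose A := 1 + `|x| + (B + `|psi x|) / n.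
have A0 : 0 <= (B + `|psi x|) / n by rewrite divr_ge0 ?addr_ge0// ltW.
have x0 := normr_ge0 x.
have AA : - A <= A by rewrite /A; lra.
have [c cA cm] := @EVT_max R psi (- A) A AA (continuous_subspaceT (der_cont dp)).
have xA : x \in `[- A, A].
  by rewrite in_itv/= -ler_norml /A; lra.
have gm y : psi y <= psi c.
  have [yA|yA] := boolP (y \in `[- A, A]); first exact: cm.
  apply: le_trans (cm _ xA).
  have Ay : A < `|y| by rewrite ltNge ler_norml; move: yA; rewrite in_itv.
  have h1 : B + `|psi x| <= n * A.
    by rewrite /A mulrDr mulrCA mulfV ?gt_eqF// mulr1 lerDr mulr_ge0// ?(ltW n0)//; lra.
  have h2 : n * A <= n * y ^+ 2.
    rewrite ler_pM2l// -(real_normK (num_real y)) (le_trans (ltW Ay))// expr2 ler_peMr//.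
    by apply: le_trans (ltW Ay); rewrite /A; lra.
  have := hB y; rewrite ler_norml => /andP[_ h3].
  have := ler_norm (- psi x); rewrite normrN /psi => h4.
  move: h1 h2 h3 h4; rewrite /psi; lra.
have uc : m < u c.
  apply: (lt_le_trans bad); apply: le_trans (gm x) _.
  by rewrite /psi lerBlDr lerDl mulr_ge0 ?sqr_ge0// ltW.
have p1c : psi1 c = 0.
  have hc : c \in `]c - 1, c + 1[ by rewrite in_itv/=; apply/andP; split; lra.
  have cc : c - 1 <= c + 1 by lra.
  have h0 := @derive1_at_max R psi (c - 1) (c + 1) c cc (fun t _ => @ex_derive _ _ _ _ _ _ _ (dp t)) hc (fun t _ => gm t).
  by rewrite -(@derive_val _ _ _ _ _ _ _ (dp c)) (@derive_val _ _ _ _ _ _ _ h0).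
have [d d0 hd] : exists2 d, 0 < d & forall y, c <= y <= c + d -> m < u y.
  have : \forall y \near c, m < u y.
    have uc' : u y @[y --> c] --> u c by apply: (der_cont d1).
    exact: (cvgr_gt (u c) uc' m uc).
  move=> /nbhs_ballP[r /= r0 hr]; exists (r / 2); first by rewrite divr_gt0.
  move=> y /andP[cy yc]; apply: hr; rewrite /ball /= ler0_norm ?subr_le0//.
  by lra.
(* The Gaussian factor removes the drift term of the equation. To the right of c the derivative of
   [ka] is positive as long as u > m, so psi would increase past its maximum. *)
pose ka y := psi1 y * gauss y.
have dk : der ka (fun y => (q * u y + h y - 2 * n + 2 * n * y ^+ 2) * gauss y).
  apply: eq_der (derM (derB d2 (derZ n (derZ 2 der_id))) gauss_der) _ => y.
  rewrite eq2 /psi1; ring.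
have ka0 y : c < y -> y <= c + d -> 0 < psi1 y.
  move=> cy yd; rewrite -(pmulr_lgt0 _ (gauss_gt0 y)) -/(ka y).
  have [z /andP[cz zy] E] := der_MVT dk (ltW cy).
  have kc : ka c = 0 by rewrite /ka p1c mul0r.
  have -> : ka y = ka y - ka c by rewrite kc subr0.
  rewrite E mulr_gt0 ?subr_gt0// mulr_gt0 ?gauss_gt0//.
  have h1 : m < u z by apply: hd; rewrite cz (le_trans zy).
  have := hH z; rewrite ler_norml => /andP[h2 _].
  have h3 : 2 * n + H < q * u z by rewrite (mulrC q) -ltr_pdivrMr.
  have : 0 <= 2 * n * z ^+ 2 by rewrite mulr_ge0 ?sqr_ge0// mulr_ge0// ltW.
  lra.
have a1 : psi c <= psi (c + d / 2).
  apply: der_le dp _ _; first lra.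
  move=> y /andP[]; rewrite le_eqVlt => /orP[/eqP <- _|cy yd]; first by rewrite p1c.
  by rewrite ltW// ka0//; lra.
have [z /andP[z1 z2] E] : exists2 z, c + d / 2 <= z <= c + d & psi (c + d) - psi (c + d / 2) = psi1 z * (c + d - (c + d / 2)).
  by apply: der_MVT dp _; lra.
have : 0 < psi1 z * (c + d - (c + d / 2)).
  by rewrite mulr_gt0 ?ka0//; lra.
by rewrite -E; have := gm (c + d); lra.
Qed.

(* The derivatives of the solution f0 of Stein's equation f' = x f + h - e, obtained by
   differentiating the equation: f^(n+1) = x f^(n) + n f^(n-1) + h^(n). *)
Fixpoint stein (f0 : R -> R) (h : nat -> R -> R) (e : R) n x : R :=
  match n with
  | 0 => f0 x
  | n1.+1 => match n1 with
    | 0 => x * f0 x + h 0%N x - e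
    | n2.+1 => x * stein f0 h e n1 x + n1%:R * stein f0 h e n2 x + h n1 x
    end
  end.

Lemma steinSS f0 (h : nat -> R -> R) e n x : stein f0 h e n.+2 x =
  x * stein f0 h e n.+1 x + n.+1%:R * stein f0 h e n x + h n.+1 x.
Proof. by []. Qed.

Lemma stein_der f0 (h : nat -> R -> R) e q : jet q h -> der f0 (stein f0 h e 1) ->
  jet q.+1 (stein f0 h e).
Proof.
move=> jh d0; elim/ltn_ind=> -[|k] IH kq //.
apply: (eq_der (g := fun x => (1 * stein f0 h e k x + x * stein f0 h e k.+1 x) +
    k%:R * stein f0 h e k x + h k.+1 x)); last first.
  by move=> x; rewrite steinSS -natr1; ring.
have dk : der (stein f0 h e k) (stein f0 h e k.+1) by apply: IH => //; exact: ltnW.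
have dh := jh k kq.
case: k IH kq dk dh => [|k] IH kq dk dh.
  apply: (eq_der (g := fun x => 1 * f0 x + x * stein f0 h e 1 x + h 1%N x - 0)).
    exact: derB (derD (derM der_id dk) dh) (der_cst e).
  by move=> x /=; rewrite subr0 mul0r addr0.
have dk' : der (stein f0 h e k) (stein f0 h e k.+1) by apply: IH => //; do 2 apply: ltnW.
apply: eq_der (derD (derD (derM der_id dk) (derZ k.+1%:R dk')) dh) _ => x.
by [].
Qed.

(* The (q-1)-st derivative u of f solves u'' - x u' - q u = h^(q), so that the maximum principle
   bounds it by |h^(q)|/q, and the barrier then bounds u' and u''. *)
Theorem stein_solution (h : nat -> R -> R) q (B H : R) : (0 < q)%N -> jet q h -> continuous (h q) ->
  (forall k x, (k <= q)%N -> `|h k x| <= B) -> (forall x, `|h q x| <= H) ->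
  exists f : nat -> R -> R, [/\ jet q.+1 f, continuous (f q.+1),
    exists B', forall k x, (k <= q.+1)%N -> `|f k x| <= B',
    forall x, f 1%N x - x * f 0%N x = h 0%N x - Ex gam (h 0%N)
    & forall x, `|f q x| <= 10 * H /\ `|f q.+1 x| <= 4 * H].
Proof.
move=> q0 jh chq hB hH.
have H0 : 0 <= H := le_trans (normr_ge0 _) (hH 0).
have B0 : 0 <= B := le_trans (normr_ge0 _) (hB 0%N 0 isT).
have mh0 : measurable_fun setT (h 0%N) := der_meas (jh 0%N q0).
have h0B x : `|h 0%N x| <= B * (1 + `|x|) ^+ 0 by rewrite expr0 mulr1 hB.
have Ih0 : integ gam (h 0%N) := integ_gauss mh0 h0B.
set e := Ex gam (h 0%N).
pose g x := h 0%N x - e.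
have dg : der g (fun x => h 1%N x - 0) := derB (jh 0%N q0) (der_cst e).
have gB x : `|g x| <= (B + `|e|) * (1 + `|x|) ^+ 0.
  by rewrite expr0 mulr1 (le_trans (ler_normB _ _))// lerD2r hB.
have g0 : \int[mu]_x (g x * gauss x) = 0.
  have E : Ex gam g = 0 by rewrite ExB// ?Ex_cst ?subrr//; exact: integ_cst.
  by apply/eqP; move/eqP: E; rewrite (Ex_gaussE (der_meas dg) gB) mulf_eq0 gt_eqF ?npk_gt0.
have [F [dF F1 F2]] : exists F, [/\ der F (fun x => g x * gauss x),
    (forall e : R, 0 < e -> exists M, forall x, x <= - M -> `|F x| <= e) &
    (forall e : R, 0 < e -> exists M, forall x, M <= x -> `|F x - \int[mu]_t (g t * gauss t)| <= e)].
  apply: (@primitive _ (B + `|e|) 0).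
    by apply: der_cont (derM dg gauss_der).
  by move=> x; rewrite normrM (ger0_norm (ltW (gauss_gt0 x))) ler_wpM2r ?(ltW (gauss_gt0 x)).
(* Since [g] is centred, [F] vanishes at both ends, and so does [f0 * gauss]; this singles out the
   bounded solution. *)
pose f0 x := F x * expR (x ^+ 2 / 2).
have ee x : gauss x * expR (x ^+ 2 / 2) = 1 by rewrite /gauss -expRD addNr expR0.
have d0 : der f0 (stein f0 h e 1).
  have dE : der (fun x => expR (x ^+ 2 / 2)) (fun x => x * expR (x ^+ 2 / 2)).
    apply: eq_der.
      by apply: der_expR; apply: (derM (derX 2 der_id) (der_cst (2^-1))).
    by move=> x /=; congr (_ * _); field.
  apply: eq_der (derM dF dE) _ => x /=.
  by rewrite /f0 -[X in X + _]mulrA ee /g; ring.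
pose f := stein f0 h e.
have jf : jet q.+1 f := stein_der jh d0.
have fe x : F x = f0 x * gauss x by rewrite /f0 -mulrA (mulrC (expR _)) ee mulr1.
have vf0 : vanish (fun x => f0 x * gauss x).
  move=> r r0; have [M1 h1] := F1 r r0; have [M2 h2] := F2 r r0.
  exists (`|M1| + `|M2|) => x hx; rewrite -fe.
  have n1 := normr_ge0 M1. have n2 := normr_ge0 M2.
  have l1 := ler_norm M1. have l2 := ler_norm M2.
  have [x0|x0] := leP 0 x.
    have := h2 x; rewrite g0 subr0; apply; move: hx; rewrite (ger0_norm x0); lra.
  by apply: h1; move: hx; rewrite (ltr0_norm x0); lra.
have b0 x := @barrier f0 g (B + `|e|) x
  (eq_der d0 (fun x => esym (addrA _ _ _))) (fun y => le_trans (gB y) ltac:(by rewrite expr0 mulr1)) vf0.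
(* Crude bounds on all derivatives in terms of B. They supply the boundedness that the maximum
   principle and [barrier] presuppose. *)
have bk k : (k <= q)%N -> exists B', 0 <= B' /\ forall i x, (i <= k.+1)%N -> `|f i x| <= B'.
  elim: k => [|k IH] kq.
    exists (5 * (B + `|e|)); have C0 : 0 <= B + `|e| by rewrite addr_ge0.
    split; first by rewrite mulr_ge0.
    case=> [|[|//]] x _; first by have [] := b0 x.
    have [b1 _] := b0 x; rewrite /f /= -addrA (le_trans (ler_normD _ _))//.
    have := gB x; rewrite expr0 mulr1 /g => b2; move: b1 b2; lra.
  have [B' [B'0 hB']] := IH (ltnW kq).
  pose v x := k.+1%:R * f k x + h k.+1 x.
  have hv x : `|v x| <= k.+1%:R * B' + B.
    by rewrite (le_trans (ler_normD _ _))// lerD// ?hB// normrM normr_nat ler_wpM2l// hB'.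
  have dk : der (f k.+1) (fun x => x * f k.+1 x + v x).
    by apply: eq_der (jf k.+1 kq) _ => x; rewrite /f steinSS /v addrA.
  have vk : vanish (fun x => f k.+1 x * gauss x).
    by apply: (@gauss_vanish _ B' 0) => x; rewrite expr0 mulr1 hB'.
  have C0 : 0 <= k.+1%:R * B' + B by rewrite addr_ge0// mulr_ge0.
  exists (B' + (k.+1%:R * B' + B) *+ 2); split; first by rewrite addr_ge0// mulrn_wge0.
  move=> i x; rewrite leq_eqVlt => /orP[/eqP ->|ik].
    rewrite /f steinSS -addrA -/(v x) (le_trans (ler_normD _ _))// (@le_trans _ _ ((k.+1%:R * B' + B) *+ 2))//.
      by rewrite mulr2n lerD//; have [] := barrier x dk hv vk.
    by rewrite lerDr.
  by apply: (le_trans (hB' i x ik)); rewrite lerDl mulrn_wge0.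
have [B' [B'0 hB']] := bk q (leqnn q).
exists f; split=> //.
- case: q q0 jh chq {hB hH} jf {bk hB'} => // q _ jh chq jf.
  move=> x; apply: cvgD; last exact: chq.
  apply: cvgD; first by apply: cvgM; [exact: cvg_id|exact: der_cont (jf q.+1 _) x].
  by apply: cvgM; [exact: cvg_cst|apply: der_cont (jf q _) x; rewrite ltnW].
- by exists B'.
- by move=> x; rewrite /f /=; ring.
case: q q0 jh chq hB hH jf {bk} hB' => // q _ jh chq hB hH jf hB'.
have q0 : 0 < q.+1%:R :> R by rewrite ltr0n.
have mp y : `|f q y| <= H / q.+1%:R.
  have d1 : der (f q) (f q.+1) by apply: jf; rewrite ltnS leqnSn.
  have d2 : der (f q.+1) (f q.+2) by apply: jf.
  have bq x : `|f q x| <= B' by apply: hB'; rewrite (leq_trans (leqnSn q))// leqnSn.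
  rewrite ler_norml; apply/andP; split.
    rewrite lerNl; apply: (@maxprinciple (fun x => - f q x) (fun x => - f q.+1 x) (fun x => - f q.+2 x) (fun x => - h q.+1 x) _ B') => //.
    - exact: derN.
    - exact: derN.
    - by move=> x; rewrite normrN.
    - by move=> x; rewrite /f steinSS; ring.
    - by move=> x; rewrite normrN.
  apply: (@maxprinciple (f q) (f q.+1) (f q.+2) (h q.+1) _ B') => //.
(* The maximum principle gives |v| <= 2 H. [barrier] with V = 2 H then yields 10 H = 5 V for f^(q),
   and 4 H = V + V for the next derivative, which is x f^(q) + v. *)
pose v x := q.+1%:R * f q x + h q.+1 x.
have hv x : `|v x| <= 2 * H.
  rewrite (le_trans (ler_normD _ _))// (_ : 2 * H = H + H); last by ring.
  rewrite lerD// normrM normr_nat -ler_pdivlMl// mulrC; exact: mp.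
have dk : der (f q.+1) (fun x => x * f q.+1 x + v x).
  by apply: eq_der (jf q.+1 _) _ => // x; rewrite /f steinSS /v addrA.
have vk : vanish (fun x => f q.+1 x * gauss x).
  by apply: (@gauss_vanish _ B' 0) => x; rewrite expr0 mulr1 hB'// ltnW.
move=> x; have [b1 b2] := barrier x dk hv vk; split; first by apply: le_trans b2 _; lra.
rewrite /f steinSS -addrA -/(v x) (le_trans (ler_normD _ _))//.
by have := hv x; move: b1; rewrite /f; lra.
Qed.

End Gauss.

(** * Edgeworth polynomials *)

Section PolyBounds.
Context {R : realType}.
Implicit Types (Q S : {poly R}) (N : nat) (K : R).

(** Number and size of the coefficients are kept apart: the number stays fixed over a family while K
    carries the power of eps. *)
Definition bp N K Q := (size Q <= N)%N /\ forall i, `|Q`_i| <= K.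

Lemma bp_ge0 N K Q : bp N K Q -> 0 <= K.
Proof. by case=> _ /(_ 0%N); exact: le_trans. Qed.

Lemma bp_le N N' K K' Q : (N <= N')%N -> K <= K' -> bp N K Q -> bp N' K' Q.
Proof. by move=> nn kk [h1 h2]; split=> [|i]; [exact: leq_trans nn|exact: le_trans kk]. Qed.

Lemma bp0 : bp 0 0 0.
Proof. by split=> [|i]; rewrite ?size_poly0// coef0 normr0. Qed.

Lemma bpC (a : R) : bp 1 `|a| a%:P.
Proof. by split=> [|i]; rewrite ?size_polyC_leq1// coefC; case: ifP => _//; rewrite normr0. Qed.

Lemma bpD N K K' Q S : bp N K Q -> bp N K' S -> bp N (K + K') (Q + S).
Proof.
move=> [a1 a2] [b1 b2]; split=> [|i]; last by rewrite coefD (le_trans (ler_normD _ _))// lerD.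
by rewrite (leq_trans (size_polyD _ _))// geq_max a1.
Qed.

Lemma bpZ N K Q (a : R) : bp N K Q -> bp N (`|a| * K) (a *: Q).
Proof.
move=> [a1 a2]; split=> [|i]; last by rewrite coefZ normrM ler_wpM2l.
exact: leq_trans (size_scale_leq _ _) a1.
Qed.

Lemma bpM N N' K K' Q S : bp N K Q -> bp N' K' S ->
  bp (N + N') ((N + N')%:R * (K * K')) (Q * S).
Proof.
move=> bQ bS; have K0 := bp_ge0 bQ; have K'0 := bp_ge0 bS.
have [a1 a2] := bQ; have [b1 b2] := bS.
have sz : (size (Q * S)%R <= N + N')%N.
  apply: leq_trans (size_polyMleq _ _) _; apply: leq_trans (leq_pred _) _.
  exact: leq_add.
split=> // i; have [iN|Ni] := ltnP i (N + N'); last first.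
  by rewrite nth_default ?normr0 ?mulr_ge0// (leq_trans sz).
rewrite coefM (le_trans (ler_norm_sum _ _ _))//.
apply: (@le_trans _ _ (\sum_(j < i.+1) K * K')).
  by apply: ler_sum => j _; rewrite normrM ler_pM.
by rewrite sumr_const card_ord -[leLHS]mulr_natl ler_wpM2r ?mulr_ge0// ler_nat.
Qed.

(* The adjoint of d/dx in L^2 of the Gaussian. *)
Definition Dst Q : {poly R} := 'X * Q - Q^`().

Lemma bpDst N K Q : bp N K Q -> bp N.+1 (N.+1%:R * K) (Dst Q).
Proof.
move=> bQ; have K0 := bp_ge0 bQ; have [a1 a2] := bQ; split=> [|i].
  rewrite (leq_trans (size_polyD _ _))// size_polyN geq_max; apply/andP; split.
    apply: leq_trans (size_polyMleq _ _) _; rewrite size_polyX /= //.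
  apply/leq_sizeP => j Nj; rewrite coef_deriv nth_default ?mul0rn//.
  by rewrite (leq_trans a1)// (leq_trans (leqnSn N))// (leq_trans Nj).
rewrite coefB coefXM coef_deriv; have [iN|Ni] := ltnP i N.
  rewrite (le_trans (ler_normB _ _))// -(add1n N) natrD mulrDl mul1r lerD//.
    by case: i iN => [|i] _ /=; rewrite ?normr0.
  by rewrite -[_ *+ i.+1]mulr_natl normrM normr_nat ler_pM// ler_nat.
rewrite [Q`_i.+1]nth_default ?(leq_trans a1)// ?(leq_trans Ni)// mul0rn subr0.
apply: (@le_trans _ _ K); first by case: i Ni => [|i] _ /=; rewrite ?normr0.
by rewrite ler_peMl// ler1n.
Qed.

Lemma horner_le N K Q x : bp N K Q -> `|Q.[x]| <= N%:R * K * (1 + `|x|) ^+ N.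
Proof.
move=> bQ; have K0 := bp_ge0 bQ; have [a1 a2] := bQ.
have x1 : 1 <= 1 + `|x| by rewrite lerDl.
rewrite (horner_coef_wide _ a1) (le_trans (ler_norm_sum _ _ _))//.
apply: (@le_trans _ _ (\sum_(i < N) K * (1 + `|x|) ^+ N)).
  apply: ler_sum => i _; rewrite normrM ler_pM// normrX.
  apply: (@le_trans _ _ ((1 + `|x|) ^+ i)); first by rewrite lerXn2r ?nnegrE ?addr_ge0 ?lerDr.
  by rewrite ler_weXn2l// ltnW.
by rewrite sumr_const card_ord -[leLHS]mulr_natl mulrA.
Qed.

(** The operator S |-> 2 S + X S' - S'' is triangular on monomials with diagonal entry n + 2, hence
    invertible. It arises in [gE_stein]. *)
Lemma euler_monomial (c : R) n : let S : {poly R} := c *: 'X^n in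
  S *+ 2 + 'X * S^`() - S^`()^`() =
  (c * n.+2%:R) *: 'X^n - (c * (n%:R * n.-1%:R)) *: 'X^(n.-2).
Proof.
rewrite /= derivZ derivXn derivZ derivMn derivXn.
have Mn (v : {poly R}) k : v *+ k = k%:R *: v by rewrite scaler_nat.
rewrite (Mn (c *: 'X^n) 2) (Mn 'X^(n.-1) n) (Mn 'X^(n.-2) n.-1) (Mn (_ *: 'X^(n.-2)) n).
have XS (a b : R) (v : {poly R}) : 'X * (a *: (b *: v)) = (a * b) *: ('X * v).
  by rewrite -scalerAr -scalerAr scalerA.
rewrite XS !scalerA.
case: n => [|n] /=; first by rewrite !mulr0 !scale0r !subr0 addr0 mulrC.
by rewrite -exprS -scalerDl -!mulrA; congr (_ *: _ - _ *: _); rewrite -?[n.+3]addn2 ?natrD; ring.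
Qed.

(** The leading coefficient is removed and the rest, of lower degree, is treated recursively; the
    constant depends on the degree only. *)
Lemma Theta_ex N : exists T, 0 <= T /\ forall Q K, bp N K Q ->
  exists S, bp N (T * K) S /\ S *+ 2 + 'X * S^`() - S^`()^`() = Q.
Proof.
elim/ltn_ind: N => -[|n] IH.
  exists 0; split=> // Q K [/size_poly_leq0P -> _]; exists 0; split.
    by rewrite mul0r; exact: bp0.
  by rewrite mul0rn deriv0 mulr0 deriv0 !addr0 subr0.
have [T [T0 hT]] := IH n (ltnSn n).
exists (1 + T * (1 + n%:R * n%:R)); split; first by rewrite addr_ge0// mulr_ge0// addr_ge0// mulr_ge0.
move=> Q K bQ; have K0 := bp_ge0 bQ; have [a1 a2] := bQ.
pose c := Q`_n / n.+2%:R.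
have c1 : `|c| <= K.
  rewrite normrM normfV normr_nat ler_pdivrMr ?ltr0n//.
  by rewrite (le_trans (a2 n))// ler_peMr// ler1n.
pose S0 := c *: 'X^n : {poly R}.
pose E0 := S0 *+ 2 + 'X * S0^`() - S0^`()^`().
have E0E : E0 = (c * n.+2%:R) *: 'X^n - (c * (n%:R * n.-1%:R)) *: 'X^(n.-2).
  exact: euler_monomial.
have bR : bp n ((1 + n%:R * n%:R) * K) (Q - E0).
  rewrite E0E; split.
    apply/leq_sizeP => j; rewrite leq_eqVlt => /orP[/eqP <-|nj].
      rewrite !coefB !coefZ !coefXn eqxx mulr1 /c divfK ?pnatr_eq0//.
      have z k : k%:R * k.-1%:R * (k == k.-2)%:R = 0 :> R.
        case: k => [|[|k]] /=; rewrite ?mul0r ?mulr0// gtn_eqF ?mulr0// ltnW//.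
      by rewrite -[_ * (n == _)%:R]mulrA z mulr0 subr0 subrr.
    rewrite !coefB !coefZ !coefXn nth_default ?(leq_trans a1)// gtn_eqF// mulr0.
    rewrite gtn_eqF ?mulr0 ?subrr ?subr0//.
    by apply: leq_ltn_trans nj; rewrite (leq_trans (leq_pred _))// leq_pred.
  move=> i; rewrite !coefB !coefZ !coefXn.
  have [->|ni] := eqVneq i n.
    rewrite mulr1 /c divfK ?pnatr_eq0// opprB addrCA subrr addr0.
    apply: (@le_trans _ _ (n%:R * n%:R * K)); last by rewrite mulrDl mul1r lerDr.
    rewrite !normrM !normr_nat [leRHS]mulrC -mulrA ler_pM// ?mulr_ge0//.
    have nn : n.-1%:R <= n%:R :> R by rewrite ler_nat leq_pred.
      by rewrite -normrM.
    by rewrite -mulrA ler_wpM2l//; case: (_ == _); rewrite ?normr1 ?normr0 ?mulr1 ?mulr0 ?ler0n ?ler_nat ?leq_pred.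
  rewrite mulr0 sub0r opprK (le_trans (ler_normD _ _))// mulrDl mul1r lerD//.
  have nn : n.-1%:R <= n%:R :> R by rewrite ler_nat leq_pred.
  rewrite !normrM !normr_nat [leRHS]mulrC -mulrA ler_pM// ?mulr_ge0//.
    by rewrite -normrM.
  by rewrite -mulrA ler_wpM2l//; case: (_ == _); rewrite ?normr1 ?normr0 ?mulr1 ?mulr0 ?ler0n ?ler_nat ?leq_pred.
have [S1 [bS1 ES1]] := hT _ _ bR.
exists (S0 + S1); split.
  rewrite mulrDl mul1r; apply: bpD; last by rewrite -mulrA; apply: bp_le bS1.
  split=> [|i]; first by rewrite (leq_trans (size_scale_leq _ _))// size_polyXn.
  by rewrite coefZ coefXn normrM; case: (_ == _); rewrite ?normr1 ?normr0 ?mulr1 ?mulr0.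
rewrite !derivD mulrnDl mulrDr.
move: ES1; rewrite /E0 => ES1.
rewrite -[RHS](subrK E0) -ES1 /E0; ring.
Qed.

End PolyBounds.

Section BigO.
Context {R : realType} {E : Type}.
Variable eps : E -> R.
Hypothesis eps0 : forall e, 0 <= eps e.
Hypothesis eps1 : forall e, eps e <= 1.
Implicit Types (Q S : E -> {poly R}).

(** Coefficients of order eps^s and bounded degree, uniformly over the index set E. *)
Definition bO s Q := exists N K, 0 <= K /\ forall e, bp N (K * eps e ^+ s) (Q e).

Lemma bO_le s t Q : (t <= s)%N -> bO s Q -> bO t Q.
Proof.
move=> ts [N [K [K0 h]]]; exists N, K; split=> // e; apply: bp_le (h e) => //.
by rewrite ler_wpM2l// ler_wiXn2l.
Qed.

Lemma bOD s Q S : bO s Q -> bO s S -> bO s (fun e => Q e + S e).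
Proof.
move=> [N [K [K0 h]]] [N' [K' [K'0 h']]]; exists (maxn N N'), (K + K'); split; first exact: addr_ge0.
move=> e; rewrite mulrDl; apply: bpD.
  by apply: bp_le (h e); rewrite ?leq_maxl.
by apply: bp_le (h' e); rewrite ?leq_maxr.
Qed.

Lemma bOZ s (t : nat) (a : E -> R) (A : R) Q : 0 <= A -> (forall e, `|a e| <= A * eps e ^+ t) ->
  bO s Q -> bO (t + s) (fun e => a e *: Q e).
Proof.
move=> A0 ha [N [K [K0 h]]]; exists N, (A * K); split; first exact: mulr_ge0.
move=> e; apply: bp_le (bpZ (a e) (h e)) => //.
by rewrite exprD mulrACA ler_wpM2r// mulr_ge0// exprn_ge0.
Qed.

Lemma bOZc s (a : R) Q : bO s Q -> bO s (fun e => a *: Q e).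
Proof. by move=> h; apply: (@bOZ s 0 (fun=> a) `|a|) => // e; rewrite expr0 mulr1. Qed.

Lemma bOM s t Q S : bO s Q -> bO t S -> bO (s + t) (fun e => Q e * S e).
Proof.
move=> [N [K [K0 h]]] [N' [K' [K'0 h']]]; exists (N + N')%N, ((N + N')%:R * (K * K')).
split; first by rewrite !mulr_ge0.
by move=> e; rewrite -mulrA exprD mulrACA; exact: bpM.
Qed.

Lemma bODst s Q : bO s Q -> bO s (fun e => Dst (Q e)).
Proof.
move=> [N [K [K0 h]]]; exists N.+1, (N.+1%:R * K); split; first exact: mulr_ge0.
by move=> e; rewrite -mulrA; exact: bpDst.
Qed.

Lemma bO_iter s j Q : bO s Q -> bO s (fun e => iter j Dst (Q e)).
Proof. by move=> h; elim: j => // j IH; exact: bODst IH. Qed.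

Lemma bO0 s : bO s (fun=> 0).
Proof. by exists 0%N, 0; split=> // e; rewrite mul0r; exact: bp0. Qed.

Lemma bOC (a : R) : bO 0 (fun=> a%:P).
Proof. by exists 1%N, `|a|; split=> // e; rewrite expr0 mulr1; exact: bpC. Qed.

Lemma bOX s i Q : bO s Q -> bO (i * s) (fun e => Q e ^+ i).
Proof.
move=> h; elim: i => [|i IH]; first by apply: (bOC 1).
by under eq_fun do rewrite exprS; rewrite mulSn; exact: bOM.
Qed.

Lemma bO_sum s (I : eqType) (r : seq I) (Q : I -> E -> {poly R}) :
  (forall i, i \in r -> bO s (Q i)) -> bO s (fun e => \sum_(i <- r) Q i e).
Proof.
elim: r => [|i r IH] h; first by under eq_fun do rewrite big_nil; exact: bO0.
under eq_fun do rewrite big_cons; apply: bOD; first by apply: h; rewrite mem_head.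
by apply: IH => j jr; apply: h; rewrite inE jr orbT.
Qed.

Lemma bO_Theta s Q : bO s Q -> exists S, bO s S /\
  forall e, S e *+ 2 + 'X * (S e)^`() - (S e)^`()^`() = Q e.
Proof.
move=> [N [K [K0 h]]]; have [T [T0 hT]] := @Theta_ex R N.
have [S hS] := choice (fun e => hT _ _ (h e)).
exists S; split; last by move=> e; have [] := hS e.
by exists N, (T * K); split; [exact: mulr_ge0|move=> e; rewrite -mulrA; have [] := hS e].
Qed.

(* Taylor expansion and i - 1 Gaussian integrations by parts turn E h(Z + D(Z)) - E h(Z) into
   E h'(Z) Gam(Z), up to a remainder of order p. *)
Definition Gam p (D : {poly R}) := \sum_(1 <= i < p) (i`!%:R)^-1 *: iter i.-1 Dst (D ^+ i).

Lemma iter_DstB j (A B : {poly R}) : iter j Dst (A - B) = iter j Dst A - iter j Dst B.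
Proof. by elim: j => //= j ->; rewrite /Dst derivB mulrBr opprD opprK; ring. Qed.

(** [Gam D] is D plus terms at least quadratic in D. Adding the current residual to D therefore
    gains one order of eps, and p - 1 corrections of D = 0 suffice. *)
Theorem Gam_inverse p Q : (0 < p)%N -> bO 1 Q ->
  exists D, bO 1 D /\ bO p (fun e => Q e - Gam p (D e)).
Proof.
move=> p0 hQ; suff: forall s, (s < p)%N -> exists D, bO 1 D /\ bO s.+1 (fun e => Q e - Gam p (D e)).
  by move/(_ p.-1); rewrite prednK//; apply.
elim=> [|s IH] sp.
  exists (fun=> 0); split; first exact: bO0.
  have G0 : Gam p 0 = 0.
    rewrite /Gam big_nat big1// => i /andP[i0 _]; rewrite expr0n gtn_eqF//=.
    by have := iter_DstB i.-1 0 0; rewrite !subrr => ->; rewrite scaler0.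
  by under eq_fun do rewrite G0 subr0.
have [D [hD hr]] := IH (ltnW sp).
pose r e := Q e - Gam p (D e).
have hr1 : bO 1 r by exact: bO_le hr.
exists (fun e => D e + r e); split; first exact: bOD.
(* The linear term of [Gam] cancels the residual r. What is left contains differences (D + r)^i -
   D^i with i >= 2, each divisible by r with a quotient of order eps. *)
have E0 e : Q e - Gam p (D e + r e) =
    \sum_(2 <= i < p) (- (i`!%:R)^-1) *: iter i.-1 Dst ((D e + r e) ^+ i - D e ^+ i).
  have p2 : (1 < p)%N by apply: leq_trans sp.
  rewrite -{1}(subrK (Gam p (D e)) (Q e)) -/(r e) /Gam big_ltn// [in X in _ - X]big_ltn//= !expr1.
  rewrite invr1 !scale1r [X in X - _]addrA [X in X - _]addrC opprD addrACA addrA.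
  rewrite (addrC (r e)) subrK -sumrB; apply: eq_bigr => i _.
  by rewrite iter_DstB scaleNr scalerBr opprB.
under eq_fun do rewrite E0.
apply: bO_sum => i; rewrite mem_index_iota => /andP[i2 _].
apply: bOZc; apply: bO_iter.
under eq_fun => e.
  rewrite subrXX (addrC (D e)) addrK.
  over.
rewrite -addn1; apply: bOM => //.
under eq_fun do rewrite -(big_mkord xpredT (fun j => (r _ + D _) ^+ (i.-1 - j) * D _ ^+ j)).
apply: bO_sum => j; rewrite mem_index_iota => /andP[_ ji].
have := bOM (@bOX 1 (i.-1 - j) _ (bOD hr1 hD)) (@bOX 1 j _ hD).
rewrite !muln1 subnK; last by rewrite -ltnS prednK// ltnW.
apply: bO_le; rewrite -ltnS prednK//; exact: ltnW.
Qed.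

End BigO.

Section GaussPoly.
Context {R : realType}.
Local Notation gam := (@std_normal R).
Implicit Types (Q S : {poly R}) (u : R -> R) (f h : nat -> R -> R).

Definition gE Q u : R := Ex gam (fun x => u x * Q.[x]).

Lemma horner_der Q : der (horner Q) (horner Q^`()).
Proof.
elim/poly_ind: Q => [|Q c IH].
  have h0 : horner (0 : {poly R}) = fun=> 0 by apply/funext => x; rewrite horner0.
  by rewrite deriv0 h0; exact: der_cst.
rewrite (_ : horner _ = fun x => Q.[x] * id x + c); last first.
  by apply/funext => x; rewrite !hornerE.
apply: eq_der (derD (derM IH der_id) (der_cst c)) _ => x.
by rewrite derivD derivC derivM derivX !hornerE.
Qed.

Lemma bp_ex Q : exists N K, bp N K Q.
Proof.
exists (size Q), (\sum_(i < size Q) `|Q`_i|); split=> // i.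
have [iQ|Qi] := ltnP i (size Q); last first.
  by rewrite nth_default// normr0 sumr_ge0.
by rewrite (bigD1 (Ordinal iQ))//= lerDl sumr_ge0.
Qed.

Lemma integ_uQ u Q B : measurable_fun setT u -> (forall x, `|u x| <= B) ->
  integ gam (fun x => u x * Q.[x]).
Proof.
move=> mu hu; have [N [K bQ]] := bp_ex Q.
apply: (@integ_gauss _ _ (B * (N%:R * K)) N).
  by apply: measurable_funM => //; exact: der_meas (horner_der Q).
by move=> x; rewrite normrM -mulrA ler_pM// horner_le.
Qed.

Lemma gED Q S u B : measurable_fun setT u -> (forall x, `|u x| <= B) ->
  gE (Q + S) u = gE Q u + gE S u.
Proof.
move=> mu hu; rewrite /gE -ExD; [|exact: integ_uQ hu..].
by apply: eq_Ex => x; rewrite hornerD mulrDr.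
Qed.

Lemma gEZ a Q u B : measurable_fun setT u -> (forall x, `|u x| <= B) ->
  gE (a *: Q) u = a * gE Q u.
Proof.
move=> mu hu; rewrite /gE -ExZ; last exact: integ_uQ hu.
by apply: eq_Ex => x; rewrite hornerZ mulrCA.
Qed.

Lemma gE_sum (I : Type) (r : seq I) (Q : I -> {poly R}) u B : measurable_fun setT u ->
  (forall x, `|u x| <= B) -> gE (\sum_(i <- r) Q i) u = \sum_(i <- r) gE (Q i) u.
Proof.
move=> mu hu; elim: r => [|i r IH].
  by rewrite !big_nil /gE; under eq_Ex do rewrite horner0 mulr0; rewrite Ex_cst.
by rewrite !big_cons (gED _ _ mu hu) IH.
Qed.

Lemma gE1 u : gE 1 u = Ex gam u.
Proof. by apply: eq_Ex => x; rewrite hornerC mulr1. Qed.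

Lemma gE_ibp u u' Q B : der u u' -> continuous u' -> (forall x, `|u x| <= B) ->
  (forall x, `|u' x| <= B) -> gE Q u' = gE (Dst Q) u.
Proof.
move=> du cu' hu hu'; have mu := der_meas du; have mu' := continuous_measurable_fun cu'.
have B0 : 0 <= B := le_trans (normr_ge0 _) (hu 0).
have dv := derM du (horner_der Q).
have [N [K bQ]] := bp_ex Q; have [N' [K' bQ']] := bp_ex Q^`().
have K0 := bp_ge0 bQ; have K'0 := bp_ge0 bQ'.
pose M := maxn N N'; pose c := B * (N%:R * K) + B * (N'%:R * K').
have x1 (x : R) : 1 <= 1 + `|x| :> R by rewrite lerDl.
have p1 (x : R) n : (n <= M)%N -> (1 + `|x|) ^+ n <= (1 + `|x|) ^+ M :> R by move=> h; rewrite ler_weXn2l.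
have := @gauss_ibp R _ _ c M dv.
have -> : Ex gam (fun x => u' x * Q.[x] + u x * (Q^`()).[x]) = gE Q u' + gE Q^`() u.
  by rewrite ExD//; [exact: integ_uQ hu'|exact: integ_uQ hu].
have -> : Ex gam (fun x => x * (u x * Q.[x])) = gE ('X * Q) u.
  by apply: eq_Ex => x; rewrite hornerM hornerX mulrCA.
have -> : gE (Dst Q) u = gE ('X * Q) u - gE Q^`() u.
  by rewrite /Dst -scaleN1r (gED _ _ mu hu) (gEZ _ _ mu hu) mulN1r.
move=> <-; first by rewrite addrK.
- move=> x; apply: cvgD; apply: cvgM; [exact: cu'|exact: der_cont (horner_der Q) x| |].
    exact: der_cont du x.
  exact: der_cont (horner_der _) x.
- move=> x; rewrite normrM /c mulrDl ler_wpDr//.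
    by rewrite !mulr_ge0// exprn_ge0// addr_ge0.
  by rewrite -mulrA ler_pM// (le_trans (horner_le x bQ))// ler_wpM2l ?mulr_ge0// p1// leq_maxl.
- move=> x; rewrite (le_trans (ler_normD _ _))// !normrM /c mulrDl lerD// -mulrA ler_pM//.
    by rewrite (le_trans (horner_le x bQ))// ler_wpM2l ?mulr_ge0// p1// leq_maxl.
  by rewrite (le_trans (horner_le x bQ'))// ler_wpM2l ?mulr_ge0// p1// leq_maxr.
Qed.

Lemma jet_cont n f k : jet n f -> continuous (f n) -> (k <= n)%N -> continuous (f k).
Proof.
move=> jf cf; rewrite leq_eqVlt => /orP[/eqP -> //|kn].
exact: der_cont (jf k kn).
Qed.

Lemma gE_iter n f B k j Q : jet n f -> continuous (f n) ->
  (forall i x, (i <= n)%N -> `|f i x| <= B) -> (k + j <= n)%N ->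
  gE Q (f (k + j)%N) = gE (iter j Dst Q) (f k).
Proof.
move=> jf cf hf; elim: j Q => [|j IH] Q kj; first by rewrite addn0.
rewrite iterSr -IH; last by rewrite (leq_trans _ kj)// leq_add2l.
rewrite addnS in kj *; apply: (@gE_ibp _ _ _ B).
- exact: jf.
- exact: jet_cont jf cf kj.
- by move=> x; apply: hf; exact: ltnW.
- by move=> x; apply: hf.
Qed.

(** Allows a weight on f' to be exchanged for a weight on h'. With T the second iterate of [Dst] on
    S, integration by parts moves T onto h - e = f' - x f; the terms in T f' cancel, and the
    remaining T' equals [Dst] of 2 S + X S' - S'' because (Dst U)' = U + Dst U'. *)
Lemma gE_stein (h0 h1 f0 f1 : R -> R) B e S : der h0 h1 -> der f0 f1 -> continuous h1 -> continuous f1 ->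
  (forall x, `|h0 x| <= B) -> (forall x, `|h1 x| <= B) ->
  (forall x, `|f0 x| <= B) -> (forall x, `|f1 x| <= B) ->
  (forall x, f1 x - x * f0 x = h0 x - e) ->
  gE (Dst S) h1 = - gE (S *+ 2 + 'X * S^`() - S^`()^`()) f1.
Proof.
move=> dh df ch cf bh0 bh1 bf0 bf1 st.
have mf0 := der_meas df; have mf1 := continuous_measurable_fun cf.
have mh0 := der_meas dh.
set T := Dst (Dst S).
have dh' : der (fun x => h0 x - e) h1.
  by apply: eq_der (derB dh (der_cst e)) _ => x; rewrite subr0.
have bh' x : `|h0 x - e| <= B + `|e| by rewrite (le_trans (ler_normB _ _))// lerD2r.
have bh1' x : `|h1 x| <= B + `|e| by rewrite (le_trans (bh1 x))// lerDl.
rewrite (gE_ibp (Dst S) dh' ch bh' bh1') -/T.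
have -> : gE T (fun x => h0 x - e) = gE T f1 - gE ('X * T) f0.
  rewrite /gE -ExB; [|exact: integ_uQ bf1|exact: integ_uQ bf0].
  by apply: eq_Ex => x; rewrite -st hornerM hornerX; ring.
have -> : 'X * T = Dst T + T^`() by rewrite /Dst subrK.
rewrite (gED _ _ mf0 bf0) -(gE_ibp T df cf bf0 bf1) opprD addrA subrr add0r; congr (- _).
have dD (U : {poly R}) : (Dst U)^`() = U + Dst U^`().
  by rewrite /Dst derivB derivM derivX mul1r addrA.
have -> : T^`() = Dst (S *+ 2 + 'X * S^`() - S^`()^`()).
  by rewrite /T !dD /Dst !(derivD, derivN, derivMn, derivM, derivX) mulr2n; ring.
by rewrite -(gE_ibp _ df cf bf0 bf1).
Qed.

End GaussPoly.

Section Edgeworth.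
Context {R : realType} {E : Type}.
Local Notation gam := (@std_normal R).
Variables (mu : E -> probability R R) (eps : E -> R) (c : nat -> E -> R) (p : nat) (C : R).
Hypothesis eps0 : forall e, 0 <= eps e.
Hypothesis eps1 : forall e, eps e <= 1.
Hypothesis C0 : 0 <= C.
Hypothesis mu_id : forall e, integ (mu e) id.
Hypothesis c_le : forall k e, (1 < k <= p)%N -> `|c k e| <= C * eps e ^+ k.-1.
Hypothesis stein_exp : forall e q (f : nat -> R -> R) B M, (0 < q <= p)%N -> jet q.+1 f ->
  continuous (f q.+1) -> (forall k x, (k <= q.+1)%N -> `|f k x| <= B) ->
  (forall x, `|f q x| <= M /\ `|f q.+1 x| <= M) ->
  `|Ex (mu e) (fun x => x * f 0%N x) - Ex (mu e) (f 1%N) -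
     \sum_(2 <= k < q.+1) c k e * Ex (mu e) (f k)| <= C * eps e ^+ q * M.

(* Stein's equation for h trades h for f; the terms E f^(k)(W) of the expansion of
   E W f(W) - E f'(W) are expanded in turn, at order Q - k + 1. *)
Theorem edgeworth Q : (Q <= p)%N -> exists (Pf : nat -> E -> {poly R}) (K : R),
  [/\ 0 <= K, forall q, (0 < q <= Q)%N -> bO eps 1 (Pf q) &
   forall e q (h : nat -> R -> R) B M, (0 < q <= Q)%N -> jet q h -> continuous (h q) ->
    (forall k x, (k <= q)%N -> `|h k x| <= B) -> (forall x, `|h q x| <= M) ->
    `|Ex (mu e) (h 0%N) - Ex gam (h 0%N) - gE (Pf q e) (h 1%N)| <= K * eps e ^+ q * M].
Proof.
elim: Q => [|Q IH] Qp.
  by exists (fun _ _ => 0), 0; split=> // [q|e q h B M]; case: q.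
have [Pf [K [K0 hP hE]]] := IH (ltnW Qp).
pose q := Q.+1.
(* E f^(k)(W) is E f^(k)(Z) plus the correction of order q + 1 - k, a weight on f^(k+1). Integrated
   by parts down to f', both together become the weight [T k]. *)
pose T k e := iter k.-1 Dst (1 + Dst (Pf (q.+1 - k)%N e)).
have rk k : (1 < k <= q)%N -> (0 < q.+1 - k <= Q)%N.
  by rewrite /q => /andP[k1 kq]; apply/andP; split; lia.
have /choice[S hS] : forall k, exists S : E -> {poly R}, (1 < k <= q)%N -> bO eps 0 S /\
    forall e, S e *+ 2 + 'X * (S e)^`() - (S e)^`()^`() = T k e.
  move=> k; have [kq|_] := boolP (1 < k <= q)%N; last by exists (fun=> 0).
  have [S hS] : exists S, bO eps 0 S /\
      forall e, S e *+ 2 + 'X * (S e)^`() - (S e)^`()^`() = T k e.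
    apply: bO_Theta => //; apply: bO_iter; apply: (@bOD _ _ _ _ (fun=> 1)).
      by apply: (bOC eps 1).
    by apply: bODst; apply: (@bO_le _ _ _ eps0 eps1 1) => //; apply: hP; exact: rk.
  by exists S.
(* By Stein's equation E h(W) - E h(Z) is, up to the error, minus the sum of the c_k E f^(k)(W); the
   sign is absorbed by [gE_stein]. *)
pose Pn e := \sum_(2 <= k < q.+1) c k e *: Dst (S k e).
exists (fun j => if j == q then Pn else Pf j), (10 * C + \sum_(2 <= k < q.+1) C * (K * 10) + K).
have s0 : 0 <= \sum_(2 <= k < q.+1) C * (K * 10) by apply: sumr_ge0 => k _; rewrite !mulr_ge0.
split.
- by rewrite !addr_ge0// mulr_ge0.
- move=> j /andP[j0 jq]; case: eqP => [_|/eqP jn]; last first.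
    by apply: hP; rewrite j0 /= -ltnS ltn_neqAle jn.
  apply: bO_sum => k; rewrite mem_index_iota => /andP[k2 kq].
  have kk : (1 < k <= q)%N by rewrite k2.
  apply: (@bO_le _ _ _ eps0 eps1 (k.-1 + 0)); first by rewrite addn0 -ltnS prednK// ltnW.
  apply: (bOZ eps0 C0) => [e|]; first by apply: c_le; rewrite k2 (leq_trans _ Qp).
  by apply: bODst; have [] := hS k kk.
move=> e j h B M /andP[j0 jq] jh ch hB hM.
have M0 : 0 <= M := le_trans (normr_ge0 _) (hM 0).
have KM r : 0 <= K * eps e ^+ r * M by rewrite !mulr_ge0// exprn_ge0.
case: eqP => [jE|/eqP jn]; last first.
  apply: le_trans (hE e j h B M _ jh ch hB hM) _.
    by rewrite j0 /= -ltnS ltn_neqAle jn.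
  by rewrite -!mulrA ler_wpM2r ?mulr_ge0 ?exprn_ge0// lerDr addr_ge0// mulr_ge0.
subst j; have [f [jf cf [B' hf] fst fb]] := stein_solution j0 jh ch hB hM.
set eh := Ex gam (h 0%N) in fst *.
have B'0 : 0 <= B' := le_trans (normr_ge0 _) (hf 0%N 0 isT).
have B0 : 0 <= B := le_trans (normr_ge0 _) (hB 0%N 0 isT).
have cfk k : (k <= q.+1)%N -> continuous (f k) by exact: jet_cont jf cf.
have mf k : (k <= q.+1)%N -> measurable_fun setT (f k).
  by move=> kq; apply: continuous_measurable_fun; exact: cfk.
have If k : (k <= q.+1)%N -> integ (mu e) (f k).
  by move=> kq; apply: (integ_bnd _ (mf k kq)) => x; exact: hf kq.
have Ixf : integ (mu e) (fun x => x * f 0%N x).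
  apply: (integ_le (g := fun x : R => B' * `|x|)).
  - by apply: measurable_funM => //; exact: mf.
  - by move=> x; rewrite normrM mulrC ler_wpM2r// hf.
  - by apply: integZ; apply: integ_norm; exact: mu_id.
have Eh : Ex (mu e) (h 0%N) = Ex (mu e) (f 1%N) - Ex (mu e) (fun x => x * f 0%N x) + eh.
  rewrite -ExB//; last exact: If.
  rewrite -[eh in RHS](Ex_cst (mu e)) -ExD; [|apply: integB => //; exact: If|exact: integ_cst].
  by apply: eq_Ex => x; rewrite fst subrK.
have st := stein_exp e (q := q) (M := 10 * M) _ jf cf hf.
have {st} st := st ltac:(by rewrite Qp).
have {st} st := st ltac:(by move=> x; have [a1 a2] := fb x; split => //; apply: le_trans a2 _; lra).
have hk k : (1 < k <= q)%N -> `|Ex (mu e) (f k) - gE (T k e) (f 1%N)| <= K * eps e ^+ (q.+1 - k) * (10 * M).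
  move=> kq; have /andP[k1 k2] := kq; have k0 : (k <= q.+1)%N by exact: leqW.
  have jk := jet_shift k0 jf.
  have := hE e (q.+1 - k)%N (fun i => f (k + i)%N) B' (10 * M) (rk k kq) jk.
  rewrite addn0 subnKC// => /(_ cf) h1.
  have {h1} h1 := h1 ltac:(by move=> i x ik; apply: hf; rewrite -(subnKC k0) leq_add2l).
  have {h1} h1 := h1 ltac:(by move=> x; have [_ a2] := fb x; apply: le_trans a2 _; lra).
  have -> : gE (T k e) (f 1%N) = Ex gam (f k) + gE (Pf (q.+1 - k)%N e) (f (k + 1)%N).
    have -> : f k = f (1 + k.-1)%N by rewrite add1n prednK// ltnW.
    rewrite -gE1 -(gE_iter _ jf cf hf) ?add1n ?prednK// ?(ltnW k1)//.
    rewrite (gED _ _ (mf k k0) (fun x => hf k x k0)); congr (_ + _).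
    by rewrite (gE_iter (j := 1) _ jf cf hf)// addn1 ltnS.
  by rewrite opprD addrA.
have hT k : (1 < k <= q)%N -> gE (T k e) (f 1%N) = - gE (Dst (S k e)) (h 1%N).
  move=> kq; have [_ hSe] := hS k kq; rewrite -hSe.
  apply/esym; rewrite (@gE_stein _ (h 0%N) (h 1%N) (f 0%N) (f 1%N) (B + B') eh) ?opprK//.
  - exact: jh.
  - exact: jf.
  - by apply: jet_cont jh ch _.
  - exact: cfk.
  - by move=> x; rewrite (le_trans (hB _ x _))// lerDl.
  - by move=> x; rewrite (le_trans (hB _ x _))// lerDl.
  - by move=> x; rewrite (le_trans (hf _ x _))// lerDr.
  - by move=> x; rewrite (le_trans (hf _ x _))// lerDr.
have mh1 : measurable_fun setT (h 1%N) by apply: continuous_measurable_fun; exact: jet_cont jh ch _.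
have bh1 x : `|h 1%N x| <= B by exact: hB.
have -> : gE (Pn e) (h 1%N) = \sum_(2 <= k < q.+1) c k e * gE (Dst (S k e)) (h 1%N).
  rewrite (gE_sum _ _ mh1 bh1); apply: eq_bigr => k _; exact: gEZ mh1 bh1.
rewrite Eh addrK.
have -> : Ex (mu e) (f 1%N) - Ex (mu e) (fun x => x * f 0%N x) -
    \sum_(2 <= k < q.+1) c k e * gE (Dst (S k e)) (h 1%N) =
    - (Ex (mu e) (fun x => x * f 0%N x) - Ex (mu e) (f 1%N) -
     \sum_(2 <= k < q.+1) c k e * Ex (mu e) (f k)) -
    \sum_(2 <= k < q.+1) c k e * (Ex (mu e) (f k) + gE (Dst (S k e)) (h 1%N)).
  under [in X in _ = _ - X]eq_bigr do rewrite mulrDr.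
  rewrite big_split /=; ring.
set s := \sum_(2 <= k < q.+1) C * (K * 10) in s0 *.
have -> : (10 * C + s + K) * eps e ^+ q * M =
    C * eps e ^+ q * (10 * M) + s * (eps e ^+ q * M) + K * eps e ^+ q * M by ring.
apply: ler_wpDr; first exact: KM.
rewrite (le_trans (ler_normB _ _))// normrN lerD//.
rewrite (le_trans (ler_norm_sum _ _ _))// /s mulr_suml big_nat [leRHS]big_nat.
apply: ler_sum => k; rewrite ltnS => kq; have /andP[k2 k3] := kq.
rewrite normrM -[gE (Dst _) _]opprK -hT//.
have ck : `|c k e| <= C * eps e ^+ k.-1 by apply: c_le; rewrite k2 (leq_trans k3).
apply: le_trans (ler_pM (normr_ge0 _) (normr_ge0 _) ck (hk k kq)) _.
have -> : eps e ^+ q = eps e ^+ k.-1 * eps e ^+ (q.+1 - k).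
  by rewrite -exprD; congr (_ ^+ _); rewrite /q in k3 *; lia.
by rewrite le_eqVlt; apply/orP; left; apply/eqP; ring.
Qed.

Lemma bO_moment D k : bO eps 1 D -> exists K, 0 <= K /\
  forall e, Ex gam (fun x => `|(D e).[x]| ^+ k) <= K * eps e ^+ k.
Proof.
move=> [N [K [K0 h]]]; pose m := Ex gam (fun x : R => (1 + `|x|) ^+ (N * k)).
have mp n : measurable_fun setT (fun x : R => (1 + `|x|) ^+ n).
  by apply: measurable_funX; apply: measurable_funD => //; exact: normr_measurable.
have Ip n : integ gam (fun x : R => (1 + `|x|) ^+ n).
  by apply: (@integ_gauss _ _ 1 n) => // x; rewrite mul1r ger0_norm// exprn_ge0// addr_ge0.
exists ((N%:R * K) ^+ k * m); split.
  by rewrite mulr_ge0 ?exprn_ge0 ?mulr_ge0//; apply: Ex_ge0 => x; rewrite exprn_ge0// addr_ge0.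
move=> e; apply: (@le_trans _ _ (Ex gam (fun x => ((N%:R * K) * eps e) ^+ k * (1 + `|x|) ^+ (N * k)))).
  have le x : `|(D e).[x]| ^+ k <= ((N%:R * K) * eps e) ^+ k * (1 + `|x|) ^+ (N * k).
    rewrite exprM -exprMn lerXn2r ?nnegrE ?mulr_ge0 ?exprn_ge0 ?addr_ge0//.
    by have := horner_le x (h e); rewrite expr1 mulrA.
  apply: le_Ex => //; last exact: integZ.
  apply: (integ_le _ _ (integZ _ (Ip (N * k)%N))) => [|x]; last first.
    by rewrite ger0_norm ?exprn_ge0//; exact: le.
  apply: measurable_funX; apply: (measurableT_comp (@normr_measurable R setT)).
  exact: der_meas (horner_der _).
by rewrite ExZ// exprMn mulrAC.
Qed.

Theorem edgeworth_map : (0 < p)%N -> exists D : E -> {poly R}, bO eps 1 D /\ exists K, 0 <= K /\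
  forall e (h : nat -> R -> R) B M, jet p h -> continuous (h p) ->
    (forall k x, (k <= p)%N -> `|h k x| <= B) -> (forall x, `|h p x| <= M) ->
    (forall i, (0 < i < p)%N -> h i 0 = 0) ->
    `|Ex (mu e) (h 0%N) - Ex gam (fun x => h 0%N (x + (D e).[x]))| <= K * eps e ^+ p * M.
Proof.
move=> p0; have [Pf [K [K0 hP hE]]] := edgeworth (leqnn p).
have pp : (0 < p <= p)%N by rewrite p0 leqnn.
have [D [hD hr]] := Gam_inverse eps0 eps1 p0 (hP p pp).
have [K1 [K10 hK1]] := bO_moment p hD.
have [N [K2 [K20 hK2]]] := hr.
pose m := Ex gam (fun x : R => (1 + `|x|) ^+ (p + N)).
have mp n : measurable_fun setT (fun x : R => (1 + `|x|) ^+ n).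
  by apply: measurable_funX; apply: measurable_funD => //; exact: normr_measurable.
have Ip n : integ gam (fun x : R => (1 + `|x|) ^+ n).
  by apply: (@integ_gauss _ _ 1 n) => // x; rewrite mul1r ger0_norm// exprn_ge0// addr_ge0.
have m0 : 0 <= m by apply: Ex_ge0 => x; rewrite exprn_ge0// addr_ge0.
exists D; split=> //; exists (K + (N%:R * K2) * m + K1); split; first by rewrite !addr_ge0// !mulr_ge0.
move=> e h B M jh ch hB hM h0.
have M0 : 0 <= M := le_trans (normr_ge0 _) (hM 0).
have ck k : (k <= p)%N -> continuous (h k) by exact: jet_cont jh ch.
have mh k : (k <= p)%N -> measurable_fun setT (h k).
  by move=> kp; apply: continuous_measurable_fun; exact: ck.
have mD : measurable_fun setT (horner (D e)) := der_meas (horner_der _).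
(* Because the derivatives of orders 1, ..., p - 1 vanish at 0, h' is bounded in terms of M alone;
   otherwise the residual polynomial r would bring in B. *)
have h1 x : `|h 1%N x| <= M * (1 + `|x|) ^+ p.
  have jh1 : jet p.-1 (fun i => h (1 + i)%N) by rewrite -subn1; exact: jet_shift jh.
  have := tayrem_le 0 x jh1; rewrite add1n prednK// => /(_ _ hM).
  rewrite /tayrem add0r big1 ?subr0 => [hh|i _]; last first.
    by rewrite h0 ?mulr0// add1n /= -[X in (_ < X)%N](prednK p0) ltnS.
  apply: le_trans hh _; rewrite ler_wpM2l//.
  apply: (@le_trans _ _ ((1 + `|x|) ^+ p.-1)); first by rewrite lerXn2r ?nnegrE ?addr_ge0 ?lerDr.
  by rewrite ler_weXn2l ?lerDl// leq_pred.
pose r := Pf p e - Gam p (D e).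
have Er : `|gE r (h 1%N)| <= (N%:R * K2) * m * eps e ^+ p * M.
  have Ir := integ_uQ r (mh 1%N p0) (fun x => hB 1%N x p0).
  have Im : integ gam (fun x : R => (N%:R * K2 * eps e ^+ p * M) * (1 + `|x|) ^+ (p + N)) by exact: integZ.
  apply: (@le_trans _ _ (Ex gam (fun x : R => (N%:R * K2 * eps e ^+ p * M) * (1 + `|x|) ^+ (p + N)))).
    apply: normr_Ex_le => // x; rewrite normrM.
    have hx := horner_le x (hK2 e).
    apply: le_trans (ler_pM (normr_ge0 _) (normr_ge0 _) (h1 x) hx) _.
    by rewrite exprD le_eqVlt; apply/orP; left; apply/eqP; ring.
  by rewrite ExZ// le_eqVlt; apply/orP; left; apply/eqP; rewrite /m; ring.
pose t x := tayrem h p x (D e).[x].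
pose sm x := \sum_(a < p) (D e).[x] ^+ a / a`!%:R * h a x.
have ht x : `|t x| <= M * `|(D e).[x]| ^+ p by exact: tayrem_le jh hM.
have msm (a : nat) : (a < p)%N -> integ gam (fun x => (D e).[x] ^+ a / a`!%:R * h a x).
  move=> ap; have := integ_uQ ((a`!%:R)^-1 *: D e ^+ a) (mh a (ltnW ap)) (fun x => hB a x (ltnW ap)).
  apply: eq_ind; congr (integ _ _); apply/funext => x; rewrite hornerZ horner_exp; ring.
have Ism : integ gam sm by apply: integ_sum => a; exact: msm.
have tE x : h 0%N (x + (D e).[x]) = t x + sm x by rewrite /t /tayrem /sm subrK.
have IhD : integ gam (fun x => h 0%N (x + (D e).[x])).
  apply: (@integ_bnd _ _ _ _ _ B) => [|x]; last exact: hB.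
  apply: (measurableT_comp (mh 0%N isT)); exact: measurable_funD.
have It : integ gam t.
  have -> : t = fun x => h 0%N (x + (D e).[x]) - sm x by apply/funext => x; rewrite tE addrK.
  exact: integB.
have IDp : integ gam (fun x => `|(D e).[x]| ^+ p).
  have [N' [K' b']] := bp_ex (D e ^+ p).
  apply: (@integ_gauss _ _ (N'%:R * K') N').
    by apply: measurable_funX; apply: (measurableT_comp (@normr_measurable R setT)).
  by move=> x; rewrite -normrX normr_id -horner_exp; exact: horner_le.
have Et : `|Ex gam t| <= K1 * eps e ^+ p * M.
  apply: (@le_trans _ _ (Ex gam (fun x => M * `|(D e).[x]| ^+ p))).
    by apply: normr_Ex_le => //; exact: integZ.
  by rewrite ExZ// [leRHS]mulrC ler_wpM2l.
have Esm : Ex gam sm = Ex gam (h 0%N) + gE (Gam p (D e)) (h 1%N).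
  rewrite Ex_sum; last by move=> a; exact: msm.
  rewrite -(big_mkord xpredT (fun a => Ex gam (fun x => (D e).[x] ^+ a / a`!%:R * h a x))).
  rewrite big_ltn//; congr (_ + _).
    by apply: eq_Ex => x; rewrite expr0 fact0 divr1 mul1r.
  rewrite (gE_sum _ _ (mh 1%N p0) (fun x => hB 1%N x p0)) big_nat [RHS]big_nat.
  apply: eq_bigr => a /andP[a0 ap].
  rewrite (gEZ _ _ (mh 1%N p0) (fun x => hB 1%N x p0)).
  rewrite -(gE_iter _ jh ch hB) ?add1n ?prednK// ?(ltnW ap)//.
  rewrite -(gEZ _ _ (mh a (ltnW ap)) (fun x => hB a x (ltnW ap))).
  by apply: eq_Ex => x; rewrite hornerZ horner_exp; ring.
have main := hE e p h B M pp jh ch hB hM.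
have -> : Ex (mu e) (h 0%N) - Ex gam (fun x => h 0%N (x + (D e).[x])) =
   (Ex (mu e) (h 0%N) - Ex gam (h 0%N) - gE (Pf p e) (h 1%N)) + gE r (h 1%N) - Ex gam t.
  have -> : Ex gam (fun x => h 0%N (x + (D e).[x])) = Ex gam t + Ex gam sm.
    by rewrite -ExD//; apply: eq_Ex => x; rewrite tE.
  rewrite Esm /r -(scaleN1r (Gam p (D e))).
  rewrite (gED _ _ (mh 1%N p0) (fun x => hB 1%N x p0)) (gEZ _ _ (mh 1%N p0) (fun x => hB 1%N x p0)).
  ring.
rewrite (le_trans (ler_normB _ _))// !mulrDl lerD// (le_trans (ler_normD _ _))// lerD//.
Qed.

End Edgeworth.

(** * Smooth interpolation of separated sequences *)

Section Step.
Context {R : realType}.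
Implicit Types (f g : R -> R) (x y : R) (n m k p : nat).

(** A quadratic error bound gives differentiability at all points at once, including the kink of |x|
    in x |x|. *)
Lemma der_quad f g (C : R) : (forall x h, `|f (x + h) - f x - g x * h| <= C * h ^+ 2) -> der f g.
Proof.
move=> fC x.
have C0 : 0 <= C by have := le_trans (normr_ge0 _) (fC 0 1); rewrite expr1n mulr1.
have C1 : 0 < C + 1 by rewrite ltr_wpDl.
have cv : (h^-1 *: ((f \o shift x) (h *: (1 : R)) - f x)) @[h --> 0^'] --> g x.
  apply/cvgrPdist_le => e e0; near=> h.
  have h0 : h != 0 by near: h; exact: nbhs_dnbhs_neq.
  rewrite /= /shift /= [h *: 1]mulr1 [h + x]addrC.
  have -> : g x - h^-1 *: (f (x + h) - f x) = - (h^-1 * (f (x + h) - f x - g x * h)).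
    by rewrite /GRing.scale /=; field.
  rewrite normrN normrM normfV ler_pdivrMl ?normr_gt0//; apply: le_trans (fC x h) _.
  rewrite -(real_normK (num_real h)) expr2 mulrCA ler_wpM2l//.
  have : `|h| <= e / (C + 1).
    by near: h; apply: dnbhs0_le; rewrite divr_gt0.
  rewrite ler_pdivlMr// => he.
  by apply: le_trans he; rewrite mulrC ler_wpM2l// lerDl.
apply: DeriveDef; last exact/cvg_lim.
by apply/cvg_ex; exists (g x).
Unshelve. all: by end_near. Qed.

(* x_+^(n+1), which is n times continuously differentiable *)
Definition tp n x : R := x ^+ n * ((x + `|x|) / 2).

Lemma tp_der n : der (tp n.+1) (fun x => n.+2%:R * tp n x).
Proof.
have h : der (fun x => x * `|x|) (fun x => 2 * `|x|).
  apply: (@der_quad _ _ 2) => x h; have h2 := sqr_ge0 h.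
  have := sqr_ge0 x; have := sqr_ge0 (x + h).
  rewrite ler_norml; have [x0|x0] := ger0P x; have [y0|y0] := ger0P (x + h) => ? ?; apply/andP; split; nra.
have t1 : der (tp 1) (fun x => x + `|x|).
  rewrite (_ : tp 1 = fun x => 2^-1 * (x ^+ 2 + x * `|x|)); last first.
    by apply/funext => x; rewrite /tp expr1; field.
  apply: eq_der (derZ 2^-1 (derD (derX 2 der_id) h)) _ => x /=.
  by rewrite expr1; field.
elim: n => [|n IH].
  by apply: eq_der t1 _ => x; rewrite /tp expr0 mul1r mulrCA divff// mulr1.
rewrite (_ : tp n.+2 = fun x => id x * tp n.+1 x); last by apply/funext => x; rewrite /tp [in LHS]exprS -mulrA.
apply: eq_der (derM der_id IH) _ => x; rewrite /tp -(natr1 n.+2) exprS; ring.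
Qed.

Lemma tp_le0 n x : x <= 0 -> tp n x = 0.
Proof. by move=> x0; rewrite /tp ler0_norm// subrr mul0r mulr0. Qed.

Lemma tp_ge0 n x : 0 <= x -> tp n x = x ^+ n.+1.
Proof. by move=> x0; rewrite /tp ger0_norm// exprSr; congr (_ * _); field. Qed.

Definition nab f x : R := f x - f (x - 1).

Lemma nab_der f g : der f g -> der (nab f) (nab g).
Proof.
move=> h; apply: derB => //.
by have := der_shift (-1) h; under eq_fun do rewrite addrC; under [X in der _ X]eq_fun do rewrite addrC.
Qed.

Lemma iter_nab_der k f g : der f g -> der (iter k nab f) (iter k nab g).
Proof. by move=> h; elim: k => //= k; exact: nab_der. Qed.

(* B-splines, as iterated differences of truncated powers *)
Definition bsp n := iter n.+1 nab (fun x => tp n x / n.+1`!%:R).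

Lemma bsp_der n : der (bsp n.+1) (nab (bsp n)).
Proof.
rewrite /bsp -iterS; apply: iter_nab_der.
apply: eq_der (derM (tp_der n) (der_cst _)) _ => x.
rewrite mulr0 addr0 [n.+2`!]factS natrM invfM mulrACA mulfV ?pnatr_eq0// mul1r.
by [].
Qed.

Lemma iter_nab_le0 k f : (forall x, x <= 0 -> f x = 0) -> forall x, x <= 0 -> iter k nab f x = 0.
Proof.
move=> h; elim: k => [|k IH] x x0 //=; first exact: h.
by rewrite /nab !IH ?subrr//; lra.
Qed.

Lemma bsp_le0 n x : x <= 0 -> bsp n x = 0.
Proof. by apply: iter_nab_le0 => y y0; rewrite tp_le0// mul0r. Qed.

(** By induction: the derivative of [bsp n.+1] is a backward difference of [bsp n], so it is
    nonnegative, and it vanishes where the latter has become constant. *)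
Lemma bsp_mono n : {homo bsp n : x y / x <= y} /\ forall x, n.+1%:R <= x -> bsp n x = bsp n n.+1%:R.
Proof.
elim: n => [|n [IH1 IH2]].
  have E x : bsp 0 x = ((x + `|x|) - (x - 1 + `|x - 1|)) / 2.
    by rewrite /bsp /= /nab /tp !expr0 !mul1r divr1 mulrBl divr1.
  split=> [x y xy|x x1]; rewrite !E.
    rewrite ler_pM2r ?invr_gt0//.
    have [? |?] := ger0P x; have [? |?] := ger0P y; have [? |?] := ger0P (x - 1); have [? |?] := ger0P (y - 1); lra.
  congr (_ / _); rewrite subrr normr0 !ger0_norm ?subr_ge0//; lra.
have h0 x : 0 <= nab (bsp n) x by rewrite subr_ge0 IH1//; lra.
split=> [x y xy|x xn].
  by apply: der_le (bsp_der n) xy _ => z _.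
apply/eqP; rewrite eq_le; apply/andP; split.
  apply: der_ge (bsp_der n) xn _ => z /andP[nz _].
  rewrite /nab !IH2 ?subrr//; move: nz; rewrite -(natr1 n.+1); lra.
by apply: der_le (bsp_der n) xn _.
Qed.

(** At 1 only the unshifted truncated power contributes to the iterated difference. *)
Lemma bsp_gt0 n : 0 < bsp n n.+1%:R.
Proof.
have [m _] := bsp_mono n.
apply: (@lt_le_trans _ _ (bsp n 1)); last by apply: m; rewrite ler1n.
have h k f : (forall x, x <= 0 -> f x = 0) -> iter k nab f 1 = f 1.
  move=> f0; elim: k => //= k; rewrite /nab => ->.
  by rewrite (iter_nab_le0 k f0) ?subr0// subrr.
rewrite /bsp h => [|x x0]; last by rewrite tp_le0// mul0r.
by rewrite tp_ge0// expr1n divr_gt0// ltr0n fact_gt0.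
Qed.

Lemma iter_nab_bound k f B : (forall x, `|f x| <= B) -> forall x, `|iter k nab f x| <= 2 ^+ k * B.
Proof.
move=> h; elim: k => [|k IH] x; first by rewrite expr0 mul1r.
by rewrite /= /nab (le_trans (ler_normB _ _))// exprS -mulrA mulr_natl mulr2n lerD.
Qed.

Lemma iter_nab_cst k f (m c : R) : (forall x, m <= x -> f x = c) ->
  forall x, m + k.+1%:R <= x -> iter k.+1 nab f x = 0.
Proof.
move=> h; elim: k => [|k IH] x mx.
  by rewrite /= /nab !h ?subrr//; lra.
rewrite iterS /nab !IH ?subrr//; move: mx; rewrite -(natr1 k.+1); lra.
Qed.

(** [bsp p], rescaled from [0, p + 1] to [0, 1] and divided by its final value; the k-th derivative
    is a k-fold difference of [bsp (p - k)]. *)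
Lemma smooth_step p : exists (S : nat -> R -> R) (B : R), [/\ jet p S, continuous (S p),
  forall k x, `|S k x| <= B,
  (forall x, x <= 0 -> S 0%N x = 0) /\ (forall x, 1 <= x -> S 0%N x = 1) &
  (forall x, 0 <= S 0%N x <= 1) /\
  forall k x, (0 < k <= p)%N -> x <= 0 \/ 1 <= x -> S k x = 0].
Proof.
pose N := p.+1; pose kap := bsp p N%:R.
have k0 : 0 < kap := bsp_gt0 p.
have N0 : 0 < N%:R :> R by rewrite ltr0n.
pose V k := iter k nab (bsp (p - k)).
pose S k x := if (k <= p)%N then N%:R ^+ k * V k (N%:R * x) / kap else 0.
have bb n x : `|bsp n x| <= bsp n n.+1%:R.
  have [m c] := bsp_mono n; have b0 : 0 <= bsp n x.
    have [x0|x0] := leP x 0; first by rewrite bsp_le0.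
    by rewrite -(bsp_le0 n (lexx 0)) m// ltW.
  by rewrite ger0_norm//; have [x0|/ltW x0] := leP x n.+1%:R; [exact: m|rewrite c].
pose B := \sum_(k < p.+1) `|N%:R ^+ k / kap| * (2 ^+ k * bsp (p - k) (p - k).+1%:R).
exists S, B; split.
- move=> k kp; rewrite /S kp ltnW//.
  have dV : der (V k) (V k.+1).
    rewrite /V iterSr; apply: iter_nab_der.
    have -> : (p - k = (p - k.+1).+1)%N by rewrite -subSn.
    exact: bsp_der.
  apply: eq_der (derM (derM (der_cst (N%:R ^+ k)) (der_scale N%:R dV)) (der_cst kap^-1)) _ => x.
  by rewrite mul0r add0r mulr0 addr0 exprS; ring.
- have cV : continuous (bsp 0).
    have E x : bsp 0 x = ((x + `|x|) - (x - 1 + `|x - 1|)) / 2.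
      by rewrite /bsp /= /nab /tp !expr0 !mul1r divr1 mulrBl divr1.
    rewrite (_ : bsp 0 = fun x => ((x + `|x|) - (x - 1 + `|x - 1|)) / 2); last exact/funext.
    move=> x; apply: cvgM; last exact: cvg_cst.
    apply: cvgB; first by apply: cvgD; [exact: cvg_id|exact: norm_continuous].
    have c1 : (y - 1) @[y --> x] --> x - 1 by apply: cvgB; [exact: cvg_id|exact: cvg_cst].
    by apply: cvgD => //; exact: cvg_norm.
  have cI k f : continuous f -> continuous (iter k nab f).
    move=> cf; elim: k => //= k IH x; apply: cvgB; first exact: IH.
    apply: (cvg_comp (fun y => y - 1)); last exact: IH.
    by apply: cvgB; [exact: cvg_id|exact: cvg_cst].
  rewrite /S leqnn => x; apply: cvgM; last exact: cvg_cst.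
  apply: cvgM; first exact: cvg_cst.
  apply: (cvg_comp (fun y => N%:R * y)); last by rewrite /V subnn; exact: cI.
  by apply: cvgM; [exact: cvg_cst|exact: cvg_id].
- move=> k x; have B0 : 0 <= B.
    by apply: sumr_ge0 => i _; rewrite !mulr_ge0// ltW// bsp_gt0.
  rewrite /S; case: ifP => kp; last by rewrite normr0.
  have kp' : (k < p.+1)%N by [].
  rewrite /B (bigD1 (Ordinal kp'))//= ler_wpDr//.
    by apply: sumr_ge0 => i _; rewrite !mulr_ge0// ltW// bsp_gt0.
  by rewrite mulrAC normrM ler_wpM2l// iter_nab_bound.
- rewrite /S /V /=; split=> x x0; rewrite expr0 mul1r subn0.
    by rewrite bsp_le0 ?mul0r// pmulr_rle0.
  have [_ ->] := bsp_mono p; last by rewrite ler_peMr// ltW.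
  by rewrite divff// gt_eqF.
split.
  move=> x; rewrite /S /V /= expr0 mul1r subn0; have [m c] := bsp_mono p.
  apply/andP; split.
    rewrite divr_ge0// ?(ltW k0)//.
    have [x0|x0] := leP (N%:R * x) 0; first by rewrite bsp_le0.
    by rewrite -(bsp_le0 p (lexx 0)) m// ltW.
  by rewrite ler_pdivrMr// mul1r (le_trans (ler_norm _))// bb.
move=> k x /andP[kk kp] xx; rewrite /S kp.
suff -> : V k (N%:R * x) = 0 by rewrite mulr0 mul0r.
case: xx => x0.
  by apply: iter_nab_le0 => [y|]; [exact: bsp_le0|rewrite pmulr_rle0].
have [_ c] := bsp_mono (p - k).
rewrite /V; case: k kk kp c => // k _ kp c.
apply: (iter_nab_cst c); rewrite -natrD.
have -> : ((p - k.+1).+1 + k.+1 = N)%N by rewrite addSn subnK.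
by rewrite ler_peMr// ltW.
Qed.

End Step.

(** * Interpolation between two sequences on the integers *)

Section Whitney.
Context {R : realType}.
Implicit Types (a b i j u v w : int) (r : nat) (c x : R).

Definition dist i j : nat := absz (i - j).

Lemma ball_argmax (F : int -> R) a r :
  exists w, (dist w a <= r)%N /\ forall i, (dist i a <= r)%N -> F i <= F w.
Proof.
elim: r => [|r [w [wr hw]]].
  by exists a; split=> [|i ia]; [rewrite /dist; lia|rewrite (_ : i = a)//; move: ia; rewrite /dist; lia].
pose pm (e : bool) : int := if e then a + r.+1%:Z else a - r.+1%:Z.
have hp i : (dist i a <= r.+1)%N -> [\/ (dist i a <= r)%N, i = pm true | i = pm false].
  rewrite /dist /pm => ia; have [?|?] := leqP `|i - a| r; first by constructor 1.
  by have [?|?] := leP i a; [constructor 3|constructor 2]; lia.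
have dp e : (dist (pm e) a <= r.+1)%N by case: e; rewrite /dist /pm; lia.
pose w1 := if F w <= F (pm true) then pm true else w.
have h1 : F w <= F w1 /\ F (pm true) <= F w1 /\ (dist w1 a <= r.+1)%N.
  rewrite /w1; case: (leP (F w) (F (pm true))) => h; split=> //; split=> //; first exact: ltW.
  exact: leqW.
pose w2 := if F w1 <= F (pm false) then pm false else w1.
have h2 : F w1 <= F w2 /\ F (pm false) <= F w2 /\ (dist w2 a <= r.+1)%N.
  rewrite /w2; case: (leP (F w1) (F (pm false))) => h; split=> //; split=> //; first exact: ltW.
  by case: h1 => _ [].
exists w2; split; first by case: h2 => _ [].
move=> i /hp[ir|->|->].
- by apply: le_trans (hw i ir) _; apply: le_trans h2.1; exact: h1.1.
- by apply: le_trans h2.1; exact: h1.2.1.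
- exact: h2.2.1.
Qed.

Variable p : nat.
Hypothesis p0 : (0 < p)%N.

Section Node.
Variables f g : int -> R.
Hypothesis hfg : forall i j, f i - g j <= (dist i j)%:R ^+ p.

(* c separates f and g at distance less than r of a, and no constant does so up to distance r;
   hence c may vary by O(r^p) when a moves by a quarter of r, at the price of a
   bounded p-th derivative. *)
Definition node a r c := [/\ (0 < r)%N, forall i, (dist i a < r)%N -> f i <= c <= g i &
  exists u v, [/\ (dist u a <= r)%N, (dist v a <= r)%N, g v < f u &
    `|c - g v| <= (2 * r)%:R ^+ p]].

Lemma fg_le i : f i <= g i.
Proof.
have := hfg i i; rewrite /dist (_ : `|i - i|%N = 0%N); last by lia.
by rewrite expr0n gtn_eqF// subr_le0.
Qed.

Lemma pow_dist i j n : (dist i j <= n)%N -> f i - g j <= n%:R ^+ p.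
Proof. by move=> h; apply: le_trans (hfg i j) _; rewrite lerXn2r ?nnegrE// ler_nat. Qed.

(** r is the least radius at which some g v falls below some f u. The value c is g v itself if that
    separates f and g inside the ball, and otherwise the maximum of f or the minimum of g there;
    either way it differs from g v by the cost of a distance at most 2 r. *)
Lemma node_ex a : (exists u v, g v < f u) -> exists r c, node a r c.
Proof.
move=> [u0 [v0 uv0]].
pose P r := `[< exists u v, [/\ (dist u a <= r)%N, (dist v a <= r)%N & g v < f u] >].
have exP : exists r, P r.
  exists (maxn (dist u0 a) (dist v0 a)); apply/asboolP; exists u0, v0.
  by rewrite leq_maxl leq_maxr.
case: (ex_minnP exP) => r /asboolP[u [v [ur vr uv]]] rmin.
have r0 : (0 < r)%N.
  case: r ur vr {rmin} => // ur vr.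
  have e : u = v by move: ur vr; rewrite /dist; lia.
  by move: uv; rewrite e ltNge fg_le.
have below i j : (dist i a < r)%N -> (dist j a < r)%N -> f i <= g j.
  move=> ir jr; rewrite leNgt; apply/negP => ij.
  have : (r <= r.-1)%N by apply: rmin; apply/asboolP; exists i, j; split=> //; rewrite -ltnS prednK.
  by rewrite leqNgt prednK// leqnn.
have pr i : (dist i a < r)%N = (dist i a <= r.-1)%N by rewrite -[RHS]ltnS prednK.
have d2 i j : (dist i a <= r)%N -> (dist j a <= r)%N -> (dist i j <= 2 * r)%N.
  by rewrite /dist; lia.
have P0 : 0 <= (2 * r)%:R ^+ p :> R by rewrite exprn_ge0.
have [w [wr hw]] := ball_argmax f a r.-1; rewrite -pr in wr.
have [w' [wr' hw']] := ball_argmax (fun i => - g i) a r.-1; rewrite -pr in wr'.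
have [h1|h1] := leP (f w) (g v); last first.
  exists r, (f w); split=> //.
    by move=> i ir; rewrite hw -?pr//= below.
  exists u, v; split=> //; rewrite gtr0_norm ?subr_gt0//.
  by apply: pow_dist; apply: d2 => //; exact: ltnW.
have [h2|h2] := leP (g v) (g w'); last first.
  exists r, (g w'); split=> //.
    by move=> i ir; rewrite below//= -lerN2 hw' -?pr.
  exists u, v; split=> //; rewrite ltr0_norm ?subr_lt0// opprB.
  apply: le_trans (_ : f u - g w' <= _); first by rewrite lerD2r ltW.
  by apply: pow_dist; apply: d2 => //; exact: ltnW.
exists r, (g v); split=> //.
  move=> i ir; apply/andP; split; first by apply: le_trans h1; rewrite hw -?pr.
  by apply: le_trans h2 _; rewrite -lerN2 hw' -?pr.
by exists u, v; split=> //; rewrite subrr normr0.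
Qed.

(** The pair that defeats separation around a lies within r + dist b a of b, so the radius is
    1-Lipschitz in the centre. *)
Lemma node_radius a b r r' c c' : node a r c -> node b r' c' -> (r' <= r + dist b a)%N.
Proof.
move=> [_ _ [u [v [ur vr uv _]]]] [_ h _]; rewrite leqNgt; apply/negP => lt.
have /andP[h1 _] : f u <= c' <= g u by apply: h; move: ur lt; rewrite /dist; lia.
have /andP[_ h2] : f v <= c' <= g v by apply: h; move: vr lt; rewrite /dist; lia.
by move: uv; rewrite ltNge (le_trans h1).
Qed.

(** From g v < f u <= g v' + M^p and its mirror image, g v and g v' differ by at most M^p; comparing
    c with g v and c' with g v' accounts for the other two units. *)
Lemma node_close a b r r' c c' M : node a r c -> node b r' c' ->
  (2 * r <= M)%N -> (2 * r' <= M)%N -> (r + r' + dist b a <= M)%N -> `|c - c'| <= 3 * M%:R ^+ p.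
Proof.
move=> [_ _ [u [v [ur vr uv cv]]]] [_ _ [u' [v' [ur' vr' uv' cv']]]] M1 M2 M3.
have mono (k : nat) : (k <= M)%N -> k%:R ^+ p <= M%:R ^+ p :> R.
  by move=> kM; rewrite lerXn2r ?nnegrE// ler_nat.
have k1 : f u' - g v <= M%:R ^+ p.
  by apply: pow_dist; move: vr ur' M3; rewrite /dist; clear; lia.
have k2 : f u - g v' <= M%:R ^+ p.
  by apply: pow_dist; move: vr' ur M3; rewrite /dist; clear; lia.
have e1 := le_trans cv (mono _ M1); have e2 := le_trans cv' (mono _ M2).
move: e1 e2 k1 k2 uv uv'; rewrite !ler_norml.
by move: (M%:R ^+ p) => Z; move: (f u) (g v) (f u') (g v') => A B C D; clear; lra.
Qed.

Variables (S : nat -> R -> R) (BS : R).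
Hypothesis jS : jet p S.
Hypothesis cS : continuous (S p).
Hypothesis bS : forall k x, `|S k x| <= BS.
Hypothesis S_lo : forall x, x <= 0 -> S 0%N x = 0.
Hypothesis S_hi : forall x, 1 <= x -> S 0%N x = 1.
Hypothesis S_01 : forall x, 0 <= S 0%N x <= 1.
Hypothesis S_out : forall k x, (0 < k <= p)%N -> x <= 0 \/ 1 <= x -> S k x = 0.
Variable n : int.
Hypothesis fn : forall i, n <= i -> f i = f n.
Hypothesis gn : forall i, n <= i -> g i = g n.

(** [node_close] applied at 16 times the step length L of the construction, the radii being at most
    5 L. *)
Let C2 : R := 3 * 16 ^+ p.
Let C1 : R := C2 * BS.

Lemma near_ge a i x : a%:~R <= x -> `|x - i%:~R| <= 1 / 2 -> a <= i.
Proof.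
move=> ax; rewrite ler_norml => /andP[h1 h2].
by rewrite -ltzD1 -(ltr_int R) rmorphD/=; lra.
Qed.

Lemma near_le a i x : x <= a%:~R -> `|x - i%:~R| <= 1 / 2 -> i <= a.
Proof.
move=> ax; rewrite ler_norml => /andP[h1 h2].
by rewrite -ltzD1 -(ltr_int R) rmorphD/=; lra.
Qed.

(** From the node at a the construction moves right by about a quarter of the radius, to a node with
    value c', and joins c to c' by a smooth step of that width L. Its p-th derivative is of order |c
    - c'| L^-p, which is bounded. N bounds the number of steps left before n, where f and g become
    constant. *)
Lemma whitney_right N a r c : node a r c -> n <= a + N%:Z -> exists h : nat -> R -> R,
  [/\ jet p h, continuous (h p), exists B, forall k x, `|h k x| <= B,
    forall x, `|h p x| <= C1 &
    (forall x, x <= a%:~R -> h 0%N x = c /\ forall k, (0 < k <= p)%N -> h k x = 0) /\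
    forall i x, a%:~R <= x -> `|x - i%:~R| <= 1 / 2 -> f i - C2 <= h 0%N x <= g i + C2].
Proof.
have BS0 : 0 <= BS := le_trans (normr_ge0 _) (bS 0 0).
have C20 : 0 <= C2 by rewrite mulr_ge0// exprn_ge0.
have C10 : 0 <= C1 by rewrite mulr_ge0.
elim: N a r c => [|N IH] a r c na.
  rewrite addr0 => an; exists (fun k x => if k is 0%N then c else 0); split.
  - by case=> [|k] _; exact: der_cst.
  - by case: p p0 => // q _ x; exact: cvg_cst.
  - by exists `|c| => -[|k] x; rewrite ?normr0.
  - by case: p p0 => // q _ x; rewrite normr0.
  split; first by move=> x _; split=> // -[|k].
  move=> i x ax xi; have ai := near_ge ax xi.
  have [r0 h _] := na; have := h a; rewrite /dist subrr => /(_ r0).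
  rewrite (fn an) (gn an) -(fn (le_trans an ai)) -(gn (le_trans an ai)).
  by move=> /andP[h1 h2]; move: C20 h1 h2; move: C2 => Z Z0 h1 h2; apply/andP; split; lra.
move=> nN; have [r0 hin viol] := na.
(* The quarter of r rounded up, so that L <= r <= 4 L and L is positive. *)
pose L := (r.-1 %/ 4).+1; pose b := a + L%:Z.
have Lr : (L <= r)%N by rewrite /L; move: r0; clear; lia.
have rL : (r <= 4 * L)%N by rewrite /L; move: r0; clear; lia.
have dba : dist b a = L by rewrite /dist /b; lia.
have dab : dist a b = L by rewrite /dist /b; lia.
have [r' [c' nb]] : exists r' c', node b r' c'.
  by apply: node_ex; case: viol => u [v [_ _ uv _]]; exists u, v.
have nb' : n <= b + N%:Z by move: nN; rewrite /b /L; clear; lia.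
have [h' [jh ch [B' bh] ph [h'a h'i]]] := IH b r' c' nb nb'.
have rr' := node_radius na nb; have r'r := node_radius nb na; rewrite dba in rr'; rewrite dab in r'r.
have cc : `|c - c'| <= C2 * L%:R ^+ p.
  have := node_close (M := 16 * L) na nb; rewrite dba natrM exprMn mulrA.
  by apply; move: Lr rL rr'; clear; lia.
have L0 : 0 < L%:R :> R by rewrite ltr0n.
have bE : b%:~R = a%:~R + L%:R :> R by rewrite /b intrD.
pose s x := (x - a%:~R) / L%:R.
have s_lo x : x <= a%:~R -> s x <= 0 by move=> xa; rewrite pmulr_lle0 ?invr_gt0// subr_le0.
have s_hi x : b%:~R <= x -> 1 <= s x.
  by move=> xb; rewrite ler_pdivlMr// mul1r lerBrDl -bE.
have ds : der s (fun=> L%:R^-1).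
  by apply: eq_der (derM (derB der_id (der_cst a%:~R)) (der_cst L%:R^-1)) _ => x; ring.
(* Equal to c to the left of a, where h' is still c', and to h' to the right of b. *)
pose h k x := h' k x + (if k is 0%N then c - c' else 0) - (c - c') * (L%:R^-1 ^+ k * S k (s x)).
exists h; split.
- move=> k kp; rewrite /h.
  apply: eq_der (derB (derD (jh k kp) (der_cst (if k is 0%N then c - c' else 0)))
    (derZ (c - c') (derZ (L%:R^-1 ^+ k) (der_comp (jS kp) ds)))) _ => x.
  by rewrite addr0 exprSr; ring.
- move=> x; rewrite /h; apply: cvgB; first by apply: cvgD; [exact: ch|exact: cvg_cst].
  apply: cvgM; first exact: cvg_cst.
  apply: cvgM; first exact: cvg_cst.
  by apply: (cvg_comp s); [exact: der_cont ds x|exact: cS].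
- exists (B' + `|c - c'| + `|c - c'| * BS) => k x.
  rewrite /h (le_trans (ler_normB _ _))// lerD ?(le_trans (ler_normD _ _))// ?lerD//.
    by case: k; rewrite ?normr0.
  rewrite normrM ler_wpM2l// normrM normrX -[leRHS]mul1r ler_pM//.
  by rewrite exprn_ile1// ger0_norm ?invr_ge0 ?ler0n// invf_le1// ler1n.
- move=> x; rewrite /h (_ : (if p is 0%N then c - c' else 0) = 0) ?addr0; last by case: p p0.
  have [xb|/ltW xb] := leP x b%:~R; last first.
    by rewrite S_out ?p0 ?leqnn//; [rewrite !mulr0 subr0|right; exact: s_hi].
  have [_ ->] := h'a x xb; last by rewrite p0 leqnn.
  rewrite sub0r normrN normrM normrM normrX.
  apply: (@le_trans _ _ (C2 * L%:R ^+ p * (L%:R^-1 ^+ p * BS))).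
    rewrite ler_pM ?mulr_ge0// ler_pM// ger0_norm ?invr_ge0//.
  by rewrite mulrA -(mulrA C2) -exprMn mulfV ?gt_eqF// expr1n mulr1.
split.
  move=> x xa; have xb : x <= b%:~R by rewrite bE (le_trans xa)// lerDl.
  have [e0 ek] := h'a x xb; rewrite /h; split.
    by rewrite e0 S_lo ?s_lo// !mulr0 subr0 addrC subrK.
  move=> k kp; rewrite ek// S_out//; last by left; exact: s_lo.
  by case: k kp => //= k _; rewrite !mulr0 subr0 addr0.
move=> i x ax xi; have [xb|/ltW xb] := leP x b%:~R; last first.
  by rewrite /h S_hi ?s_hi// expr0 mul1r mulr1 addrK; exact: h'i.
have [e0 _] := h'a x xb.
have ai := near_ge ax xi; have ib := near_le xb xi.
rewrite /h e0 expr0 mul1r; set t := S 0%N (s x).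
have /andP[t0 t1] : 0 <= t <= 1 := S_01 (s x).
have -> : c' + (c - c') - (c - c') * t = c + (c' - c) * t by ring.
(* For r >= 3 the stretch from a to b lies strictly inside both balls, so c, c' and all values
   between them separate f and g. For smaller r only the sites a and b occur, and the loss is at
   most |c - c'| <= [C2]. *)
have [r3|r3] := leqP 3 r.
  have /andP[a1 a2] : f i <= c <= g i.
    by apply: hin; move: ai ib r3; rewrite /dist /b /L; clear; lia.
  have /andP[b1 b2] : f i <= c' <= g i.
    have [_ + _] := nb; apply; move: ai ib r3 r'r; rewrite /dist /b /L; clear; lia.
  by apply/andP; split; nra.
have L1 : L = 1%N by rewrite /L; move: r3; clear; lia.
have /andP[a1 a2] : f a <= c <= g a by apply: hin; rewrite /dist subrr.
have /andP[b1 b2] : f b <= c' <= g b.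
  by have [r'0 + _] := nb; apply; rewrite /dist subrr.
have cc2 : `|c - c'| <= C2 by move: cc; rewrite L1 expr1n mulr1.
have cc3 : - C2 <= c - c' <= C2 by rewrite -ler_norml.
have [-> | ->] : i = a \/ i = b by move: ai ib; rewrite /b L1; clear; lia.
  by apply/andP; split; nra.
by apply/andP; split; nra.
Qed.

End Node.

(** Two one-sided constructions start from a node at 0 and are joined there; both are flat at 0,
    hence the vanishing derivatives. A node fails to exist only if a constant separates f from g,
    and then the maximum of f will do. *)
Theorem whitney : exists C1 C2 : R, [/\ 0 <= C1, 0 <= C2 &
  forall (f g : int -> R) (n : nat), (forall i j, f i - g j <= (dist i j)%:R ^+ p) ->
  (forall i, n%:Z <= i -> f i = f n%:Z /\ g i = g n%:Z) ->
  (forall i, i <= - n%:Z -> f i = f (- n%:Z) /\ g i = g (- n%:Z)) ->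
  exists h : nat -> R -> R, [/\ jet p h, continuous (h p), exists B, forall k x, `|h k x| <= B,
    forall x, `|h p x| <= C1 & (forall k, (0 < k <= p)%N -> h k 0 = 0) /\
    forall i x, `|x - i%:~R| <= 1 / 2 -> f i - C2 <= h 0%N x <= g i + C2]].
Proof.
have [S [BS [jS cS bS [Slo Shi] [S01 Sout]]]] := @smooth_step R p.
have BS0 : 0 <= BS := le_trans (normr_ge0 _) (bS 0%N 0).
have C20 : 0 <= 3 * 16 ^+ p :> R by rewrite mulr_ge0// exprn_ge0.
exists (3 * 16 ^+ p * BS), (3 * 16 ^+ p); split=> //; first exact: mulr_ge0.
move=> f g n fg hn hm.
have [viol|nv] := pselect (exists u v, g v < f u); last first.
  have [w [wn hw]] := ball_argmax f 0 n.
  have le i : f i <= f w.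
    have [ni|ni] := leP n%:Z i; first by rewrite (hn i ni).1; apply: hw; rewrite /dist; clear; lia.
    have [ni'|ni'] := leP i (- n%:Z); first by rewrite (hm i ni').1; apply: hw; rewrite /dist; clear; lia.
    by apply: hw; move: ni ni'; rewrite /dist; clear; lia.
  exists (fun k x => if k is 0%N then f w else 0); split.
  - by case=> [|k] _; exact: der_cst.
  - by case: p p0 => // q _ x; exact: cvg_cst.
  - by exists `|f w| => -[|k] x; rewrite ?normr0.
  - by move=> x; case: p p0 => // q _; rewrite normr0 !mulr_ge0// exprn_ge0.
  split; first by case.
  move=> i x _; have h1 := le i.
  have h2 : f w <= g i by rewrite leNgt; apply/negP => h; apply: nv; exists w, i.
  by move: C20 h1 h2; move: (3 * _) => Z Z0 h1 h2; apply/andP; split; lra.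
have [r [c nd]] := node_ex fg 0 viol.
pose f' i := f (- i); pose g' i := g (- i).
have fg' i j : f' i - g' j <= (dist i j)%:R ^+ p.
  by rewrite (_ : dist i j = dist (- i) (- j)) ?fg// /dist; clear; lia.
have nd' : node f' g' 0 r c.
  have [r0 hin [u [v [ur vr uv cv]]]] := nd; split=> //.
    by move=> i ir; apply: hin; move: ir; rewrite /dist; clear; lia.
  exists (- u), (- v); rewrite /f' /g' !opprK; split=> //.
    by move: ur; rewrite /dist; clear; lia.
  by move: vr; rewrite /dist; clear; lia.
have n0 : n%:Z <= 0 + n%:Z by rewrite add0r.
have [h1 [j1 c1 [B1 b1] t1 [a1 i1]]] := whitney_right fg jS cS bS Slo Shi S01 Sout
  (fun i ni => (hn i ni).1) (fun i ni => (hn i ni).2) nd n0.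
have hm' i : n%:Z <= i -> f' i = f' n%:Z /\ g' i = g' n%:Z.
  by move=> ni; apply: hm; rewrite lerN2.
have [h2 [j2 c2 [B2 b2] t2 [a2 i2]]] := whitney_right fg' jS cS bS Slo Shi S01 Sout
  (fun i ni => (hm' i ni).1) (fun i ni => (hm' i ni).2) nd' n0.
pose h k x := h1 k x + (-1) ^+ k * h2 k (- x) - (if k is 0%N then c else 0).
have pp : (0 < p <= p)%N by rewrite p0 leqnn.
have hp x : h p x = h1 p x + (-1) ^+ p * h2 p (- x) by rewrite /h; case: p p0 => // q _; rewrite subr0.
exists h; split.
- move=> k kp.
  have d2 : der (fun x => h2 k (- x)) (fun x => -1 * h2 k.+1 (- x)).
    have := der_scale (-1) (j2 k kp); under eq_fun do rewrite mulN1r.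
    by under [X in der _ X]eq_fun do rewrite [in h2 _ _]mulN1r.
  apply: eq_der (derB (derD (j1 k kp) (derZ ((-1) ^+ k) d2)) (der_cst (if k is 0%N then c else 0))) _ => x.
  by rewrite /h exprSr; ring.
- move=> x; rewrite (_ : h p = fun x => h1 p x + (-1) ^+ p * h2 p (- x)); last exact/funext.
  apply: cvgD; first exact: c1.
  apply: cvgM; first exact: cvg_cst.
  by apply: (cvg_comp -%R); [apply: cvgN; exact: cvg_id|exact: c2].
- exists (B1 + B2 + `|c|) => k x; rewrite /h (le_trans (ler_normB _ _))// lerD//.
    by rewrite (le_trans (ler_normD _ _))// lerD// normrM normrX normrN1 expr1n mul1r.
  by case: k; rewrite ?normr0.
- move=> x; rewrite hp; have [x0|/ltW x0] := leP x 0.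
    by have [_ ->] := a1 x x0; rewrite // add0r normrM normrX normrN1 expr1n mul1r.
  have x0' : - x <= 0%:~R by rewrite oppr_le0.
  by have [_ ->] := a2 _ x0'; rewrite // mulr0 addr0.
split.
  move=> k kp; rewrite /h oppr0; have [_ ->//] := a1 0 (lexx _); have [_ ->//] := a2 0 (lexx _).
  by rewrite mulr0 addr0 sub0r; case: k kp => // k _; rewrite oppr0.
move=> i x xi; rewrite /h expr0 mul1r; have [x0|/ltW x0] := leP x 0.
  have [-> _] := a1 x x0.
  have xx : 0%:~R <= - x by rewrite oppr_ge0.
  have xi' : `|- x - (- i)%:~R| <= 1 / 2 by rewrite rmorphN/= opprK -normrN opprD opprK.
  have := i2 (- i) (- x) xx xi'; rewrite /f' /g' opprK.
  by rewrite addrAC subrr add0r.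
have x0' : - x <= 0%:~R by rewrite oppr_le0.
by have [-> _] := a2 _ x0'; rewrite addrK; exact: i1.
Qed.

End Whitney.

From mathcomp Require Import zify.

(** * Optimal transport on the line *)

Section MonotoneCoupling.
Context {R : realType}.
Implicit Types (i j k n a : nat) (x y : R).

Lemma pow_tangent p x y : 0 <= x -> 0 <= y ->
  x ^+ p.+1 + p.+1%:R * x ^+ p * (y - x) <= y ^+ p.+1.
Proof.
move=> x0 y0; elim: p => [|p IH]; first by rewrite expr0 !expr1; lra.
have := ler_wpM2l y0 IH; rewrite -exprS; apply: le_trans.
have : 0 <= p.+1%:R * x ^+ p * (y - x) ^+ 2 by apply: mulr_ge0 (sqr_ge0 _); rewrite mulr_ge0 ?exprn_ge0.
rewrite -(natr1 p.+1) !exprS expr0; lra.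
Qed.

Lemma pow_convex p x : (0 < p)%N -> 2 * `|x| ^+ p <= `|x + 1| ^+ p + `|x - 1| ^+ p.
Proof.
case: p => // p _; wlog x0 : x / 0 <= x.
  move=> H; have [|x0] := leP 0 x; first exact: H.
  have := H (- x); rewrite normrN -(normrN (- x + 1)) -(normrN (- x - 1)) !opprD !opprK addrC.
  by rewrite (addrC (`|_| ^+ _)); apply; rewrite oppr_ge0 ltW.
rewrite (ger0_norm x0) (ger0_norm (addr_ge0 x0 ler01)).
have h1 := @pow_tangent p x (x + 1) x0 (addr_ge0 x0 ler01).
have h2 := @pow_tangent p x `|x - 1| x0 (normr_ge0 _).
have h3 : - (p.+1%:R * x ^+ p) <= p.+1%:R * x ^+ p * (`|x - 1| - x).
  rewrite -[leLHS]mulrN1 ler_wpM2l ?mulr_ge0 ?exprn_ge0//.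
  by have := lerB_dist x 1; rewrite (ger0_norm x0) normr1; lra.
lra.
Qed.

(** Convexity of the cost makes its increments in the first variable decrease in the second. *)
Lemma pow_monge p i a a' : (0 < p)%N -> (a <= a')%N ->
  `|i.+1%:R - a'%:R| ^+ p - `|i%:R - a'%:R| ^+ p <=
  `|i.+1%:R - a%:R| ^+ p - `|i%:R - a%:R| ^+ p :> R.
Proof.
move=> p0 /subnKC <-; elim: (a' - a)%N => [|m IH]; first by rewrite addn0.
apply: le_trans IH; rewrite addnS -!natr1.
have := @pow_convex p (i%:R - (a + m)%:R) p0.
rewrite (_ : i%:R - (_ + m)%:R - 1 = i%:R - ((a + m)%:R + 1)); last by ring.
rewrite (_ : i%:R + 1 - ((a + m)%:R + 1) = i%:R - (a + m)%:R); last by ring.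
rewrite (_ : i%:R - (_ + m)%:R + 1 = i%:R + 1 - (a + m)%:R); last by ring.
lra.
Qed.

Variables (n : nat) (mu nu : nat -> R) (cst : nat -> nat -> R).
Hypothesis mu0 : forall i, 0 <= mu i.
Hypothesis nu0 : forall i, 0 <= nu i.
Hypothesis mass : \sum_(i < n) mu i = \sum_(i < n) nu i.
Hypothesis monge : forall i a a', (a <= a')%N ->
  cst i.+1 a' - cst i a' <= cst i.+1 a - cst i a.

Let F i := \sum_(k < i) mu k.
Let G j := \sum_(k < j) nu k.
(** The joint distribution function of the quantile coupling; its mixed differences [pim] are the
    point masses. *)
Let H i j := Num.min (F i) (G j).
Let pim i j := H i.+1 j.+1 - H i j.+1 - H i.+1 j + H i j.

Let F_le i i' : (i <= i')%N -> F i <= F i'.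
Proof.
move=> /subnKC <-; elim: (i' - i)%N => [|m IH]; first by rewrite addn0.
by rewrite addnS /F big_ord_recr/= (le_trans IH)// lerDl.
Qed.

Let G_le i i' : (i <= i')%N -> G i <= G i'.
Proof.
move=> /subnKC <-; elim: (i' - i)%N => [|m IH]; first by rewrite addn0.
by rewrite addnS /G big_ord_recr/= (le_trans IH)// lerDl.
Qed.

Let FS i : F i.+1 = F i + mu i. Proof. by rewrite /F big_ord_recr. Qed.
Let GS i : G i.+1 = G i + nu i. Proof. by rewrite /G big_ord_recr. Qed.

Let pim_ge0 i j : 0 <= pim i j.
Proof.
rewrite /pim /H FS GS; have := mu0 i; have := nu0 j.
move: (F i) (G j) (mu i) (nu j) => A B a b b0 a0.
have [?|?] := leP (A + a) (B + b); have [?|?] := leP A (B + b);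
have [?|?] := leP (A + a) B; have [?|?] := leP A B; lra.
Qed.

Let pim_supp i j : pim i j != 0 -> F i < G j.+1 /\ G j < F i.+1.
Proof.
move=> pn; split; rewrite ltNge; apply/negP => h; move: pn; rewrite /pim /H.
  have h1 := F_le (leqnSn i); have h2 := G_le (leqnSn j).
  rewrite (min_r h) (min_r (le_trans h h1)) (min_r (le_trans h2 h)) (min_r (le_trans (le_trans h2 h) h1)).
  by move/negP; apply; apply/eqP; ring.
have h1 := F_le (leqnSn i); have h2 := G_le (leqnSn j).
rewrite (min_l h) (min_l (le_trans h h2)) (min_l (le_trans h1 h)) (min_l (le_trans (le_trans h1 h) h2)).
by move/negP; apply; apply/eqP; ring.
Qed.

Let telescope_ord (u : nat -> R) m : \sum_(k < m) (u k.+1 - u k) = u m - u 0%N.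
Proof. by elim: m => [|m IH]; rewrite ?big_ord0 ?subrr// big_ord_recr/= IH; ring. Qed.

Let row i : (i < n)%N -> \sum_(j < n) pim i j = mu i.
Proof.
move=> ni.
have -> : \sum_(j < n) pim i j = (H i.+1 n - H i n) - (H i.+1 0 - H i 0).
  by rewrite -(telescope_ord (fun j => H i.+1 j - H i j)); apply: eq_bigr => j _; rewrite /pim; ring.
rewrite /H.
have F0 k : 0 <= F k by rewrite /F sumr_ge0.
have Fn k : (k <= n)%N -> F k <= G n by move=> kn; rewrite /G -mass; exact: F_le.
have -> : G 0 = 0 by rewrite /G big_ord0.
rewrite (min_l (Fn _ ni)) (min_l (Fn _ (ltnW ni))) !min_r// FS; ring.
Qed.

Let col j : (j < n)%N -> \sum_(i < n) pim i j = nu j.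
Proof.
move=> nj.
have -> : \sum_(i < n) pim i j = (H n j.+1 - H n j) - (H 0 j.+1 - H 0 j).
  by rewrite -(telescope_ord (fun i => H i j.+1 - H i j)); apply: eq_bigr => i _; rewrite /pim; ring.
rewrite /H.
have G0 k : 0 <= G k by rewrite /G sumr_ge0.
have Gn k : (k <= n)%N -> G k <= F n by move=> kn; rewrite /F mass; exact: G_le.
have -> : F 0 = 0 by rewrite /F big_ord0.
rewrite (min_r (Gn _ nj)) (min_r (Gn _ (ltnW nj))) !min_l// GS; ring.
Qed.

(** The column met at the mass level F k, where row k takes over from row k - 1, or n if there is
    none. The dual potential grows from row to row by the cost increment in this column. *)
Let ac k := find (fun j => F k < G j.+1) (iota 0 n).

Let ac_le k j : (j < n)%N -> F k < G j.+1 -> (ac k <= j)%N.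
Proof.
move=> jn h; rewrite leqNgt; apply/negP => ja.
by have := before_find 0%N ja; rewrite nth_iota ?add0n ?h.
Qed.

Let ac_ge k j : (j < n)%N -> G j < F k -> (j <= ac k)%N.
Proof.
move=> jn h; rewrite leqNgt; apply/negP => ja.
have an : (ac k < n)%N by exact: ltn_trans jn.
have : has (fun j => F k < G j.+1) (iota 0 n) by rewrite has_find size_iota.
move/(nth_find 0%N); rewrite -/(ac k) nth_iota// add0n ltNge => /negP; apply.
by rewrite (le_trans _ (ltW h))// G_le.
Qed.

Let f i := \sum_(k < i) (cst k.+1 (ac k.+1) - cst k (ac k.+1)).

(** After row i the columns [ac] are at least j, before it at most j. The Monge property then makes
    f - cst(., j) decrease away from i on both sides. *)
Let f_opt i j : (i < n)%N -> (j < n)%N -> pim i j != 0 ->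
  forall k, f k - cst k j <= f i - cst i j.
Proof.
move=> ni nj /pim_supp[s1 s2].
have fS k : f k.+1 = f k + (cst k.+1 (ac k.+1) - cst k (ac k.+1)) by rewrite /f big_ord_recr.
have up m : f (i + m)%N - cst (i + m) j <= f i - cst i j.
  elim: m => [|m IH]; first by rewrite addn0.
  apply: le_trans IH; rewrite addnS fS.
  have h : (j <= ac (i + m).+1)%N.
    by apply: ac_ge => //; apply: lt_le_trans s2 _; apply: F_le; rewrite ltnS leq_addr.
  have := monge (i + m) h; lra.
have dn m : (m <= i)%N -> f (i - m)%N - cst (i - m) j <= f i - cst i j.
  elim: m => [|m IH] mi; first by rewrite subn0.
  apply: le_trans (IH (ltnW mi)).
  have e : (i - m = (i - m.+1).+1)%N by rewrite -subSn.
  rewrite e fS -e.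
  have h : (ac (i - m) <= j)%N.
    by apply: ac_le => //; apply: le_lt_trans s1; apply: F_le; exact: leq_subr.
  have := monge (i - m.+1) h; rewrite -e; lra.
move=> k; have [ik|/ltnW ki] := leqP i k; first by rewrite -(subnKC ik).
by rewrite -(subKn ki) dn// leq_subr.
Qed.

(* f and g are the Kantorovich potentials of the quantile coupling. *)
Theorem monotone_coupling : (0 < n)%N -> exists (pi : nat -> nat -> R) (f g : nat -> R),
  [/\ forall i j, 0 <= pi i j, forall i, (i < n)%N -> \sum_(j < n) pi i j = mu i,
   forall j, (j < n)%N -> \sum_(i < n) pi i j = nu j,
   forall i j, (i < n)%N -> (j < n)%N -> f i - g j <= cst i j &
   \sum_(i < n) \sum_(j < n) pi i j * cst i j = \sum_(i < n) f i * mu i - \sum_(j < n) g j * nu j].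
Proof.
move=> n0.
have max_ex j : exists i0 : 'I_n, forall i : 'I_n, f i - cst i j <= f i0 - cst i0 j.
  exists [arg max_(i > Ordinal n0) (f i - cst i j)]%O.
  by case: arg_maxP => // i _ h k; exact: h.
have [m hm] := choice max_ex.
pose g j := f (m j) - cst (m j) j.
exists pim, f, g; split; [exact: pim_ge0|exact: row|exact: col| |].
  by move=> i j ni nj; rewrite lerBlDr -lerBlDl; exact: (hm j (Ordinal ni)).
have E (i j : 'I_n) : pim i j * cst i j = pim i j * f i - pim i j * g j.
  rewrite -mulrBr; have [->|pn] := eqVneq (pim i j) 0; first by rewrite !mul0r.
  congr (_ * _); have h1 := f_opt (ltn_ord i) (ltn_ord j) pn (m j).
  have h2 := hm j i; rewrite /g; lra.
under eq_bigr do under eq_bigr do rewrite E.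
under eq_bigr do rewrite big_split /= sumrN.
rewrite big_split /= sumrN; congr (_ - _).
  by apply: eq_bigr => i _; rewrite -mulr_suml row// mulrC.
rewrite exchange_big /=; apply: eq_bigr => j _.
by rewrite -mulr_suml col// mulrC.
Qed.

End MonotoneCoupling.

(** * Couplings with prescribed cell masses *)

Section FiniteCoupling.
Context {d1 d2 : measure_display} {T1 : measurableType d1} {T2 : measurableType d2} {R : realType}.
Variables (P1 : probability T1 R) (P2 : probability T2 R).

Lemma fineP {d} {T : measurableType d} (P : probability T R) A : measurable A ->
  P A = (fine (P A))%:E.
Proof. by move=> mA; rewrite fineK// fin_num_measure. Qed.

Lemma cell_sum {d} {T : measurableType d} (P : probability T R) (n : nat) (I : T -> nat) A :
  (forall i, measurable (I @^-1` [set i])) -> (forall x, (I x < n)%N) -> measurable A ->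
  \sum_(i < n) fine (P (A `&` I @^-1` [set i : nat])) = fine (P A).
Proof.
move=> mI In mA.
have mAI i : measurable (A `&` I @^-1` [set i]) by exact: measurableI.
under eq_bigr do rewrite -(Ex_indic P (mAI _)).
rewrite -Ex_sum; last by move=> i; exact: integ_indic.
rewrite -Ex_indic//; apply: eq_Ex => x.
rewrite (bigD1 (Ordinal (In x)))//= big1 ?addr0 => [|i ix].
  by rewrite !indicE in_setI [X in _ && X]mem_set ?andbT.
rewrite indicE in_setI [X in _ && X]memNset ?andbF//= => xi.
by move/eqP: ix; apply; apply: val_inj.
Qed.

(** Dividing by cell masses is harmless: a cell of mass 0 receives no weight from [pi]. *)
Lemma marginal_sum {d} {T : measurableType d} (P : probability T R) (n : nat) (I : T -> nat) A
    (pi : nat -> nat -> R) (nu : nat -> R) :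
  (forall i, measurable (I @^-1` [set i])) -> (forall x, (I x < n)%N) -> measurable A ->
  (forall i j, 0 <= pi i j) ->
  (forall i, (i < n)%N -> \sum_(j < n) pi i j = fine (P (I @^-1` [set i]))) ->
  (forall j, (j < n)%N -> \sum_(i < n) pi i j = nu j) ->
  \sum_(i < n) \sum_(j < n) pi i j / (fine (P (I @^-1` [set i : nat])) * nu j) *
    (fine (P (A `&` I @^-1` [set i : nat])) * nu j) = fine (P A).
Proof.
move=> mI In mA pi0 row col; rewrite -(cell_sum P mI In mA); apply: eq_bigr => i _.
have z (u : nat -> R) (k : nat) : (forall j, 0 <= u j) -> (k < n)%N -> \sum_(j < n) u j = 0 -> u k = 0.
  move=> u0 kn /eqP; rewrite psumr_eq0// => /allP/(_ (Ordinal kn)).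
  by rewrite mem_index_enum => /(_ isT)/eqP.
set m := fine (P (I @^-1` _)); set a := fine _.
have -> : \sum_(j < n) pi i j / (m * nu j) * (a * nu j) = \sum_(j < n) pi i j * (a / m).
  apply: eq_bigr => j _; have [nj|nj] := eqVneq (nu j) 0.
    have -> : pi i j = 0.
      apply: (z (fun i => pi i j)) => //.
      by rewrite col.
    by rewrite !mul0r.
  rewrite invfM; have := mulVf nj; move: (m^-1) (nu j)^-1 => u v h.
  by transitivity (pi i j * (a * u) * (v * nu j)); [ring|rewrite h mulr1].
rewrite -mulr_suml row// -/m; have [m0|m0] := eqVneq m 0; last by rewrite mulrC divfK.
have mAI : measurable (A `&` I @^-1` [set i : nat]) by exact: measurableI.
have am : a <= m by apply: fine_le; rewrite ?fin_num_measure//; apply: le_measure; rewrite ?inE.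
have a0 : 0 <= a by rewrite fine_ge0.
by rewrite m0 mul0r; apply/esym/eqP; rewrite eq_le a0 -m0 am.
Qed.

Lemma cell_disj {d} {T : measurableType d} (P : probability T R) (K : T -> nat) (a b : nat) :
  a != b -> fine (P (K @^-1` [set a] `&` K @^-1` [set b])) = 0.
Proof.
move=> ab; rewrite (_ : _ `&` _ = set0) ?measure0//.
by apply/seteqP; split=> // x [/= h1 h2]; move: ab; rewrite -h1 h2 eqxx.
Qed.

(** On each product of two cells, the product measure is rescaled to the mass [pi i j]. *)
Theorem finite_coupling (n : nat) (I : T1 -> nat) (J : T2 -> nat) (pi : nat -> nat -> R) :
  (forall i, measurable (I @^-1` [set i])) -> (forall j, measurable (J @^-1` [set j])) ->
  (forall x, (I x < n)%N) -> (forall x, (J x < n)%N) -> (forall i j, 0 <= pi i j) ->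
  (forall i, (i < n)%N -> \sum_(j < n) pi i j = fine (P1 (I @^-1` [set i]))) ->
  (forall j, (j < n)%N -> \sum_(i < n) pi i j = fine (P2 (J @^-1` [set j]))) ->
  exists g : probability (T1 * T2)%type R,
  [/\ forall A, measurable A -> g (A `*` setT) = P1 A,
      forall A, measurable A -> g (setT `*` A) = P2 A &
      forall i j, (i < n)%N -> (j < n)%N -> fine (g (I @^-1` [set i] `*` J @^-1` [set j])) = pi i j].
Proof.
move=> mI mJ In Jn pi0 row col.
pose mm i := fine (P1 (I @^-1` [set i])); pose nn j := fine (P2 (J @^-1` [set j])).
have w0 i j : 0 <= pi i j / (mm i * nn j) by rewrite divr_ge0// mulr_ge0// fine_ge0.
have mIJ i j : measurable (I @^-1` [set i] `*` J @^-1` [set j]) by exact: measurableX.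
pose g0 : {measure set (T1 * T2)%type -> \bar R} :=
  msum (fun i => msum (fun j => mscale (NngNum (w0 i j)) (mrestr (P1 \x P2)%E (mIJ i j))) n) n.
have g0E A B : measurable A -> measurable B -> g0 (A `*` B) =
    (\sum_(i < n) \sum_(j < n) pi i j / (mm i * nn j) *
      (fine (P1 (A `&` I @^-1` [set i : nat])) * fine (P2 (B `&` J @^-1` [set j : nat]))))%:E.
  move=> mA mB; rewrite /g0 /msum /= -sumEFin; apply: eq_bigr => i _.
  rewrite /msum -sumEFin; apply: eq_bigr => j _.
  have mAI : measurable (A `&` I @^-1` [set i : nat]) by exact: measurableI.
  have mBJ : measurable (B `&` J @^-1` [set j : nat]) by exact: measurableI.
  transitivity ((pi i j / (mm i * nn j))%:E *
      (P1 \x P2) ((A `&` I @^-1` [set i : nat]) `*` (B `&` J @^-1` [set j : nat])))%E.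
    by rewrite setXI.
  by rewrite product_measure1E// [RHS]EFinM; congr (_ * _)%E; rewrite EFinM !fineK ?fin_num_measure.
have marg1 A : measurable A -> g0 (A `*` setT) = P1 A.
  move=> mA; rewrite g0E// [RHS]fineP// -(marginal_sum mI In mA pi0 row col); congr (_%:E).
  by apply: eq_bigr => i _; apply: eq_bigr => j _; rewrite setTI.
have marg2 A : measurable A -> g0 (setT `*` A) = P2 A.
  move=> mA; rewrite g0E// [RHS]fineP//.
  rewrite -(@marginal_sum _ _ P2 n J A (fun j i => pi i j) mm mJ Jn mA (fun i j => pi0 j i) col row).
  congr (_%:E); rewrite exchange_big; apply: eq_bigr => i _; apply: eq_bigr => j _.
  by rewrite setTI [mm _ * _]mulrC [fine (P1 _) * _]mulrC.
have mass : g0 setT = 1%E by rewrite -setXTT marg1// probability_setT.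
(* [g0] already has mass 1; normalising only supplies the structure of a probability. *)
pose g := mnormalize g0 (P1 \x P2)%E.
have gE A : g A = g0 A.
  by rewrite /g /mnormalize /= mass /= onee_eq0 /= invr1 mule1.
exists g; split=> [A mA|A mA|i j ni nj].
- exact: etrans (gE _) (marg1 A mA).
- exact: etrans (gE _) (marg2 A mA).
transitivity (fine (g0 (I @^-1` [set i] `*` J @^-1` [set j]))).
  by apply: (congr1 (@fine R)); exact: gE.
rewrite g0E//=.
have z (u : nat -> R) (k : nat) : (forall j, 0 <= u j) -> (k < n)%N -> \sum_(j < n) u j = 0 -> u k = 0.
  move=> u0 kn /eqP; rewrite psumr_eq0// => /allP/(_ (Ordinal kn)).
  by rewrite mem_index_enum => /(_ isT)/eqP.
rewrite (bigD1 (Ordinal ni))//= [X in _ + X]big1 ?addr0 => [|k ki]; last first.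
  by rewrite big1// => l _; rewrite cell_disj ?mul0r ?mulr0// eq_sym.
rewrite (bigD1 (Ordinal nj))//= [X in _ + X]big1 ?addr0 => [|k ki]; last first.
  by rewrite [fine (P2 _)]cell_disj ?mulr0// eq_sym.
rewrite !setIid -/(mm i) -/(nn j).
have [m0|m0] := eqVneq (mm i) 0; first by rewrite m0 !mul0r mulr0 (z (pi i))// row.
have [n0|n0] := eqVneq (nn j) 0; first by rewrite n0 !mulr0 (z (fun i => pi i j))// col.
by rewrite divfK// mulf_neq0.
Qed.

End FiniteCoupling.

Section Push.
Context {d1 d2 : measure_display} {T1 : measurableType d1} {T2 : measurableType d2} {R : realType}.
Variables (g : probability T1 R) (P : probability T2 R) (phi : T1 -> T2).
Hypothesis mphi : measurable_fun setT phi.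
Hypothesis law : forall A, measurable A -> g (phi @^-1` A) = P A.

Lemma push_ge0 (u : T2 -> \bar R) : measurable_fun setT u -> (forall x, 0 <= u x)%E ->
  (\int[g]_x u (phi x) = \int[P]_x u x)%E.
Proof.
move=> mu u0; transitivity (\int[pushforward g phi]_x u x)%E.
  by rewrite (ge0_integral_pushforward mphi).
by apply: eq_measure_integral => A mA _; exact: law.
Qed.

Lemma push_integ u : integ P u -> integ g (fun x => u (phi x)).
Proof.
move=> /integrableP[mu h]; apply/integrableP; split.
  by apply/measurable_EFinP; apply: (measurableT_comp (f := u)) => //; exact/measurable_EFinP.
rewrite (push_ge0 (u := fun x => `|(u x)%:E|%E))//.
exact: measurableT_comp.
Qed.

Lemma push_Ex u : integ P u -> Ex g (fun x => u (phi x)) = Ex P u.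
Proof.
move=> Iu; have mu := integ_meas Iu.
have mE : measurable_fun setT (EFin \o u) by exact/measurable_EFinP.
rewrite /Ex /Rintegral integralE [in RHS]integralE; congr (fine (_ - _)).
  rewrite -(push_ge0 (u := (EFin \o u)^\+%E) (measurable_funepos mE)) => [|x]; last exact: funepos_ge0.
  by apply: eq_integral => x _; rewrite !funeposE.
rewrite -(push_ge0 (u := (EFin \o u)^\-%E) (measurable_funeneg mE)) => [|x]; last exact: funeneg_ge0.
by apply: eq_integral => x _; rewrite !funenegE.
Qed.

Lemma pull_integ u : measurable_fun setT u -> integ g (fun x => u (phi x)) -> integ P u.
Proof.
move=> mu /integrableP[_ h]; apply/integrableP; split; first exact/measurable_EFinP.
rewrite -(push_ge0 (u := fun x => `|(u x)%:E|%E))//.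
by apply: measurableT_comp => //; exact/measurable_EFinP.
Qed.

End Push.

Section Tail.
Context {d : measure_display} {Omega : measurableType d} {R : realType}.
Variable P : probability Omega R.

(** Dominated convergence: the indicator of |Y| >= m tends to 0 pointwise. *)
Lemma small_tail (f Y : Omega -> R) : integ P f -> (forall w, 0 <= f w) ->
  measurable_fun setT Y -> forall e, 0 < e ->
  exists m0 : nat, forall m, (m0 <= m)%N -> Ex P (fun w => f w * (m%:R <= `|Y w|)%R%:R) <= e.
Proof.
move=> If f0 mY e e0; have mf := integ_meas If.
pose u (n : nat) w := f w * (n%:R <= `|Y w|)%R%:R.
have mu n : measurable_fun setT (u n).
  apply: measurable_funM => //.
  have mb : measurable_fun setT (fun w => n%:R <= `|Y w|).
    by apply: measurable_fun_ler => //; exact: measurableT_comp.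
  by apply: (measurableT_comp (f := fun b : bool => (nat_of_bool b)%:R : R)).
have uf n w : `|u n w| <= f w.
  by rewrite /u normrM (ger0_norm (f0 w)) normr_nat ler_piMr// lern1 leq_b1.
have Iu n : integ P (u n) := integ_le (mu n) (uf n) If.
have cv0 w : (u n w)%:E @[n --> \oo] --> (0 : \bar R)%E.
  have [M hM] : exists M : nat, `|Y w| < M%:R.
    by exists (Num.truncn `|Y w|).+1; rewrite truncnS_gt.
  apply: cvg_near_cst; near=> n; rewrite /u leNgt (lt_le_trans hM) ?mulr0// ler_nat.
  by near: n; exact: nbhs_infty_ge.
have mEu n : measurable_fun setT (fun w => (u n w)%:E) by exact/measurable_EFinP.
have uEf w n : [set: Omega] w -> (`|(u n w)%:E| <= (f w)%:E)%E by move=> _; rewrite lee_fin uf.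
have [_ _ cv] := dominated_convergence measurableT mEu (measurable_cst (0 : \bar R)%E)
  (aeW P (fun w _ => cv0 w)) If (aeW P uEf).
have {}cv : Ex P (u n) @[n --> \oo] --> (0 : R).
  by apply: fine_cvg; move: cv; rewrite integral0.
have [m0 _ hm] : \forall n \near \oo, `|Ex P (u n)| < e.
  by move/cvgr0Pnorm_lt: cv; apply.
by exists m0 => m mm; apply: le_trans (ler_norm _) (ltW (hm m mm)).
Unshelve. all: by end_near. Qed.

End Tail.

(** * Discretisation and the transport bound *)

Section Transport.
Context {R : realType}.
Implicit Types (m n i j : nat).

Lemma pow_sum4 p (a b c d : R) : 0 <= a -> 0 <= b -> 0 <= c -> 0 <= d ->
  (a + b + c + d) ^+ p <= 4 ^+ p * (a ^+ p + b ^+ p + c ^+ p + d ^+ p).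
Proof.
move=> a0 b0 c0 d0.
have P (t : R) : 0 <= t -> 0 <= t ^+ p by move=> ?; exact: exprn_ge0.
have key t : 0 <= t -> a <= t -> b <= t -> c <= t -> d <= t -> (a + b + c + d) ^+ p <= 4 ^+ p * t ^+ p.
  by move=> t0 *; rewrite -exprMn lerXn2r ?nnegrE ?addr_ge0 ?mulr_ge0//; lra.
have A := P a a0; have B := P b b0; have C := P c c0; have D := P d d0.
have fin t : 0 <= t -> a <= t -> b <= t -> c <= t -> d <= t ->
    t ^+ p <= a ^+ p + b ^+ p + c ^+ p + d ^+ p -> (a + b + c + d) ^+ p <= 4 ^+ p * (a ^+ p + b ^+ p + c ^+ p + d ^+ p).
  move=> t0 h1 h2 h3 h4 h; apply: le_trans (key t t0 h1 h2 h3 h4) _.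
  by rewrite ler_wpM2l// exprn_ge0.
have [ab|/ltW ab] := leP a b; have [cd|/ltW cd] := leP c d.
- by have [bd|/ltW bd] := leP b d; [apply: (fin d)|apply: (fin b)] => //; lra.
- by have [bd|/ltW bd] := leP b c; [apply: (fin c)|apply: (fin b)] => //; lra.
- by have [bd|/ltW bd] := leP a d; [apply: (fin d)|apply: (fin a)] => //; lra.
- by have [bd|/ltW bd] := leP a c; [apply: (fin c)|apply: (fin a)] => //; lra.
Qed.

(** All integers beyond m in absolute value are sent to the two extreme ones, which leaves the cells
    0, ..., 2 m. *)
Definition clipz m (k : int) : int := if k <= - m%:Z then - m%:Z else if m%:Z <= k then m%:Z else k.
Definition ix m (k : int) : nat := absz (clipz m k + m%:Z).
Definition rnd (y : R) : int := Num.floor (y + 1 / 2).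
Definition cell m (y : R) : nat := ix m (rnd y).

Lemma rnd_near (y : R) : `|y - (rnd y)%:~R| <= 1 / 2.
Proof.
have /andP[h1 h2] := floor_itv (y + 1 / 2); rewrite -/(rnd y) in h1 h2.
by move: h2; rewrite intrD ler_norml => h2; apply/andP; split; lra.
Qed.

Lemma ix_le m k : (ix m k < (2 * m).+1)%N.
Proof. by rewrite /ix /clipz; case: ifP => h1; [|case: ifP => h2]; lia. Qed.

Lemma ixE m k : (ix m k)%:Z = clipz m k + m%:Z.
Proof. by rewrite /ix /clipz; case: ifP => h1; [|case: ifP => h2]; lia. Qed.

Lemma cell_meas m i : measurable (cell m @^-1` [set i] : set R).
Proof.
have mc : measurable_fun setT (fun y : R => (cell m y)%:R : R).
  apply: nondecreasing_measurable => // y z yz; rewrite ler_nat.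
  have : rnd y <= rnd z by apply: le_floor; rewrite lerD2r.
  rewrite /cell /ix /clipz; move: (rnd y) (rnd z) => a b ab.
  by do 2 (case: ifP => ?; [|case: ifP => ?]); lia.
have -> : cell m @^-1` [set i] = (fun y : R => (cell m y)%:R : R) @^-1` [set i%:R].
  by apply/seteqP; split=> y /=; [move=> ->|move/eqP; rewrite eqr_nat => /eqP].
by rewrite -[X in measurable X]setTI; apply: mc => //; exact: measurable_set1.
Qed.

(** Rounding costs at most 1/2; truncation costs at most |y|, and nothing unless |y| >= m. *)
Lemma cell_err m (y : R) : `|y - ((cell m y)%:R - m%:R)| <= 1 / 2 + `|y| * (m%:R <= `|y|)%R%:R.
Proof.
have e : (cell m y)%:R - m%:R = (clipz m (rnd y))%:~R :> R.
  by rewrite -[X in X - _]/((cell m y)%:Z%:~R) ixE intrD addrK.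
rewrite e; have := rnd_near y; rewrite ler_norml => /andP[h1 h2].
rewrite /clipz; have m0 : 0 <= m%:R :> R by [].
have y0 := normr_ge0 y.
case: ifPn => a1; [|case: ifPn => a2].
- have b1 : (rnd y)%:~R <= - m%:R :> R by rewrite -[X in _ <= - X]/(m%:Z%:~R) -mulrNz ler_int.
  rewrite mulrNz -[m%:Z%:~R]/(m%:R : R).
  have [c|c] := leP m%:R `|y|.
    by rewrite mulr1; move: c; have [?|?] := ger0P y; rewrite ler_norml => ?; apply/andP; split; lra.
  by rewrite mulr0 addr0; move: c; rewrite ltr_norml ler_norml => /andP[? ?]; apply/andP; split; lra.
- have b1 : m%:R <= (rnd y)%:~R :> R by rewrite -[X in X <= _]/(m%:Z%:~R) ler_int.
  rewrite -[m%:Z%:~R]/(m%:R : R).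
  have [c|c] := leP m%:R `|y|.
    by rewrite mulr1; move: c; have [?|?] := ger0P y; rewrite ler_norml => ?; apply/andP; split; lra.
  by rewrite mulr0 addr0; move: c; rewrite ltr_norml ler_norml => /andP[? ?]; apply/andP; split; lra.
rewrite (le_trans (rnd_near y))// lerDl mulr_ge0//.
Qed.

Lemma ix_dist m k l : (absz ((ix m k)%:Z - (ix m l)%:Z) <= dist k l)%N.
Proof.
rewrite !ixE /dist /clipz.
by do 2 (case: ifP => ?; [|case: ifP => ?]); lia.
Qed.

Lemma ix_hi m (k : int) : m%:Z <= k -> ix m k = ix m m%:Z.
Proof. by rewrite /ix /clipz => mk; do 2 (case: ifP => ?; [|case: ifP => ?]); lia. Qed.

Lemma ix_lo m (k : int) : k <= - m%:Z -> ix m k = ix m (- m%:Z).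
Proof. by rewrite /ix /clipz => mk; do 2 (case: ifP => ?; [|case: ifP => ?]); lia. Qed.

Lemma natr_dist i j : `|i%:R - j%:R| = (absz (i%:Z - j%:Z))%:R :> R.
Proof.
by rewrite -[i%:R]/(i%:Z%:~R) -[j%:R]/(j%:Z%:~R) -intrB -intr_norm -abszE.
Qed.

Lemma cell_Ex {d} {T : measurableType d} (P : probability T R) n (I : T -> nat) (u : nat -> R) :
  (forall i, measurable (I @^-1` [set i])) -> (forall x, (I x < n)%N) ->
  integ P (fun x => u (I x)) /\
  Ex P (fun x => u (I x)) = \sum_(i < n) u i * fine (P (I @^-1` [set i : nat])).
Proof.
move=> mI In.
have E x : u (I x) = \sum_(i < n) u i * \1_(I @^-1` [set i : nat]) x.
  rewrite (bigD1 (Ordinal (In x)))//= big1 ?addr0 => [|i ix].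
    by rewrite indicE mem_set ?mulr1.
  rewrite indicE memNset ?mulr0//= => xi.
  by move/eqP: ix; apply; apply: val_inj.
have Ii (i : nat) : integ P (fun x => u i * \1_(I @^-1` [set i : nat]) x).
  by apply: integZ; exact: integ_indic.
have -> : (fun x => u (I x)) = fun x => \sum_(i < n) u i * \1_(I @^-1` [set i : nat]) x by apply/funext.
split; first exact: integ_sum.
rewrite Ex_sum//; apply: eq_bigr => i _; rewrite ExZ; last exact: integ_indic.
by congr (_ * _); rewrite -Ex_indic.
Qed.

Lemma half_pow p (t : R) (b : bool) : (0 < p)%N -> 0 <= t ->
  (1 / 2 + t * b%:R) ^+ p <= 4 ^+ p * (1 + t ^+ p * b%:R).
Proof.
move=> p0 t0.
have b0 : 0 <= t * b%:R by rewrite mulr_ge0.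
have h2 : 0 <= 1 / 2 :> R by [].
have := pow_sum4 p h2 b0 (lexx 0) (lexx 0).
rewrite !addr0 expr0n gtn_eqF//= !addr0 => /le_trans; apply.
rewrite ler_wpM2l ?exprn_ge0// lerD//.
  by rewrite exprn_ile1//; lra.
by rewrite exprMn; case: b {b0} => /=; rewrite ?expr1n// expr0n gtn_eqF.
Qed.

Lemma der_exprV_scale f g' (e : R) k : der f g' ->
  der (fun x => e ^+ k * f (e * x)) (fun x => e ^+ k.+1 * g' (e * x)).
Proof.
move=> h; apply: eq_der (derZ (e ^+ k) (der_scale e h)) _ => x.
by rewrite exprSr mulrA.
Qed.

(* Discretise both laws on cells of width eps. The smooth function of Whitney's theorem
   interpolates the dual potentials of the discretised problem, which bounds its cost. *)
Theorem transport p : (0 < p)%N -> exists Cp, 0 <= Cp /\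
  forall (mu nu : probability R R) (phi : R -> R) (eps K : R), 0 < eps -> 0 <= K ->
  measurable_fun setT phi -> integ mu (fun x => `|x| ^+ p) -> integ nu (fun x => `|phi x| ^+ p) ->
  integ nu (fun x => `|phi x - x| ^+ p) -> Ex nu (fun x => `|phi x - x| ^+ p) <= K * eps ^+ p ->
  (forall (h : nat -> R -> R) B M, jet p h -> continuous (h p) ->
    (forall k x, (k <= p)%N -> `|h k x| <= B) -> (forall x, `|h p x| <= M) ->
    (forall i, (0 < i < p)%N -> h i 0 = 0) ->
    `|Ex mu (h 0%N) - Ex nu (fun x => h 0%N (phi x))| <= K * eps ^+ p * M) ->
  exists g : probability (R * R)%type R, [/\ coupling mu nu g,
    integ g (fun z => `|z.1 - z.2| ^+ p) &
    Ex g (fun z => `|z.1 - z.2| ^+ p) <= Cp * (1 + K) * eps ^+ p].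
Proof.
move=> p0; have [C1 [C2 [C10 C20 whit]]] := @whitney R p p0.
have q4 : 0 <= 4 ^+ p :> R by rewrite exprn_ge0.
exists (4 ^+ p * (4 * 4 ^+ p + C1 + 2 * C2 + 1)); split.
  by rewrite mulr_ge0// !addr_ge0// ?mulr_ge0.
move=> mu nu phi eps K e0 K0 mphi Imu Inu ID ED Hh.
pose y x := eps^-1 * x.
have ep : 0 <= eps^-1 by rewrite invr_ge0 ltW.
have my : measurable_fun setT y by exact: measurable_funM.
have myz : measurable_fun setT (fun z => y (phi z)) by exact: measurable_funM.
have yp x : `|y x| ^+ p = eps^-1 ^+ p * `|x| ^+ p by rewrite normrM (ger0_norm ep) exprMn.
have I1 : integ mu (fun x => `|y x| ^+ p) by under eq_fun do rewrite yp; exact: integZ.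
have I2 : integ nu (fun x => `|y (phi x)| ^+ p) by under eq_fun do rewrite yp; exact: integZ.
have [m1 h1] := small_tail I1 (fun x => exprn_ge0 p (normr_ge0 _)) my ltr01.
have [m2 h2] := small_tail I2 (fun x => exprn_ge0 p (normr_ge0 _)) myz ltr01.
(* A level at which both truncated p-th moments, measured in cells, are at most 1. *)
pose m := maxn m1 m2; pose n := (2 * m).+1.
have {}h1 := h1 m (leq_maxl _ _); have {}h2 := h2 m (leq_maxr _ _).
(* The second coordinate is classified by the cell of phi z: the coupling is with [nu], while its
   cell masses are those of the image of [nu] under phi. *)
pose I x := cell m (y x); pose J z := cell m (y (phi z)).
have mI i : measurable (I @^-1` [set i]).
  by have := my measurableT _ (cell_meas m i); rewrite setTI.
have mJ i : measurable (J @^-1` [set i]).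
  by have := myz measurableT _ (cell_meas m i); rewrite setTI.
have In x : (I x < n)%N := ix_le m _.
have Jn x : (J x < n)%N := ix_le m _.
pose mui i := fine (mu (I @^-1` [set i])); pose nuj j := fine (nu (J @^-1` [set j])).
have mass1 (P : probability R R) (k : R -> nat) : (forall i, measurable (k @^-1` [set i])) ->
    (forall x, (k x < n)%N) -> \sum_(i < n) fine (P (k @^-1` [set i : nat])) = 1.
  move=> mk kn; have := congr1 fine (@probability_setT _ _ _ P) => /= <-.
  rewrite -(cell_sum P mk kn measurableT); apply: eq_bigr => i _.
  by rewrite setTI.
have mass : \sum_(i < n) mui i = \sum_(i < n) nuj i by rewrite /mui /nuj !mass1.
have [pi [f [g [pi0 row col fg cost]]]] := @monotone_coupling R n mui nuj
  (fun i j => `|i%:R - j%:R| ^+ p) (fun i => fine_ge0 (measure_ge0 _ _))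
  (fun i => fine_ge0 (measure_ge0 _ _)) mass (fun i a a' => pow_monge i p0) isT.
have [G [G1 G2 G3]] := finite_coupling mI mJ In Jn pi0 row col.
have [h [jh ch [B bB] hp [h0 sand]]] : exists h : nat -> R -> R, [/\ jet p h, continuous (h p), exists B, forall k x, `|h k x| <= B,
    forall x, `|h p x| <= C1 & (forall k, (0 < k <= p)%N -> h k 0 = 0) /\
    forall (i : int) x, `|x - i%:~R| <= 1 / 2 -> f (ix m i) - C2 <= h 0%N x <= g (ix m i) + C2].
  apply: (whit (fun k => f (ix m k)) (fun k => g (ix m k)) m).
  - move=> i j; apply: le_trans (fg _ _ (ix_le m i) (ix_le m j)) _.
    by rewrite natr_dist lerXn2r ?nnegrE// ler_nat; exact: ix_dist.
  - by move=> i im; rewrite (ix_hi im).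
  - by move=> i im; rewrite (ix_lo im).
(* Back at the original scale the p-th derivative is at most eps^-p [C1], so the assumed error K
   eps^p M becomes the constant K [C1]. *)
pose hs k x := eps^-1 ^+ k * h k (y x).
have B0 : 0 <= B := le_trans (normr_ge0 _) (bB 0%N 0).
have e1 : 1 <= 1 + eps^-1 by rewrite lerDl.
have main : `|Ex mu (hs 0%N) - Ex nu (fun x => hs 0%N (phi x))| <= K * eps ^+ p * (eps^-1 ^+ p * C1).
  apply: (Hh hs ((1 + eps^-1) ^+ p * B)).
  - by move=> k kp; apply: der_exprV_scale; exact: jh.
  - move=> x; apply: cvgM; first exact: cvg_cst.
    by apply: (cvg_comp y); [apply: cvgM; [exact: cvg_cst|exact: cvg_id]|exact: ch].
  - move=> k x kp; rewrite normrM ler_pM// ger0_norm ?exprn_ge0//.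
    apply: (@le_trans _ _ ((1 + eps^-1) ^+ k)); first by rewrite lerXn2r ?nnegrE ?addr_ge0// lerDr.
    by rewrite ler_weXn2l.
  - by move=> x; rewrite normrM ler_pM// ger0_norm ?exprn_ge0.
  - move=> i /andP[i0 ip]; rewrite /hs /y mulr0 h0 ?mulr0//; apply/andP; split=> //; exact: ltnW.
have {}main : `|Ex mu (hs 0%N) - Ex nu (fun x => hs 0%N (phi x))| <= K * C1.
  apply: le_trans main _; rewrite mulrA -(mulrA K) -exprMn mulfV ?gt_eqF// expr1n mulr1//.
have hsE x : hs 0%N x = h 0%N (y x) by rewrite /hs expr0 mul1r.
have ch0 : continuous (h 0%N).
  by case: p p0 jh ch {Imu Inu ID ED Hh I1 I2 h1 h2 cost fg yp q4 hp h0 main whit} => // p _ jh _; exact: der_cont (jh 0%N _).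
have mh0 : measurable_fun setT (h 0%N) := continuous_measurable_fun ch0.
have mhs : measurable_fun setT (hs 0%N).
  by rewrite (_ : hs 0%N = h 0%N \o y); [exact: (measurableT_comp mh0 my)|exact/funext].
have Ih : integ mu (hs 0%N) by apply: (integ_bnd _ mhs (c := B)) => x; rewrite hsE.
have Ih' : integ nu (fun x => hs 0%N (phi x)).
  apply: (integ_bnd _ (c := B)) => [|x]; last by rewrite hsE.
  exact: (measurableT_comp mhs mphi).
have [If Ef] := cell_Ex mu f mI In; have [Ig Eg] := cell_Ex nu g mJ Jn.
have lo : \sum_(i < n) f i * mui i <= Ex mu (hs 0%N) + C2.
  rewrite -Ef -[C2](Ex_cst mu) -ExD//; last exact: integ_cst.
  apply: le_Ex => // [|x]; first by apply: integD => //; exact: integ_cst.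
  by have /andP[+ _] := sand (rnd (y x)) (y x) (rnd_near _); rewrite lerBlDr hsE.
have hi : Ex nu (fun x => hs 0%N (phi x)) - C2 <= \sum_(i < n) g i * nuj i.
  rewrite lerBlDr -Eg -[C2](Ex_cst nu) -ExD//; last exact: integ_cst.
  apply: le_Ex => // [|x]; first by apply: integD => //; exact: integ_cst.
  by have /andP[_ +] := sand (rnd (y (phi x))) (y (phi x)) (rnd_near _); rewrite hsE.
have cost' : \sum_(i < n) \sum_(j < n) pi i j * `|i%:R - j%:R| ^+ p <= K * C1 + 2 * C2.
  rewrite cost; move: main; rewrite ler_norml => /andP[_]; lra.
have law1 A : measurable A -> G ((fst : R * R -> R) @^-1` A) = mu A.
  by move=> mA; rewrite -G1//; congr (G _); apply/seteqP; split=> [[a b]|[a b] []].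
have law2 A : measurable A -> G ((snd : R * R -> R) @^-1` A) = nu A.
  by move=> mA; rewrite -G2//; congr (G _); apply/seteqP; split=> [[a b]|[a b] []].
pose U x := 4 ^+ p * (1 + `|y x| ^+ p * (m%:R <= `|y x|)%R%:R).
pose U' x := 4 ^+ p * (1 + `|y (phi x)| ^+ p * (m%:R <= `|y (phi x)|)%R%:R).
have tail_integ (P : probability R R) (Y : R -> R) : measurable_fun setT Y -> integ P (fun x => `|Y x| ^+ p) ->
    integ P (fun x => `|Y x| ^+ p * (m%:R <= `|Y x|)%R%:R).
  move=> mY IY; apply: (integ_le _ _ IY) => [|x].
    apply: measurable_funM; first exact: integ_meas IY.
    have mb : measurable_fun setT (fun w => m%:R <= `|Y w|).
      by apply: measurable_fun_ler => //; exact: (measurableT_comp (@normr_measurable R setT)).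
    by apply: (measurableT_comp (f := fun b : bool => (nat_of_bool b)%:R : R)).
  by rewrite normrM normrX normr_id normr_nat ler_piMr ?exprn_ge0// lern1 leq_b1.
have IU : integ mu U by apply: integZ; apply: integD; [exact: integ_cst|exact: tail_integ].
have IU' : integ nu U' by apply: integZ; apply: integD; [exact: integ_cst|exact: (tail_integ nu (fun x => y (phi x)))].
have EU : Ex mu U <= 4 ^+ p * 2.
  rewrite ExZ; last by apply: integD; [exact: integ_cst|exact: tail_integ].
  rewrite ler_wpM2l// ExD; [|exact: integ_cst|exact: tail_integ].
  by rewrite Ex_cst -[2]/(1 + 1) lerD2l.
have EU' : Ex nu U' <= 4 ^+ p * 2.
  rewrite ExZ; last by apply: integD; [exact: integ_cst|exact: (tail_integ nu (fun x => y (phi x)))].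
  rewrite ler_wpM2l// ExD; [|exact: integ_cst|exact: (tail_integ nu (fun x => y (phi x)))].
  by rewrite Ex_cst -[2]/(1 + 1) lerD2l.
pose V (z : R * R) : R := `|(I z.1)%:R - (J z.2)%:R| ^+ p.
have mIJ i j : measurable (I @^-1` [set i] `*` J @^-1` [set j]) by exact: measurableX.
have VE (z : R * R) : V z = \sum_(i < n) \sum_(j < n) `|i%:R - j%:R| ^+ p * \1_(I @^-1` [set i : nat] `*` J @^-1` [set j : nat]) z.
  rewrite (bigD1 (Ordinal (In z.1)))//= [X in _ + X]big1 ?addr0 => [|i ii]; last first.
    rewrite big1// => j _; rewrite indicE memNset ?mulr0//= => -[xi _].
    by move/eqP: ii; apply; apply: val_inj.
  rewrite (bigD1 (Ordinal (Jn z.2)))//= [X in _ + X]big1 ?addr0 => [|j jj]; last first.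
    rewrite indicE memNset ?mulr0//= => -[_ xj].
    by move/eqP: jj; apply; apply: val_inj.
  by rewrite indicE mem_set ?mulr1.
have Iij (i j : nat) : integ G (fun z => `|i%:R - j%:R| ^+ p * \1_(I @^-1` [set i] `*` J @^-1` [set j]) z).
  by apply: integZ; exact: integ_indic.
have Vf : V = fun z => \sum_(i < n) \sum_(j < n) `|i%:R - j%:R| ^+ p * \1_(I @^-1` [set i : nat] `*` J @^-1` [set j : nat]) z by exact/funext.
have IV : integ G V.
  by rewrite Vf; apply: integ_sum => i; apply: integ_sum => j; exact: Iij.
have EV : Ex G V = \sum_(i < n) \sum_(j < n) pi i j * `|i%:R - j%:R| ^+ p.
  rewrite Vf Ex_sum; last by move=> i; apply: integ_sum => j; exact: Iij.
  apply: eq_bigr => i _; rewrite Ex_sum; last by move=> j; exact: Iij.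
  apply: eq_bigr => j _; rewrite ExZ; last exact: integ_indic.
  by rewrite -(G3 i j)// -(Ex_indic G (mIJ i j)) mulrC.
have mf1 : measurable_fun setT (fst : R * R -> R) by exact: measurable_fst.
have mf2 : measurable_fun setT (snd : R * R -> R) by exact: measurable_snd.
pose Dz x := `|phi x - x| ^+ p.
have J1 := push_integ mf1 law1 IU; have J2 := push_integ mf2 law2 IU'.
have J3 := push_integ mf2 law2 ID.
have F1 := push_Ex mf1 law1 IU; have F2 := push_Ex mf2 law2 IU'; have F3 := push_Ex mf2 law2 ID.
(* The four terms pay for the discretisation of the first point, the distance between the cells, the
   discretisation of phi z, and the displacement from z to phi z. *)
pose Dm (z : R * R) := 4 ^+ p * (eps ^+ p * U z.1 + eps ^+ p * V z + eps ^+ p * U' z.2 + Dz z.2).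
have IDm : integ G Dm.
  by apply: integZ; apply: integD => //; do 2 (apply: integD; last exact: integZ); exact: integZ.
have cell_pow x : `|eps * (y x - ((cell m (y x))%:R - m%:R))| ^+ p <=
    eps ^+ p * (4 ^+ p * (1 + `|y x| ^+ p * (m%:R <= `|y x|)%R%:R)).
  rewrite normrM (gtr0_norm e0) exprMn ler_wpM2l ?exprn_ge0 ?(ltW e0)//.
  apply: le_trans (half_pow _ p0 (normr_ge0 _)).
  by rewrite lerXn2r ?nnegrE ?addr_ge0 ?mulr_ge0// cell_err.
have dom (z : R * R) : `|z.1 - z.2| ^+ p <= Dm z.
  have ey x : eps * y x = x by rewrite /y mulrA mulfV ?gt_eqF// mul1r.
  set a := eps * (y z.1 - ((I z.1)%:R - m%:R)).
  set b := eps * ((I z.1)%:R - (J z.2)%:R).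
  set c := eps * (y (phi z.2) - ((J z.2)%:R - m%:R)).
  have dec : z.1 - z.2 = a + b - c + (phi z.2 - z.2).
    by rewrite /a /b /c !mulrBr !ey; ring.
  have tri : `|z.1 - z.2| <= `|a| + `|b| + `|c| + `|phi z.2 - z.2|.
    by rewrite dec (le_trans (ler_normD _ _))// lerD2r (le_trans (ler_normB _ _))// lerD2r ler_normD.
  apply: (@le_trans _ _ ((`|a| + `|b| + `|c| + `|phi z.2 - z.2|) ^+ p)).
    by rewrite lerXn2r ?nnegrE ?addr_ge0.
  apply: le_trans (pow_sum4 _ _ _ _ _) _ => //.
  rewrite /Dm ler_wpM2l// lerD2r !lerD//.
  - exact: cell_pow.
  - by rewrite /b normrM (gtr0_norm e0) exprMn.
  - exact: cell_pow.
have mc : measurable_fun setT (fun z : R * R => `|z.1 - z.2| ^+ p).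
  by apply: measurable_funX; apply: (measurableT_comp (@normr_measurable R setT)); exact: measurable_funB.
have Ic : integ G (fun z => `|z.1 - z.2| ^+ p).
  apply: (integ_le mc _ IDm) => z; rewrite ger0_norm ?exprn_ge0//; exact: dom.
exists G; split=> //.
  by move=> A mA; rewrite G1// G2.
apply: le_trans (le_Ex Ic IDm dom) _.
have eP : 0 <= eps ^+ p by rewrite exprn_ge0// ltW.
have E1 : Ex G Dm = 4 ^+ p * (eps ^+ p * Ex mu U + eps ^+ p * Ex G V + eps ^+ p * Ex nu U' + Ex nu Dz).
  have Z1 := integZ (eps ^+ p) J1; have Z2 := integZ (eps ^+ p) IV; have Z3 := integZ (eps ^+ p) J2.
  rewrite /Dm ExZ; last by apply: integD => //; apply: integD => //; exact: integD.
  congr (_ * _); rewrite ExD//; last by apply: integD => //; exact: integD.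
  rewrite ExD//; last exact: integD.
  rewrite ExD//; congr (_ + _ + _ + _).
  - by apply: etrans (ExZ _ J1) _; congr (_ * _).
  - exact: ExZ.
  - by apply: etrans (ExZ _ J2) _; congr (_ * _).
  - exact: F3.
rewrite E1 -!mulrA ler_wpM2l//.
have k1 : eps ^+ p * Ex mu U <= eps ^+ p * (4 ^+ p * 2) by rewrite ler_wpM2l.
have k2 : eps ^+ p * Ex nu U' <= eps ^+ p * (4 ^+ p * 2) by rewrite ler_wpM2l.
have k3 : eps ^+ p * Ex G V <= eps ^+ p * (K * C1 + 2 * C2) by rewrite EV ler_wpM2l.
have k4 : 0 <= eps ^+ p * (C1 + 4 * 4 ^+ p * K + 2 * C2 * K + 1).
  by rewrite mulr_ge0// !addr_ge0// !mulr_ge0.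
have -> : (4 * 4 ^+ p + C1 + 2 * C2 + 1) * ((1 + K) * eps ^+ p) =
   eps ^+ p * (4 ^+ p * 2) + eps ^+ p * (K * C1 + 2 * C2) + eps ^+ p * (4 ^+ p * 2) + K * eps ^+ p +
   eps ^+ p * (C1 + 4 * 4 ^+ p * K + 2 * C2 * K + 1) by ring.
rewrite ler_wpDr// !lerD//.
Qed.

End Transport.

Section WassersteinFamily.
Context {R : realType} {E : Type}.
Local Notation gam := (@std_normal R).

Lemma wasserstein_le (p : nat) (nu mu : probability R R) (g : probability (R * R)%type R) (c : R) :
  (0 < p)%N -> coupling nu mu g -> integ g (fun z => `|z.1 - z.2| ^+ p) ->
  0 <= c -> Ex g (fun z => `|z.1 - z.2| ^+ p) <= c ^+ p -> (wasserstein p nu mu <= c%:E)%E.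
Proof.
move=> p0 cg Ig c0 Eg; rewrite /wasserstein.
apply: le_trans (ereal_inf_lbound _) _; first by exists g.
rewrite unlock /=.
have pn0 : p%:R != 0 :> R by rewrite pnatr_eq0 -lt0n.
have -> : (\int[g]_x `|(x.1 - x.2)%:E| `^ p%:R = (Ex g (fun z => `|z.1 - z.2| ^+ p))%:E)%E.
  rewrite /Ex /Rintegral fineK; last exact: integrable_fin_num.
  by apply: eq_integral => x _; rewrite /= powR_mulrn.
rewrite poweR_EFin lee_fin; apply: (@le_trans _ _ ((c ^+ p) `^ p%:R^-1)).
  by rewrite ge0_ler_powR ?nnegrE ?invr_ge0 ?exprn_ge0//; apply: Ex_ge0 => z; rewrite exprn_ge0.
by rewrite -powR_mulrn// -powRrM mulfV// powRr1.
Qed.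

Theorem wasserstein_family (p : nat) (C : R) (mu : E -> probability R R) (eps : E -> R)
    (c : nat -> E -> R) : (0 < p)%N -> 0 <= C -> (forall e, 0 < eps e) -> (forall e, eps e <= 1) ->
  (forall e, integ (mu e) (fun x => `|x| ^+ p)) ->
  (forall k e, (1 < k <= p)%N -> `|c k e| <= C * eps e ^+ k.-1) ->
  (forall e q (f : nat -> R -> R) B M, (0 < q <= p)%N -> jet q.+1 f ->
    continuous (f q.+1) -> (forall k x, (k <= q.+1)%N -> `|f k x| <= B) ->
    (forall x, `|f q x| <= M /\ `|f q.+1 x| <= M) ->
    `|Ex (mu e) (fun x => x * f 0%N x) - Ex (mu e) (f 1%N) -
       \sum_(2 <= k < q.+1) c k e * Ex (mu e) (f k)| <= C * eps e ^+ q * M) ->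
  exists K : R, 0 <= K /\ forall e, (wasserstein p (mu e) gam <= (K * eps e)%:E)%E.
Proof.
move=> p0 C0 eps_gt0 eps1 Ip cle st.
have eps0 e : 0 <= eps e := ltW (eps_gt0 e).
have Iid e : integ (mu e) id.
  apply: (integ_le (f := fun x : R => x) (g := fun x : R => 1 + `|x| ^+ p) _ _ _) => //.
    move=> x; have [x1|x1] := leP `|x| 1; first by rewrite (le_trans x1)// lerDl exprn_ge0.
    by rewrite (le_trans (ler_eXnr p0 (ltW x1)))// lerDr.
  by apply: integD => //; exact: integ_cst.
have [D [hD [K1 [K10 hK1]]]] := edgeworth_map eps0 eps1 C0 Iid cle st p0.
have [K2 [K20 hK2]] := bO_moment eps0 p hD.
have [Cp [Cp0 tr]] := @transport R p p0.
pose K := K1 + K2; have K0 : 0 <= K by rewrite addr_ge0.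
pose A := Cp * (1 + K).
have A0 : 0 <= A by rewrite mulr_ge0// addr_ge0.
exists (A `^ p%:R^-1); split; first exact: powR_ge0.
move=> e; pose phi (x : R) := x + (D e).[x].
have poly_integ (Q : {poly R}) : integ gam (fun x => `|Q.[x]| ^+ p).
  have [N [k b]] := bp_ex (Q ^+ p).
  apply: (@integ_gauss _ _ (N%:R * k) N).
    apply: measurable_funX; apply: (measurableT_comp (@normr_measurable R setT)).
    exact: der_meas (horner_der Q).
  by move=> x; rewrite -normrX normr_id -horner_exp; exact: horner_le.
have phiE x : phi x = ('X + D e).[x] by rewrite hornerD hornerX.
have mphi : measurable_fun setT phi.
  by rewrite (_ : phi = horner ('X + D e)); [exact: der_meas (horner_der _)|exact/funext].
have dE x : phi x - x = (D e).[x] by rewrite /phi addrC addKr.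
have eP : 0 <= eps e ^+ p by rewrite exprn_ge0.
have [||||g [cg Ig Eg]] := tr (mu e) gam phi (eps e) K (eps_gt0 e) K0 mphi (Ip e).
- by under eq_fun do rewrite phiE; exact: poly_integ.
- by under eq_fun do rewrite dE; exact: poly_integ.
- under eq_Ex do rewrite dE; apply: le_trans (hK2 e) _.
  by rewrite ler_wpM2r// lerDr.
- move=> h B M jh ch hB hM h0; apply: le_trans (hK1 e h B M jh ch hB hM h0) _.
  have M0 : 0 <= M := le_trans (normr_ge0 _) (hM 0).
  by rewrite ler_wpM2r// ler_wpM2r// lerDl.
apply: (wasserstein_le p0 cg Ig); first by rewrite mulr_ge0// powR_ge0.
apply: le_trans Eg _; rewrite exprMn -/A ler_wpM2r//.
rewrite -powR_mulrn ?powR_ge0// -powRrM mulVf ?powRr1//.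
by rewrite pnatr_eq0 -lt0n.
Qed.

End WassersteinFamily.

(** * Lattice geometry and mixing coefficients *)

Section Lattice.
Context {d : nat}.
Implicit Types (u v : 'rV[int]_d).

Definition ldist u v : nat := absz (`|u - v|%R : int).

Lemma normZE (u : 'rV[int]_d) : `|u| = mx_norm u. Proof. by []. Qed.

Lemma ldistE u v : `|u - v| = (ldist u v)%:Z.
Proof. by rewrite /ldist gez0_abs// normr_ge0. Qed.

Lemma ldist_coord u v j : (absz (u ord0 j - v ord0 j) <= ldist u v)%N.
Proof.
rewrite -lez_nat -ldistE normZE mx_normrE abszE.
apply: le_trans (le_bigmax _ _ (ord0, j)); by rewrite /= !mxE.
Qed.

Lemma ldist_attained u v : (0 < ldist u v)%N -> exists j, absz (u ord0 j - v ord0 j) = ldist u v.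
Proof.
move=> d0; have n0 : mx_norm (u - v) != 0.
  by rewrite -normZE ldistE; case: (ldist u v) d0.
have [[i j] /= h] := mx_norm_neq0 n0; exists j.
by apply/eqP; rewrite -eqz_nat -ldistE normZE h abszE [i]ord1 !mxE.
Qed.

(** The coordinates relative to u, shifted into 0, ..., 2 l; this is faithful on the ball of radius
    l. *)
Definition box l u v : {ffun 'I_d -> 'I_(2 * l).+1} :=
  [ffun k => inord (absz (v ord0 k - u ord0 k + l%:Z))].

Lemma box_inj l u v w : (ldist v u <= l)%N -> (ldist w u <= l)%N ->
  forall k, box l u v k = box l u w k -> v ord0 k = w ord0 k.
Proof.
move=> vl wl k; rewrite !ffunE => /(congr1 val); have := ldist_coord v u k.
have := ldist_coord w u k; move: (v ord0 k) (w ord0 k) (u ord0 k) => a b c.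
by move=> h1 h2; rewrite /= !inordK; lia.
Qed.

Lemma card_ball (T : {fset 'rV[int]_d}) u l : (#|[pred v : T | (ldist (fsval v) u <= l)%N]| <= (2 * l).+1 ^ d)%N.
Proof.
have inj : {in [pred v : T | (ldist (fsval v) u <= l)%N] &, injective (fun v : T => box l u (fsval v))}.
  move=> v w; rewrite !inE => hv hw /ffunP E; apply/val_inj/rowP => k.
  by exact: box_inj hv hw _ (E k).
rewrite -(card_in_imset inj); apply: leq_trans (max_card _) _.
by rewrite card_ffun !card_ord.
Qed.

Definition face l (j : 'I_d) u v : {ffun 'I_d -> 'I_(2 * l).+1} :=
  [ffun k => if k == j then ord0 else box l u v k].

Lemma card_face (T : {fset 'rV[int]_d}) u l (j : 'I_d) (c : int) :
  (#|[pred v : T | (ldist (fsval v) u <= l)%N && (fsval v ord0 j == c)]| <= (2 * l).+1 ^ d.-1)%N.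
Proof.
set A := [pred v : T | _].
have inj : {in A &, injective (fun v : T => face l j u (fsval v))}.
  move=> v w; rewrite !inE => /andP[hv /eqP vj] /andP[hw /eqP wj] /ffunP E.
  apply/val_inj/rowP => k; rewrite ?ord1; have [->|kj] := eqVneq k j; first by rewrite vj wj.
  by apply: (box_inj hv hw); have := E k; rewrite /face ffunE [in RHS]ffunE (negbTE kj).
rewrite -(card_in_imset inj).
have : [set face l j u (fsval v) | v in A]%SET \subset pffun_on ord0 (predC1 j) predT.
  apply/fintype.subsetP => f /imsetP[v _ ->]; apply/pffun_onP; split=> //.
  by apply/supportP => k; rewrite inE negbK => /eqP ->; rewrite ffunE eqxx.
move=> /subset_leq_card h; apply: leq_trans h _.
by rewrite card_pffun_on cardC1 !card_ord.
Qed.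

Lemma card_exists (I U : finType) (A : {pred I}) (Q : I -> pred U) (c : nat) :
  (forall i, (#|[pred x | Q i x]| <= c)%N) ->
  (#|[pred x | [exists i in A, Q i x]]| <= #|A| * c)%N.
Proof.
move=> h; apply: (@leq_trans (\sum_(i in A) #|[pred x | Q i x]|)); last first.
  by rewrite -sum_nat_const; apply: leq_sum.
have E i : #|[pred x | Q i x]| = (\sum_x Q i x)%N.
  by rewrite -sum1_card big_mkcond; apply: eq_bigr => x _; rewrite inE; case: (Q i x).
rewrite (eq_bigr _ (fun i _ => E i)) exchange_big /= -sum1_card [leqLHS]big_mkcond.
apply: leq_sum => x _; rewrite inE; case: ifP => // /existsP[i /andP[iA Qi]].
by rewrite (bigD1 i)//= Qi.
Qed.

(** In the maximum norm some coordinate realises the distance l, so the point lies on one of the 2 d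
    faces of a cube. *)
Lemma card_sphere (T : {fset 'rV[int]_d}) u l : (0 < l)%N ->
  (#|[pred v : T | ldist (fsval v) u == l]| <= 2 * d * (2 * l).+1 ^ d.-1)%N.
Proof.
move=> l0; pose Q (x : 'I_d * bool) (v : T) := (ldist (fsval v) u <= l)%N &&
  (fsval v ord0 x.1 == u ord0 x.1 + (-1) ^+ x.2 * l%:Z).
have h x : (#|[pred v | Q x v]| <= (2 * l).+1 ^ d.-1)%N by exact: card_face.
have := card_exists predT h; rewrite card_prod card_ord card_bool [(d * 2)%N]mulnC.
apply: leq_trans; apply: subset_leq_card; apply/fintype.subsetP => v; rewrite !inE => /eqP dl.
have [j hj] : exists j, absz (fsval v ord0 j - u ord0 j) = ldist (fsval v) u.
  by apply: ldist_attained; rewrite dl.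
apply/existsP; exists (j, fsval v ord0 j < u ord0 j); rewrite inE /= /Q /= dl leqnn /=.
move: hj; rewrite dl; move: (fsval v ord0 j) (u ord0 j) => a b.
by have [ab|ab] := ltP a b; rewrite ?expr0 ?expr1 => ?; apply/eqP; lia.
Qed.

Variable T : {fset 'rV[int]_d}.
Implicit Types (I J : {set T}).

(* Truncated at L: all the sites beyond distance L form one last shell. *)
Definition sdist L I (v : T) : nat := \big[minn/L]_(i in I) ldist (fsval v) (fsval i).

Lemma sdist_le L I (v : T) : (sdist L I v <= L)%N.
Proof.
by rewrite /sdist; elim/big_rec: _ => // i x _; rewrite geq_min => ->; rewrite orbT.
Qed.

Lemma sdist_le_dist L I (v i : T) : i \in I -> (sdist L I v <= ldist (fsval v) (fsval i))%N.
Proof.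
move=> iI; rewrite /sdist; elim: (index_enum _) (mem_index_enum i) => // j s IH.
rewrite inE big_cons => /orP[/eqP <-|/IH h]; first by rewrite iI geq_min leqnn.
by case: ifP => // _; rewrite geq_min h orbT.
Qed.

Lemma sdist_set0 L (v : T) : sdist L finset.set0 v = L.
Proof. by rewrite /sdist big_pred0// => i; rewrite inE. Qed.

Lemma sdist_attained L I (v : T) : sdist L I v = L \/
  exists2 i, i \in I & ldist (fsval v) (fsval i) = sdist L I v.
Proof.
rewrite /sdist; elim/big_rec: _ => [|i x iI IH]; first by left.
rewrite /minn; case: ifP => _; last by [].
by right; exists i.
Qed.

Lemma card_sdist_ball L I l : (l < L)%N ->
  (#|[pred v : T | (sdist L I v <= l)%N]| <= #|I| * (2 * l).+1 ^ d)%N.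
Proof.
move=> lL; apply: leq_trans (card_exists (mem I) (Q := fun i v : T => (ldist (fsval v) (fsval i) <= l)%N) _).
  apply: subset_leq_card; apply/fintype.subsetP => v; rewrite !inE => vl.
  have [E|[i iI E]] := sdist_attained L I v; first by move: vl; rewrite E leqNgt lL.
  by apply/existsP; exists i; rewrite iI E.
by move=> i; exact: card_ball.
Qed.

Lemma card_sdist_sphere L I l : (0 < l < L)%N ->
  (#|[pred v : T | sdist L I v == l]| <= #|I| * (2 * d * (2 * l).+1 ^ d.-1))%N.
Proof.
move=> /andP[l0 lL].
apply: leq_trans (card_exists (mem I) (Q := fun i v : T => ldist (fsval v) (fsval i) == l) _).
  apply: subset_leq_card; apply/fintype.subsetP => v; rewrite !inE => /eqP vl.
  have [E|[i iI E]] := sdist_attained L I v; first by move: lL; rewrite -vl E ltnn.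
  by apply/existsP; exists i; rewrite iI E vl /=.
by move=> i; exact: card_sphere.
Qed.

End Lattice.

(** * Mixing coefficients *)

Section AlphaMixing.
Context {disp : measure_display} {Omega : measurableType disp} {R : realType}.
Variable P : probability Omega R.

Lemma fine_prob01 (A : set Omega) : measurable A -> 0 <= fine (P A) <= 1.
Proof.
move=> mA; rewrite fine_ge0 ?measure_ge0//= -lee_fin fineK ?fin_num_measure//.
exact: probability_le1.
Qed.

Lemma mixing_gap_le1 (A B : set Omega) : measurable A -> measurable B ->
  `|fine (P (A `&` B)) - fine (P A) * fine (P B)| <= 1.
Proof.
move=> mA mB; have /andP[a0 a1] := fine_prob01 mA; have /andP[b0 b1] := fine_prob01 mB.
have /andP[c0 c1] := fine_prob01 (measurableI _ _ mA mB).
have p0 := mulr_ge0 a0 b0; have p1 : fine (P A) * fine (P B) <= 1 by rewrite mulr_ile1.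
by rewrite ler_norml; apply/andP; split; lra.
Qed.

Context {d : nat} {T : {fset 'rV[int]_d}}.
Variable X : T -> {RV P >-> R}.
Implicit Types (U V : {set T}).

Let gapset U V : set R := [set `|fine (P (a `&` b)) - fine (P a) * fine (P b)| |
  a in sigma_field X U & b in sigma_field X V].

Lemma sigma_field_measurable U A : sigma_field X U A -> measurable A.
Proof. exact: (gens_measurable (fun i => measurable_funPT (X i))). Qed.

Lemma gapset_ub U V : ubound (gapset U V) 1.
Proof.
move=> _ [A sA [B sB <-]].
by apply: mixing_gap_le1; exact: sigma_field_measurable sA || exact: sigma_field_measurable sB.
Qed.

Lemma gapset_neq0 U V : gapset U V !=set0.
Proof.
exists (`|fine (P (set0 `&` set0)) - fine (P set0) * fine (P set0)|).
by exists set0; [exact: sigma_algebra0|exists set0 => //; exact: sigma_algebra0].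
Qed.

Lemma alpha_mixing_le1 U V : alpha_mixing P (sigma_field X U) (sigma_field X V) <= 1.
Proof. by apply: sup_le_ub; [exact: gapset_neq0|exact: gapset_ub]. Qed.

Let mixset q l : set R := [set alpha_mixing P (sigma_field X U.1) (sigma_field X U.2) |
    U in [set U : {set T} * {set T} | (#|U.1| <= q)%N /\ far_apart l U.1 U.2]].

Lemma mixset_ub q l : ubound (mixset q l) 1.
Proof. by move=> _ [[U V] _ <-]; exact: alpha_mixing_le1. Qed.

Lemma mixset_neq0 q l : mixset q l !=set0.
Proof.
exists (alpha_mixing P (sigma_field X finset.set0) (sigma_field X finset.set0)).
exists (finset.set0, finset.set0) => //; split=> /=; first by rewrite cards0.
by move=> i1 i2; rewrite inE.
Qed.

Lemma alpha_coef01 q l : 0 <= alpha_coef X q l <= 1.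
Proof.
rewrite /alpha_coef le_max lexx /= ge_max ler01 /=.
by apply: sup_le_ub; [exact: mixset_neq0|exact: mixset_ub].
Qed.

Lemma alpha_coef_anti q l l' : (l <= l')%N -> alpha_coef X q l' <= alpha_coef X q l.
Proof.
move=> ll; rewrite /alpha_coef ge_max le_max lexx /= le_max; apply/orP; right.
apply: sup_le_ub; first exact: mixset_neq0.
move=> _ [U [Uq far] <-]; apply: sup_upper_bound.
  by split; [exact: mixset_neq0|exists 1; exact: mixset_ub].
exists U => //; split=> // i1 i2 h1 h2; apply: le_trans (far _ _ h1 h2).
by rewrite lez_nat.
Qed.

Lemma alpha_coef_ge q l U V A B : (#|U| <= q)%N -> far_apart l U V ->
  sigma_field X U A -> sigma_field X V B ->
  `|fine (P (A `&` B)) - fine (P A) * fine (P B)| <= alpha_coef X q l.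
Proof.
move=> Uq far sA sB; apply: (@le_trans _ _ (alpha_mixing P (sigma_field X U) (sigma_field X V))).
  apply: sup_upper_bound; last by exists A => //; exists B.
  by split; [exact: gapset_neq0|exists 1; exact: gapset_ub].
rewrite /alpha_coef le_max; apply/orP; right; apply: sup_upper_bound.
  by split; [exact: mixset_neq0|exists 1; exact: mixset_ub].
by exists (U, V).
Qed.

End AlphaMixing.

Section Moments.
Context {disp : measure_display} {Omega : measurableType disp} {R : realType}.
Variables (P : probability Omega R) (r : \bar R) (K : R).
Hypothesis K0 : 0 <= K.

(** The constant of the envelope max(1, |f|). For r = +oo the convention [fine r = 0] makes the last
    term 1. *)
Definition momK : R := 1 + K + K `^ fine r.

Lemma momK_ge1 : 1 <= momK.
Proof. by rewrite /momK -addrA lerDl addr_ge0// powR_ge0. Qed.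

Lemma Lnorm_dm (f : Omega -> R) : measurable_fun setT f -> (1 <= r)%E ->
  ('N[P]_r[EFin \o f] <= K%:E)%E -> dm P r momK 1 f.
Proof.
move=> mf r1 nf; exists (fun w => Num.max 1 `|f w|); last by move=> w; rewrite expr1 le_max lexx orbT.
have mm : measurable_fun setT (fun w => Num.max 1 `|f w|).
  by apply: measurable_maxr => //; exact: measurableT_comp.
split=> //; first by move=> w; rewrite le_max lexx.
  by apply: le_trans momK_ge1.
move: nf; rewrite /momK unlock; case: r r1 => [s||] //= s1.
- rewrite lee_fin in s1; have s0 : 0 < s by exact: lt_le_trans s1.
  move=> nf.
  have mp : measurable_fun setT (fun w => `|f w| `^ s).
    by exact: (measurableT_comp (measurable_powR s) (measurableT_comp (@normr_measurable R setT) mf)).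
  have If0 : (\int[P]_x (`|f x| `^ s)%:E <= (K `^ s)%:E)%E.
    have i0 : (0 <= \int[P]_x (`|f x| `^ s)%:E)%E by apply: integral_ge0 => x _; rewrite lee_fin powR_ge0.
    have h := gt0_ler_poweR (ltW s0) _ _ nf; rewrite -poweR_EFin.
    by rewrite -[leLHS]poweRe1// -(mulVf (lt0r_neq0 s0)) poweRrM h// in_itv /= leey andbT ?poweR_ge0// lee_fin.
  have Is : integ P (fun w => `|f w| `^ s).
    apply/integrableP; split; first exact/measurable_EFinP.
    apply: le_lt_trans (ltry (K `^ s)); apply: le_trans If0; rewrite le_eqVlt; apply/orP; left.
    by apply/eqP; apply: eq_integral => x _ /=; rewrite ger0_norm// powR_ge0.
  have E : Ex P (fun w => `|f w| `^ s) <= K `^ s.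
    by rewrite /Ex /Rintegral -lee_fin fineK//; exact: integrable_fin_num.
  have bd w : Num.max 1 `|f w| `^ s <= 1 + `|f w| `^ s.
    rewrite maxEle; case: ifP => _; first by rewrite lerDr.
    by rewrite powR1 lerDl powR_ge0.
  have Ism : integ P (fun w => 1 + `|f w| `^ s) by apply: integD => //; exact: integ_cst.
  have Im : integ P (fun w => Num.max 1 `|f w| `^ s).
    apply: integ_le Ism; first exact: (measurableT_comp (measurable_powR s) mm).
    by move=> w; rewrite ger0_norm ?powR_ge0.
  split=> //; apply: le_trans (le_Ex Im Ism bd) _.
  rewrite ExD//; last exact: integ_cst.
  by rewrite Ex_cst /=; move: E K0; lra.
- rewrite probability_setT lte01 => /ess_sup_inf.ess_supP; apply: filterS => w /=.
  by rewrite lee_fin powRr0 ge_max => fw; apply/andP; split; move: fw K0; lra.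
Qed.

End Moments.

Section Powers.
Context {R : realType}.
Implicit Types (a : nat -> R) (x : R).

Lemma pow_succ_diff k l : l.+1%:R ^+ k <= l%:R ^+ k + k%:R * l.+1%:R ^+ k.-1 :> R.
Proof.
elim: k => [|k IH]; first by rewrite !expr0 mul0r addr0.
have l0 : 0 <= l%:R :> R by [].
have ll : l%:R <= l.+1%:R :> R by rewrite ler_nat.
rewrite exprSr [l%:R ^+ k.+1]exprSr -[k.+1.-1]/k.
have h : l.+1%:R ^+ k * l%:R <= (l%:R ^+ k + k%:R * l.+1%:R ^+ k.-1) * l%:R :> R by rewrite ler_wpM2r.
have h2 : k%:R * l.+1%:R ^+ k.-1 * l%:R <= k%:R * l.+1%:R ^+ k :> R.
  case: k {IH h} => [|k]; first by rewrite !mul0r.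
  by rewrite -mulrA ler_wpM2l// exprSr ler_wpM2l// exprn_ge0.
rewrite -[X in _ * X <= _]natr1 -[X in _ + X * _]natr1 mulrDr mulr1 [in leRHS]mulrDl mul1r.
by move: h h2; rewrite mulrDl; lra.
Qed.

Lemma pow_sum_ge k b L : (b <= L)%N ->
  L%:R ^+ k <= b%:R ^+ k + k%:R * \sum_(b.+1 <= l < L.+1) l%:R ^+ k.-1 :> R.
Proof.
move=> /subnK <-; elim: (L - b)%N => [|n IH]; first by rewrite big_geq// mulr0 addr0.
rewrite addSn big_nat_recr/=; last by rewrite ltnS leq_addl.
by apply: le_trans (pow_succ_diff _ _) _; rewrite mulrDr addrA lerD2r.
Qed.

(* k l^(k-1) >= l^k - (l-1)^k telescopes. *)
Lemma tail_absorb a k b L : (forall l, 0 <= a l) -> (forall l l', (l <= l')%N -> a l' <= a l) ->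
  (b <= L)%N ->
  L%:R ^+ k * a L <= b%:R ^+ k * a L + k%:R * \sum_(b.+1 <= l < L.+1) l%:R ^+ k.-1 * a l.
Proof.
move=> a0 aa bL; apply: (@le_trans _ _ ((b%:R ^+ k + k%:R * \sum_(b.+1 <= l < L.+1) l%:R ^+ k.-1) * a L)).
  by rewrite ler_wpM2r// pow_sum_ge.
rewrite mulrDl lerD2l -mulrA ler_wpM2l// mulr_suml.
rewrite big_nat_cond [leRHS]big_nat_cond; apply: ler_sum => l /andP[/andP[_ lL] _].
by rewrite ler_wpM2l ?exprn_ge0// aa.
Qed.

End Powers.

(** * Volumes of balls and shells in the lattice *)

Section Scales.
Context {R : realType}.
Variables (d p L : nat).
Hypothesis d0 : (0 < d)%N.

(** One l^d covers the ordinary shells up to l, the other the last shell at L. *)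
Definition blf (l : nat) : R := 1 + 2 * l%:R ^+ d.
(* The last shell has up to #|T| sites, which is comparable to L^d for the window at hand. *)
Definition shf (l : nat) : R := if l == L then l%:R ^+ d else l%:R ^+ d.-1.
(** At most p + 1 centres, each with spheres of at most 2 d 3^d l^(d-1) sites; the term 2^d covers
    the whole index set by L^d. *)
Definition nbf : R := (p.+1 * (2 * d * 3 ^ d) + 2 ^ d)%:R.

Lemma blf1 l : 1 <= blf l.
Proof. by rewrite lerDl mulr_ge0// exprn_ge0. Qed.

Lemma blf_mono l l' : (l <= l')%N -> blf l <= blf l'.
Proof. by move=> ll; rewrite lerD2l ler_wpM2l// lerXn2r ?nnegrE// ler_nat. Qed.

Lemma blf_le l : (0 < l)%N -> blf l <= 3 * l%:R ^+ d.
Proof.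
move=> l0; have : 1 <= l%:R ^+ d :> R by rewrite exprn_ege1// ler1n.
by rewrite /blf; lra.
Qed.

Lemma shf0 l : 0 <= shf l.
Proof. by rewrite /shf; case: ifP => _; rewrite exprn_ge0. Qed.

Lemma sum_pow l l' : \sum_(l.+1 <= i < l') i%:R ^+ d.-1 <= l'%:R ^+ d :> R.
Proof.
elim: l' => [|l' IH]; first by rewrite big_geq// exprn_ge0.
have [ll|ll] := leqP l.+1 l'; last by rewrite big_geq// exprn_ge0.
rewrite big_nat_recr//= -(prednK d0) [leRHS]exprS; apply: le_trans (lerD IH (lexx _)) _.
rewrite -{1}(prednK d0) exprS -[X in _ + X]mul1r -mulrDl natr1 ler_wpM2l//.
by rewrite lerXn2r ?nnegrE// ler_nat.
Qed.

Lemma shf_blf l l' : \sum_(l.+1 <= i < l') shf i <= blf l'.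
Proof.
apply: (@le_trans _ _ (\sum_(l.+1 <= i < l') (i%:R ^+ d.-1 + (if i == L then i%:R ^+ d else 0)))).
  apply: ler_sum => i _; rewrite /shf; case: ifP => _; last by rewrite addr0.
  by rewrite lerDr exprn_ge0.
rewrite big_split /=; have := sum_pow l l'.
have : \sum_(l.+1 <= i < l') (if i == L then i%:R ^+ d else 0) <= l'%:R ^+ d :> R.
  case: (boolP (l.+1 <= L < l')%N) => h; last first.
    rewrite big_nat_cond big1 ?exprn_ge0// => i /andP[hi _]; case: eqP => // iL.
    by move: h; rewrite -iL hi.
  rewrite (bigD1_seq L) ?mem_index_iota ?iota_uniq//= eqxx big1 ?addr0; last first.
    by move=> i /negbTE ->.
  by case/andP: h => _ /ltnW h; rewrite lerXn2r ?nnegrE// ler_nat.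
rewrite /blf; lra.
Qed.

End Scales.

Section Errors.
Context {R : realType}.
Variables (d b w : nat).
Hypothesis d0 : (0 < d)%N.
Hypothesis b0 : (0 < b)%N.
Let L := (b.+1 + w)%N.
Variable a : nat -> R.
Hypothesis a0 : forall l, 0 <= a l.
Hypothesis a_anti : forall l l', (l <= l')%N -> a l' <= a l.

Local Notation bl := (@blf R d).
Local Notation sh := (@shf R d L).

Definition wsum (k : nat) : R := \sum_(b.+1 <= l < L.+1) l%:R ^+ k.-1 * a l.

Lemma wsum_ge0 k : 0 <= wsum k.
Proof. by apply: sumr_ge0 => l _; rewrite mulr_ge0// exprn_ge0. Qed.

(** The last shell, with L^d in place of L^(d-1), is set apart as the final term. *)
Lemma Err_le n tau : (0 < n)%N -> 0 <= tau ->
  Err bl sh a L n tau b <= 3 ^+ n * (tau * b%:R ^+ (d * n) + wsum (d * n) + L%:R ^+ (d * n) * a L).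
Proof.
move=> n0 tau0; have h3 : 1 <= 3 :> R by rewrite ler1n.
have blX l k : (0 < l)%N -> bl l ^+ k <= 3 ^+ k * l%:R ^+ (d * k).
  move=> l0; rewrite exprM -exprMn lerXn2r ?nnegrE ?mulr_ge0 ?exprn_ge0//.
    exact: le_trans (blf1 d l).
  exact: blf_le.
rewrite /Err -addrA mulrDr lerD//.
  by rewrite mulrCA ler_wpM2l// blX.
have dn : (d * n).-1 = (d.-1 + d * n.-1)%N.
  by case: (n) n0 => // k _; rewrite mulnS /=; case: (d) d0.
have dn' : (d * n)%N = (d + d * n.-1)%N by case: (n) n0 => // k _; rewrite mulnS.
rewrite big_nat_recr; last by rewrite /L addSn ltnS leq_addr.
rewrite mulrDr /=; apply: lerD.
  apply: (@le_trans _ _ (3 ^+ n * \sum_(b.+1 <= l < L) l%:R ^+ (d * n).-1 * a l)).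
    rewrite mulr_sumr big_nat_cond [leRHS]big_nat_cond; apply: ler_sum => l /andP[/andP[bl' lL] _].
    have l0 : (0 < l)%N by exact: leq_ltn_trans bl'.
    rewrite /shf (ltn_eqF lL) mulrA ler_wpM2r// dn exprD mulrCA ler_wpM2l ?exprn_ge0//.
    apply: le_trans (blX l n.-1 l0) _.
    by rewrite ler_wpM2r ?exprn_ge0// ler_weXn2l// leq_pred.
  rewrite ler_wpM2l ?exprn_ge0// /wsum [leRHS]big_nat_recr/=; last by rewrite /L addSn ltnS leq_addr.
  by rewrite lerDl mulr_ge0// exprn_ge0.
rewrite /shf eqxx mulrA ler_wpM2r// dn' exprD mulrCA ler_wpM2l ?exprn_ge0//.
apply: le_trans (blX L n.-1 _) _; first by rewrite /L.
by rewrite ler_wpM2r ?exprn_ge0// ler_weXn2l// leq_pred.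
Qed.

(** [tail_absorb] bounds the last shell by the sum over the shells and by b^(d n), which the bound
    contains anyway. *)
Lemma Err_low n tau : (0 < n)%N -> 0 <= tau -> (forall l, a l <= 1) ->
  Err bl sh a L n tau b <= 3 ^+ n * (1 + tau + (d * n)%:R) * (b%:R ^+ (d * n) + wsum (d * n)).
Proof.
move=> n0 tau0 a1; apply: le_trans (Err_le n0 tau0) _.
rewrite -mulrA ler_wpM2l ?exprn_ge0//.
have := tail_absorb (d * n)%N a0 a_anti (leq_trans (leqnSn b) (leq_addr w b.+1)).
have : b%:R ^+ (d * n) * a L <= b%:R ^+ (d * n) by rewrite ler_piMr ?exprn_ge0.
have : 0 <= (d * n)%:R * b%:R ^+ (d * n) :> R by rewrite mulr_ge0// exprn_ge0.
have : 0 <= tau * wsum (d * n) by rewrite mulr_ge0// wsum_ge0.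
rewrite -/L -/(wsum (d * n)); move: (wsum _) (b%:R ^+ _) (L%:R ^+ _ * _) (_ * a L) => S B T U.
by move: (_%:R) => k; lra.
Qed.

(** When L >= 2 b the term b^k a_L of [tail_absorb] is at most half the left-hand side and can be
    moved there. This matters at the top order, where no free term b^k is available. *)
Lemma tail_wsum k : (2 * b <= L)%N -> (0 < k)%N -> L%:R ^+ k * a L <= 2 * k%:R * wsum k.
Proof.
move=> bL k0; have := tail_absorb k a0 a_anti (leq_trans (leqnSn b) (leq_addr w b.+1)).
rewrite -/L -/(wsum k).
have : 2 * (b%:R ^+ k * a L) <= L%:R ^+ k * a L.
  rewrite mulrA ler_wpM2r//; apply: (@le_trans _ _ ((2 * b%:R) ^+ k)).
    by rewrite exprMn ler_wpM2r ?exprn_ge0// -[leLHS]expr1 ler_weXn2l// ler1n.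
  by rewrite lerXn2r ?nnegrE ?mulr_ge0// -natrM ler_nat.
move: (_ * a L) (b%:R ^+ _ * _) (wsum _) => T B S; lra.
Qed.

End Errors.

Section Field.
Context {disp : measure_display} {Omega : measurableType disp} {R : realType}.
Variables (P : probability Omega R) (r : \bar R).
Context {d : nat} {T : {fset 'rV[int]_d}}.
Variable X : T -> {RV P >-> R}.
Variables (p q b : nat) (K : R).
Hypothesis d0 : (0 < d)%N.
Hypothesis q0 : (0 < q)%N.
Hypothesis qp : (q <= p)%N.
Hypothesis b0 : (0 < b)%N.
Hypothesis K0 : 0 <= K.
Hypothesis r1 : (1 <= r)%E.
Hypothesis hqr : (q.+1%:R%:E < r)%E.
Hypothesis normX : forall i, ('N[P]_r[EFin \o X i] <= K%:E)%E.

Let w := @window R d #|` T|.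
Let L := (b.+1 + w)%N.
Let a := alpha_coef X p.+1.
Let bl := @blf R d.
Let sh := @shf R d L.
Let nb := @nbf R d p.
Let XX (i : T) : Omega -> R := X i.

Local Notation Wsum := (Wsum XX).

Lemma mXX i : measurable_fun setT (XX i). Proof. exact: measurable_funPT. Qed.

Lemma dmX i : dm P r (momK r K) 1 (XX i).
Proof. by apply: Lnorm_dm => //; exact: normX. Qed.

Lemma nbf1 : 1 <= nb.
Proof. by rewrite /nb /nbf ler1n addn_gt0 expn_gt0 orbT. Qed.

(** The window w is the integer part of N^(1/d) / 2, so N^(1/d) < 2 (w + 1) <= 2 L. *)
Lemma card_le_L : (#|` T|)%:R <= 2 ^+ d * L%:R ^+ d :> R.
Proof.
rewrite -exprMn.
have h : (#|` T|)%:R `^ d%:R^-1 <= 2 * L%:R :> R.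
  have := truncnS_gt ((#|` T|)%:R `^ d%:R^-1 / 2 : R); rewrite -/(window d #|` T|) -/w => h.
  have : w.+1%:R <= L%:R :> R by rewrite ler_nat /L addSn ltnS leq_addl.
  lra.
have dn0 : d%:R != 0 :> R by rewrite pnatr_eq0 -lt0n.
rewrite (_ : #|` T|%:R = (#|` T|%:R `^ d%:R^-1) ^+ d :> R); last first.
  by rewrite -powR_mulrn ?powR_ge0// -powRrM mulVf// powRr1.
by rewrite lerXn2r ?nnegrE ?powR_ge0// mulr_ge0.
Qed.

Lemma ball_bound (I : {set T}) l : (#|I| <= q.+1)%N -> (b <= l <= L)%N ->
  (#|[set u | (sdist L I u <= l)%N]|)%:R <= nb * bl l.
Proof.
move=> Iq /andP[bl' lL].
have l0 : (0 < l)%N by exact: leq_trans bl'.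
have -> : #|[set u | (sdist L I u <= l)%N]| = #|[pred u : T | (sdist L I u <= l)%N]|.
  by apply: eq_card => u; rewrite !inE; apply/idP/idP => [/set_mem|h]//; exact/mem_set.
have lb : l%:R ^+ d <= bl l.
  by rewrite /bl /blf; have : 0 <= l%:R ^+ d :> R by []; lra.
have [lL'|lL'] := ltnP l L.
  apply: (@le_trans _ _ (p.+1 * (3 ^ d * l ^ d))%:R).
    rewrite ler_nat; apply: leq_trans (card_sdist_ball I lL') _.
    rewrite leq_mul//; first exact: leq_trans Iq _.
    by rewrite -expnMn leq_exp2r//; nlia l0.
  rewrite mulnA natrM natrX ler_pM// /nb /nbf ler_nat.
  apply: leq_trans (leq_addr _ _); rewrite leq_mul2l /=; apply: leq_pmull.
  by rewrite muln_gt0.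
have E : l = L by apply/eqP; rewrite eqn_leq lL lL'.
apply: (@le_trans _ _ (#|` T|)%:R).
  by rewrite ler_nat cardfE; exact: max_card.
apply: le_trans card_le_L _; rewrite -E ler_pM ?exprn_ge0//.
by rewrite /nb /nbf natrD natrX lerDr.
Qed.

Lemma shell_bound (I : {set T}) l : (#|I| <= q.+1)%N -> (b < l <= L)%N ->
  (#|[set u | sdist L I u == l]|)%:R <= nb * sh l.
Proof.
move=> Iq /andP[bl' lL].
have l0 : (0 < l)%N by exact: leq_ltn_trans bl'.
have -> : #|[set u | sdist L I u == l]| = #|[pred u : T | sdist L I u == l]|.
  by apply: eq_card => u; rewrite !inE; apply/idP/idP => [/set_mem|h]//; exact/mem_set.
rewrite /sh /shf; case: eqP => [->|/eqP lL'].
  apply: (@le_trans _ _ (#|` T|)%:R).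
    by rewrite ler_nat cardfE; exact: max_card.
  apply: le_trans card_le_L _; rewrite ler_wpM2r ?exprn_ge0//.
  by rewrite /nb /nbf natrD natrX lerDr.
have lL2 : (0 < l < L)%N by rewrite l0 ltn_neqAle lL' lL.
apply: (@le_trans _ _ (p.+1 * (2 * d * 3 ^ d) * l ^ d.-1)%:R).
  rewrite ler_nat; apply: leq_trans (card_sdist_sphere I lL2) _.
  rewrite -!mulnA leq_mul//; first exact: leq_trans Iq _.
  rewrite leq_mul2l /= leq_mul2l; apply/orP; right.
  apply: (@leq_trans (3 ^ d.-1 * l ^ d.-1)); last by rewrite leq_mul2r leq_exp2l// leq_pred orbT.
  rewrite -expnMn; case: (d.-1) => // k; rewrite leq_exp2r//; nlia l0.
by rewrite natrM natrX ler_wpM2r ?exprn_ge0// /nb /nbf ler_nat leq_addr.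
Qed.

Lemma mix_bound (I U : {set T}) l : (#|I| <= q.+1)%N -> (b < l <= L)%N ->
  (forall u, u \in U -> (l <= sdist L I u)%N) ->
  forall A B, <<s gens XX I >> A -> <<s gens XX U >> B ->
  `|fine (P (A `&` B)) - fine (P A) * fine (P B)| <= a l.
Proof.
move=> Iq _ far A B sA sB; apply: (alpha_coef_ge (U := I) (V := U)) => //; first exact: leq_trans Iq _.
move=> i u iI uU; rewrite distrC ldistE lez_nat; apply: leq_trans (far u uU) _.
exact: sdist_le_dist.
Qed.

Lemma bL : (b < L)%N. Proof. by rewrite /L addSn ltnS leq_addr. Qed.

Lemma a01 l : 0 <= a l <= 1. Proof. exact: alpha_coef01. Qed.

Lemma alt_anti l l' : (l <= l')%N -> alt r q a l' <= alt r q a l.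
Proof.
move=> ll; rewrite /alt; apply: ge0_ler_powR; rewrite ?nnegrE.
- by apply/ltW/mixing_exp_gt0.
- by case/andP: (a01 l').
- by case/andP: (a01 l).
- exact: alpha_coef_anti.
Qed.

Lemma alt_ge0 l : 0 <= alt r q a l. Proof. exact: powR_ge0. Qed.

Lemma alt_le1 l : alt r q a l <= 1.
Proof. by case/andP: (a01 l) => ? ?; apply: powR_le1 => //; apply/ltW/mixing_exp_gt0. Qed.

Lemma momK_ge0 : 0 <= momK r K. Proof. exact: le_trans (momK_ge1 r K0). Qed.

Lemma ccst_ge0 : 0 <= ccst r q (momK r K) nb (2 * q).
Proof.
have nb0 : 0 <= nb by exact: le_trans nbf1.
by rewrite /ccst /kap; have := Ct_ge0 r q momK_ge0 (2 * q); move: (Ct _ _ _ _) => c c0; rewrite !addr_ge0 ?mulr_ge0 ?addr_ge0.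
Qed.

(** Depends on the field through r, d, p, q and the moment bound only, hence is uniform along the
    sequence of fields. *)
Definition Clow : R := let K1 := momK r K in
  CE (ccst r q K1 nb (2 * q)) q * (3 ^+ q * (1 + Ct r q K1 (2 * q) + (d * q)%:R)).

Lemma Exp_low : Exp P XX q (fun F => [/\ jet q F, forall x, `|F q x| <= 1 & measurable_fun setT (F q)])
   (fun F => Ex P (fun x => Wsum (enum {: T}) x * F 0%N (Wsum (enum {: T}) x)))
   (#|{: T}|%:R * (Clow * (b%:R ^+ (d * q) + wsum b w (fun l => a l `^ mixing_exp r q.+1%:R) (d * q)))).
Proof.
apply: Exp_le; last apply: (@expansion_low _ _ _ P r T XX q q (momK r K) nb (sdist L) bl sh a b L (2 * q)).
- rewrite ler_wpM2l// /Clow -[leRHS]mulrA ler_wpM2l ?CE_ge0 ?ccst_ge0//.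
  by apply: Err_low => //; [exact: alt_ge0|exact: alt_anti|exact/Ct_ge0/momK_ge0|exact: alt_le1].
- exact: mXX.
- exact: momK_ge0.
- exact: dmX.
- exact: momK_ge1.
- by [].
- by [].
- exact: nbf1.
- by move=> u; exact: sdist_set0.
- by move=> I u; exact: sdist_le.
- exact: ball_bound.
- exact: shell_bound.
- exact: blf1.
- exact: blf_mono.
- exact: shf0.
- exact: shf_blf.
- by move=> l; exact: alpha_coef01.
- exact: mix_bound.
- by move=> F [].
- by move=> F [].
- by move=> F [].
- exact: bL.
- by [].
- by [].
Qed.

Variables (lam1 hh delta : R).
Hypothesis hqr2 : (q.+2%:R%:E <= r)%E.
Hypothesis delta01 : 0 <= delta <= 1.
Hypothesis hqd : ((q.+1%:R + delta)%:E < r)%E.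
Hypothesis hh0 : 0 <= hh.
Hypothesis lam10 : 0 <= lam1.
Hypothesis bw : (b <= w)%N.

Definition Bref : R := let K1 := momK r K in let Km := Kn r q K1 (2 * q) + K1 + K1 in
  let mq2 := momq q.+1 Km in
  Mn r q K1 (2 * q) * (3 * (mq2 + nb * mq2 + mq2 * (kap nb (2 * q).+1 * mq2)) +
    nb * covC Km (q.+1%:R + delta) + covq q (Kn r q K1 (2 * q).+1 + 1)).

Lemma Bref_ge0 : 0 <= Bref.
Proof.
have k1 := momK_ge0; have nb1 := nbf1; have nb0 : 0 <= nb by exact: le_trans nb1.
have /andP[de0 de1] := delta01.
rewrite /Bref; set Km := _ + momK r K + momK r K; set mq2 := momq q.+1 Km.
have km0 : 0 <= Km by exact: addr_ge0 (addr_ge0 (Kn_ge0 r q k1 (2 * q)) k1) k1.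
have mq0 : 0 <= mq2 by exact: momq_ge0.
have cq0 : 0 <= covq q (Kn r q (momK r K) (2 * q).+1 + 1) by rewrite covq_ge0// addr_ge0// Kn_ge0.
have cv0 : 0 <= covC Km (q.+1%:R + delta) by apply: covC_ge0 => //; rewrite addr_ge0.
have kp0 : 0 <= kap nb (2 * q).+1 by rewrite mulr_ge0.
have M0 : 0 <= Mn r q (momK r K) (2 * q) by exact: Mn_ge0.
move: (kap _ _) kp0 (covC _ _) cv0 (covq _ _) cq0 (Mn _ _ _ _) M0 => k kk0 u u0 v v0 M M0.
by rewrite mulr_ge0// !addr_ge0 ?mulr_ge0 ?addr_ge0 ?mulr_ge0.
Qed.

Definition Cref : R := CE (ccst r q (momK r K) nb (2 * q)) q * (3 ^+ q * ((Bref + 1) * (1 + 2 * (d * q)%:R))).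

Let S1 : R := \sum_(b.+1 <= l < L.+1) l%:R `^ (d%:R * delta - delta) * ald r q a delta l.

Lemma shf_pow l : (b < l < L)%N -> (nb * sh l) `^ delta <= nb * l%:R `^ (d%:R * delta - delta).
Proof.
move=> /andP[bl' lL]; have l0 : (0 < l)%N by exact: leq_ltn_trans bl'.
have nb1 := nbf1; have nb0 : 0 <= nb by exact: le_trans nb1.
have /andP[de0 de1] := delta01.
rewrite powRM//; last by exact: shf0.
rewrite /sh /shf (ltn_eqF lL) -powR_mulrn// -powRrM.
have -> : d.-1%:R * delta = d%:R * delta - delta :> R.
  by rewrite -{2}(prednK d0) -natr1 mulrDl mul1r addrK.
rewrite ler_wpM2r ?powR_ge0// -[leRHS](powRr1 nb0); exact: ler_powR.
Qed.

Lemma tau_ref_le : tau_ref r q (momK r K) nb bl sh a b L (2 * q) lam1 hh delta <=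
  Bref * (lam1 * b%:R ^+ d + hh * S1 + alt r q a L).
Proof.
have k1 := momK_ge0; have nb1 := nbf1; have nb0 : 0 <= nb by exact: le_trans nb1.
have /andP[de0 de1] := delta01.
have sd0 : 0 <= q.+1%:R + delta by rewrite addr_ge0.
rewrite /tau_ref /Bref.
set Km := _ + momK r K + momK r K; set mq2 := momq q.+1 Km.
have km0 : 0 <= Km by exact: addr_ge0 (addr_ge0 (Kn_ge0 r q k1 (2 * q)) k1) k1.
have mq0 : 0 <= mq2 by exact: momq_ge0.
rewrite -[leRHS]mulrA ler_wpM2l ?Mn_ge0//.
have cv0 : 0 <= covC Km (q.+1%:R + delta) by exact: covC_ge0.
have cq0 : 0 <= covq q (Kn r q (momK r K) (2 * q).+1 + 1) by rewrite covq_ge0// addr_ge0// Kn_ge0.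
have kp0 : 0 <= kap nb (2 * q).+1 by rewrite mulr_ge0.
have A0 : 0 <= alt r q a L by exact: alt_ge0.
have b3 : bl b <= 3 * b%:R ^+ d by exact: blf_le.
have s1 : \sum_(b.+1 <= l < L) (nb * sh l) `^ delta * ald r q a delta l <= nb * S1.
  rewrite /S1 mulr_sumr [leRHS]big_nat_recr/=; last exact: bL.
  rewrite -[leLHS]addr0; apply: lerD; last by rewrite !mulr_ge0 ?powR_ge0.
  rewrite big_nat_cond [leRHS]big_nat_cond; apply: ler_sum => l /andP[hl _].
  by rewrite mulrA ler_wpM2r ?powR_ge0// shf_pow.
have S10 : 0 <= S1 by apply: sumr_ge0 => l _; rewrite mulr_ge0 ?powR_ge0.
move: (covC _ _) cv0 (covq _ _) cq0 (kap _ _) kp0 (alt _ _ _ _) A0 (\sum_(_ <= l < L) _) s1 => u u0 v v0 k kk0 A A0 S s1.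
set U := mq2 + nb * mq2 + mq2 * (k * mq2).
have U0 : 0 <= U by rewrite !addr_ge0 ?mulr_ge0.
apply: (@le_trans _ _ (lam1 * U * (3 * b%:R ^+ d) + hh * u * (nb * S1) + v * A)).
  rewrite lerD// lerD//; last by rewrite ler_wpM2l ?mulr_ge0.
  rewrite (_ : _ + _ = lam1 * U * bl b); last by rewrite /U; ring.
  by rewrite ler_wpM2l ?mulr_ge0.
have x1 : 0 <= lam1 * b%:R ^+ d by rewrite mulr_ge0// exprn_ge0.
have x2 : 0 <= hh * S1 by rewrite mulr_ge0.
have nu0 : 0 <= nb * u by rewrite mulr_ge0.
have -> : lam1 * U * (3 * b%:R ^+ d) + hh * u * (nb * S1) + v * A =
  3 * U * (lam1 * b%:R ^+ d) + nb * u * (hh * S1) + v * A by ring.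
have U3 : 0 <= 3 * U by rewrite mulr_ge0.
move: (3 * U) U3 (nb * u) nu0 (lam1 * _) x1 (hh * _) x2 => c1 c10 c2 c20 y1 y10 y2 y20.
have h1 : 0 <= c1 * y2 by rewrite mulr_ge0. have h2 : 0 <= c1 * A by rewrite mulr_ge0.
have h3 : 0 <= c2 * y1 by rewrite mulr_ge0. have h4 : 0 <= c2 * A by rewrite mulr_ge0.
have h5 : 0 <= v * y1 by rewrite mulr_ge0. have h6 : 0 <= v * y2 by rewrite mulr_ge0.
rewrite !mulrDl !mulrDr; lra.
Qed.

Lemma Exp_ref : Exp P XX q.+1 (fun F => [/\ jet q.+1 F, forall x, `|F q x| <= 1,
    measurable_fun setT (F q), forall x, `|F q.+1 x| <= lam1 &
    forall x y, `|F q x - F q y| <= hh * `|x - y| `^ delta])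
   (fun F => Ex P (fun x => Wsum (enum {: T}) x * F 0%N (Wsum (enum {: T}) x)))
   (#|{: T}|%:R * (Cref * (lam1 * b%:R ^+ (d * q.+1) + hh * b%:R ^+ (d * q) * S1 +
      wsum b w (alt r q a) (d * q)))).
Proof.
apply: Exp_le; last apply: (@expansion_refined _ _ _ P r T XX q q.+1 (momK r K) nb (sdist L) bl sh a b L (2 * q)
   _ _ _ _ _ _ _ _ _ _ _ _ _ _ _ _ _ _ _ _ _ _ _ _ lam1 hh delta).
- have B0 := Bref_ge0; have A0 := alt_ge0 L.
  have S10 : 0 <= S1 by apply: sumr_ge0 => l _; rewrite mulr_ge0 ?powR_ge0.
  have y1 : 0 <= lam1 * b%:R ^+ d by rewrite mulr_ge0// exprn_ge0.
  have y2 : 0 <= hh * S1 by rewrite mulr_ge0.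
  have t0 : 0 <= Bref * (lam1 * b%:R ^+ d + hh * S1 + alt r q a L) by rewrite mulr_ge0// !addr_ge0.
  rewrite ler_wpM2l// /Cref -[leRHS]mulrA ler_wpM2l ?CE_ge0 ?ccst_ge0//.
  apply: (@le_trans _ _ (Err bl sh (alt r q a) L q (Bref * (lam1 * b%:R ^+ d + hh * S1 + alt r q a L)) b)).
    rewrite /Err lerD2r ler_wpM2r ?tau_ref_le// exprn_ge0//; exact: le_trans (blf1 d b).
  apply: le_trans (Err_le w d0 b0 alt_ge0 q0 t0) _; rewrite -/L -[leRHS]mulrA ler_wpM2l ?exprn_ge0//.
  (* The hypothesis b <= w on the window serves to apply [tail_wsum]. *)
  have bL2 : (2 * b <= b.+1 + w)%N by nlia bw.
  have dq : (0 < d * q)%N by rewrite muln_gt0 d0.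
  have := tail_wsum alt_ge0 alt_anti bL2 dq; rewrite -/L.
  have W0 : 0 <= wsum b w (alt r q a) (d * q) by apply: wsum_ge0; exact: alt_ge0.
  have hb : b%:R ^+ (d * q) * alt r q a L <= L%:R ^+ (d * q) * alt r q a L.
    by rewrite ler_wpM2r// lerXn2r ?nnegrE// ler_nat ltnW// bL.
  rewrite mulnS exprD.
  have k0 : 0 <= 2 * (d * q)%:R :> R by rewrite mulr_ge0.
  have bb : 0 <= b%:R ^+ (d * q) :> R by rewrite exprn_ge0.
  move: (wsum _ _ _ _) W0 Bref B0 (alt _ _ _ _) A0 (2 * _) k0 (L%:R ^+ _) (b%:R ^+ (d * q)) bb hb {t0 bL2 dq}.
  move=> S W0 B B0 A A0 k k0 M x x0 hb h.
  set y := lam1 * b%:R ^+ d; set z := hh * S1.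
  have u0 : 0 <= y * x + z * x by rewrite addr_ge0 ?mulr_ge0.
  rewrite -[leRHS]mulrA [hh * x * S1]mulrAC [lam1 * _]mulrA -/y -/z.
  have h1 : B * (x * A) <= B * (M * A) by rewrite ler_wpM2l.
  have h2 : B * (M * A) <= B * (k * S) by rewrite ler_wpM2l.
  have h3 : 0 <= B * (y * x + z * x) * k by rewrite !mulr_ge0.
  have h4 : 0 <= (y * x + z * x) * k by rewrite mulr_ge0.
  have h5 : 0 <= B * S by rewrite mulr_ge0.
  by move: u0 h h1 h2 h3 h4 h5; move: (y) (z) => ? ? *; lra.
- exact: mXX.
- exact: momK_ge0.
- exact: dmX.
- exact: momK_ge1.
- by [].
- by [].
- exact: nbf1.
- by move=> u; exact: sdist_set0.
- by move=> I u; exact: sdist_le.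
- exact: ball_bound.
- exact: shell_bound.
- exact: blf1.
- exact: blf_mono.
- exact: shf0.
- exact: shf_blf.
- by move=> l; exact: alpha_coef01.
- exact: mix_bound.
- by move=> F [/(jet_le (leqnSn q))].
- by move=> F [].
- by move=> F [].
- exact: bL.
- by [].
- by [].
- by [].
- by [].
- by [].
- by [].
- by [].
- by move=> F [].
- by move=> F [].
- by move=> F [].
Qed.

End Field.

(** * Cumulants *)

Section Triangular.
Context {R : realType}.
Implicit Types (m t a c : nat -> R).

Lemma triangular_ex m t n : t 0%N = 1 -> exists c, forall k, (k <= n)%N ->
  m k = \sum_(b < k.+1) c b * t (k - b)%N.
Proof.
move=> t0; elim: n => [|n [c IH]].
  exists m => k; rewrite leqn0 => /eqP ->.
  by rewrite big_ord_recl big_ord0 subnn t0 mulr1 addr0.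
pose c' b := if (b <= n)%N then c b else m n.+1 - \sum_(b < n.+1) c b * t (n.+1 - b)%N.
exists c' => k; rewrite leq_eqVlt => /orP[/eqP ->|kn].
  rewrite big_ord_recr/= subnn t0 mulr1 /c' ltnn.
  rewrite [X in X + _](_ : _ = \sum_(b < n.+1) c b * t (n.+1 - b)%N); first by rewrite addrC subrK.
  by apply: eq_bigr => b _; rewrite -ltnS ltn_ord.
rewrite IH//; apply: eq_bigr => b _; rewrite /c' ifT//.
by have := ltn_ord b; rewrite ltnS => bk; apply: leq_trans bk _; rewrite -ltnS.
Qed.

Lemma triangular_uniq t a c n : t 0%N = 1 ->
  (forall k, (k < n)%N -> \sum_(b < k.+1) a b * t (k - b)%N = \sum_(b < k.+1) c b * t (k - b)%N) ->
  forall k, (k < n)%N -> a k = c k.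
Proof.
move=> t0 h; elim/ltn_ind => k IH kn; have := h _ kn.
rewrite !big_ord_recr/= subnn t0 !mulr1.
rewrite (eq_bigr (fun b : 'I_k => c b * t (k - b)%N)); first exact: addrI.
by move=> b _; rewrite IH// (ltn_trans _ kn).
Qed.

(** Removes the normalisation l M <= 1 of the test functions. For M = 0 the scale l is unrestricted,
    which forces A = 0. *)
Lemma scale_bound (A M e : R) : 0 <= M -> 0 <= e ->
  (forall l : R, 0 <= l -> l * M <= 1 -> l * `|A| <= e) -> `|A| <= e * M.
Proof.
move=> M0 e0 h; have [M1|] := ltP 0 M.
  have := h M^-1; rewrite invr_ge0 M0 mulVf ?gt_eqF// => /(_ isT (lexx _)).
  by rewrite ler_pdivrMl// mulrC.
move=> M1; have M00 : M = 0 by apply/eqP; rewrite eq_le M1.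
rewrite M00 mulr0 leNgt; apply/negP => A0.
have := h ((e + 1) / `|A|); rewrite M00 mulr0 ler01 divr_ge0 ?addr_ge0// => /(_ isT isT).
by rewrite divfK ?gt_eqF// leNgt ltrDl ltr01.
Qed.

End Triangular.

Section Cumulants.
Context {R : realType}.
Variable mu : probability R R.
Local Notation Ex := (Ex mu).
Local Notation integ := (integ mu).

Definition mono (i : nat) (x : R) : R := i`!%:R^-1 * x ^+ i.
(** The derivatives of x^k / k!, among which those of order above k vanish. *)
Definition mjet (k b : nat) : R -> R := if (b <= k)%N then mono (k - b) else fun=> 0.

Lemma mono0 x : mono 0 x = 1. Proof. by rewrite /mono fact0 invr1 mul1r expr0. Qed.

Lemma der_mono i : der (mono i.+1) (mono i).
Proof.
rewrite (_ : mono i = fun x => i.+1`!%:R^-1 * (i.+1%:R * x ^+ i * 1)).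
  exact: derZ (derX i.+1 (@der_id R)).
apply/funext => x; rewrite /mono mulr1 mulrA; congr (_ * _).
by rewrite factS natrM invfM mulrAC mulVf ?mul1r// pnatr_eq0.
Qed.

Lemma mjet_jet k q : jet q (mjet k).
Proof.
move=> i _; rewrite /mjet; have [ik|ik] := ltnP i k.
  by rewrite ltnW// -(subnSK ik); exact: der_mono.
have [ki|ki] := leqP i k; last exact: der_cst.
have -> : (k - i = 0)%N by apply/eqP; rewrite subn_eq0.
by rewrite (_ : mono 0 = fun=> 1); [exact: der_cst|apply/funext => x; exact: mono0].
Qed.

Variables (p : nat) (dl : nat -> R).
Hypothesis p0 : (0 < p)%N.
Hypothesis momI : forall k, (k <= p.+1)%N -> integ (fun x : R => x ^+ k).
Hypothesis mean0 : Ex (fun x => x) = 0.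
Hypothesis var1 : Ex (fun x => x ^+ 2) = 1.
Hypothesis dl0 : forall q, 0 <= dl q.
Hypothesis low : forall q, (0 < q < p)%N -> exists a : nat -> R, forall F : nat -> R -> R,
  jet q.+1 F -> (forall x, `|F q.+1 x| <= 1) -> measurable_fun setT (F q.+1) ->
  `|Ex (fun x => x * F 0%N x) - \sum_(b < q.+1) a b * Ex (F b)| <= dl q.
Hypothesis top : exists a : nat -> R, forall F : nat -> R -> R,
  jet p.+1 F -> (forall x, `|F p x| <= 1) -> (forall x, `|F p.+1 x| <= 1) -> measurable_fun setT (F p.+1) ->
  `|Ex (fun x => x * F 0%N x) - \sum_(b < p.+1) a b * Ex (F b)| <= dl p.

Let t i := Ex (mono i).
Let m k := Ex (fun x => x * mono k x).
Let Tk k b := if (b <= k)%N then t (k - b)%N else 0.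

Lemma mono_integ i : (i <= p.+1)%N -> integ (mono i).
Proof. by move=> ip; apply: integZ; exact: momI. Qed.

Lemma xmono_integ i : (i <= p)%N -> integ (fun x => x * mono i x).
Proof.
move=> ip; rewrite (_ : (fun x => x * mono i x) = fun x => i`!%:R^-1 * x ^+ i.+1); last first.
  by apply/funext => x; rewrite /mono mulrCA -exprS.
by apply: integZ; exact: momI.
Qed.

Lemma t0 : t 0%N = 1.
Proof. by rewrite /t (_ : mono 0 = fun=> 1) ?Ex_cst//; apply/funext => x; exact: mono0. Qed.

Lemma Ex_mjet k b l : (k <= p)%N -> Ex (fun x => l * mjet k b x) = l * Tk k b.
Proof.
move=> kp; rewrite /mjet /Tk; case: ifP => bk.
  by rewrite ExZ//; apply: mono_integ; rewrite (leq_trans (leq_subr _ _))// ltnW.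
by rewrite (_ : (fun x : R => l * 0) = fun=> 0) ?Ex_cst ?mulr0//; apply/funext => x; rewrite mulr0.
Qed.

Lemma Ex_xmjet k l : (k <= p)%N -> Ex (fun x => x * (l * mjet k 0 x)) = l * m k.
Proof.
move=> kp; rewrite /mjet /= subn0 -ExZ; last exact: xmono_integ.
by apply: eq_Ex => x; rewrite mulrCA.
Qed.

Lemma sum_Tk k n (a : nat -> R) : (k < n)%N -> \sum_(b < n) a b * Tk k b = \sum_(b < k.+1) a b * t (k - b)%N.
Proof.
move=> kn; rewrite -(big_mkord predT (fun b => a b * Tk k b)) (big_cat_nat (n := k.+1))//=.
rewrite [X in _ + X]big_nat_cond [X in _ + X]big1 ?addr0; last first.
  by move=> b /andP[/andP[kb _] _]; rewrite /Tk leqNgt kb mulr0.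
by rewrite big_mkord; apply: eq_bigr => b _; rewrite /Tk -ltnS ltn_ord.
Qed.

(* Testing against F = l x^k / k!, with l arbitrary, forces exact equality. *)
Lemma exact_moments q (a : nat -> R) k (e : R) : (k < q)%N -> (k <= p)%N -> 0 <= e ->
  (forall l : R, `|Ex (fun x => x * (l * mjet k 0 x)) -
     \sum_(b < q) a b * Ex (fun x => l * mjet k b x)| <= e) ->
  m k = \sum_(b < k.+1) a b * t (k - b)%N.
Proof.
move=> kq kp e0 h; apply/eqP; rewrite -subr_eq0 -normr_le0 -[leRHS](mulr0 e).
apply: scale_bound => // l l0 _; have := h l; rewrite Ex_xmjet//.
under eq_bigr do rewrite Ex_mjet// mulrCA.
by rewrite -mulr_sumr sum_Tk// -mulrBr normrM (ger0_norm l0).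
Qed.

Lemma mjet_gt k b : (k < b)%N -> mjet k b = fun=> 0.
Proof. by move=> kb; rewrite /mjet leqNgt kb. Qed.

Lemma jetZ q (F : nat -> R -> R) (l : R) : jet q F -> jet q (fun b x => l * F b x).
Proof. by move=> jF i iq; apply: derZ; exact: jF. Qed.

Theorem stein_of_expansion : exists c : nat -> R,
  (forall k, (1 < k <= p)%N -> `|c k| <= dl k.-1) /\
  (forall q (f : nat -> R -> R) B M, (0 < q <= p)%N -> jet q.+1 f -> continuous (f q.+1) ->
    (forall k x, (k <= q.+1)%N -> `|f k x| <= B) ->
    (forall x, `|f q x| <= M /\ `|f q.+1 x| <= M) ->
    `|Ex (fun x => x * f 0%N x) - Ex (f 1%N) - \sum_(2 <= k < q.+1) c k * Ex (f k)| <= 2 * dl q * M).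
Proof.
have jj j n : jet n (mjet j) by exact: mjet_jet.
(* The coefficients are defined by the moments, through a triangular system with unit diagonal; mean
   0 and variance 1 then give c_0 = 0 and c_1 = 1. *)
have [c hc] := triangular_ex m p t0.
have c0 : c 0%N = 0.
  have := hc 0%N isT; rewrite big_ord_recl big_ord0 subnn t0 mulr1 addr0 => <-.
  by rewrite -mean0; apply: eq_Ex => x; rewrite mono0 mulr1.
have c1 : c 1%N = 1.
  have := hc 1%N p0; rewrite !big_ord_recl big_ord0/= c0 mul0r add0r t0 mulr1 addr0 => <-.
  by rewrite -var1; apply: eq_Ex => x; rewrite /mono invr1 mul1r.
(* At order q < p the monomials of degree at most q have zero (q + 1)-st derivative, so all the
   coefficients of the expansion are determined exactly and equal the c_k. *)
have lowc q : (0 < q < p)%N -> forall F : nat -> R -> R, jet q.+1 F -> (forall x, `|F q.+1 x| <= 1) ->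
    measurable_fun setT (F q.+1) ->
    `|Ex (fun x => x * F 0%N x) - \sum_(b < q.+1) c b * Ex (F b)| <= dl q.
  move=> qp; have [a ha] := low qp; have /andP[q0 qp'] := qp.
  have ac k : (k < q.+1)%N -> a k = c k.
    apply: (triangular_uniq t0) => j jq; have jp : (j <= p)%N by rewrite (leq_trans _ (ltnW qp')).
    rewrite -hc//; symmetry; apply: (exact_moments jq jp (dl0 q)) => l.
    apply: (ha (fun b x => l * mjet j b x)); first by apply: jetZ; exact: mjet_jet.
      by move=> x; rewrite mjet_gt// mulr0 normr0.
    by rewrite mjet_gt//; exact: measurable_funM.
  move=> F jF F1 mF; have := ha F jF F1 mF.
  by rewrite (eq_bigr (fun b : 'I_q.+1 => c b * Ex (F b))) // => b _; rewrite ac.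
exists c; split.
  case=> // k /andP[]; rewrite ltnS => k0 kp /=; have kkp : (0 < k < p)%N by rewrite k0.
  (* For x^(k+1) / (k+1)! the expansion of order k lacks exactly the term c_(k+1) of the exact
     identity, so its error bounds that coefficient. *)
  have := lowc k kkp (mjet k.+1) (jj _ _).
  have -> : mjet k.+1 k.+1 = fun=> 1.
    by apply/funext => x; rewrite /mjet leqnn subnn mono0.
  move=> /(_ (fun=> _)); rewrite normr1 => /(_ (lexx _) (measurable_cst _)).
  have := hc _ kp; rewrite big_ord_recr/= subnn t0 mulr1.
  rewrite /mjet /= subn0 -/(m k.+1) => ->.
  rewrite [X in _ - X](_ : _ = \sum_(b < k.+1) c b * t (k.+1 - b)%N); first by rewrite addrAC subrr add0r.
  by apply: eq_bigr => b _; rewrite ltnW.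
move=> q f B M /andP[q0 qp] jf cf fB fM.
have M0 : 0 <= M := le_trans (normr_ge0 _) (fM 0).1.
have mf b : (b <= q.+1)%N -> measurable_fun setT (f b).
  move=> bq; apply: continuous_measurable_fun; exact: jet_cont jf cf bq.
have If b : (b <= q.+1)%N -> integ (f b).
  by move=> bq; apply: (@integ_bnd _ _ _ mu (f b) B); [exact: mf|move=> x; exact: fB].
have Ix : integ (fun x : R => x) by exact: (momI (k := 1%N)).
have B0 : 0 <= B := le_trans (normr_ge0 _) (fB 0%N 0 isT).
have Ixf : integ (fun x => x * f 0%N x).
  apply: (@integ_le _ _ _ mu (fun x : R => x * f 0%N x) (fun x : R => B * `|x|) _ _ _).
  - by apply: measurable_funM => //; exact: mf.
  - by move=> x; rewrite normrM mulrC ler_wpM2r// fB.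
  - by apply: integZ; exact: integ_norm.
pose A (a : nat -> R) := Ex (fun x => x * f 0%N x) - \sum_(b < q.+1) a b * Ex (f b).
have -> : Ex (fun x => x * f 0%N x) - Ex (f 1%N) - \sum_(2 <= k < q.+1) c k * Ex (f k) = A c.
  have := big_mkord predT (fun b => c b * Ex (f b)) (n := q.+1); rewrite /A => <-.
  rewrite [in RHS]big_ltn// [in RHS]big_ltn//.
  by rewrite c0 c1 mul0r mul1r add0r opprD addrA.
have scale (a : nat -> R) (e : R) : 0 <= e -> (forall l : R, 0 <= l -> l * M <= 1 ->
   `|Ex (fun x => x * (l * f 0%N x)) - \sum_(b < q.+1) a b * Ex (fun x => l * f b x)| <= e) ->
   `|A a| <= e * M.
  move=> e0 h; apply: scale_bound => // l l0 lM; have := h l l0 lM.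
  rewrite (_ : Ex (fun x => x * (l * f 0%N x)) = Ex (fun x => l * (x * f 0%N x))); last first.
    by apply: eq_Ex => x; rewrite mulrCA.
  rewrite ExZ// (eq_bigr (fun b : 'I_q.+1 => l * (a b * Ex (f b)))); last first.
    by move=> b _; rewrite ExZ; [rewrite mulrCA|apply: If; exact/ltnW/ltn_ord].
  by rewrite -mulr_sumr -mulrBr normrM (ger0_norm l0).
have lf l b : 0 <= l -> l * M <= 1 -> (b == q) || (b == q.+1) -> forall x, `|l * f b x| <= 1.
  move=> l0 lM bq x; rewrite normrM (ger0_norm l0); apply: le_trans lM; rewrite ler_wpM2l//.
  by case/orP: bq => /eqP ->; [exact: (fM x).1|exact: (fM x).2].
have mlf l b : (b <= q.+1)%N -> measurable_fun setT (fun x => l * f b x).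
  by move=> bq; apply: measurable_funM => //; exact: mf.
have dq0 : 0 <= dl q * M by rewrite mulr_ge0.
move: qp; rewrite leq_eqVlt => /orP[/eqP qp|qp]; last first.
  apply: (@le_trans _ _ (dl q * M)); last by rewrite -mulrA; lra.
  apply: scale => // l l0 lM; apply: (lowc q _ (fun b x => l * f b x)).
  - by rewrite q0.
  - exact: jetZ.
  - by apply: lf => //; rewrite eqxx orbT.
  - exact: mlf.
have [a ha] := top; rewrite -qp in ha.
have ap k : (k < q)%N -> a k = c k.
  apply: (triangular_uniq t0) => j jq; have jp : (j <= p)%N by rewrite -qp ltnW.
  rewrite -hc//; symmetry; apply: (exact_moments (q := q.+1) (k := j) (ltnW jq) jp (dl0 q)) => l.
  apply: (ha (fun b x => l * mjet j b x)); first by apply: jetZ; exact: mjet_jet.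
  - by move=> x; rewrite mjet_gt// mulr0 normr0.
  - by move=> x; rewrite (mjet_gt (ltnW jq : (j < q.+1)%N)) mulr0 normr0.
  - by rewrite (mjet_gt (ltnW jq : (j < q.+1)%N)); exact: measurable_funM.
(* At the top order x^q / q! has q-th derivative 1, so the last coefficient is known only up to
   [dl q]; correcting it doubles the error. *)
have aq : `|c q - a q| <= dl q.
  have := ha (mjet q) (jj _ _).
  have -> : mjet q q = fun=> 1 by apply/funext => x; rewrite /mjet leqnn subnn mono0.
  rewrite mjet_gt//.
  move=> /(_ (fun=> _) (fun=> _)); rewrite normr1 normr0 ler01 => /(_ (lexx _) isT (measurable_cst _)).
  have qp' : (q <= p)%N by rewrite qp.
  have := hc _ qp'; rewrite big_ord_recr/= subnn t0 mulr1 [in X in _ -> X]big_ord_recr/=.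
  rewrite {1 3}/mjet /= subn0 -/(m q) leqnn subnn -/(t 0) t0 mulr1 => ->.
  rewrite [X in _ - (X + _)](_ : _ = \sum_(b < q) c b * t (q - b)%N); last first.
    by apply: eq_bigr => b _; rewrite ap// /mjet ltnW.
  by rewrite opprD addrACA subrr add0r.
have Aa : `|A a| <= dl q * M.
  apply: scale => // l l0 lM; apply: (ha (fun b x => l * f b x)).
  - exact: jetZ.
  - by apply: lf => //; rewrite eqxx.
  - by apply: lf => //; rewrite eqxx orbT.
  - exact: mlf.
have -> : A c = A a + (a q - c q) * Ex (f q).
  have E : \sum_(b < q) a b * Ex (f b) = \sum_(b < q) c b * Ex (f b).
    by apply: eq_bigr => b _; rewrite ap.
  by rewrite /A !big_ord_recr/= E; ring.
have Efq : `|Ex (f q)| <= M.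
  apply: le_trans (normr_Ex (If q (leqnSn q))) _.
  by apply: Ex_le_cst; [apply: integ_norm; exact: If|move=> x; exact: (fM x).1].
apply: (le_trans (ler_normD _ _)); rewrite -mulrA mulr_natl mulr2n lerD// normrM distrC.
by rewrite ler_pM.
Qed.

End Cumulants.

Lemma rate_sum_arith {R : realType} (k sm sz u v h X : R) : sm <= k * X -> sz <= X -> 0 <= k * u -> 0 <= k * v ->
  (k + 1) * (X + u + v) <= (k + 1) * h -> sm + sz + u + v <= (k + 1) * h.
Proof. lra. Qed.

(** * Comparison of the two rates *)

Section Rates.
Context {R : realType}.
Variables (d p : nat) (r : \bar R) (N m : nat) (a : nat -> R) (delta S : R).
Hypothesis d0 : (0 < d)%N.
Hypothesis p0 : (0 < p)%N.
Hypothesis N0 : (0 < N)%N.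
Hypothesis m0 : (0 < m)%N.
Hypothesis a01 : forall l, 0 <= a l <= 1.
Hypothesis hpr : ((p + 2)%:R%:E <= r)%E.

Local Notation rat := (@remainder_at R d r N a).
Local Notation rem := (@remainder R d r N a m).
Local Notation m1 := (M1 d p r N a m delta).
Local Notation m2 := (M2 d p r N a m).

Lemma remainder_at_ge0 j b : 0 <= rat j b.
Proof.
rewrite mulr_ge0 ?powR_ge0// addr_ge0 ?exprn_ge0// sumr_ge0// => l _.
by rewrite mulr_ge0 ?exprn_ge0 ?powR_ge0.
Qed.

Lemma remainder_le j b : (0 < b <= m)%N -> rem j <= rat j b.
Proof.
move=> hb; have : b \in index_iota 1 m.+1 by rewrite mem_index_iota ltnS.
rewrite /remainder; elim: (index_iota _ _) => // i s IH; rewrite inE big_cons ge_min.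
by case/orP => [/eqP <-|/IH ->]; rewrite ?lexx ?orbT.
Qed.

Lemma remainder_attained j : exists2 b, (0 < b <= m)%N & rem j = rat j b.
Proof.
rewrite /remainder big_nat_cond; apply: (big_ind (fun x => exists2 b, (0 < b <= m)%N & x = rat j b)).
- by exists 1%N => //; rewrite m0.
- by move=> x y hx hy; rewrite /Num.min; case: ifP.
- by move=> b /andP[hb _]; exists b.
Qed.

Lemma remainder_ge0 j : 0 <= rem j.
Proof. by have [b _ ->] := remainder_attained j; exact: remainder_at_ge0. Qed.

Lemma M1_ge0 : 0 <= m1.
Proof.
rewrite !mulr_ge0 ?powR_ge0 ?exprn_ge0// sumr_ge0// => l _.
by rewrite mulr_ge0 ?powR_ge0.
Qed.

Lemma M2_ge0 : 0 <= m2.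
Proof.
rewrite mulr_ge0 ?powR_ge0// sumr_ge0// => l _.
by rewrite mulr_ge0 ?exprn_ge0 ?powR_ge0.
Qed.

Let rt := rate d p r N a m delta.

Lemma sum_rem_ge0 : 0 <= \sum_(1 <= j < p) rem j `^ (p%:R / j%:R).
Proof. by apply: sumr_ge0 => j _; exact: powR_ge0. Qed.

Lemma size_gt0 : 0 < N%:R `^ (- (p%:R / 2)) * m%:R ^+ (d * p.+1) :> R.
Proof. by rewrite mulr_gt0 ?powR_gt0 ?exprn_gt0 ?ltr0n. Qed.

Lemma rate_gt0 : 0 < rt.
Proof.
rewrite /rt /rate; have := sum_rem_ge0; have := size_gt0; have := M1_ge0; have := M2_ge0.
lra.
Qed.

Lemma rate_top : N%:R `^ (- (p%:R / 2)) * m%:R ^+ (d * p.+1) + m1 + m2 <= rt.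
Proof. by rewrite /rt /rate; have := sum_rem_ge0; lra. Qed.

(** The purpose of the exponents p / j in the rate: with eps its p-th root, R_j is at most eps^j. *)
Lemma rate_rem j : (0 < j < p)%N -> rem j <= (rt `^ p%:R^-1) ^+ j.
Proof.
move=> /andP[j0 jp].
have pn0 : p%:R != 0 :> R by rewrite pnatr_eq0 -lt0n.
have jn0 : j%:R != 0 :> R by rewrite pnatr_eq0 -lt0n.
have h : rem j `^ (p%:R / j%:R) <= rt.
  have : rem j `^ (p%:R / j%:R) <= \sum_(1 <= j < p) rem j `^ (p%:R / j%:R).
    rewrite (bigD1_seq j) ?mem_index_iota ?iota_uniq//= ?j0// lerDl.
    by apply: sumr_ge0 => i _; exact: powR_ge0.
  by rewrite /rt /rate; have := size_gt0; have := M1_ge0; have := M2_ge0; lra.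
rewrite -powR_mulrn ?powR_ge0// -powRrM.
have -> : rem j = (rem j `^ (p%:R / j%:R)) `^ (p%:R^-1 * j%:R).
  rewrite -powRrM (_ : _ * _ = 1) ?powRr1 ?remainder_ge0//.
  by field; rewrite jn0 pn0.
by apply: ge0_ler_powR => //; rewrite ?nnegrE ?mulr_ge0 ?invr_ge0 ?powR_ge0// ltW// rate_gt0.
Qed.

Let x : R := N%:R `^ (- 2^-1) * m%:R ^+ (2 * d) + m2 `^ p%:R^-1.
Hypothesis S0 : 0 <= S.
Hypothesis sumS : \sum_(m.+1 <= l < (m.+1 + @window R d N).+1) l%:R ^+ d.-1 * a l `^ mixing_exp r (p%:R + 1) <= S.
Hypothesis x1 : x <= 1.

Lemma x_gt0 : 0 < x.
Proof. by rewrite ltr_wpDr ?powR_ge0// mulr_gt0 ?powR_gt0 ?exprn_gt0 ?ltr0n. Qed.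

Lemma split_pow (u t : R) i k : 0 <= u -> 0 < t -> (i <= k)%N -> u ^+ i <= t ^+ i + u ^+ k / t ^+ (k - i).
Proof.
move=> u0 t0 ik; have [ut|tu] := leP u t.
  by rewrite ler_wpDr ?divr_ge0 ?exprn_ge0 ?(ltW t0)// lerXn2r ?nnegrE ?(ltW t0).
rewrite ler_wpDl ?exprn_ge0 ?(ltW t0)// ler_pdivlMr ?exprn_gt0//.
by rewrite -{2}(subnKC ik) exprD ler_wpM2l ?exprn_ge0// lerXn2r ?nnegrE ?(ltW t0) ?(ltW tu).
Qed.

Lemma mixing_exp_anti (s t : R) : 0 <= t -> s <= t -> (t%:E < r)%E -> mixing_exp r t <= mixing_exp r s.
Proof.
move=> t0 st; rewrite /mixing_exp; case: r => [u||] //; rewrite lte_fin => tu.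
by rewrite ler_wpM2r ?invr_ge0 ?lerB// ltW// (le_lt_trans t0).
Qed.

Lemma a_pow j l : (0 < j < p)%N -> a l `^ mixing_exp r (j%:R + 2) <= a l `^ mixing_exp r (p%:R + 1).
Proof.
move=> /andP[j0 jp]; have /andP[al0 al1] := a01 l.
have pr : ((p%:R + 1 : R)%:E < r)%E.
  by apply: lt_le_trans hpr; rewrite lte_fin natrD ltrD2l ltr1n.
have h : mixing_exp r (p%:R + 1) <= mixing_exp r (j%:R + 2).
  apply: mixing_exp_anti => //.
  have : j.+1%:R <= p%:R :> R by rewrite ler_nat.
  by rewrite -natr1; lra.
have [->|an0] := eqVneq (a l) 0; last by apply: ger_powR => //; rewrite lt_neqAle eq_sym an0 al0.
have p1 : 0 < mixing_exp r (p%:R + 1) by apply: mixing_exp_gt0 => //; rewrite addr_ge0.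
by rewrite !powR0// gt_eqF// (lt_le_trans p1).
Qed.

(** R_j is evaluated at b = m. With t = N^(1/2) x, the weight l^(d j) is bounded by t^j plus l^(d
    (p-1)) / t^(p-1-j): the summability bound S handles the first part and M^(ii) <= x^p the
    second. *)
Lemma rem_bound j : (0 < j < p)%N -> rem j <= (2 + S) * x ^+ j.
Proof.
move=> jj; have /andP[j0 jp] := jj; have xp := x_gt0.
apply: le_trans (remainder_le j (b := m) _) _; first by rewrite m0 leqnn.
have NR : 0 < N%:R :> R by rewrite ltr0n.
pose s : R := N%:R `^ 2^-1; have s0 : 0 < s by rewrite powR_gt0.
have sX k : N%:R `^ (- (k%:R / 2)) = (s ^+ k)^-1.
  by rewrite /s -powR_mulrn ?powR_ge0// -powRrM mulrC powRN.
have m1R : 1 <= m%:R :> R by rewrite ler1n.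
have xs : m%:R ^+ (2 * d) <= s * x.
  rewrite /x mulrDr; apply: ler_wpDr; first by rewrite mulr_ge0 ?powR_ge0 ?(ltW s0).
  by rewrite powRN -/s mulrA mulfV ?mul1r ?gt_eqF.
have M2x : m2 <= x ^+ p.
  have pn0 : p%:R != 0 :> R by rewrite pnatr_eq0 -lt0n.
  rewrite -[leLHS](powRr1 M2_ge0) -(mulVf pn0) powRrM powR_mulrn ?powR_ge0//.
  rewrite lerXn2r ?nnegrE ?powR_ge0 ?(ltW xp)// /x lerDr mulr_ge0 ?powR_ge0 ?exprn_ge0//.
rewrite /remainder_at sX mulrC ler_pdivrMr ?exprn_gt0// -mulrA -exprMn [x * s]mulrC.
set t := s * x; have t0 : 0 < t by rewrite mulr_gt0.
have h1 : m%:R ^+ (d * j.+1) <= t ^+ j.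
  apply: (@le_trans _ _ ((m%:R ^+ (2 * d)) ^+ j)); last by rewrite lerXn2r ?nnegrE ?exprn_ge0// ltW.
  rewrite -exprM ler_weXn2l//; move: j0; clear; case: j => // j _; nia.
suff h2 : \sum_(m.+1 <= l < (m.+1 + @window R d N).+1) l%:R ^+ (d * j.+1).-1 * a l `^ mixing_exp r (j%:R + 2) <= (1 + S) * t ^+ j.
  by apply: le_trans (lerD h1 h2) _; rewrite -{1}[t ^+ j]mul1r -mulrDl addrA.
have jp1 : (j <= p.-1)%N by rewrite -ltnS prednK.
pose A l := a l `^ mixing_exp r (p%:R + 1); have A0 l : 0 <= A l by exact: powR_ge0.
apply: (@le_trans _ _ (\sum_(m.+1 <= l < (m.+1 + @window R d N).+1)
   (t ^+ j * (l%:R ^+ d.-1 * A l) + (t ^+ (p.-1 - j))^-1 * (l%:R ^+ (d * p).-1 * A l)))).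
  apply: ler_sum => l _; apply: (@le_trans _ _ (l%:R ^+ (d * j.+1).-1 * A l)).
    by rewrite ler_wpM2l ?exprn_ge0// a_pow.
  rewrite !mulrA -mulrDl ler_wpM2r//.
  have E1 : (d * j.+1).-1 = (d * j + d.-1)%N by rewrite mulnS; case: (d) d0 => // e _; rewrite addSn /= addnC.
  have E2 : (d * p).-1 = (d * p.-1 + d.-1)%N.
    by rewrite -{1}(prednK p0) mulnS; case: (d) d0 => // e _; rewrite addSn /= addnC.
  rewrite E1 E2 !exprD mulrA -mulrDl ler_wpM2r ?exprn_ge0// !exprM.
  by rewrite [_^-1 * _]mulrC split_pow ?exprn_ge0.
rewrite big_split/= -!mulr_sumr [leRHS]mulrDl mul1r addrC lerD//; last first.
  by rewrite mulrC ler_wpM2r ?exprn_ge0// ltW.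
have -> : \sum_(m.+1 <= l < (m.+1 + @window R d N).+1) l%:R ^+ (d * p).-1 * A l = s ^+ p.-1 * m2.
  rewrite /M2 mulrA (_ : s ^+ p.-1 * N%:R `^ (- ((p%:R - 1) / 2)) = 1) ?mul1r//.
  have -> : - ((p%:R - 1) / 2) = - (p.-1%:R / 2) :> R by rewrite -{1}(prednK p0) -natr1 addrK.
  by rewrite sX mulfV// expf_neq0// gt_eqF.
rewrite mulrC ler_pdivrMr ?exprn_gt0// -exprD subnKC//.
rewrite /t exprMn ler_wpM2l ?exprn_ge0 ?(ltW s0)//; apply: le_trans M2x _.
by rewrite -{1}(prednK p0) exprS ler_piMl// exprn_ge0// ltW.
Qed.

Let h := x + m1 `^ p%:R^-1 + m2 `^ p%:R^-1.
Definition Krate : R := p%:R * (2 + S) ^+ p + 1.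

Lemma powR_pinv (y : R) : 0 <= y -> (y `^ p%:R^-1) ^+ p = y.
Proof.
move=> y0; have pn0 : p%:R != 0 :> R by rewrite pnatr_eq0 -lt0n.
by rewrite -powR_mulrn ?powR_ge0// -powRrM mulVf// powRr1.
Qed.

Lemma add_pow (u v : R) : 0 <= u -> 0 <= v -> u ^+ p + v ^+ p <= (u + v) ^+ p.
Proof.
move=> u0 v0; case: (p) p0 => // n _; elim: n => [|n IH]; first by rewrite !expr1.
rewrite ![_ ^+ n.+2]exprS mulrDl lerD//.
- by rewrite ler_wpM2l// lerXn2r ?nnegrE ?addr_ge0// lerDl.
- by rewrite ler_wpM2l// lerXn2r ?nnegrE ?addr_ge0// lerDr.
Qed.

Lemma rate_bound : rt <= Krate * h ^+ p.
Proof.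
have xp := x_gt0; have x0 := ltW xp.
have z1 : 0 <= m1 `^ p%:R^-1 := powR_ge0 _ _. have z2 : 0 <= m2 `^ p%:R^-1 := powR_ge0 _ _.
have hx : x ^+ p + m1 + m2 <= h ^+ p.
  rewrite -{1}(powR_pinv M1_ge0) -{1}(powR_pinv M2_ge0).
  apply: (@le_trans _ _ ((x + m1 `^ p%:R^-1) ^+ p + (m2 `^ p%:R^-1) ^+ p)).
    by rewrite lerD2r; exact: add_pow.
  exact: add_pow (addr_ge0 x0 z1) z2.
have s2 : 1 <= 2 + S by rewrite -[leLHS]addr0 lerD// ler1n.
have hs : \sum_(1 <= j < p) rem j `^ (p%:R / j%:R) <= p%:R * (2 + S) ^+ p * x ^+ p.
  apply: (@le_trans _ _ (\sum_(1 <= j < p) (2 + S) ^+ p * x ^+ p)); last first.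
    rewrite sumr_const_nat -[leLHS]mulr_natl mulrA ler_wpM2r ?exprn_ge0//.
    by rewrite ler_wpM2r ?exprn_ge0 ?ler_nat ?leq_subr// (le_trans ler01).
  rewrite big_nat_cond [leRHS]big_nat_cond; apply: ler_sum => j /andP[jp _].
  have /andP[j0 jp'] := jp; have jn0 : j%:R != 0 :> R by rewrite pnatr_eq0 -lt0n.
  apply: (@le_trans _ _ (((2 + S) * x ^+ j) `^ (p%:R / j%:R))).
    apply: ge0_ler_powR; rewrite ?nnegrE ?divr_ge0 ?remainder_ge0//; last exact: rem_bound.
    by rewrite mulr_ge0 ?exprn_ge0// (le_trans ler01).
  have s0 : 0 <= 2 + S by rewrite (le_trans ler01).
  rewrite powRM ?exprn_ge0// ler_pM ?powR_ge0//.
    rewrite -powR_mulrn//; apply: ler_powR => //.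
    by rewrite ler_piMr// invf_le1 ?ltr0n// ler1n.
  by rewrite -powR_mulrn// -powRrM mulrCA mulfV// mulr1 powR_mulrn.
have hsz : N%:R `^ (- (p%:R / 2)) * m%:R ^+ (d * p.+1) <= x ^+ p.
  apply: (@le_trans _ _ ((N%:R `^ (- 2^-1) * m%:R ^+ (2 * d)) ^+ p)); last first.
    by rewrite lerXn2r ?nnegrE ?mulr_ge0 ?powR_ge0 ?exprn_ge0// lerDl powR_ge0.
  rewrite exprMn -(powR_mulrn p (powR_ge0 N%:R (- 2^-1))) -powRrM mulNr [2^-1 * _]mulrC ler_wpM2l ?powR_ge0//.
  rewrite -exprM ler_weXn2l ?ler1n//; move: p0; clear; case: p => // q _; nia.
have k0 : 0 <= p%:R * (2 + S) ^+ p by rewrite mulr_ge0// exprn_ge0// (le_trans ler01).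
exact: rate_sum_arith hs hsz (mulr_ge0 k0 M1_ge0) (mulr_ge0 k0 M2_ge0) (ler_wpM2l (addr_ge0 k0 ler01) hx).
Qed.

End Rates.

(** The variance bound c N <= s^2 trades powers of the norming constant for powers of N; one power
    of N is spent on the sum over the sites. *)
Lemma sig_scale {R : realType} (c N s e : R) : 0 < c -> 0 < N -> 0 < s -> c * N <= s ^+ 2 -> 0 <= e ->
  N * s `^ (- (e + 2)) <= c `^ (- ((e + 2) / 2)) * N `^ (- (e / 2)).
Proof.
move=> c0 N0 s0 h e0; have cN : 0 < c * N by rewrite mulr_gt0.
have e2 : 0 <= (e + 2) / 2 by rewrite divr_ge0// addr_ge0.
have -> : s `^ (- (e + 2)) = (s ^+ 2) `^ (- ((e + 2) / 2)).
  by rewrite -powR_mulrn ?(ltW s0)// -powRrM; congr (_ `^ _); field.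
apply: (@le_trans _ _ (N * (c * N) `^ (- ((e + 2) / 2)))).
  rewrite ler_wpM2l ?(ltW N0)// !powRN lef_pV2 ?posrE ?powR_gt0 ?exprn_gt0//.
  by apply: ge0_ler_powR; rewrite ?nnegrE ?(ltW cN) ?exprn_ge0 ?(ltW s0).
rewrite powRM ?(ltW c0) ?(ltW N0)// mulrCA ler_wpM2l ?powR_ge0//.
have -> : - (e / 2) = 1 + - ((e + 2) / 2) by field.
by rewrite powRD ?powRr1 ?(ltW N0)// (gt_eqF N0) implybT.
Qed.

Lemma top_rate_arith {R : realType} (N s1 si sd C Ca A1 Y A3 n1 n2 n3 c1 c2 c3 : R) :
  C <= Ca -> 0 <= Ca -> 0 <= A1 -> 0 <= Y -> 0 <= A3 -> 0 <= c1 -> 0 <= c2 -> 0 <= c3 ->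
  0 <= n1 -> 0 <= n2 -> 0 <= n3 -> 0 <= N -> 0 <= s1 -> 0 <= si -> 0 <= sd ->
  N * (si * s1) <= c1 * n1 -> N * (s1 * sd) <= c2 * n2 -> N * s1 <= c3 * n3 ->
  s1 * (N * (C * (si * A1 + 2 * sd * Y + A3))) <= Ca * (c1 + 2 * c2 + c3) * (n1 * A1 + n2 * Y + n3 * A3).
Proof.
move=> CC Ca0 A10 Y0 A30 c10 c20 c30 n10 n20 n30 N0 s10 si0 sd0 h1 h2 h3.
apply: (@le_trans _ _ (Ca * (N * (si * s1) * A1 + 2 * (N * (s1 * sd)) * Y + N * s1 * A3))).
  rewrite (_ : Ca * _ = s1 * (N * (Ca * (si * A1 + 2 * sd * Y + A3)))); last by ring.
  by rewrite !ler_wpM2l// ler_wpM2r// !addr_ge0 ?mulr_ge0.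
rewrite -[leRHS]mulrA ler_wpM2l//.
have g1 : N * (si * s1) * A1 <= c1 * n1 * A1 by rewrite ler_wpM2r.
have g2 : N * (s1 * sd) * Y <= c2 * n2 * Y by rewrite ler_wpM2r.
have g3 : N * s1 * A3 <= c3 * n3 * A3 by rewrite ler_wpM2r.
have x1 : 0 <= n1 * A1 by rewrite mulr_ge0.
have x2 : 0 <= n2 * Y by rewrite mulr_ge0.
have x3 : 0 <= n3 * A3 by rewrite mulr_ge0.
have q1 : 0 <= c1 * (n2 * Y + n3 * A3) by rewrite mulr_ge0 ?addr_ge0.
have q2 : 0 <= c2 * (n1 * A1 + n3 * A3) by rewrite mulr_ge0 ?addr_ge0.
have q3 : 0 <= c3 * (n1 * A1 + n2 * Y) by rewrite mulr_ge0 ?addr_ge0.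
by move: g1 g2 g3 q1 q2 q3; clear; lra.
Qed.

(** * The law of the normalised sum of one field *)

Section Law.
Context {disp : measure_display} {Omega : measurableType disp} {R : realType}.
Variables (P : probability Omega R) (r : \bar R).
Context {d : nat} {T : {fset 'rV[int]_d}}.
Variable X : T -> {RV P >-> R}.
Variables (p m : nat) (K c delta : R).
Hypothesis d0 : (0 < d)%N.
Hypothesis p0 : (0 < p)%N.
Hypothesis m0 : (0 < m)%N.
Hypothesis K0 : 0 <= K.
Hypothesis hpr : ((p + 2)%:R%:E <= r)%E.
Hypothesis normX : forall i, ('N[P]_r[EFin \o X i] <= K%:E)%E.
Hypothesis meanX : forall i, ('E_P[X i] = 0)%E.
Hypothesis c0 : 0 < c.
Hypothesis N0 : (0 < #|` T|)%N.
Hypothesis sigc : c * (#|` T|)%:R <= sigma2 X.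
Hypothesis mw : (m <= @window R d #|` T|)%N.
Hypothesis delta01 : 0 <= delta <= 1.
Hypothesis hdr : ((p.+1%:R + delta)%:E < r)%E.

Let XX (i : T) : Omega -> R := X i.
Let S := Wsum XX (enum {: T}).
Let sg : R := Num.sqrt (sigma2 X).
Let W := normalized_sum X.
Let mu : probability R R := distribution P W.

Lemma sg2 : sg ^+ 2 = sigma2 X.
Proof. by rewrite /sg sqr_sqrtr// (le_trans _ sigc)// mulr_ge0// ltW. Qed.

Lemma sg_gt0 : 0 < sg.
Proof. by rewrite sqrtr_gt0 (lt_le_trans _ sigc)// mulr_gt0// ltr0n. Qed.

Lemma field_sumE w : field_sum X w = S w.
Proof.
rewrite /field_sum /S /Wsum big_enum/=.
by elim/big_ind2: _ => // f x g y fx gy; rewrite -fx -gy.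
Qed.

Lemma W_E w : W w = sg^-1 * S w. Proof. by rewrite -field_sumE. Qed.

Lemma dmX1 i : dm P r (momK r K) 1 (XX i).
Proof.
by apply: Lnorm_dm => //; [rewrite (le_trans _ hpr)// lee_fin ler1n addn2|exact: normX].
Qed.

Lemma pdS : pd P r 1 S.
Proof.
have [i iT] : exists i, i \in T by apply/fset0Pn; rewrite -cardfs_gt0.
have [A dA _] := dmX1 [` iT]%fset.
apply: pd_sum; first by exists (momK r K), A.
by move=> j; apply: dm_pd (dmX1 j); exact: measurable_funPT.
Qed.

Lemma dom_ex : exists k A, dom P r k A.
Proof.
have [i iT] : exists i, i \in T by apply/fset0Pn; rewrite -cardfs_gt0.
by have [A dA _] := dmX1 [` iT]%fset; exists (momK r K), A.
Qed.

Lemma S_integ k : (k <= p.+1)%N -> integ P (fun w => S w ^+ k).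
Proof.
move=> kp; apply: (@pd_integ _ _ _ P r k); last first.
  by have := pd_exp k dom_ex pdS; rewrite mul1n.
by apply: le_trans hpr; rewrite lee_fin ler_nat addn2 ltnW.
Qed.

Lemma mW : measurable_fun setT W. Proof. exact: measurable_funPT. Qed.

Lemma lawW A : measurable A -> P (W @^-1` A) = mu A. Proof. by []. Qed.

Lemma mu_Ex u : integ mu u -> Ex mu u = Ex P (fun w => u (W w)).
Proof. by move=> iu; rewrite (push_Ex mW lawW iu). Qed.

Lemma mu_pow k : (k <= p.+1)%N -> integ mu (fun x => x ^+ k).
Proof.
move=> kp; apply: (pull_integ mW lawW); first exact: exprn_measurable.
rewrite (_ : (fun w => W w ^+ k) = fun w => (sg^-1) ^+ k * S w ^+ k).
  by apply: integZ; exact: S_integ.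
by apply/funext => w; rewrite W_E exprMn.
Qed.

Lemma mu_growth (g : R -> R) k (b : R) : measurable_fun setT g -> (k <= p.+1)%N ->
  (forall x, `|g x| <= b * (1 + `|x|) ^+ k) -> integ mu g.
Proof.
move=> mg kp gb; apply: (integ_le (f := g) (g := fun x : R => b * (1 + `|x|) ^+ k) _ _ _) => //.
apply: integZ; rewrite (_ : (fun x : R => (1 + `|x|) ^+ k) = fun x : R => \sum_(i < k.+1) `|x| ^+ i *+ 'C(k, i)).
  apply: integ_sum => i; under eq_fun do rewrite -mulr_natl -normrX.
  by apply: integZ; apply: integ_norm; apply: mu_pow; rewrite (leq_trans _ kp)// -ltnS.
by apply/funext => x; rewrite addrC exprD1n.
Qed.

Lemma S_mean : Ex P S = 0.
Proof.
rewrite /S /Wsum Ex_sum; last first.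
  move=> i; apply: (@pd_integ _ _ _ P r 1); last by apply: dm_pd (dmX1 i); exact: measurable_funPT.
  by apply: le_trans hpr; rewrite lee_fin ler_nat addn2.
rewrite big1// => i _.
by have := meanX i; rewrite unlock /Ex /Rintegral => ->.
Qed.

Lemma mu_mean : Ex mu (fun x => x) = 0.
Proof.
rewrite mu_Ex; last exact: (mu_pow (k := 1)).
under eq_Ex do rewrite W_E.
by rewrite ExZ ?S_mean ?mulr0//; exact: (S_integ (k := 1)).
Qed.

Lemma mu_var : Ex mu (fun x => x ^+ 2) = 1.
Proof.
rewrite mu_Ex; last exact: mu_pow.
under eq_Ex do rewrite W_E exprMn.
rewrite ExZ; last exact: S_integ.
have -> : Ex P (fun w => S w ^+ 2) = sg ^+ 2.
  rewrite sg2 /sigma2 /variance.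
  have E0 : fine ('E_P[field_sum X])%E = 0.
    by rewrite -S_mean unlock /Ex /Rintegral; congr fine; apply: eq_integral => w _; rewrite field_sumE.
  rewrite unlock E0 /Ex /Rintegral unlock; congr fine; apply: eq_integral => w _.
  rewrite (_ : ((_ \- _) * (_ \- _)) w = (field_sum X w - 0) * (field_sum X w - 0))//.
  by rewrite field_sumE subr0 expr2.
by rewrite -exprMn mulVf ?expr1n// gt_eqF// sg_gt0.
Qed.

(* The derivatives of s |-> sg^n F(s / sg), normalised so that the n-th one keeps its bound. *)
Definition resc n (F : nat -> R -> R) (k : nat) (s : R) : R := sg ^+ n * (sg^-1 ^+ k * F k (sg^-1 * s)).

Lemma resc_jet n q F : jet q F -> jet q (resc n F).
Proof.
move=> jF k kq; rewrite (_ : resc n F k.+1 = fun s => sg ^+ n * (sg^-1 ^+ k * (sg^-1 * F k.+1 (sg^-1 * s)))).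
  by apply: derZ; apply: derZ; apply: der_scale; exact: jF.
by apply/funext => s; rewrite /resc exprSr -!mulrA.
Qed.

Lemma resc_top n F s : resc n F n s = F n (sg^-1 * s).
Proof. by rewrite /resc mulrA -exprMn mulfV ?expr1n ?mul1r// gt_eqF// sg_gt0. Qed.

Lemma jet_integ n F b : (n <= p)%N -> jet n F -> (forall x, `|F n x| <= 1) -> measurable_fun setT (F n) ->
  (b <= n)%N -> integ mu (F b).
Proof.
move=> np jF F1 mF bn.
have [e [e0 he]] := jet_growth (jet_shift bn jF) (M := 1) (fun y => eq_ind_r (fun i => `|F i y| <= 1) (F1 y) (subnKC bn)).
apply: (mu_growth (k := (n - b)%N) (b := e)).
- by move: bn; rewrite leq_eqVlt => /orP[/eqP -> //|bn]; exact: der_meas (jF b bn).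
- by rewrite (leq_trans (leq_subr _ _))// leqW.
- by move=> x; have := he x; rewrite addn0.
Qed.

Lemma jet_xinteg n F : (n <= p)%N -> (0 < n)%N -> jet n F -> (forall x, `|F n x| <= 1) ->
  integ mu (fun x => x * F 0%N x).
Proof.
move=> np n0 jF F1; have [e [e0 he]] := jet_growth jF F1.
apply: (mu_growth (k := n.+1) (b := e)) => //.
  by apply: measurable_funM => //; exact: der_meas (jF 0%N n0).
move=> x; rewrite normrM exprS mulrCA ler_pM//; first by rewrite lerDr.
Qed.

Lemma rescale n Q (a : nat -> R) e F : (0 < n <= p)%N -> (Q <= n.+1)%N -> jet n F ->
  (forall x, `|F n x| <= 1) -> measurable_fun setT (F n) ->
  `|Ex P (fun w => S w * resc n F 0%N (S w)) - \sum_(b < Q) a b * EW P XX (resc n F) b| <= e ->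
  `|Ex mu (fun x => x * F 0%N x) - \sum_(b < Q) (a b * sg^-1 ^+ b.+1) * Ex mu (F b)| <=
    sg^-1 ^+ n.+1 * e.
Proof.
move=> /andP[n0 np] Qn jF F1 mF.
have s0 := sg_gt0; have sn : sg != 0 by rewrite gt_eqF.
have E b : (b <= n)%N -> EW P XX (resc n F) b = sg ^+ n * (sg^-1 ^+ b * Ex mu (F b)).
  move=> bn; have I := jet_integ np jF F1 mF bn.
  have I2 := push_integ mW lawW I.
  rewrite mu_Ex// -!ExZ//; last exact: integZ.
  by apply: eq_Ex => w; rewrite /resc W_E.
have E0 : Ex P (fun w => S w * resc n F 0%N (S w)) = sg ^+ n.+1 * Ex mu (fun x => x * F 0%N x).
  have I := jet_xinteg np n0 jF F1; have I2 := push_integ mW lawW I.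
  rewrite mu_Ex// -ExZ//; apply: eq_Ex => w; rewrite /resc expr0 mul1r W_E exprS.
  by move: (F 0%N (sg^-1 * S w)) (S w) (sg ^+ n) => u v z; field.
have -> : \sum_(b < Q) a b * EW P XX (resc n F) b =
    sg ^+ n.+1 * \sum_(b < Q) (a b * sg^-1 ^+ b.+1) * Ex mu (F b).
  rewrite mulr_sumr; apply: eq_bigr => b _; rewrite E; last by rewrite -ltnS (leq_trans (ltn_ord b)).
  rewrite exprS [sg^-1 ^+ b.+1]exprS; move: (sg^-1 ^+ b) (sg ^+ n) (Ex mu _) (a b) => u v y z.
  by field.
rewrite E0 -mulrBr normrM (ger0_norm (exprn_ge0 _ (ltW s0))) => h.
by rewrite exprVn mulrC ler_pdivlMr ?exprn_gt0// mulrC.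
Qed.

Let N : R := (#|` T|)%:R.
Let a := alpha_coef X p.+1.
Let rem j : R := remainder d r #|` T| a m j.

Lemma N_gt0 : 0 < N. Proof. by rewrite ltr0n. Qed.

Lemma sg_pow k (e : R) : e + 2 = k%:R -> 0 <= e ->
  N * sg^-1 ^+ k <= c `^ (- ((e + 2) / 2)) * N `^ (- (e / 2)).
Proof.
move=> ek e0; have := sig_scale c0 N_gt0 sg_gt0 (_ : c * N <= sg ^+ 2) e0; rewrite sg2 => /(_ sigc).
by rewrite {1}ek powRN powR_mulrn ?(ltW sg_gt0)// exprVn.
Qed.

Definition Clow_s (q : nat) : R := `|@Clow R r d p q.+1 K| * c `^ (- ((q%:R + 2) / 2)).

Definition Ctop_s : R := `|@Cref R r d p p K delta| *
  (c `^ (- ((p%:R + 2) / 2)) + 2 * c `^ (- ((p%:R - 1 + delta + 2) / 2)) + c `^ (- ((p%:R - 1 + 2) / 2))).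

Definition Cfield : R := \sum_(q < p) Clow_s q + Ctop_s.

Lemma Clow_s_ge0 q : 0 <= Clow_s q. Proof. by rewrite mulr_ge0 ?powR_ge0. Qed.
Lemma Ctop_s_ge0 : 0 <= Ctop_s.
Proof. by rewrite mulr_ge0// !addr_ge0 ?mulr_ge0 ?powR_ge0. Qed.

Lemma Clow_field q : (q < p)%N -> Clow_s q <= Cfield.
Proof.
move=> qp; rewrite /Cfield (bigD1 (Ordinal qp))//= -addrA lerDl addr_ge0 ?Ctop_s_ge0//.
by apply: sumr_ge0 => i _; exact: Clow_s_ge0.
Qed.

Lemma Ctop_field : Ctop_s <= Cfield.
Proof. by rewrite /Cfield lerDr; apply: sumr_ge0 => i _; exact: Clow_s_ge0. Qed.

Lemma Cfield_ge0 : 0 <= Cfield. Proof. exact: le_trans Ctop_s_ge0 Ctop_field. Qed.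

(** The error of order q: R_q below the top, and at the top the part of the rate that does not
    involve the R_j. *)
Definition dfield (q : nat) : R := Cfield *
  (if (q < p)%N then rem q else N `^ (- (p%:R / 2)) * m%:R ^+ (d * p.+1) +
     M1 d p r #|` T| a m delta + M2 d p r #|` T| a m).

Lemma r_ge1 : (1 <= r)%E.
Proof. by apply: le_trans hpr; rewrite lee_fin ler1n addn2. Qed.

Lemma low_field q : (0 < q < p)%N -> exists e : nat -> R, forall F : nat -> R -> R,
  jet q.+1 F -> (forall x, `|F q.+1 x| <= 1) -> measurable_fun setT (F q.+1) ->
  `|Ex mu (fun x => x * F 0%N x) - \sum_(b < q.+1) e b * Ex mu (F b)| <= dfield q.
Proof.
(* The expansion is started at the scale b that realises the minimum in R_q. *)
move=> /andP[q0 qp]; have [b /andP[b0 bm] Eb] := remainder_attained d r #|` T| a m0 q.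
have hqr : (q.+2%:R%:E < r)%E.
  by apply: lt_le_trans hpr; rewrite lte_fin ltr_nat addn2 !ltnS.
have [e he] := Exp_low d0 (isT : (0 < q.+1)%N) qp b0 K0 r_ge1 hqr normX.
exists (fun b => e b * sg^-1 ^+ b.+1) => F jF F1 mF.
have qp' : (0 < q.+1 <= p)%N by [].
have G1 x : `|resc q.+1 F q.+1 x| <= 1 by rewrite resc_top.
have mG : measurable_fun setT (resc q.+1 F q.+1).
  rewrite (_ : resc _ _ _ = fun s => F q.+1 (sg^-1 * s)); last by apply/funext => x; exact: resc_top.
  by apply: (measurableT_comp mF); exact: measurable_funM.
have := he (resc q.+1 F) (And3 (resc_jet _ jF) G1 mG).
move=> /(rescale qp' (leqnSn _) jF F1 mF) h; apply: le_trans h _.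
rewrite /dfield qp -cardfE -/N /rem Eb; set C := Clow _ _ _ _.
set Y := _ + wsum _ _ _ _.
have Y0 : 0 <= Y.
  by rewrite addr_ge0 ?exprn_ge0//; apply: wsum_ge0 => l; exact: powR_ge0.
have E : remainder_at d r #|` T| a q b = N `^ (- (q%:R / 2)) * Y.
  by rewrite /remainder_at /Y /wsum -[q.+2]addn2 natrD.
rewrite E; apply: (@le_trans _ _ (Clow_s q * (N `^ (- (q%:R / 2)) * Y))); last first.
  by rewrite ler_wpM2r ?Clow_field// mulr_ge0 ?powR_ge0.
rewrite mulrCA mulrA; have := sg_pow (k := q.+2) (e := q%:R) _ (ler0n _ _).
rewrite -[q.+2]addn2 natrD => /(_ erefl) h.
apply: (@le_trans _ _ (N * sg^-1 ^+ (q + 2) * (`|C| * Y))).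
  by rewrite ler_wpM2l ?mulr_ge0 ?exprn_ge0 ?invr_ge0 ?(ltW sg_gt0)// ler_wpM2r// ler_norm.
apply: le_trans (ler_wpM2r _ h) _; first by rewrite mulr_ge0.
by rewrite /Clow_s -/C le_eqVlt; apply/orP; left; apply/eqP; ring.
Qed.

Lemma top_field : exists e : nat -> R, forall F : nat -> R -> R,
  jet p.+1 F -> (forall x, `|F p x| <= 1) -> (forall x, `|F p.+1 x| <= 1) -> measurable_fun setT (F p.+1) ->
  `|Ex mu (fun x => x * F 0%N x) - \sum_(b < p.+1) e b * Ex mu (F b)| <= dfield p.
Proof.
have s0 := sg_gt0; have /andP[de0 de1] := delta01.
have hqr : (p.+1%:R%:E < r)%E.
  by apply: lt_le_trans hpr; rewrite lte_fin ltr_nat addn2.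
have hqr2 : (p.+2%:R%:E <= r)%E by rewrite -addn2.
have si0 : 0 <= sg^-1 by rewrite invr_ge0 ltW.
have hh0 : 0 <= 2 * sg^-1 `^ delta by rewrite mulr_ge0 ?powR_ge0.
have [e he] := Exp_ref d0 p0 (leqnn p) m0 K0 r_ge1 hqr normX hqr2 delta01 hdr hh0 si0 mw.
exists (fun b => e b * sg^-1 ^+ b.+1) => F jF F1 F2 mF.
have pp : (0 < p <= p)%N by rewrite p0 leqnn.
have mFp : measurable_fun setT (F p) by exact: der_meas (jF p (ltnSn p)).
have G1 x : `|resc p F p x| <= 1 by rewrite resc_top.
have mG : measurable_fun setT (resc p F p).
  rewrite (_ : resc _ _ _ = fun s => F p (sg^-1 * s)); last by apply/funext => x; exact: resc_top.
  by apply: (measurableT_comp mFp); exact: measurable_funM.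
have G2 x : `|resc p F p.+1 x| <= sg^-1.
  have -> : resc p F p.+1 x = sg^-1 * resc p.+1 F p.+1 x.
    by rewrite /resc [sg ^+ p.+1]exprS -!mulrA mulKf// lt0r_neq0.
  by rewrite resc_top normrM ger0_norm// ler_piMr.
(* F^(p) is bounded by 1 and 1-Lipschitz, so its increment over u is at most 2 and at most u, hence
   at most 2 u^[delta]. *)
have G3 x y : `|resc p F p x - resc p F p y| <= 2 * sg^-1 `^ delta * `|x - y| `^ delta.
  rewrite !resc_top -mulrA -powRM//.
  have := der_norm_le (jF p (ltnSn p)) F2 (sg^-1 * x) (sg^-1 * y).
  rewrite mul1r -mulrBr normrM (ger0_norm si0).
  have : 0 <= sg^-1 * `|x - y| by rewrite mulr_ge0.
  have f2 : `|F p (sg^-1 * x) - F p (sg^-1 * y)| <= 2.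
    by rewrite (le_trans (ler_normB _ _))// -[2]/(1 + 1) lerD.
  move: (sg^-1 * `|x - y|) (F p _ - F p _) f2 => u v f2 u0 vu.
  have [u1|/ltW u1] := leP u 1; last first.
    apply: le_trans f2 _; rewrite ler_peMr//; exact: powR_ge1.
  apply: le_trans vu _; have [->|un0] := eqVneq u 0; first by rewrite mulr_ge0 ?powR_ge0.
  apply: (@le_trans _ _ (u `^ delta)); last by rewrite ler_peMl ?powR_ge0// ler1n.
  by rewrite -[leLHS](powRr1 u0); apply: ger_powR => //; rewrite lt_neqAle eq_sym un0 u0.
have cl := And5 (resc_jet p jF) G1 mG G2 G3.
have := he _ cl.
move=> /(rescale pp (leqnn _) (jet_le (leqnSn p) jF) F1 mFp) h; apply: le_trans h _.
rewrite /dfield ltnn -cardfE -/N; set C := Cref _ _ _ _ _.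
set A1 := m%:R ^+ (d * p.+1); set A3 := wsum _ _ _ _.
set S1 := \sum_(_ <= l < _) _.
have S10 : 0 <= S1 by apply: sumr_ge0 => l _; rewrite mulr_ge0 ?powR_ge0.
have A10 : 0 <= A1 by rewrite exprn_ge0.
have A30 : 0 <= A3 by apply: wsum_ge0 => l; exact: powR_ge0.
have A20 : 0 <= m%:R ^+ (d * p) * S1 by rewrite mulr_ge0 ?exprn_ge0.
have p1 : 0 <= p%:R - 1 :> R by rewrite subr_ge0 ler1n.
have E1 : M1 d p r #|` T| a m delta = N `^ (- ((p%:R - 1 + delta) / 2)) * (m%:R ^+ (d * p) * S1).
  by rewrite /M1 -mulrA /S1 /ald -[p.+1%:R]natr1.
have E3 : M2 d p r #|` T| a m = N `^ (- ((p%:R - 1) / 2)) * A3.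
  by rewrite /M2 /A3 /wsum /alt -[p.+1%:R]natr1.
have h1 := sg_pow (k := p.+2) (e := p%:R) _ (ler0n _ _).
rewrite -[p.+2]addn2 natrD in h1; have {}h1 := h1 erefl.
have h3 := sg_pow (k := p.+1) (e := p%:R - 1) _ p1.
have e3 : p%:R - 1 + 2 = p.+1%:R :> R by rewrite -[p.+1%:R]natr1; ring.
have {}h3 := h3 e3.
have pd0 : 0 <= p%:R - 1 + delta by rewrite addr_ge0.
have h2 := sig_scale c0 N_gt0 s0 (_ : c * N <= sg ^+ 2) pd0.
rewrite sg2 in h2; have {}h2 := h2 sigc.
have e2 : sg `^ (- (p%:R - 1 + delta + 2)) = sg^-1 ^+ p.+1 * sg^-1 `^ delta.
  have -> : sg^-1 ^+ p.+1 = sg `^ (- p.+1%:R) by rewrite powRN powR_mulrn ?(ltW s0)// exprVn.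
  have -> : sg^-1 `^ delta = sg `^ (- delta) by rewrite -powR_inv1 ?(ltW s0)// -powRrM mulN1r.
  rewrite -powRD ?(gt_eqF s0) ?implybT//; congr (_ `^ _); rewrite -e3; ring.
rewrite e2 in h2; rewrite E1 E3.
move: (N `^ (- (p%:R / 2))) (powR_ge0 N (- (p%:R / 2))) h1 => n1 n10 h1.
move: (N `^ (- ((p%:R - 1) / 2))) (powR_ge0 N (- ((p%:R - 1) / 2))) h3 => n3 n30 h3.
move: (N `^ (- ((p%:R - 1 + delta) / 2))) (powR_ge0 N (- ((p%:R - 1 + delta) / 2))) h2 => n2 n20 h2.
apply: (@le_trans _ _ (Ctop_s * (n1 * A1 + n2 * (m%:R ^+ (d * p) * S1) + n3 * A3))); last first.
  by rewrite ler_wpM2r ?Ctop_field// !addr_ge0 ?mulr_ge0.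
rewrite /Ctop_s -/C.
rewrite addn2 exprS in h1.
have := top_rate_arith (ler_norm C) (normr_ge0 C) A10 A20 A30 (powR_ge0 _ _) (powR_ge0 _ _) (powR_ge0 _ _) n10 n20 n30
  (ltW N_gt0) (exprn_ge0 _ si0) si0 (powR_ge0 _ _) h1 h2 h3.
by rewrite -!mulrA.
Qed.

Theorem field_stein : exists k : nat -> R,
  (forall j, (1 < j <= p)%N -> `|k j| <= dfield j.-1) /\
  (forall q (f : nat -> R -> R) B M, (0 < q <= p)%N -> jet q.+1 f -> continuous (f q.+1) ->
    (forall j x, (j <= q.+1)%N -> `|f j x| <= B) ->
    (forall x, `|f q x| <= M /\ `|f q.+1 x| <= M) ->
    `|Ex mu (fun x => x * f 0%N x) - Ex mu (f 1%N) - \sum_(2 <= j < q.+1) k j * Ex mu (f j)|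
      <= 2 * dfield q * M).
Proof.
apply: stein_of_expansion.
- exact: p0.
- exact: mu_pow.
- exact: mu_mean.
- exact: mu_var.
- move=> q; rewrite mulr_ge0 ?Cfield_ge0//; case: ifP => _; first exact: remainder_ge0.
  apply: addr_ge0; last exact: M2_ge0.
  by apply: addr_ge0; [rewrite mulr_ge0 ?powR_ge0 ?exprn_ge0|exact: M1_ge0].
- exact: low_field.
- exact: top_field.
Qed.

End Law.

(** * Asymptotics *)

Section Limits.
Context {R : realType}.

Lemma limn_einf_gt0 (u : nat -> \bar R) : (0 < limn_einf u)%E ->
  exists c : R, 0 < c /\ \forall n \near \oo, (c%:E <= u n)%E.
Proof.
rewrite limn_einf_lim (cvg_lim _ (@cvg_einfs_sup R u))// => /ereal_sup_gt[_ [n0 _ <-] h].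
have [c [c0 hc]] : exists c : R, 0 < c /\ (c%:E <= einfs u n0)%E.
  case: (einfs u n0) h => [c||]//; first by exists c; rewrite lte_fin in h.
  by move=> _; exists 1; rewrite leey.
exists c; split=> //; exists n0 => // n /= nn; apply: le_trans hc _.
by apply: ereal_inf_lbound; exists n.
Qed.

Lemma lty_bound (y : \bar R) : (y < +oo)%E -> exists K : R, 0 <= K /\ (y <= K%:E)%E.
Proof.
case: y => [y||]// _; last by exists 0; rewrite leNye.
by exists `|y|; split=> //; rewrite lee_fin ler_norm.
Qed.

Lemma eseries_partial (f : nat -> R) (S : R) k M : (forall l, 0 <= f l) -> (0 < k)%N ->
  (\sum_(1 <= l <oo) (f l)%:E <= S%:E)%E -> \sum_(k <= l < M) f l <= S.
Proof.
move=> f0 k0 h; rewrite -lee_fin; apply: le_trans h.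
have [Mk|kM] := leqP M k.
  by rewrite big_geq//; apply: nneseries_ge0 => l _ _; rewrite lee_fin.
apply: (@le_trans _ _ (\sum_(1 <= l < M) (f l)%:E)%E).
  rewrite sumEFin lee_fin (big_cat_nat (n := k) k0 (ltnW kM))//= lerDr.
  by apply: sumr_ge0.
by apply: nneseries_lim_ge => l _ _; rewrite lee_fin.
Qed.

End Limits.

Lemma wasserstein_ge0 {R : realType} p (nu mu : probability R R) : (0 <= wasserstein p nu mu)%E.
Proof. by apply: le_ereal_inf_tmp => _ [g _ <-]; exact: Lnorm_ge0. Qed.

Section Main.
Context {R : realType} {d p : nat} {T : nat -> {fset 'rV[int]_d}} {disp : nat -> measure_display}
  {Omega : forall n, measurableType (disp n)} {P : forall n, probability (Omega n) R}.
Variables (X : forall n, T n -> {RV (P n) >-> R}) (r : \bar R) (m : nat -> nat) (delta K c : R) (n0 : nat).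
Let N n := #|` T n|.
Let alpha n l := alpha_coef (@X n) p.+1 l.
Let rt n := rate d p r (N n) (alpha n) (m n) delta.
Let Wp n := wasserstein p (distribution (P n) (normalized_sum (@X n))) std_normal.
Hypothesis d0 : (0 < d)%N.
Hypothesis p0 : (0 < p)%N.
Hypothesis m0 : forall n, (0 < m n)%N.
Hypothesis N0 : forall n, (0 < N n)%N.
Hypothesis K0 : 0 <= K.
Hypothesis c0 : 0 < c.
Hypothesis hpr : ((p + 2)%:R%:E <= r)%E.
Hypothesis normX : forall n i, ('N[P n]_r[EFin \o @X n i] <= K%:E)%E.
Hypothesis meanX : forall n i, ('E_(P n)[@X n i] = 0)%E.
Hypothesis delta01 : 0 <= delta <= 1.
Hypothesis hdr : ((p.+1%:R + delta)%:E < r)%E.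
Hypothesis sigc : forall n, (n0 <= n)%N -> c * (N n)%:R <= sigma2 (@X n).
Hypothesis mw : forall n, (n0 <= n)%N -> (m n <= @window R d (N n))%N.
Hypothesis rt1 : forall n, (n0 <= n)%N -> rt n <= 1.

Theorem wasserstein_rate : exists2 Kw : R, 0 <= Kw &
  forall n, (n0 <= n)%N -> (Wp n <= (Kw * rt n `^ p%:R^-1)%:E)%E.
Proof.
pose C := 2 * @Cfield R r d p K c delta.
have CF : 0 <= @Cfield R r d p K c delta by exact: Cfield_ge0.
have rt_gt0 n : 0 < rt n by apply: rate_gt0.
(* Reindexing past n0 makes the eventual bounds hold for every member of the family. *)
pose nn e := (n0 + e)%N; have nn0 e : (n0 <= nn e)%N by exact: leq_addr.
pose mu e : probability R R := distribution (P (nn e)) (normalized_sum (@X (nn e))).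
pose eps e := rt (nn e) `^ p%:R^-1.
have epsX e : eps e ^+ p = rt (nn e).
  by rewrite powR_pinv// ltW.
have dle e q : (0 < q <= p)%N -> @dfield _ _ R _ r _ _ (@X (nn e)) p (m (nn e)) K c delta q <= @Cfield R r d p K c delta * eps e ^+ q.
  move=> /andP[q0 qp]; rewrite /dfield ler_wpM2l//; case: ltnP => qp'.
    by apply: (rate_rem d r _ delta p0 (N0 (nn e)) (m0 (nn e))); rewrite q0.
  have -> : q = p by apply/eqP; rewrite eqn_leq qp qp'.
  by rewrite epsX; apply: rate_top.
have fs e := field_stein d0 p0 (m0 (nn e)) K0 hpr (@normX (nn e)) (@meanX (nn e)) c0 (N0 (nn e))
  (sigc (nn0 e)) (mw (nn0 e)) delta01 hdr.
have [kk hk] := choice fs.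
have [||||Kw [Kw0 hKw]] := @wasserstein_family R nat p C mu eps (fun k e => kk e k) p0 (mulr_ge0 (ler0n R 2) CF)
  (fun e => powR_gt0 _ (rt_gt0 _)).
- move=> e; apply: (@le_trans _ _ (1 `^ p%:R^-1)); last by rewrite powR1.
  apply: ge0_ler_powR; rewrite ?nnegrE ?invr_ge0//.
    by rewrite ltW.
  by apply: rt1.
- move=> e; under eq_fun do rewrite -normrX; apply: integ_norm.
  exact: mu_pow K0 hpr (@normX (nn e)) (N0 (nn e)) _ (leqnSn p).
- move=> k e kp; have [h _] := hk e; apply: le_trans (h k kp) _.
  have kp' : (0 < k.-1 <= p)%N by move: kp; clear; lia.
  apply: le_trans (dle e _ kp') _; rewrite ler_wpM2r ?exprn_ge0 ?powR_ge0//.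
  by rewrite /C mulr_natl mulr2n lerDl.
- move=> e q f B M qp jf cf fB fM; have [_ h] := hk e.
  apply: le_trans (h q f B M qp jf cf fB fM) _.
  have M0 : 0 <= M := le_trans (normr_ge0 _) (fM 0).1.
  by rewrite ler_wpM2r// /C -mulrA ler_wpM2l// dle.
exists Kw => // n nn1; have := hKw (n - n0)%N.
by rewrite /mu /eps /nn subnKC.
Qed.

End Main.

Section Asymptotics.
Context {R : realType}.

Lemma size_small (d : nat) (N m : nat -> nat) : (0 < d)%N -> (forall n, (0 < N n)%N) ->
  (fun n => (m n)%:R : R^o) =o_\oo (fun n => (N n)%:R `^ (4 * d%:R)^-1 : R^o) ->
  forall e : R, 0 < e -> \forall n \near \oo,
    (N n)%:R `^ (- 2^-1) * (m n)%:R ^+ (2 * d) <= e /\ (m n)%:R <= e * (N n)%:R `^ (4 * d%:R)^-1.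
Proof.
(* The cap at 1 ensures e1^(2 d) <= e1. *)
move=> d0 N0 /eqoP h e e0; pose e1 := Num.min e 1.
have e10 : 0 < e1 by rewrite lt_min e0 ltr01.
have := h e1 e10; apply: filterS => n.
rewrite !ger0_norm ?powR_ge0// => hn; split; last first.
  by apply: le_trans hn _; rewrite ler_wpM2r ?powR_ge0// ge_min lexx.
have NR : 0 < (N n)%:R :> R by rewrite ltr0n.
have dn0 : d%:R != 0 :> R by rewrite pnatr_eq0 -lt0n.
apply: (@le_trans _ _ ((N n)%:R `^ (- 2^-1) * (e1 * (N n)%:R `^ (4 * d%:R)^-1) ^+ (2 * d))).
  by rewrite ler_wpM2l ?powR_ge0// lerXn2r ?nnegrE// mulr_ge0 ?powR_ge0// ltW.
rewrite exprMn mulrCA -[X in _ * (_ * X)]powR_mulrn ?powR_ge0// -powRrM.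
have -> : (4 * d%:R)^-1 * (2 * d)%:R = 2^-1 :> R by rewrite natrM; field; exact: dn0.
rewrite powRN mulVf ?mulr1 ?gt_eqF ?powR_gt0//.
apply: (@le_trans _ _ e1); last by rewrite ge_min lexx.
rewrite -[leRHS]expr1; apply: ler_wiXn2l; rewrite ?(ltW e10)//.
- by rewrite ge_min lexx orbT.
- by rewrite muln_gt0.
Qed.

Lemma root_small (p : nat) (u : nat -> R) : (0 < p)%N -> u @ \oo --> (0 : R) ->
  (forall n, 0 <= u n) -> forall e : R, 0 < e -> \forall n \near \oo, u n `^ p%:R^-1 <= e.
Proof.
move=> p0 hu u0 e e0; have ep : 0 < e ^+ p by rewrite exprn_gt0.
move/cvgrPdist_le : hu => /(_ _ ep); apply: filterS => n.
rewrite sub0r normrN ger0_norm// => h.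
have pn0 : p%:R != 0 :> R by rewrite pnatr_eq0 -lt0n.
have -> : e = (e ^+ p) `^ p%:R^-1 by rewrite -powR_mulrn ?(ltW e0)// -powRrM mulfV// powRr1// ltW.
by apply: ge0_ler_powR; rewrite ?nnegrE ?invr_ge0// ltW.
Qed.

Lemma le_window d N m : (0 < d)%N -> (0 < N)%N -> m%:R <= 2^-1 * N%:R `^ (4 * d%:R)^-1 :> R ->
  (m <= @window R d N)%N.
Proof.
move=> d0 N0 h; rewrite /window truncn_ge_nat ?divr_ge0 ?powR_ge0//.
apply: le_trans h _; rewrite mulrC ler_wpM2r//; apply: ler_powR; rewrite ?ler1n//.
have dR : 0 < d%:R :> R by rewrite ltr0n.
by rewrite lef_pV2 ?posrE ?mulr_gt0// ler_peMl ?(ltW dR)// ler1n.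
Qed.

End Asymptotics.

Theorem theorem2p6 (R : realType) (d p : nat)
    (T : nat -> {fset 'rV[int]_d})
    (disp : nat -> measure_display)
    (Omega : forall n, measurableType (disp n))
    (P : forall n, probability (Omega n) R)
    (X : forall n, T n -> {RV (P n) >-> R})
    (r : \bar R) (m : nat -> nat) (delta : R) :
  let N n := #|` T n| in
  let alpha n l := alpha_coef (@X n) p.+1 l in
  let M1n n := M1 d p r (N n) (alpha n) (m n) delta in
  let M2n n := M2 d p r (N n) (alpha n) (m n) in
  let Wp n := wasserstein p (distribution (P n) (normalized_sum (@X n)))
                std_normal in
  (0 < d)%N -> (0 < p)%N ->
  (forall n, T n != fset0) ->
  (forall n, T n `<=` T n.+1)%fset ->
  N @ \oo --> \oo ->
  (forall n (i : T n), (X n i : Omega n -> R) \in Lfun (P n) 2%:E) ->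
  (forall n (i : T n), ('E_(P n)[X n i] = 0)%E) ->
  ((p + 2)%:R%:E <= r)%E ->
  (0 < limn_einf (fun n => (sigma2 (@X n) / (N n)%:R)%:E))%E ->
  (ereal_sup [set ereal_sup [set ('N[P n]_r[EFin \o X n i])%E | i in [set: T n]] |
     n in [set: nat]] < +oo)%E ->
  (ereal_sup [set \sum_(1 <= l <oo)
       (l%:R ^+ d.-1 * alpha n l `^ mixing_exp r (p%:R + 1))%:E |
     n in [set: nat]] < +oo)%E ->
  (forall n, (0 < m n)%N) ->
  (fun n => (m n)%:R : R^o) =o_\oo
    (fun n => (N n)%:R `^ (4 * d%:R)^-1 : R^o) ->
  0 <= delta <= 1 -> (delta%:E < r - (p%:R + 1)%:E)%E ->
  M1n @ \oo --> (0 : R) ->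
  M2n @ \oo --> (0 : R) ->
  [/\ Wp @ \oo --> 0%E,
      ebigO Wp (fun n =>
        rate d p r (N n) (alpha n) (m n) delta `^ p%:R^-1)
    & exists f1 f2 f3 : nat -> R^o,
      [/\ f1 =O_\oo (fun n => (N n)%:R `^ (- 2^-1) * (m n)%:R ^+ (2 * d) : R^o),
          f2 =O_\oo (fun n => M1n n `^ p%:R^-1 : R^o),
          f3 =O_\oo (fun n => M2n n `^ p%:R^-1 : R^o)
        & \forall n \near \oo, Wp n = (f1 n + f2 n + f3 n)%:E]].
Proof.
move=> N alpha M1n M2n Wp d0 p0 Tn0 _ _ _ meanX hpr lim nsup ssup m0 mo delta01 hd cM1 cM2.
have N0 n : (0 < N n)%N by rewrite cardfs_gt0.
have hdr : ((p.+1%:R + delta)%:E < r)%E.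
  move: hpr hd; case: (r) => [s||]; last by rewrite leNgt ltNyr.
    by move=> _; rewrite -EFinB !lte_fin -[p.+1%:R]natr1; lra.
  by move=> _ _; rewrite ltry.
have [K [K0 hK]] := lty_bound nsup.
have normX n i : ('N[P n]_r[EFin \o @X n i] <= K%:E)%E.
  by apply: le_trans hK; apply: (@le_trans _ _ (ereal_sup [set ('N[P n]_r[EFin \o X n i])%E | i in [set: T n]]));
    apply: ereal_sup_ubound; [exists i|exists n].
have [S [S0 hS]] := lty_bound ssup.
have sumS n : \sum_((m n).+1 <= l < ((m n).+1 + @window R d (N n)).+1)
    l%:R ^+ d.-1 * alpha n l `^ mixing_exp r (p%:R + 1) <= S.
  apply: (eseries_partial (f := fun l => l%:R ^+ d.-1 * alpha n l `^ mixing_exp r (p%:R + 1))) => //.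
    by move=> l; rewrite mulr_ge0 ?exprn_ge0 ?powR_ge0.
  by apply: le_trans hS; apply: ereal_sup_ubound; exists n.
have [c [c0 hc]] := limn_einf_gt0 lim.
have M10 n : 0 <= M1n n by exact: M1_ge0.
have M20 n : 0 <= M2n n by exact: M2_ge0.
pose g1 n : R := (N n)%:R `^ (- 2^-1) * (m n)%:R ^+ (2 * d).
pose g2 n := M1n n `^ p%:R^-1. pose g3 n := M2n n `^ p%:R^-1.
have g10 n : 0 < g1 n by rewrite mulr_gt0 ?powR_gt0 ?exprn_gt0 ?ltr0n.
have g20 n : 0 <= g2 n by exact: powR_ge0.
have g30 n : 0 <= g3 n by exact: powR_ge0.
pose G n := g1 n + g2 n + g3 n.
have G0 n : 0 < G n := ltr_wpDr (g30 n) (ltr_wpDr (g20 n) (g10 n)).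
have Gsmall e : 0 < e -> \forall n \near \oo, G n <= e.
  move=> e0; have e3 : 0 < e / 3 by rewrite divr_gt0.
  have h1 := size_small d0 N0 mo e3; have h2 := root_small p0 cM1 M10 e3.
  have h3 := root_small p0 cM2 M20 e3.
  apply: filterS3 h1 h2 h3 => n [h1 _] h2 h3.
  have -> : e = e / 3 + e / 3 + e / 3 by field.
  exact: lerD (lerD h1 h2) h3.
pose rt n := rate d p r (N n) (alpha n) (m n) delta.
have rt0 n : 0 < rt n by exact: rate_gt0.
(* The root of M^(ii) enters [rate_bound] twice, so the sum there is only bounded by 2 G; hence
   2^p. *)
pose Kr := @Krate R p S * 2 ^+ p.
have Kr1 : 1 <= Kr.
  rewrite /Kr -[leLHS]mulr1 ler_pM// ?exprn_ege1// ?ler1n//.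
  by rewrite /Krate lerDr mulr_ge0// exprn_ge0// addr_ge0.
have Kr0 : 0 < Kr by exact: lt_le_trans Kr1.
have rtG n : 2 * G n <= 1 -> rt n <= Kr * G n ^+ p.
  move=> G1; have Gn := ltW (G0 n).
  have x1 : g1 n + g3 n <= 1.
    by move: G1 (g20 n) (ltW (g10 n)) (g30 n); rewrite /G; move: (g1 n) (g2 n) (g3 n) => u v z; lra.
  have := rate_bound delta d0 p0 (N0 n) (m0 n) (fun l => alpha_coef01 (@X n) p.+1 l) hpr S0 (sumS n) x1.
  move/le_trans; apply; rewrite -/(g1 n) -/(g2 n) -/(g3 n).
  have -> : Kr * G n ^+ p = Krate p S * (2 * G n) ^+ p by rewrite /Kr -mulrA -exprMn.
  apply: ler_wpM2l.
    by rewrite /Krate addr_ge0// mulr_ge0// exprn_ge0// addr_ge0.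
  apply: lerXn2r; rewrite ?nnegrE.
  - exact: addr_ge0 (addr_ge0 (addr_ge0 (ltW (g10 n)) (g30 n)) (g20 n)) (g30 n).
  - exact: mulr_ge0.
  - by rewrite /G; have := g20 n; have := g10 n; move: (g1 n) (g2 n) (g3 n) => u v z; lra.
(* Small enough to give 2 G <= 1 / Kr, which brings both the argument of [rtG] and the rate itself
   below 1. *)
pose e0 := (2 * Kr)^-1; have e00 : 0 < e0 by rewrite invr_gt0 mulr_gt0.
have half0 : (0 : R) < 2^-1 by rewrite invr_gt0.
have [n0 _ hn0] : \forall n \near \oo, [/\ c * (N n)%:R <= sigma2 (@X n), (m n <= @window R d (N n))%N & G n <= e0].
  apply: filterS3 hc (size_small d0 N0 mo half0) (Gsmall e0 e00) => n h1 [_ h2] h3; split=> //.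
  - by move: h1; rewrite lee_fin ler_pdivlMr// ltr0n.
  - exact: le_window.
have Ge n : (n0 <= n)%N -> 2 * G n <= 1 /\ rt n <= 1.
  move=> /hn0[_ _ h]; have h2 : 2 * G n <= Kr^-1.
    by rewrite -ler_pdivlMl// -invfM.
  have h3 : 2 * G n <= 1 by rewrite (le_trans h2)// invf_le1.
  split=> //; apply: le_trans (rtG _ h3) _; rewrite mulrC -ler_pdivlMr// div1r.
  have Gn := ltW (G0 n); have G1 : G n <= 1 by lra.
  apply: (@le_trans _ _ (G n)); last by lra.
  by rewrite -[leRHS]expr1; apply: ler_wiXn2l.
have [Kw Kw0 hW] := @wasserstein_rate R d p T disp Omega P X r m delta K c n0 d0 p0 m0 N0 K0 c0 hpr normX
  meanX delta01 hdr (fun n h => let: And3 a _ _ := hn0 n h in a) (fun n h => let: And3 _ a _ := hn0 n h in a)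
  (fun n h => (Ge n h).2).
pose f n : R := fine (Wp n).
have fE n : (n0 <= n)%N -> Wp n = (f n)%:E.
  move=> /hW h; rewrite /f fineK// fin_numElt (lt_le_trans _ (wasserstein_ge0 _ _ _)) ?ltNyr//.
  exact: le_lt_trans h (ltry _).
have f0 n : 0 <= f n by apply: fine_ge0; exact: wasserstein_ge0.
have fr n : (n0 <= n)%N -> f n <= Kw * rt n `^ p%:R^-1.
  by move=> nn; rewrite -lee_fin -fE//; exact: hW.
pose Kh := Kw * Kr `^ p%:R^-1; have Kh0 : 0 <= Kh by rewrite mulr_ge0 ?powR_ge0.
have fG n : (n0 <= n)%N -> f n <= Kh * G n.
  move=> nn; apply: le_trans (fr n nn) _; rewrite -mulrA ler_wpM2l//.
  have Gn := ltW (G0 n); have pn0 : p%:R != 0 :> R by rewrite pnatr_eq0 -lt0n.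
  apply: (@le_trans _ _ ((Kr * G n ^+ p) `^ p%:R^-1)).
    apply: ge0_ler_powR; rewrite ?nnegrE ?invr_ge0//; first exact/ltW/rt0.
    - by rewrite mulr_ge0 ?exprn_ge0// ltW.
    - by apply: rtG; case: (Ge n nn).
  by rewrite powRM ?exprn_ge0 ?(ltW Kr0)// -[G n ^+ p]powR_mulrn// -powRrM mulfV// powRr1.
have near0 : \forall n \near \oo, (n0 <= n)%N by exists n0.
split.
- apply/fine_cvgP; split; first by apply: filterS near0 => n /fE ->.
  apply/cvgrPdist_le => e e_gt0; have ek : 0 < e / (Kh + 1) by rewrite divr_gt0// ltr_wpDl.
  apply: filterS2 near0 (Gsmall _ ek) => n nn h /=.
  rewrite sub0r normrN ger0_norm; last exact: f0.
  apply: le_trans (fG n nn) _; apply: (@le_trans _ _ ((Kh + 1) * G n)).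
    by rewrite ler_wpM2r ?lerDl// ltW.
  by rewrite mulrC -ler_pdivlMr// ltr_wpDl.
- exists (f : nat -> R^o); last by apply: filterS near0 => n /fE.
  apply/eqO_exP; exists (Kw + 1); first by rewrite ltr_wpDl.
  apply: filterS near0 => n /fr h; rewrite ger0_norm// ger0_norm ?powR_ge0//.
  by apply: le_trans h _; rewrite ler_wpM2r ?powR_ge0// lerDl.
(* The three terms must add up to the distance exactly, so the bounded ratio of the distance to G is
   applied to each of them. *)
pose lam n := f n / G n.
have lam0 n : 0 <= lam n by rewrite divr_ge0// ltW.
have lamK n : (n0 <= n)%N -> lam n <= Kh + 1.
  by move=> /fG h; rewrite ler_pdivrMr// (le_trans h)// ler_wpM2r ?lerDl// ltW.
have big (g : nat -> R) : (forall n, 0 <= g n) -> ((fun n => lam n * g n) : nat -> R^o) =O_\oo (g : nat -> R^o).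
  move=> g0; apply/eqO_exP; exists (Kh + 1); first by rewrite ltr_wpDl.
  apply: filterS near0 => n /lamK h; rewrite normrM !ger0_norm//.
  by rewrite ler_wpM2r.
exists (fun n => lam n * g1 n), (fun n => lam n * g2 n), (fun n => lam n * g3 n); split.
- by apply: big => n; rewrite ltW.
- exact: big.
- exact: big.
- apply: filterS near0 => n /fE ->; congr (_%:E).
  by rewrite -!mulrDr -/(G n) divfK// gt_eqF.
Qed.
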